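(* Let $n\ge1$, $l\ge2$ an integer, $0<\rho<1$, $1<r\le2$, and $m=-\frac{nl}{r}(1-\rho)$. Then every $\sigma\in\mathbb{M}_lS^m_{\rho,\rho}(\mathbb{R}^n)$ satisfies: there is $C>0$ such that for all $f_1,\dots,f_l\in\mathscr{S}(\mathbb{R}^n)$ and all $x\in\mathbb{R}^n$, $$\mathcal{M}^\sharp_{r/l}\big(T_\sigma(f_1,\dots,f_l)\big)(x)\le C\,\mathbf{M}_r(f_1,\dots,f_l)(x).$$
   Context: $\mathbb{M}_lS^m_{\rho,\rho}(\mathbb{R}^n)$: smooth $\sigma(x,\xi_1,\dots,\xi_l)$ on $(\mathbb{R}^n)^{l+1}$ with $|\partial_x^\alpha\partial_{\xi_1}^{\beta_1}\cdots\partial_{\xi_l}^{\beta_l}\sigma|\le C_{\alpha,\beta}(1+|\xi_1|+\dots+|\xi_l|)^{m+\rho|\alpha|-\rho(|\beta_1|+\dots+|\beta_l|)}$ for all multi-indices. $T_\sigma(f_1,\dots,f_l)(x)=\int_{(\mathbb{R}^n)^l}\sigma(x,\xi_1,\dots,\xi_l)\prod_j\widehat{f_j}(\xi_j)e^{2\pi i\langle x,\xi_1+\dots+\xi_l\rangle}d\xi_1\cdots d\xi_l$. For $0<t<\infty$, $\mathcal{M}^\sharp_t F(x)=\sup_{Q\ni x,\ell(Q)\ge1}\big(\frac1{|Q|}\int_Q|F|^t\big)^{1/t}+\sup_{Q\ni x,\ell(Q)<1}\inf_{c_Q\in\mathbb{C}}\big(\frac1{|Q|}\int_Q|F-c_Q|^t\big)^{1/t}$,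 suprema over cubes with sides parallel to the axes containing $x$, $\ell(Q)$ the side-length. The multi-sublinear maximal function is $\mathbf{M}(f_1,\dots,f_l)(x)=\sup_{Q\ni x}\frac1{|Q|^l}\int_{Q^l}\prod_{j=1}^l|f_j(u_j)|\,du_1\cdots du_l$, and $\mathbf{M}_r(f_1,\dots,f_l)=\big(\mathbf{M}(|f_1|^r,\dots,|f_l|^r)\big)^{1/r}$. *)

(* Defs.v *)
From HB Require Import structures.
From mathcomp Require Import all_boot all_order all_algebra complex.
From mathcomp Require Import all_classical all_reals all_analysis.
Set Implicit Arguments.
Unset Strict Implicit.
Unset Printing Implicit Defensive.
Import Order.TTheory GRing.Theory Num.Theory.
Local Open Scope ring_scope.

(* Conventions.  R^n is 'rV[R]_n; complex numbers are R[i] (= complex R).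
   Points (x, xi_1, ..., xi_l) of (R^n)^(l+1) are l.+1 x n matrices, row 0
   being x and row (lift ord0 j) being xi_(j+1).  *)

Section Defs.
Variable R : realType.
Notation C := (R[i]).

Definition cabs (z : C) : R := Num.sqrt (complex.Re z ^+ 2 + complex.Im z ^+ 2).

Definition expi (th : R) : C := Complex (cos th) (sin th).

Definition dotp n (x y : 'rV[R]_n) : R := \sum_i x 0 i * y 0 i.
Definition eucl n (x : 'rV[R]_n) : R := Num.sqrt (\sum_i x 0 i ^+ 2).

Definition pder p q (s : seq ('I_p * 'I_q)) (f : 'M[R]_(p, q) -> R)
  : 'M[R]_(p, q) -> R :=
  foldr (fun d g => 'D_(delta_mx d.1 d.2) g) f s.

Definition smoothR p q (f : 'M[R]_(p, q) -> R) : Prop :=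
  forall s x, differentiable (pder s f) x.

Definition smoothC p q (f : 'M[R]_(p, q) -> C) : Prop :=
  smoothR (fun x => complex.Re (f x)) /\ smoothR (fun x => complex.Im (f x)).

Definition mder p q (g : 'I_p -> 'I_q -> nat) (f : 'M[R]_(p, q) -> R) :=
  pder (flatten [seq nseq (g d.1 d.2) d |
                 d <- [seq (i, j) | i <- enum 'I_p, j <- enum 'I_q]]) f.

Definition mderC p q (g : 'I_p -> 'I_q -> nat) (f : 'M[R]_(p, q) -> C)
  : 'M[R]_(p, q) -> C :=
  fun x => Complex (mder g (fun y => complex.Re (f y)) x) (mder g (fun y => complex.Im (f y)) x).

Definition pack n l (sigma : 'rV[R]_n -> ('I_l -> 'rV[R]_n) -> C)
  : 'M[R]_(l.+1, n) -> C :=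
  fun M => sigma (row ord0 M) (fun j => row (lift ord0 j) M).

Definition joinidx n l (alpha : 'I_n -> nat) (beta : 'I_l -> 'I_n -> nat)
  : 'I_l.+1 -> 'I_n -> nat :=
  fun k i => if unlift ord0 k is Some j then beta j i else alpha i.

Definition in_MlS n l (m rho : R)
    (sigma : 'rV[R]_n -> ('I_l -> 'rV[R]_n) -> C) : Prop :=
  smoothC (pack sigma) /\
  forall (alpha : 'I_n -> nat) (beta : 'I_l -> 'I_n -> nat),
  exists K : R, forall M : 'M[R]_(l.+1, n),
    cabs (mderC (joinidx alpha beta) (pack sigma) M) <=
    K * powR (1 + \sum_j eucl (row (lift ord0 j) M))
             (m + rho * (\sum_i alpha i)%:R
                - rho * (\sum_j \sum_i beta j i)%:R).

Definition schwartz n (f : 'rV[R]_n -> C) : Prop :=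
  smoothC f /\
  forall (a b : 'I_n -> nat), exists K : R, forall x : 'rV[R]_n,
    `|\prod_i x 0 i ^+ a i| * cabs (mderC (fun _ : 'I_1 => b) f x) <= K.

Definition rcons_row n (t : R) (v : 'rV[R]_n) : 'rV[R]_n.+1 :=
  row_mx (t%:M) v.

Fixpoint Rintn (n : nat) : ('rV[R]_n -> R) -> R :=
  match n return ('rV[R]_n -> R) -> R with
  | 0 => fun f => f 0
  | n'.+1 => fun f => Rintegral lebesgue_measure setT
                        (fun t => Rintn (fun v => f (rcons_row t v)))
  end.

Fixpoint Eintn (n : nat) : ('rV[R]_n -> \bar R) -> \bar R :=
  match n return ('rV[R]_n -> \bar R) -> \bar R with
  | 0 => fun f => f 0
  | n'.+1 => fun f => (\int[lebesgue_measure]_(t in setT)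
                        Eintn (fun v => f (rcons_row t v)))%E
  end.

Definition Cintn n (f : 'rV[R]_n -> C) : C :=
  Complex (Rintn (fun x => complex.Re (f x))) (Rintn (fun x => complex.Im (f x))).

Definition fcons n l (u : 'rV[R]_n) (us : 'I_l -> 'rV[R]_n)
  : 'I_l.+1 -> 'rV[R]_n :=
  fun j => if unlift ord0 j is Some j' then us j' else u.

Fixpoint RintL n (l : nat) : (('I_l -> 'rV[R]_n) -> R) -> R :=
  match l return (('I_l -> 'rV[R]_n) -> R) -> R with
  | 0 => fun g => g (fun _ => 0)
  | l'.+1 => fun g => Rintn (fun u => RintL (fun us => g (fcons u us)))
  end.

Fixpoint EintL n (l : nat) : (('I_l -> 'rV[R]_n) -> \bar R) -> \bar R :=
  match l return (('I_l -> 'rV[R]_n) -> \bar R) -> \bar R with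
  | 0 => fun g => g (fun _ => 0)
  | l'.+1 => fun g => Eintn (fun u => EintL (fun us => g (fcons u us)))
  end.

Definition CintL n l (g : ('I_l -> 'rV[R]_n) -> C) : C :=
  Complex (RintL (fun xi => complex.Re (g xi))) (RintL (fun xi => complex.Im (g xi))).

Definition fourier n (f : 'rV[R]_n -> C) (xi : 'rV[R]_n) : C :=
  Cintn (fun x => f x * expi (- (2 * pi * dotp x xi))).

Definition Tsigma n l (sigma : 'rV[R]_n -> ('I_l -> 'rV[R]_n) -> C)
    (f : 'I_l -> 'rV[R]_n -> C) (x : 'rV[R]_n) : C :=
  CintL (fun xi : 'I_l -> 'rV[R]_n =>
    sigma x xi * (\prod_j fourier (f j) (xi j))
    * expi (2 * pi * dotp x (\sum_j xi j))).

Definition cube n (a : 'rV[R]_n) (s : R) : set 'rV[R]_n :=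
  [set y | forall i, a 0 i <= y 0 i <= a 0 i + s].

Definition cube_avg n (a : 'rV[R]_n) (s t : R) (F : 'rV[R]_n -> C) (c : C)
  : \bar R :=
  (((s ^+ n)^-1)%:E *
   Eintn (fun y => (\1_(cube a s) y * powR (cabs (F y - c)) t)%:E))%E.

Definition sharp_max n (t : R) (F : 'rV[R]_n -> C) (x : 'rV[R]_n) : \bar R :=
  (ereal_sup [set v | exists (a : 'rV[R]_n) (s : R), (1 <= s)%R /\ cube a s x /\
                 v = poweR (cube_avg a s t F 0%R) t^-1]
   + ereal_sup [set v | exists (a : 'rV[R]_n) (s : R), (0 < s)%R /\ (s < 1)%R /\ cube a s x /\
                 v = ereal_inf [set w | exists c : C,
                                  w = poweR (cube_avg a s t F c) t^-1]])%E.

Definition multi_max n l (f : 'I_l -> 'rV[R]_n -> C) (x : 'rV[R]_n) : \bar R :=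
  ereal_sup [set v | exists a s, 0 < s /\ cube a s x /\
     v = (((s ^+ n) ^+ l)^-1%R%:E *
          EintL (fun u : 'I_l -> 'rV[R]_n =>
           (\prod_j (\1_(cube a s) (u j) * cabs (f j (u j))))%R%:E))%E].

Definition multi_max_r n l (r : R) (f : 'I_l -> 'rV[R]_n -> C) (x : 'rV[R]_n)
  : \bar R :=
  poweR (multi_max (fun j y => (powR (cabs (f j y)) r)%:C%C) x) r^-1.

End Defs.

(* Main.v *)
(** View T_sigma as a linear operator on R^d, d = n l, applied to the tensor product F of the f_j
and restricted to the diagonal, and split sigma dyadically in frequency.  The piece at frequency
2^k is bounded in terms of the L^r norm of F over boxes of side 2^(- rho k), with rapidly decaying
tails: multiplication of the kernel by u - x differentiates the symbol, and the L^r norm replaces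
the Hausdorff-Young inequality via truncation of F at a height and a Bessel-type inequality.  With
the critical m the powers of 2^k cancel exactly, so each piece is O(Lam^(1/r)) with Lam the value
of the maximal function.  Geometric decay comes from comparing 2^k with the side s of the cube:
if 2^k s < 1 the piece oscillates by O(2^k s) on the cube, which is absorbed by the constant c_Q;
if 2^k s >= 1, the phase 2 pi (xi_1 + ... + xi_l).x varies along the cube and a Schur test with an
integration by parts in x gains a power of (2^k min(s, 2^(- rho k)))^-1 in the average.  When s
exceeds 2^(- rho k) the estimate is averaged over subcubes, the product of l local densities being
handled by the arithmetic-geometric mean inequality, which is where the exponent r / l is used.
As r / l <= 1, the averages of the pieces add up. *)

From HB Require Import structures.
From mathcomp Require Import all_boot all_order all_algebra complex.
From mathcomp Require Import all_classical all_reals all_analysis.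
From mathcomp Require Import measurable_realfun.
From mathcomp Require Import ring lra zify.
Require Import Defs.
Set Implicit Arguments.
Unset Strict Implicit.
Unset Printing Implicit Defensive.
Import Order.TTheory GRing.Theory Num.Theory.
Import numFieldNormedType.Exports.
Local Open Scope classical_set_scope.
Local Open Scope ring_scope.

(** All operators are kept real: a cosine integral with a free phase psi is stable under integration
    by parts, each derivative shifting psi by pi/2, so eight real operators per dyadic piece stand
    for the complex one. Moving x along its first axis shifts the first coordinate of all l blocks
    at once, so the phase varies at speed 2 pi times the sum of the l first frequency coordinates;
    this sum vanishes on a hyperplane, and the Schur test must weigh a slab against its complement.
    The decay exponent (r - 1) / 8 is what remains after truncating F at a height raised by the
    fourth root of frequency times length. The obstacle on large cubes is that the maximal function
    controls only the product of the l means, never one factor: one may be huge where another is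
    tiny. Each local mean is therefore divided by a bound of its average over the cube, the bounds
    having a controlled product; the product of the normalised means is at most the l-th power of a
    single density with bounded average. With q = r / l, taking the r-th root and then the q-th
    power turns this l-th power into a first power, which can be integrated. *)

Section product_sigma_finite.
Context d1 d2 (T1 : measurableType d1) (T2 : measurableType d2) (R : realType).
Variables (m1 : {sigma_finite_measure set T1 -> \bar R})
          (m2 : {sigma_finite_measure set T2 -> \bar R}).

Lemma sigma_finite_prod : sigma_finite setT (m1 \x m2)%E.
Proof.
have /sigma_finiteP[F [TF ndF Foo]] := sigma_finiteT m1.
have /sigma_finiteP[G [TG ndG Goo]] := sigma_finiteT m2.
exists (fun k => F k `*` G k).
  rewrite -setXTT TF TG predeqE => -[x y]; split; last first.
    by move=> [n _ []/= ? ?]; split; exists n.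
  move=> [/= [n _ Fnx] [k _ Gky]]; exists (maxn n k) => //; split.
  - by move: x Fnx; exact/subsetPset/ndF/leq_maxl.
  - by move: y Gky; exact/subsetPset/ndG/leq_maxr.
move=> k; have [mF Fk] := Foo k; have [mG Gk] := Goo k.
split; first exact: measurableX.
by rewrite /= product_measure1E// lte_mul_pinfty// ge0_fin_numE.
Qed.

(** A named copy of the product measure to which the sigma-finite structure can be attached, so that
    products can be iterated with Tonelli available at each stage. *)
Definition sfprod : set (T1 * T2)%type -> \bar R := (m1 \x m2)%E.
HB.instance Definition _ := Measure.on sfprod.
HB.instance Definition _ := @Measure_isSigmaFinite.Build _ _ _ sfprod sigma_finite_prod.
End product_sigma_finite.

(** * Lebesgue integration on R^d in coordinates *)

Section Euclidean.
Variable R : realType.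
Local Notation leb := (@lebesgue_measure R : {sigma_finite_measure set (measurableTypeR R) -> \bar R}).

(** The type underlying R^d is defined by recursion on d, so its measurable structure and its
    measure have to be produced along with it. *)
Record msp := Msp { mdisp : measure_display ; mty : measurableType mdisp ;
  mmeas : {sigma_finite_measure set mty -> \bar R} }.

(* Lebesgue measure on R^d, with R^d realised as R * (R * (... * unit)). *)
Fixpoint Esp (d : nat) : msp :=
  if d is d'.+1 then Msp (sfprod leb (mmeas (Esp d')))
  else Msp (@dirac _ unit tt R : {sigma_finite_measure set unit -> \bar R}).

Definition E d := mty (Esp d).
Definition mu d : {sigma_finite_measure set (E d) -> \bar R} := mmeas (Esp d).

Definition ccons (t : R) (c : nat -> R) : nat -> R :=
  fun k => if k is k'.+1 then c k' else t.

(* The coordinates of a point of R^d, extended by zero. *)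
Fixpoint co d : E d -> nat -> R :=
  match d return E d -> nat -> R with
  | 0 => fun _ _ => 0
  | d'.+1 => fun x => ccons x.1 (@co d' x.2)
  end.

Lemma measurable_co d k : measurable_fun setT (fun x : E d => co x k).
Proof.
elim: d k => [|d IH] [|k] /=; [exact: measurable_cst..| |].
  exact: measurable_fst.
exact: (measurableT_comp (IH k) measurable_snd).
Qed.

(** Integrands take coordinate sequences rather than points of [E d], so that a function can be
    split, shifted and restricted to blocks without changing its type; only sequences vanishing from
    index [d] on are sampled. *)
Definition eint d (f : (nat -> R) -> \bar R) : \bar R := (\int[mu d]_x f (co x))%E.
Definition rint d (f : (nat -> R) -> R) : R := Rintegral (mu d) setT (fun x => f (co x)).
Definition mfe d (f : (nat -> R) -> \bar R) := measurable_fun (setT : set (E d)) (f \o @co d).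
Definition mfr d (f : (nat -> R) -> R) := measurable_fun (setT : set (E d)) (f \o @co d).

Lemma mfe_EFin d f : mfr d f -> mfe d (fun c => (f c)%:E).
Proof. by move=> mf; apply/measurable_EFinP. Qed.

Lemma mfe_ccons d f t : mfe d.+1 f -> mfe d (fun c => f (ccons t c)).
Proof.
by move=> mf; exact: (measurableT_comp mf (measurable_pair1 (t : measurableTypeR R))).
Qed.

Lemma mfr_ccons d f t : mfr d.+1 f -> mfr d (fun c => f (ccons t c)).
Proof.
by move=> mf; exact: (measurableT_comp mf (measurable_pair1 (t : measurableTypeR R))).
Qed.

Lemma eint0 f : eint 0 f = f (fun _ => 0).
Proof. by rewrite /eint /= integral_dirac//= diracT mul1e. Qed.

Lemma rint0 f : rint 0 f = f (fun _ => 0).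
Proof. by rewrite /rint /Rintegral -/(eint 0 (fun c => (f c)%:E)) eint0. Qed.

Lemma eint_S d f : mfe d.+1 f -> (forall c, 0 <= f c)%E ->
  eint d.+1 f = (\int[leb]_t eint d (fun c => f (ccons t c)))%E.
Proof.
move=> mf f0; rewrite /eint.
by rewrite -(fubini_tonelli1 (m1 := leb) (m2 := mu d) (fun x : E d.+1 => f (co x))).
Qed.

Lemma eint_S2 d f : mfe d.+1 f -> (forall c, 0 <= f c)%E ->
  eint d.+1 f = eint d (fun c => \int[leb]_t f (ccons t c))%E.
Proof.
move=> mf f0; rewrite /eint.
by rewrite -(fubini_tonelli2 (m1 := leb) (m2 := mu d) (fun x : E d.+1 => f (co x))).
Qed.

Definition wt d (c : nat -> R) : R := \prod_(i < d) (1 + c i ^+ 2)^-1.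

Lemma wt_ccons d t c : wt d.+1 (ccons t c) = (1 + t ^+ 2)^-1 * wt d c.
Proof. by rewrite /wt big_ord_recl. Qed.

Lemma sq1_gt0 (t : R) : 0 < 1 + t ^+ 2.
Proof. by rewrite ltr_pwDl// sqr_ge0. Qed.

Lemma wt_gt0 d c : 0 < wt d c.
Proof. by apply: prodr_gt0 => i _; rewrite invr_gt0 sq1_gt0. Qed.

Lemma wt_le1 d c : wt d c <= 1.
Proof.
elim: d c => [|d IH] c; first by rewrite /wt big_ord0.
have -> : wt d.+1 c = (1 + c 0%N ^+ 2)^-1 * wt d (fun k => c k.+1).
  by rewrite /wt big_ord_recl.
rewrite mulr_ile1 ?IH ?invr_ge0 ?(ltW (wt_gt0 _ _)) ?(ltW (sq1_gt0 _))//.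
by rewrite invf_le1 ?sq1_gt0// lerDl sqr_ge0.
Qed.

Lemma integral_sq1V : (\int[leb]_t ((1 + t ^+ 2)^-1)%:E)%E = pi%:E.
Proof.
have := @ge0_symfun_integralT R (fun t => (1 + t ^+ 2)^-1) _ _ _.
move=> -> //; last by move=> t /=; rewrite sqrrN.
- rewrite -set_itvcy integral0y_oneDsqr -EFinM; congr EFin.
  by rewrite mulrCA divff ?mulr1.
- by move=> t; rewrite invr_ge0 ltW ?sq1_gt0.
- exact: continuous_oneDsqrV.
Qed.

Lemma measurable_sq1V : measurable_fun setT (fun t : R => (1 + t ^+ 2)^-1).
Proof. by apply: continuous_measurable_fun; exact: continuous_oneDsqrV. Qed.

Lemma mfr_coord d k : mfr d (fun c => c k).
Proof. exact: measurable_co. Qed.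

Lemma mfr_wt d : mfr d (wt d).
Proof.
apply: measurable_prod => i _.
by apply: (measurableT_comp measurable_sq1V); exact: mfr_coord.
Qed.

Lemma mfe_wt d : mfe d (fun c => (wt d c)%:E).
Proof. exact/mfe_EFin/mfr_wt. Qed.

Lemma eint_wt d : eint d (fun c => (wt d c)%:E) = (pi ^+ d)%:E.
Proof.
elim: d => [|d IH]; first by rewrite eint0 /wt big_ord0 expr0.
rewrite eint_S; [|exact: mfe_wt|by move=> c; rewrite lee_fin ltW ?wt_gt0].
rewrite exprS EFinM -integral_sq1V -ge0_integralZr//; last 3 first.
- by apply/measurable_EFinP; exact: measurable_sq1V.
- by move=> t _; rewrite lee_fin invr_ge0 ltW ?sq1_gt0.
- by rewrite lee_fin exprn_ge0 ?pi_ge0.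
apply: eq_integral => t _; rewrite -IH /eint.
rewrite -ge0_integralZl_EFin//.
- by apply: eq_integral => x _; rewrite wt_ccons EFinM.
- by move=> x _; rewrite lee_fin ltW ?wt_gt0.
- exact: mfe_wt.
- by rewrite invr_ge0 ltW ?sq1_gt0.
Qed.

(* Functions dominated by an integrable product weight: integrable together with all their sections. *)
Definition dom d (f : (nat -> R) -> R) :=
  mfr d f /\ exists K : R, forall c, `|f c| <= K * wt d c.

Lemma dom_mfr d f : dom d f -> mfr d f. Proof. by case. Qed.

Lemma wt_integrable d : (mu d).-integrable setT (fun x => (wt d (co x))%:E).
Proof.
apply/integrableP; split; first exact: mfe_wt.
under eq_integral do rewrite gee0_abs ?lee_fin ?ltW ?wt_gt0//.
by rewrite [X in (X < _)%E]eint_wt ltry.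
Qed.

Lemma dom_integrable d f : dom d f -> (mu d).-integrable setT (fun x => (f (co x))%:E).
Proof.
move=> [mf [K fK]].
apply: (@le_integrable _ _ _ _ _ measurableT _ (fun x => (K * wt d (co x))%:E)).
- exact: mfe_EFin.
- by move=> x _; rewrite !abse_EFin lee_fin (le_trans (fK _))// ler_norm.
- under eq_fun do rewrite EFinM; apply: integrableZl => //; exact: wt_integrable.
Qed.

Lemma dom_ccons d f t : dom d.+1 f -> dom d (fun c => f (ccons t c)).
Proof.
move=> [mf [K fK]]; split; first exact: mfr_ccons.
exists (K * (1 + t ^+ 2)^-1) => c; by rewrite -mulrA -wt_ccons.
Qed.

Lemma rint_S d f : dom d.+1 f ->
  rint d.+1 f = Rintegral leb setT (fun t => rint d (fun c => f (ccons t c))).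
Proof.
move=> df; rewrite /rint /Rintegral; congr fine.
rewrite -(integral12_prod_meas1 (m1 := leb) (m2 := mu d) (f := fun x : E d.+1 => (f (co x))%:E)); last first.
  exact: (@dom_integrable d.+1 f df).
apply: eq_integral => t _; rewrite /fubini_F fineK//.
exact: integrable_fin_num (dom_integrable (dom_ccons t df)).
Qed.


Lemma integrable_sq1V : leb.-integrable setT (fun t => ((1 + t ^+ 2)^-1)%:E).
Proof.
apply/integrableP; split; first by apply/measurable_EFinP; exact: measurable_sq1V.
under eq_integral do rewrite gee0_abs ?lee_fin ?invr_ge0 ?ltW ?sq1_gt0//.
by rewrite integral_sq1V ltry.
Qed.

Lemma mfr_cconsl d f c : mfr d.+1 f -> (exists x : E d, c = co x) ->
  measurable_fun setT (fun t : measurableTypeR R => f (ccons t c)).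
Proof.
move=> mf [x ->].
exact: (measurableT_comp mf (measurable_pair2 x)).
Qed.

Lemma dom_cconsl d f (x : E d) : dom d.+1 f ->
  leb.-integrable setT (fun t => (f (ccons t (co x)))%:E).
Proof.
move=> [mf [K fK]].
apply: (@le_integrable _ _ _ _ _ measurableT _ (fun t : measurableTypeR R => (K * wt d (co x) * (1 + t ^+ 2)^-1)%:E)).
- by apply/measurable_EFinP; apply: mfr_cconsl mf _; exists x.
- move=> t _; rewrite !abse_EFin lee_fin (le_trans (fK _))// wt_ccons mulrCA mulrC.
  by rewrite ler_norm.
- under eq_fun do rewrite EFinM; apply: integrableZl => //; exact: integrable_sq1V.
Qed.

Lemma rint_S2 d f : dom d.+1 f ->
  rint d.+1 f = rint d (fun c => Rintegral leb setT (fun t => f (ccons t c))).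
Proof.
move=> df; rewrite /rint /Rintegral; congr fine.
rewrite -(integral21_prod_meas1 (m1 := leb) (m2 := mu d) (f := fun x : E d.+1 => (f (co x))%:E)); last first.
  exact: (@dom_integrable d.+1 f df).
apply: eq_integral => x _; rewrite /fubini_G fineK//.
exact: integrable_fin_num (dom_cconsl x df).
Qed.

(** Tonelli for the positive and negative parts gives measurability without integrability of the
    sections: [fine] is measurable, whatever value it returns. *)
Lemma measurable_Rintegral d1 d2 (T1 : measurableType d1) (T2 : measurableType d2)
    (m2 : {sigma_finite_measure set T2 -> \bar R}) (f : T1 * T2 -> R) :
  measurable_fun setT f -> measurable_fun setT (fun x => Rintegral m2 setT (fun y => f (x, y))).
Proof.
move=> mf; rewrite /Rintegral; apply: (measurableT_comp (f := fine)) => //.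
under eq_fun do rewrite integralE.
apply: emeasurable_funB.
  rewrite (_ : (fun x => _) = fubini_F m2 (EFin \o f)^\+%E); last first.
    by apply/funext => x; apply: eq_integral => y _; rewrite !funeposE.
  apply: measurable_fun_fubini_tonelli_F; last by move=> z; exact: funepos_ge0.
  by apply: measurable_funepos; exact/measurable_EFinP.
rewrite (_ : (fun x => _) = fubini_F m2 (EFin \o f)^\-%E); last first.
  by apply/funext => x; apply: eq_integral => y _; rewrite !funenegE.
apply: measurable_fun_fubini_tonelli_F; last by move=> z; exact: funeneg_ge0.
by apply: measurable_funeneg; exact/measurable_EFinP.
Qed.

Lemma domZ d f k : dom d f -> dom d (fun c => k * f c).
Proof.
move=> [mf [K fK]]; split; first by apply: measurable_funM => //; exact: mf.
by exists (`|k| * K) => c; rewrite normrM -mulrA ler_wpM2l.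
Qed.

Lemma domD d f g : dom d f -> dom d g -> dom d (fun c => f c + g c).
Proof.
move=> [mf [K fK]] [mg [L gL]]; split; first by apply: measurable_funD; [exact: mf|exact: mg].
by exists (K + L) => c; rewrite mulrDl (le_trans (ler_normD _ _))// lerD.
Qed.

Lemma dom_bound d f g K : dom d f -> mfr d g -> (forall c, `|g c| <= K * `|f c|) -> dom d g.
Proof.
move=> [mf [L fL]] mg gf; split=> //; exists (`|K| * L) => c.
rewrite (le_trans (gf c))// -mulrA (le_trans _ (ler_wpM2l _ (fL c)))//.
by rewrite ler_wpM2r// ler_norm.
Qed.

Lemma dom_bmul d f g K : dom d f -> mfr d g -> (forall c, `|g c| <= K) ->
  dom d (fun c => f c * g c).
Proof.
move=> df mg gK; apply: (dom_bound (K := K) df).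
  by apply: measurable_funM => //; exact: dom_mfr df.
by move=> c; rewrite normrM mulrC ler_wpM2r.
Qed.

Lemma rintZ d f k : dom d f -> rint d (fun c => k * f c) = k * rint d f.
Proof. by move=> df; rewrite /rint RintegralZl//; exact: dom_integrable. Qed.

Lemma rintD d f g : dom d f -> dom d g ->
  rint d (fun c => f c + g c) = rint d f + rint d g.
Proof. by move=> df dg; rewrite /rint RintegralD//; exact: dom_integrable. Qed.

Lemma rint_abs d f : dom d f -> `|rint d f| <= rint d (fun c => `|f c|).
Proof. by move=> df; rewrite /rint le_normr_Rintegral//; exact: dom_integrable. Qed.

Lemma domN d f : dom d f -> dom d (fun c => - f c).
Proof.
move=> /(domZ (-1)); congr dom; apply/funext => c; by rewrite mulN1r.
Qed.

Lemma rintN d f : dom d f -> rint d (fun c => - f c) = - rint d f.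
Proof.
move=> df; rewrite -mulN1r -rintZ//; congr rint; by apply/funext => c; rewrite mulN1r.
Qed.

Lemma domB d f g : dom d f -> dom d g -> dom d (fun c => f c - g c).
Proof. by move=> df dg; apply: domD => //; exact: domN. Qed.

Lemma rintB d f g : dom d f -> dom d g ->
  rint d (fun c => f c - g c) = rint d f - rint d g.
Proof. by move=> df dg; rewrite rintD// ?rintN//; exact: domN. Qed.

Lemma dom_abs d f : dom d f -> dom d (fun c => `|f c|).
Proof.
move=> df; apply: (dom_bound (K := 1) df).
  by apply: measurableT_comp => //; exact: dom_mfr df.
by move=> c; rewrite normr_id mul1r.
Qed.

Lemma le_rint d f g : dom d f -> dom d g -> (forall c, f c <= g c) -> rint d f <= rint d g.
Proof.
by move=> df dg fg; rewrite /rint le_Rintegral//; exact: dom_integrable.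
Qed.

Lemma rint_ge0 d f : (forall c, 0 <= f c) -> 0 <= rint d f.
Proof. by move=> f0; apply: Rintegral_ge0. Qed.

Lemma EFin_rint d f : dom d f -> (rint d f)%:E = eint d (fun c => (f c)%:E).
Proof.
by move=> df; rewrite /rint /Rintegral fineK//; exact: integrable_fin_num (dom_integrable df).
Qed.

Fixpoint ccat n (c c' : nat -> R) : nat -> R :=
  if n is n'.+1 then ccons (c 0%N) (ccat n' (fun k => c k.+1) c') else c'.

Definition shift n (c : nat -> R) : nat -> R := fun k => c (n + k)%N.

Lemma dom_ccat n m f c : dom (n + m) f -> dom m (fun c' => f (ccat n c c')).
Proof.
elim: n f c => [|n IH] f c //= df.
exact: (IH (fun c' => f (ccons (c 0%N) c'))  _ (dom_ccons (c 0%N) df)).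
Qed.

Lemma shift_ccat n c c' : shift n (ccat n c c') = c'.
Proof.
elim: n c => [|n IH] c; first by apply/funext=> k; rewrite /shift.
by rewrite -[RHS](IH (fun k => c k.+1)); apply/funext=> k; rewrite /shift addSn.
Qed.

Definition rv n (c : nat -> R) : 'rV[R]_n := \row_i c i.

Lemma rv_ccat n c c' : rv n (ccat n c c') = rv n c.
Proof.
apply/rowP => -[k kn]; rewrite !mxE /=.
elim: n k kn c => [|n IH] [|k] //= kn c.
exact: (IH k kn (fun k => c k.+1)).
Qed.

Lemma rcons_rv n t c : rcons_row t (rv n c) = rv n.+1 (ccons t c).
Proof.
apply/rowP => j; rewrite mxE; have [k ->|k ->] := split_ordP (j : 'I_(1 + n)).
  by rewrite !mxE ord1.
by rewrite !mxE.
Qed.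

(** Carrying an inner integral over [m] further variables is what lets the iteration over blocks in
    [RintL] proceed by induction. *)
Lemma Rintn_rint n m (G : 'rV[R]_n -> (nat -> R) -> R) :
  dom (n + m) (fun c => G (rv n c) (shift n c)) ->
  Rintn (fun u => rint m (G u)) = rint (n + m) (fun c => G (rv n c) (shift n c)).
Proof.
elim: n G => [|n IH] G dG.
  rewrite /=; congr rint; apply/funext => c; congr (G _ _).
  by apply/rowP => -[].
rewrite [RHS]rint_S//=; congr Rintegral; apply/funext => t.
rewrite (IH (fun v => G (rcons_row t v))).
  by congr rint; apply/funext => c; rewrite rcons_rv.
by have := dom_ccons t dG; congr dom; apply/funext => c; rewrite rcons_rv.
Qed.


Definition blk l n (c : nat -> R) : 'I_l -> 'rV[R]_n := fun j => \row_i c (j * n + i)%N.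

Lemma blkS l n c : blk (l := l.+1) n c = fcons (rv n c) (blk (l := l) n (shift n c)).
Proof.
apply/funext => j; rewrite /fcons; case: unliftP => [k ->|->].
  by apply/rowP => i; rewrite !mxE /shift lift0 mulSn addnA.
by apply/rowP => i; rewrite !mxE mul0n.
Qed.

Lemma RintL_rint n l (g : ('I_l -> 'rV[R]_n) -> R) :
  dom (l * n) (fun c => g (blk n c)) -> RintL g = rint (l * n) (fun c => g (blk n c)).
Proof.
elim: l g => [|l IH] g dg.
  by rewrite /= rint0; congr g; apply/funext => -[].
pose G u c := g (fcons u (blk (l := l) n c)).
have dG : dom (n + l * n) (fun c => G (rv n c) (shift n c)).
  by move: dg; congr dom; apply/funext => c; rewrite /G -blkS.
rewrite [RHS](_ : _ = rint (n + l * n) (fun c => G (rv n c) (shift n c))); last first.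
  by congr rint; apply/funext => c; rewrite /G -blkS.
rewrite -Rintn_rint//=; congr Rintn; apply/funext => u.
rewrite IH//.
have := dom_ccat (fun k => if insub k is Some i then u 0 i else 0) dG.
congr dom; apply/funext => c; rewrite shift_ccat rv_ccat /G.
by congr (g (fcons _ _)); apply/rowP => i; rewrite mxE insubT//= => ?; congr (u _ _); exact: val_inj.
Qed.

Lemma mfe_ccat n m f c : mfe (n + m) f -> mfe m (fun c' => f (ccat n c c')).
Proof.
elim: n f c => [|n IH] f c //= df.
exact: (IH (fun c' => f (ccons (c 0%N) c'))  _ (mfe_ccons (c 0%N) df)).
Qed.

Lemma Eintn_eint n m (G : 'rV[R]_n -> (nat -> R) -> \bar R) :
  mfe (n + m) (fun c => G (rv n c) (shift n c)) -> (forall u c, 0 <= G u c)%E ->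
  Eintn (fun u => eint m (G u)) = eint (n + m) (fun c => G (rv n c) (shift n c)).
Proof.
elim: n G => [|n IH] G dG G0.
  rewrite /=; congr eint; apply/funext => c; congr (G _ _).
  by apply/rowP => -[].
rewrite [RHS]eint_S//=; congr integral; apply/funext => t.
rewrite (IH (fun v => G (rcons_row t v)))//.
  by congr eint; apply/funext => c; rewrite rcons_rv.
by have := mfe_ccons t dG; congr mfe; apply/funext => c; rewrite rcons_rv.
Qed.

Lemma EintL_eint n l (g : ('I_l -> 'rV[R]_n) -> \bar R) :
  mfe (l * n) (fun c => g (blk n c)) -> (forall u, 0 <= g u)%E ->
  EintL g = eint (l * n) (fun c => g (blk n c)).
Proof.
elim: l g => [|l IH] g dg g0.
  by rewrite /= eint0; congr g; apply/funext => -[].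
pose G u c := g (fcons u (blk (l := l) n c)).
have dG : mfe (n + l * n) (fun c => G (rv n c) (shift n c)).
  by move: dg; congr mfe; apply/funext => c; rewrite /G -blkS.
rewrite [RHS](_ : _ = eint (n + l * n) (fun c => G (rv n c) (shift n c))); last first.
  by congr eint; apply/funext => c; rewrite /G -blkS.
rewrite -Eintn_eint//=; last by move=> *; exact: g0.
congr Eintn; apply/funext => u.
rewrite IH//.
have := mfe_ccat (fun k => if insub k is Some i then u 0 i else 0) dG.
congr mfe; apply/funext => c; rewrite shift_ccat rv_ccat /G.
by congr (g (fcons _ _)); apply/rowP => i; rewrite mxE insubT//= => ?; congr (u _ _); exact: val_inj.
Qed.

Lemma Rintn_rint0 n (g : 'rV[R]_n -> R) :
  dom n (fun c => g (rv n c)) -> Rintn g = rint n (fun c => g (rv n c)).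
Proof.
move=> dg; have := @Rintn_rint n 0 (fun u _ => g u).
rewrite addn0 => <-//; congr Rintn; apply/funext => u.
by rewrite rint0.
Qed.

Lemma Eintn_eint0 n (g : 'rV[R]_n -> \bar R) : (forall u, 0 <= g u)%E ->
  mfe n (fun c => g (rv n c)) -> Eintn g = eint n (fun c => g (rv n c)).
Proof.
move=> g0 dg; have := @Eintn_eint n 0 (fun u _ => g u).
rewrite addn0 => <-//; congr Eintn; apply/funext => u.
by rewrite eint0.
Qed.

(** The integral of a nonnegative function is a supremum over the simple functions below it, so
    monotonicity asks for no measurability. Integrands such as that of [cube_avg] can thus be
    majorised directly. *)
Lemma le_integral_nomeas d (T : measurableType d) (m : {measure set T -> \bar R}) (f g : T -> \bar R) :
  (forall x, 0 <= f x)%E -> (forall x, f x <= g x)%E ->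
  (\int[m]_x f x <= \int[m]_x g x)%E.
Proof.
move=> f0 fg; rewrite !ge0_integralTE//; last by move=> x; exact: le_trans (f0 x) (fg x).
by apply: le_ereal_sup => _ [h hf <-]; exists h => // x; exact: le_trans (hf x) (fg x).
Qed.

Lemma le_Eintn n (f g : 'rV[R]_n -> \bar R) : (forall x, 0 <= f x)%E ->
  (forall x, f x <= g x)%E -> (Eintn f <= Eintn g)%E.
Proof.
have E0 m (h : 'rV[R]_m -> \bar R) : (forall x, 0 <= h x)%E -> (0 <= Eintn h)%E.
  by elim: m h => [|m IH] h h0 //=; apply: integral_ge0 => t _; exact: IH.
elim: n f g => [|n IH] f g f0 fg /=; first exact: fg.
apply: (@le_integral_nomeas _ (measurableTypeR R) leb) => t; first exact: E0.
exact: IH.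
Qed.

Fixpoint ecat n m : E n -> E m -> E (n + m) :=
  match n return E n -> E m -> E (n + m) with
  | 0 => fun _ y => y
  | n'.+1 => fun x y => (x.1, @ecat n' m x.2 y)
  end.

Lemma co_ecat n m (x : E n) (y : E m) : co (ecat x y) = ccat n (co x) (co y).
Proof. by elim: n x => [|n IH] x //=; rewrite IH. Qed.

Lemma measurable_ecat n m : measurable_fun setT (fun z : E n * E m => ecat z.1 z.2).
Proof.
elim: n => [|n IH] /=; first exact: measurable_snd.
apply: (@measurable_fun_pair _ _ _ _ (measurableTypeR R) (E (n + m))).
  exact: measurableT_comp measurable_fst measurable_fst.
have mp : measurable_fun setT (fun z : (measurableTypeR R * E n) * E m => (z.1.2, z.2)).
  apply: measurable_fun_pair; last exact: measurable_snd.
  exact: measurableT_comp measurable_snd measurable_fst.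
exact: measurableT_comp IH mp.
Qed.

Lemma mfe_cat n m f : mfe (n + m) f ->
  measurable_fun setT (fun z : E n * E m => f (ccat n (co z.1) (co z.2))).
Proof.
move=> mf; have := measurableT_comp mf (@measurable_ecat n m).
by congr measurable_fun; apply/funext => z /=; rewrite co_ecat.
Qed.

Lemma mfr_cat n m f : mfr (n + m) f ->
  measurable_fun setT (fun z : E n * E m => f (ccat n (co z.1) (co z.2))).
Proof.
move=> mf; have := measurableT_comp mf (@measurable_ecat n m).
by congr measurable_fun; apply/funext => z /=; rewrite co_ecat.
Qed.

Lemma eint_cat n m (f : (nat -> R) -> \bar R) : mfe (n + m) f -> (forall c, 0 <= f c)%E ->
  eint (n + m) f = eint n (fun c => eint m (fun c' => f (ccat n c c'))).
Proof.
elim: n f => [|n IH] f mf f0; first by rewrite eint0.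
rewrite [LHS]eint_S// [RHS]eint_S//.
- by apply: eq_integral => t _; rewrite (IH (fun c => f (ccons t c)))//; exact: mfe_ccons.
- have := measurable_fun_fubini_tonelli_F (m2 := mu m) _ (mfe_cat mf).
  by apply => z.
- by move=> c; apply: integral_ge0.
Qed.

Lemma wt_ccat n m c c' : wt (n + m) (ccat n c c') = wt n c * wt m c'.
Proof.
elim: n c => [|n IH] c; first by rewrite /wt big_ord0 mul1r.
by rewrite /= wt_ccons IH mulrA; congr (_ * _); rewrite [RHS]/wt big_ord_recl.
Qed.

Lemma rint_cat n m (f : (nat -> R) -> R) : dom (n + m) f ->
  rint (n + m) f = rint n (fun c => rint m (fun c' => f (ccat n c c'))).
Proof.
elim: n f => [|n IH] f df; first by rewrite rint0.
have dR : dom n.+1 (fun c => rint m (fun c' => f (ccat n.+1 c c'))).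
  split.
    have := measurable_Rintegral (mu m) (mfr_cat (dom_mfr df)).
    by congr measurable_fun.
  have [mf [K fK]] := df; exists (K * fine (eint m (fun c => (wt m c)%:E))) => c.
  rewrite (le_trans (rint_abs (dom_ccat _ df)))//.
  have dw : dom m (wt m).
    by split; [exact: mfr_wt|exists 1 => c'; rewrite mul1r ger0_norm// ltW// wt_gt0].
  rewrite -EFin_rint//= -mulrAC -rintZ//.
  apply: le_rint; [exact/dom_abs/(dom_ccat _ df)|exact: domZ|move=> c'].
  by rewrite (le_trans (fK _))// (wt_ccat n.+1) mulrA.
rewrite [LHS]rint_S// [RHS]rint_S//; congr Rintegral; apply/funext => t.
by rewrite (IH (fun c => f (ccons t c)))//; exact: dom_ccons.
Qed.

End Euclidean.

(** * Dyadic shells, one-variable calculus and integration by parts *)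

Section Tools.
Variable R : realType.
Local Notation leb := (@lebesgue_measure R : {sigma_finite_measure set (measurableTypeR R) -> \bar R}).

Lemma geo_nneseries_le (B : R) : 0 <= B ->
  (\sum_(0 <= i <oo) (B * 2 ^- i)%:E <= (2 * B)%:E)%E.
Proof.
move=> B0; apply: lime_le.
  by apply: is_cvg_nneseries => n _ _; rewrite lee_fin mulr_ge0// invr_ge0 exprn_ge0.
near=> n; rewrite sumEFin lee_fin -mulr_sumr mulrC ler_wpM2r//.
suff -> : \sum_(0 <= i < n) 2 ^- i = 2 - 2 * 2 ^- n :> R.
  by rewrite lerBlDr lerDl mulr_ge0// invr_ge0 exprn_ge0.
elim: (n) => [|k IH]; first by rewrite big_geq// expr0 invr1 mulr1 subrr.
by rewrite big_nat_recr//= IH exprS invfM; field; rewrite expf_neq0.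
Unshelve. all: by end_near. Qed.

(** The least admissible [i] works: if it is positive, minimality gives 2^(i-1) < y < 1 + y; if it
    is 0, the right side is at least 1. *)
Lemma dyadic_weight (y : R) N : 0 <= y ->
  exists i, y <= 2 ^+ i /\ (1 + y)^-1 ^+ N <= 2 ^+ N * (2 ^- i) ^+ N.
Proof.
move=> y0; have ex : exists i, y <= 2 ^+ i.
  have [k yk] : exists k : nat, y <= k%:R.
    by exists (Num.bound y); rewrite ltW// archi_boundP.
  by exists k; rewrite (le_trans yk)// -natrX ler_nat ltnW// ltn_expl.
case: (ex_minnP ex) => -[|i] yi mini.
  exists 0%N; split=> //; rewrite expr0 invr1 expr1n mulr1 (@le_trans _ _ 1)//.
    by rewrite exprn_ile1// ?invr_ge0 ?invf_le1 ?ltr_pwDl// ?addr_ge0// lerDl.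
  by rewrite exprn_ege1// ler1n.
exists i.+1; split=> //; rewrite -exprMn lerXn2r// ?nnegrE ?invr_ge0 ?addr_ge0 ?mulr_ge0 ?invr_ge0 ?exprn_ge0//.
have yi' : 2 ^+ i < y by rewrite ltNge; apply/negP => /mini; rewrite ltnn.
rewrite exprS invfM mulrA divff// mul1r lef_pV2 ?posrE ?exprn_gt0 ?ltr_pwDl//.
by rewrite (le_trans (ltW yi'))// lerDr.
Qed.

(** A point at height X is charged to a ball of radius 2^i t on which the weight is at most 2^N
    2^(-iN). The ball has mass at most L (2^i t)^D, and N > D leaves a factor 2^-i, whose sum is
    2. *)
Lemma shell d (T : measurableType d) (m : {measure set T -> \bar R}) (h : T -> \bar R)
    (X : T -> R) (L t : R) (D N : nat) :
  measurable_fun setT h -> (forall x, 0 <= h x)%E ->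
  measurable_fun setT X -> (forall x, 0 <= X x) -> 0 < t -> 0 <= L -> (D < N)%N ->
  (forall r, 0 < r -> (\int[m]_x (h x * (\1_[set y | X y <= r] x)%:E) <= (L * r ^+ D)%:E)%E) ->
  (\int[m]_x (h x * ((1 + X x / t)^-1 ^+ N)%:E) <= (2 ^+ N.+1 * L * t ^+ D)%:E)%E.
Proof.
move=> mh h0 mX X0 t0 L0 DN hL.
pose F i x := ((2 ^+ N * (2 ^- i) ^+ N)%:E * (h x * (\1_[set y | X y <= 2 ^+ i * t] x)%:E))%E.
have mS r : measurable [set y | X y <= r].
  rewrite (_ : [set y | _] = X @^-1` [set` `]-oo, r]]); last by apply/seteqP; split => y /=; rewrite in_itv.
  by rewrite -[X in measurable X]setTI; exact: mX.
have k0 i : 0 <= 2 ^+ N * (2 ^- i) ^+ N :> R by rewrite mulr_ge0// exprn_ge0// invr_ge0 exprn_ge0.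
have mF0 r : measurable_fun setT (fun x => h x * (\1_[set y | X y <= r] x)%:E)%E.
  apply: emeasurable_funM => //; apply/measurable_EFinP.
  exact: measurable_indic.
have mF i : measurable_fun setT (F i).
  by apply: emeasurable_funM => //; exact: measurable_cst.
have F0 i x : (0 <= F i x)%E.
  by rewrite /F mule_ge0 ?lee_fin// mule_ge0// lee_fin indicE.
apply: (@le_trans _ _ (\int[m]_x \sum_(0 <= i <oo) F i x)%E).
  apply: le_integral_nomeas => x.
    by rewrite mule_ge0// lee_fin exprn_ge0// invr_ge0 addr_ge0// divr_ge0// ltW.
  have [i [yi wi]] := @dyadic_weight (X x / t) N (divr_ge0 (X0 x) (ltW t0)).
  apply: (@le_trans _ _ (F i x)).
    rewrite /F muleA [X in (_ <= X * _)%E]muleC -muleA lee_wpmul2l//.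
    rewrite -EFinM lee_fin indicE mem_set ?mulr1//=.
    by rewrite -ler_pdivrMr.
  rewrite (nneseriesD1 (n := i))//.
  by rewrite leeDl// nneseries_ge0.
rewrite integral_nneseries//.
apply: (@le_trans _ _ (\sum_(0 <= i <oo) ((2 ^+ N * L * t ^+ D) * 2 ^- i)%:E)%E).
  apply: lee_nneseries => [i _ _|i _]; first by apply: integral_ge0.
  rewrite ge0_integralZl_EFin//; last by move=> x _; rewrite mule_ge0// lee_fin indicE.
  apply: (le_trans (lee_wpmul2l _ (hL _ _))); rewrite ?lee_fin ?mulr_gt0 ?exprn_gt0//.
  set w := 2 ^- i.
  have w0 : 0 <= w by rewrite invr_ge0 exprn_ge0.
  have w1 : w <= 1 by rewrite invf_le1 ?exprn_gt0// exprn_ege1// ler1n.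
  have key : w ^+ N * (2 ^+ i) ^+ D <= w.
    rewrite -(subnKC DN) exprD exprS -mulrA -mulrA ler_piMr// mulrCA mulrA.
    rewrite -mulrA -exprMn /w mulVf ?expf_neq0// expr1n mulr1.
    by rewrite exprn_ile1.
  rewrite exprMn [leLHS](_ : _ = (2 ^+ N * L * t ^+ D) * (w ^+ N * (2 ^+ i) ^+ D)); last by ring.
  by rewrite ler_wpM2l// !mulr_ge0 ?exprn_ge0// ltW.
rewrite (le_trans (geo_nneseries_le _))//; first by rewrite !mulr_ge0 ?exprn_ge0// ltW.
by rewrite lee_fin exprS !mulrA.
Qed.

(** The fundamental theorem on [-n, n] gives f n - f (-n), which the bound on f sends to 0, while
    the bound on f' justifies dominated convergence. *)
Lemma integral_derive0 (f f' : R -> R) (K : R) :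
  (forall t : R, is_derive t (1 : R) f (f' t)) -> continuous f' ->
  (forall t, `|f t| <= K * (1 + t ^+ 2)^-1) -> (forall t, `|f' t| <= K * (1 + t ^+ 2)^-1) ->
  Rintegral leb setT f' = 0.
Proof.
move=> ff' cf' fK f'K.
have K0 : 0 <= K by have := le_trans (normr_ge0 _) (fK 0); rewrite expr0n addr0 invr1 mulr1.
have mf' : measurable_fun setT f' by exact: continuous_measurable_fun.
pose g n := (EFin \o f') \_ `[(- n%:R)%R, n%:R%R].
have intK : leb.-integrable setT (fun t => (K * (1 + t ^+ 2)^-1)%:E).
  by under eq_fun do rewrite EFinM; apply: integrableZl => //; exact: integrable_sq1V.
have cf : continuous f.
  by move=> t; apply/differentiable_continuous/derivable1_diffP; have [] := ff' t.
have FTC n : (0 < n)%N -> (\int[leb]_(x in `[(- n%:R)%R, n%:R%R]) (f' x)%:E = (f n%:R)%:E - (f (- n%:R))%:E)%E.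
  move=> n0; apply: continuous_FTC2.
  - by rewrite (@lt_trans _ _ 0)// ?oppr_lt0 ltr0n.
  - exact: continuous_subspaceT.
  - split.
    + by move=> x _; have [] := ff' x.
    + by apply: cvg_at_right_filter; exact: cf.
    + by apply: cvg_at_left_filter; exact: cf.
  - by move=> x _; rewrite derive1E; have [] := ff' x.
have gE n x : x \in [set` `[(- n%:R)%R, n%:R%R]] -> g n x = (f' x)%:E.
  by move=> xn; rewrite /g patchE xn.
have mg n : measurable_fun (setT : set (measurableTypeR R)) (g n).
  apply/(@measurable_restrictT _ _ (measurableTypeR R) _ `[(- n%:R)%R, n%:R%R]); first exact: measurable_itv.
  by apply: measurable_funTS; exact/measurable_EFinP.
have cvgx x : g n x @[n --> \oo] --> (f' x)%:E.
  apply: cvg_near_cst; near=> n; apply: gE.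
  rewrite inE /= in_itv /= -ler_norml.
  by near: n; exact: nbhs_infty_ger.
have gb x n : (`|g n x| <= (K * (1 + x ^+ 2)^-1)%:E)%E.
  rewrite /g patchE; case: ifP => _ /=; first by rewrite lee_fin.
  by rewrite normr0 lee_fin (le_trans (normr_ge0 _) (f'K x)).
have mf'E : measurable_fun (setT : set (measurableTypeR R)) (EFin \o f').
  exact/measurable_EFinP.
have H1 : \forall x \ae leb, [set: measurableTypeR R] x -> g n x @[n --> \oo] --> (EFin \o f') x.
  by apply: aeW => x _; exact: cvgx.
have H2 : \forall x \ae leb, forall n, [set: measurableTypeR R] x ->
    (`|g n x| <= (K * (1 + x ^+ 2)^-1)%:E)%E.
  by apply: aeW => x n _; exact: gb.
have [_ _ cg] := dominated_convergence (mu := leb) measurableT mg mf'E H1 intK H2.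
have cg0 : (\int[leb]_x g n x)%E @[n --> \oo] --> 0%E.
  have lim0 : (2 * (K * (1 + n%:R ^+ 2)^-1) : R) @[n --> \oo] --> 0%R.
    have -> : 0 = 2 * (K * 0) :> R by rewrite !mulr0.
    apply: cvgMr; apply: cvgMr; apply/gtr0_cvgV0.
      by near=> n; rewrite sq1_gt0.
    apply/cvgryPge => A; near=> n; rewrite (@le_trans _ _ n%:R)//.
      by near: n; exact: nbhs_infty_ger.
    by rewrite -natrX nat1r ler_nat -mulnn; nia.
  apply/fine_cvgP; split.
    near=> n; rewrite -integral_mkcond FTC//.
    by near: n; exact: nbhs_infty_gt.
  apply: (@squeeze_cvgr _ _ _ _ (fun n => - (2 * (K * (1 + n%:R ^+ 2)^-1)))
    (fun n => 2 * (K * (1 + n%:R ^+ 2)^-1))) => //; last by rewrite -oppr0; exact: cvgN.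
  near=> n; rewrite /= -ler_norml -integral_mkcond FTC/=; last by near: n; exact: nbhs_infty_gt.
  rewrite (le_trans (ler_normB _ _))// mulr2n mulrDl mul1r lerD//.
  by rewrite (le_trans (fK _))// sqrrN.
have := cvg_unique _ cg cg0.
by rewrite /Rintegral => ->.
Unshelve. all: by end_near. Qed.

Definition ider (f : R -> R) (t a : R) := is_derive t (1 : R) f a.

Lemma ider_eq f t a b : ider f t a -> a = b -> ider f t b.
Proof. by move=> ? <-. Qed.

Lemma iderD f g t a b : ider f t a -> ider g t b -> ider (fun s => f s + g s) t (a + b).
Proof. exact: is_deriveD. Qed.

Lemma iderM f g t a b : ider f t a -> ider g t b ->
  ider (fun s => f s * g s) t (a * g t + f t * b).
Proof.
move=> fa gb; apply: is_derive_eq (is_deriveM fa gb) _.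
by rewrite /GRing.scale/= addrC mulrC.
Qed.

Lemma ider_cst (k t : R) : ider (fun=> k) t 0.
Proof. exact: is_derive_cst. Qed.

Lemma ider_id t : ider id t 1.
Proof. exact: is_derive_id. Qed.

Lemma iderZ k f t a : ider f t a -> ider (fun s => k * f s) t (k * a).
Proof. by move=> fa; apply: ider_eq (iderM (ider_cst k t) fa) _; rewrite mul0r add0r. Qed.

Lemma ider_lin (a b t : R) : ider (fun s => a * s + b) t a.
Proof.
by apply: ider_eq (iderD (iderZ a (ider_id t)) (ider_cst b t)) _; rewrite mulr1 addr0.
Qed.

Lemma ider_comp f g t a b : ider f (g t) a -> ider g t b -> ider (fun s => f (g s)) t (a * b).
Proof. exact: is_derive1_comp. Qed.

Lemma ider_sum (I : Type) (r : seq I) (f : I -> R -> R) (a : I -> R) t :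
  (forall i, ider (f i) t (a i)) -> ider (fun s => \sum_(i <- r) f i s) t (\sum_(i <- r) a i).
Proof.
move=> fa; elim: r => [|i r IH].
  by rewrite big_nil; under eq_fun do rewrite big_nil; exact: ider_cst.
by rewrite big_cons; under eq_fun do rewrite big_cons; exact: iderD.
Qed.

Lemma ider_sin (f : R -> R) t a : ider f t a -> ider (fun s => sin (f s)) t (a * cos (f t)).
Proof. by move=> fa; rewrite mulrC; apply: (ider_comp _ fa); exact: is_derive_sin. Qed.

Lemma ider_cos (f : R -> R) t a : ider f t a -> ider (fun s => cos (f s)) t (- (a * sin (f t))).
Proof. by move=> fa; rewrite mulrC -mulNr; apply: (ider_comp _ fa); exact: is_derive_cos. Qed.

Lemma ider_continuous (f f' : R -> R) : (forall t, ider f t (f' t)) -> continuous f.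
Proof.
by move=> H t; apply/differentiable_continuous/derivable1_diffP; have [] := H t.
Qed.

Definition upd (c : nat -> R) e s : nat -> R := fun k => if k == e then s else c k.

Lemma upd0 t c s : upd (ccons t c) 0 s = ccons s c.
Proof. by apply/funext => -[|k]. Qed.

Lemma updS t c e s : upd (ccons t c) e.+1 s = ccons t (upd c e s).
Proof. by apply/funext => -[|k]. Qed.

(** Partial derivative along coordinate [e], stated on slices so that one-variable rules apply to it
    directly. *)
Definition isd e (g g' : (nat -> R) -> R) :=
  forall c (t : R), ider (fun s => g (upd c e s)) t (g' (upd c e t)).

Definition slice_cont e (g : (nat -> R) -> R) := forall c, continuous (fun s => g (upd c e s)).

(** Fubini peels off the coordinates before [e]; once [e] comes first it is integrated innermost,
    where the integral of the derivative is already 0. *)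
Lemma rint_derive0 d e g g' : (e < d)%N -> dom d g -> dom d g' -> isd e g g' ->
  slice_cont e g' -> rint d g' = 0.
Proof.
elim: d e g g' => // d IH [|e] g g' ed dg dg' gg' cg'.
  rewrite rint_S2// (_ : (fun _ => _) = fun _ => 0); first by rewrite /rint Rintegral_cst// mul0r.
  apply/funext => c; have [_ [K gK]] := dg; have [_ [L gL]] := dg'.
  apply: (@integral_derive0 (fun t => g (ccons t c)) _ (Num.max (K * wt d c) (L * wt d c))).
  - move=> t; have := gg' (ccons 0 c) t; rewrite upd0.
    by under eq_fun do rewrite upd0.
  - by have := cg' (ccons 0 c); under eq_fun do rewrite upd0.
  - move=> t; rewrite (le_trans (gK _))// wt_ccons mulrCA mulrC ler_wpM2r ?le_max ?lexx//.
    by rewrite invr_ge0 ltW ?sq1_gt0.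
  - move=> t; rewrite (le_trans (gL _))// wt_ccons mulrCA mulrC ler_wpM2r ?le_max ?lexx ?orbT//.
    by rewrite invr_ge0 ltW ?sq1_gt0.
rewrite rint_S// (_ : (fun _ => _) = fun _ => 0); first by rewrite Rintegral_cst// mul0r.
apply/funext => t; apply: (IH e (fun c => g (ccons t c))) => //.
- exact: dom_ccons.
- exact: dom_ccons.
- move=> c s; have := gg' (ccons t c) s; rewrite updS.
  by under eq_fun do rewrite updS.
- by move=> c; have := cg' (ccons t c); under eq_fun do rewrite updS.
Qed.

Definition dot d (c v : nat -> R) := \sum_(i < d) c i * v i.

(** Real form of the Fourier integral of [a]. The free phase makes sines instances of cosines, so
    the family is closed under integration by parts. *)
Definition osc d (a : (nat -> R) -> R) (psi : R) (v : nat -> R) :=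
  rint d (fun c => a c * cos (2 * pi * dot d c v + psi)).

Lemma mfr_dot d v : mfr d (fun c => dot d c v).
Proof. by apply: measurable_sum => i; apply: measurable_funM => //; exact: mfr_coord. Qed.

Lemma mfr_cos d (g : (nat -> R) -> R) : mfr d g -> mfr d (fun c => cos (g c)).
Proof. by move=> mg; apply: measurableT_comp => //; apply: continuous_measurable_fun; exact: continuous_cos. Qed.

Lemma mfr_sin d (g : (nat -> R) -> R) : mfr d g -> mfr d (fun c => sin (g c)).
Proof. by move=> mg; apply: measurableT_comp => //; apply: continuous_measurable_fun; exact: continuous_sin. Qed.

Lemma mfr_phase d v psi : mfr d (fun c => 2 * pi * dot d c v + psi).
Proof. by apply: measurable_funD => //; apply: measurable_funM => //; exact: mfr_dot. Qed.

Lemma normr_cos (x : R) : `|cos x| <= 1. Proof. by rewrite ler_norml cos_geN1 cos_le1. Qed.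
Lemma normr_sin (x : R) : `|sin x| <= 1. Proof. by rewrite ler_norml sin_geN1 sin_le1. Qed.

Lemma dom_cos d a v psi : dom d a -> dom d (fun c => a c * cos (2 * pi * dot d c v + psi)).
Proof.
move=> da; apply: dom_bmul (1) da _ _; first by apply: mfr_cos; exact: mfr_phase.
by move=> c; exact: normr_cos.
Qed.

Lemma dom_sin d a v psi : dom d a -> dom d (fun c => a c * sin (2 * pi * dot d c v + psi)).
Proof.
move=> da; apply: dom_bmul (1) da _ _; first by apply: mfr_sin; exact: mfr_phase.
by move=> c; exact: normr_sin.
Qed.

Lemma dot_upd d e c s v : (e < d)%N -> dot d (upd c e s) v = s * v e + dot d (upd c e 0) v.
Proof.
move=> ed; rewrite /dot (bigD1 (Ordinal ed))//= [in RHS](bigD1 (Ordinal ed))//= /upd eqxx mul0r add0r.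
congr (_ + _); apply: eq_bigr => i; rewrite -val_eqE/= => /negbTE ie.
by rewrite ie.
Qed.

Lemma ider_phase d e c v psi (t : R) : (e < d)%N ->
  ider (fun s => 2 * pi * dot d (upd c e s) v + psi) t (2 * pi * v e).
Proof.
move=> ed; rewrite (_ : (fun _ => _) = fun s => (2 * pi * v e) * s + (2 * pi * dot d (upd c e 0) v + psi)).
  exact: ider_lin.
by apply/funext => s; rewrite dot_upd//; ring.
Qed.

(** The derivative of a sin(phase) in coordinate e has integral 0; the remaining sine is a cosine
    with phase advanced by pi/2, up to the sign that moves the term across. *)
Lemma osc_derive d e a a' psi v : (e < d)%N -> dom d a -> dom d a' -> isd e a a' ->
  slice_cont e a -> slice_cont e a' ->
  osc d a psi v * (2 * pi * v e) = osc d a' (psi + pi / 2) v.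
Proof.
move=> ed da da' aa' ca ca'.
pose ph c := 2 * pi * dot d c v + psi.
have := @rint_derive0 d e (fun c => a c * sin (ph c))
  (fun c => a' c * sin (ph c) + (2 * pi * v e) * (a c * cos (ph c))) ed.
have cph c : continuous (fun s => ph (upd c e s)).
  by apply: (@ider_continuous _ (fun=> 2 * pi * v e)) => t; exact: ider_phase.
rewrite rintD; [|exact: dom_sin|exact/domZ/dom_cos].
rewrite rintZ; last exact: dom_cos.
move=> H; rewrite mulrC; apply/eqP; rewrite -subr_eq0; apply/eqP.
rewrite -[RHS]H; last 1 first.
- move=> c s; apply: cvgD; first by apply: cvgM; [exact: ca'|apply: continuous_comp; [exact: cph|exact: continuous_sin]].
  by apply: cvgMr; apply: cvgM; [exact: ca|apply: continuous_comp; [exact: cph|exact: continuous_cos]].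
- rewrite addrC; congr (_ + _); rewrite -rintN; last exact: dom_cos.
  by congr rint; apply/funext => c; rewrite addrA cosDpihalf mulrN opprK.
- exact: dom_sin.
- by apply: domD; [exact: dom_sin|exact/domZ/dom_cos].
- move=> c t; apply: ider_eq (iderM (aa' c t) (ider_sin (ider_phase c v psi t ed))) _.
  by rewrite /ph; ring.
Qed.

End Tools.

(** * Spline cutoffs *)

Section Bump.
Variable R : realType.
Implicit Types (t : R) (f : R -> R).

Lemma cont_comp (f g : R -> R) : continuous f -> continuous g -> continuous (fun s => f (g s)).
Proof. by move=> cf cg t; apply: continuous_comp; [exact: cg|exact: cf]. Qed.

Lemma contD (f g : R -> R) : continuous f -> continuous g -> continuous (fun s => f s + g s).
Proof. by move=> cf cg t; apply: cvgD; [exact: cf|exact: cg]. Qed.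

Lemma contM (f g : R -> R) : continuous f -> continuous g -> continuous (fun s => f s * g s).
Proof. by move=> cf cg t; apply: cvgM; [exact: cf|exact: cg]. Qed.

Lemma cont_cst (k : R) : continuous (fun _ : R => k).
Proof. by move=> t; exact: cvg_cst. Qed.

Lemma cont_id : continuous (fun s : R => s).
Proof. by move=> t; exact: cvg_id. Qed.

Lemma cont_lin (a b : R) : continuous (fun s : R => a * s + b).
Proof. by apply: contD; [apply: contM; [exact: cont_cst|exact: cont_id]|exact: cont_cst]. Qed.

Lemma cont_sum (I : Type) (r : seq I) (f : I -> R -> R) :
  (forall i, continuous (f i)) -> continuous (fun s => \sum_(i <- r) f i s).
Proof.
move=> cf; elim: r => [|i r IH].
  by under eq_fun do rewrite big_nil; exact: cont_cst.
by under eq_fun do rewrite big_cons; exact: contD.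
Qed.

Definition leibniz (a b : nat -> R -> R) i t : R :=
  \sum_(j < i.+1) 'C(i, j)%:R * (a j t * b (i - j)%N t).

Lemma ider_leibniz (a b : nat -> R -> R) i t :
  (forall j, (j <= i)%N -> ider (a j) t (a j.+1 t)) ->
  (forall j, (j <= i)%N -> ider (b j) t (b j.+1 t)) ->
  ider (leibniz a b i) t (leibniz a b i.+1 t).
Proof.
move=> ha hb.
have H (j : 'I_i.+1) : ider (fun s => 'C(i, j)%:R * (a j s * b (i - j)%N s)) t
    ('C(i, j)%:R * (a j.+1 t * b (i - j)%N t + a j t * b (i - j).+1 t)).
  have ji : (j <= i)%N by rewrite -ltnS.
  by apply: iderZ; apply: iderM; [exact: ha|apply: hb; rewrite leq_subr].
apply: ider_eq (ider_sum (index_enum _) H) _.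
under eq_bigr do rewrite mulrDr.
rewrite big_split/= [RHS]big_ord_recl [in RHS](eq_bigr (fun j : 'I_i.+1 =>
  'C(i, j)%:R * (a j.+1 t * b (i - j)%N t) + 'C(i, j.+1)%:R * (a j.+1 t * b (i - j)%N t))); last first.
  by move=> j _; rewrite lift0 subSS binS natrD mulrDl addrC.
rewrite [in RHS]big_split/= addrCA; congr (_ + _).
rewrite big_ord_recl/= subn0 !bin0 !mul1r; congr (_ + _).
rewrite [RHS]big_ord_recr/= bin_small// mul0r addr0; apply: eq_bigr => j _.
by rewrite /fintype.bump leq0n add1n -subSn ?subSS// ltnW// ltnS.
Qed.

(** The difference quotient is within |h| of its limit, by cases on the signs of t and h + t; this
    treats t = 0 together with the other points. *)
Lemma ider_xabs t : ider (fun s => `|s| * s) t (2 * `|t|).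
Proof.
have H : (fun h : R => h^-1 *: ((fun s => `|s| * s) (h *: (1 : R) + t) - (fun s => `|s| * s) t)) @ 0^' --> 2 * `|t|.
  apply/cvgrPdist_le => e e0; near=> h.
  have h0 : h != 0 by near: h; exact: nbhs_dnbhs_neq.
  have he : `|h| <= e.
    near: h; apply: dnbhs0_le; exact: e0.
  rewrite (le_trans _ he)//= /GRing.scale/= mulr1.
  have -> : 2 * `|t| - h^-1 * (`|h + t| * (h + t) - `|t| * t) =
    h^-1 * (2 * `|t| * h - (`|h + t| * (h + t) - `|t| * t)) by field.
  rewrite normrM normfV ler_pdivrMl ?normr_gt0// -expr2 real_normK ?num_real//.
  rewrite ler_norml; have [?|?] := ger0P (h + t); have [?|?] := ger0P t; apply/andP; split; nra.
split.
  by apply/cvg_ex; exists (2 * `|t|).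
exact: cvg_lim.
Unshelve. all: by end_near. Qed.

Lemma ider_exp n f t a : ider f t a -> ider (fun s => f s ^+ n.+1) t (n.+1%:R * (a * f t ^+ n)).
Proof.
move=> fa; elim: n => [|n IH].
  by under eq_fun do rewrite expr1; rewrite expr0 mulr1 mul1r.
under eq_fun do rewrite exprS.
apply: ider_eq (iderM fa IH) _; rewrite !exprS -[in RHS]natr1; ring.
Qed.

(* The truncated power max(t, 0)^q, for q >= 1. *)
Definition tpow q t : R := (t ^+ q + `|t| * t ^+ q.-1) / 2.

Lemma tpow_neg q t : (0 < q)%N -> t <= 0 -> tpow q t = 0.
Proof. by case: q => // q _ t0; rewrite /tpow/= ler0_norm// exprS mulNr subrr mul0r. Qed.

Lemma tpow_pos q t : (0 < q)%N -> 0 <= t -> tpow q t = t ^+ q.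
Proof. by case: q => // q _ t0; rewrite /tpow/= ger0_norm// exprS; field. Qed.

Lemma ider_tpow q t : ider (tpow q.+2) t (q.+2%:R * tpow q.+1 t).
Proof.
have H1 : ider (fun s => s ^+ q.+2) t (q.+2%:R * t ^+ q.+1).
  by apply: ider_eq (ider_exp _ (ider_id t)) _; rewrite mul1r.
have H2 : ider (fun s => `|s| * s ^+ q.+1) t (q.+2%:R * (`|t| * t ^+ q)).
  case: q {H1} => [|q].
    by under eq_fun do rewrite expr1; rewrite expr0 mulr1; exact: ider_xabs.
  under eq_fun do rewrite exprS mulrA.
  apply: ider_eq (iderM (ider_xabs t) (ider_exp q (ider_id t))) _.
  by rewrite !exprS -[q.+3%:R]natr1 -[q.+2%:R]natr1; ring.
have := iderZ 2^-1 (iderD H1 H2).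
rewrite (_ : (fun s => _) = tpow q.+2); last by apply/funext => s; rewrite /tpow mulrC.
by move/ider_eq; apply; rewrite /tpow/=; field.
Qed.

Fixpoint nabla k f : R -> R := if k is k'.+1 then nabla k' (fun t => f t - f (t - 1)) else f.

Lemma nabla_sum k n (c : nat -> R) (f : nat -> R -> R) t :
  nabla k (fun t => \sum_(j < n) c j * f j t) t = \sum_(j < n) c j * nabla k (f j) t.
Proof.
elim: k f => [|k IH] f //=.
rewrite -(IH (fun j t => f j t - f j (t - 1))); congr nabla; apply/funext => s.
by rewrite -sumrB; apply: eq_bigr => j _; rewrite mulrBr.
Qed.

(** t^p - (t - 1)^p is a polynomial of degree p - 1 with leading coefficient p, so k differences
    annihilate degrees below k and leave k! from t^k. *)
Lemma nabla_exp k p t : (p <= k)%N -> nabla k (fun t => t ^+ p) t = (p == k)%:R * k`!%:R.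
Proof.
elim: k p t => [|k IH] [|p] t //= pk.
- by rewrite expr0 mul1r fact0.
- rewrite (_ : (fun t0 => _) = fun t0 => \sum_(j < 0) 0 * t0 ^+ j); last first.
    by apply/funext => s; rewrite big_ord0 !expr0 subrr.
  by rewrite (nabla_sum _ _ (fun=> 0) (fun j t => t ^+ j)) big_ord0 mul0r.
rewrite (_ : (fun t0 => _) = fun t0 => \sum_(j < p.+1) (- ((-1) ^+ (p.+1 - j) * 'C(p.+1, j)%:R)) * t0 ^+ j); last first.
  apply/funext => s; rewrite [s - 1]addrC exprDn big_ord_recr/= subnn expr0 mul1r binn.
  rewrite opprD addrCA subrr addr0 -sumrN; apply: eq_bigr => j _.
  by rewrite mulNr mulrAC -mulr_natr.
rewrite (nabla_sum _ _ (fun j => - ((-1) ^+ (p.+1 - j) * 'C(p.+1, j)%:R)) (fun j t => t ^+ j)).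
rewrite big_ord_recr/= IH// subSnn expr1 binSn mulN1r opprK.
rewrite big1 ?add0r; last first.
  move=> j _; rewrite IH; last by rewrite (leq_trans (ltnW (ltn_ord j))).
  by rewrite ltn_eqF ?mul0r ?mulr0// (leq_trans (ltn_ord j)).
rewrite eqSS; have [->|_] := eqVneq p k; last by rewrite !mul0r mulr0.
by rewrite !mul1r -natrM -factS.
Qed.

Lemma ider_nabla k f f' : (forall t, ider f t (f' t)) -> forall t, ider (nabla k f) t (nabla k f' t).
Proof.
elim: k f f' => [|k IH] f f' ff' t //=; apply: IH => s.
have h : ider (fun s => s - 1) s 1.
  by have := ider_lin 1 (-1) s; under eq_fun do rewrite mul1r.
have H2 : ider (fun t0 => f (t0 - 1)) s (f' (s - 1) * 1) by apply: (@ider_comp _ f (fun u => u - 1)).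
have := iderD (ff' s) (iderZ (-1) H2).
by under eq_fun do rewrite mulN1r; move/ider_eq; apply; rewrite mulr1 mulN1r.
Qed.

Lemma nabla_eq k f g t : (forall i, (i <= k)%N -> f (t - i%:R) = g (t - i%:R)) ->
  nabla k f t = nabla k g t.
Proof.
elim: k f g => [|k IH] f g fg /=; first by have := fg 0%N; rewrite subr0; apply.
apply: IH => i ik; rewrite fg ?(leq_trans ik)//; congr (_ - _).
by have := fg i.+1 ik; rewrite -natr1 opprD addrA.
Qed.

Lemma nabla_continuous k f : continuous f -> continuous (nabla k f).
Proof.
elim: k f => [|k IH] f cf //=; apply: IH => t; apply: cvgB; first exact: cf.
apply: continuous_comp; last exact: cf.
by apply: cvgB; [exact: cvg_id|exact: cvg_cst].
Qed.

Lemma tpow_continuous q : continuous (tpow q).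
Proof.
move=> t; rewrite /tpow; apply: cvgMl; apply: cvgD; first exact: exprn_continuous.
by apply: cvgM; [exact: norm_continuous|exact: exprn_continuous].
Qed.

(* j-th derivative of a smoothed step, equal to 0 on ]-oo, 0] and 1 on [q, +oo[. *)
Definition step q j t := ((q - j)`!%:R)^-1 * nabla q (tpow (q - j)) t.

Lemma step_le0 q j t : (j < q)%N -> t <= 0 -> step q j t = 0.
Proof.
move=> jq t0; rewrite /step (@nabla_eq q _ (fun s => \sum_(i < 0) 0 * s)).
  by rewrite (@nabla_sum _ 0%N (fun=> 0) (fun=> id)) big_ord0 mulr0.
move=> i _; rewrite big_ord0 tpow_neg ?subn_gt0//.
by rewrite subr_le0 (le_trans t0).
Qed.

(** For t >= q all the points t - i met by the differences are nonnegative, so the truncated power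
    is the true power t^(q - j) there: its q-th difference is q! when j = 0 and 0 when j > 0. *)
Lemma step_ge q j t : (j < q)%N -> q%:R <= t -> step q j t = (j == 0%N)%:R.
Proof.
move=> jq qt; rewrite /step (@nabla_eq q _ (fun s => s ^+ (q - j))).
  rewrite nabla_exp ?leq_subr//; case: j jq => [|j] jq.
    by rewrite subn0 eqxx mul1r mulVf// pnatr_eq0 -lt0n fact_gt0.
  by rewrite ltn_eqF ?mul0r ?mulr0// ltn_subrL (leq_ltn_trans _ jq).
move=> i iq; rewrite tpow_pos ?subn_gt0// subr_ge0 (le_trans _ qt)// ler_nat//.
Qed.

Lemma ider_step q j t : (j.+1 < q)%N -> ider (step q j) t (step q j.+1 t).
Proof.
move=> jq; rewrite /step.
have [p ->] : exists p, q = (p + j).+2 by exists (q - j.+2)%N; lia.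
rewrite (_ : ((p + j).+2 - j)%N = p.+2); last by lia.
rewrite (_ : ((p + j).+2 - j.+1)%N = p.+1); last by lia.
apply: ider_eq (iderZ _ (ider_nabla _ (@ider_tpow p) t)) _.
rewrite (_ : nabla _ _ t = p.+2%:R * nabla (p + j).+2 (tpow p.+1) t).
  by rewrite factS natrM invfM mulrACA mulVf ?pnatr_eq0// mul1r.
have := @nabla_sum (p + j).+2 1 (fun=> p.+2%:R) (fun=> tpow p.+1) t.
by under eq_fun do rewrite big_ord1; rewrite big_ord1.
Qed.

Lemma step_continuous q j : continuous (step q j).
Proof.
by move=> t; apply: cvgMr; apply: nabla_continuous; exact: tpow_continuous.
Qed.

Lemma continuous_supp_bounded f : continuous f -> (forall t, 2 <= `|t| -> f t = 0) ->
  exists B, forall t, `|f t| <= B.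
Proof.
move=> cf f0; have cn : continuous (fun t => `|f t|).
  by move=> t; apply: continuous_comp; [exact: cf|exact: norm_continuous].
have [x _ fx] := @EVT_max R (fun t => `|f t|) (-2) 2 ltac:(lra) (continuous_subspaceT cn).
exists `|f x| => t; have [t2|t2] := leP `|t| 2.
  by apply: fx; rewrite in_itv/= -ler_norml.
by rewrite f0 ?normr0// ltW.
Qed.

(** A plateau function given together with its derivatives up to order [M]: [b 0] equals 1 on
    [-1, 1] and 0 outside [-2, 2], and [b j] is its j-th derivative. *)
Definition is_cutoff M (b : nat -> R -> R) (B : R) :=
  [/\ forall j, (j <= M)%N -> continuous (b j),
      forall j t, (j < M)%N -> ider (b j) t (b j.+1 t),
      forall j t, (j <= M)%N -> `|b j t| <= B,
      forall j t, (j <= M)%N -> 2 <= `|t| -> b j t = 0 &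
      forall j t, (j <= M)%N -> `|t| <= 1 -> b j t = (j == 0%N)%:R].

(** A falling step plus a rising step minus 1. Rescaling by Q compresses the transition interval
    [0, q] of the step to 1 <= |t| <= 2. *)
Lemma cutoff_exists M : exists (b : nat -> R -> R) (B : R), 0 < B /\ is_cutoff M b B.
Proof.
(* With this order, the truncated powers of exponent q - j that occur for j <= M have exponent at
   least 2. *)
pose q := M.+2; pose Q : R := q%:R.
have Q0 : 0 < Q by rewrite ltr0n.
pose b j t := (- Q) ^+ j * step q j (- Q * t + 2 * Q) + Q ^+ j * step q j (Q * t + 2 * Q) - (j == 0%N)%:R.
have cb j : continuous (b j).
  apply: contD; last exact: cont_cst.
  by apply: contD; apply: contM; (try exact: cont_cst);
    apply: cont_comp; (try exact: cont_lin); exact: step_continuous.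
have b2 j t : (j <= M)%N -> 2 <= `|t| -> b j t = 0.
  move=> jM; have jq : (j < q)%N by lia.
  rewrite ler_normr => /orP[t2|t2]; rewrite /b.
    rewrite [step q j (- Q * t + _)]step_le0//; last by nra.
    rewrite step_ge//; last by rewrite -/Q; nra.
    by case: j {jM jq} => [|j] /=; rewrite mulr0 add0r ?mulr0 ?mulr1 ?expr0 subrr.
  rewrite [step q j (Q * t + _)]step_le0//; last by nra.
  rewrite step_ge//; last by rewrite -/Q; nra.
  by case: j {jM jq} => [|j] /=; rewrite ?mulr0 ?addr0 ?mulr1 ?expr0 ?subrr ?subr0.
have b1 j t : (j <= M)%N -> `|t| <= 1 -> b j t = (j == 0%N)%:R.
  move=> jM; have jq : (j < q)%N by lia.
  rewrite ler_norml => /andP[t1 t2]; rewrite /b.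
  rewrite !step_ge//; try by rewrite -/Q; nra.
  by case: j {jM jq} => [|j] /=; rewrite ?mulr0 ?mulr1 ?expr0 ?addr0 ?subr0//; ring.
have bd j t : (j < M)%N -> ider (b j) t (b j.+1 t).
  move=> jM; have jq : (j.+1 < q)%N by lia.
  have H1 := iderZ ((- Q) ^+ j) (ider_comp (ider_step _ jq) (ider_lin (- Q) (2 * Q) t)).
  have H2 := iderZ (Q ^+ j) (ider_comp (ider_step _ jq) (ider_lin Q (2 * Q) t)).
  apply: ider_eq (iderD (iderD H1 H2) (ider_cst (- (j == 0%N)%:R) t)) _.
  by rewrite /b/= !exprSr subr0 addr0; ring.
have [F bF] : exists F : nat -> R, forall j t, (j <= M)%N -> `|b j t| <= F j.
  have H j : exists Bj, (j <= M)%N -> forall t, `|b j t| <= Bj.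
    have [jM|jM] := leqP j M; last by exists 0.
    by have [B bB] := continuous_supp_bounded (cb j) (b2 j ^~ jM); exists B.
  by have [F HF] := choice H; exists F => j t jM; exact: HF.
exists b, (1 + \sum_(j < M.+1) `|F j|); split.
  by rewrite ltr_pwDl// sumr_ge0.
split=> // j t jM; rewrite (le_trans (bF j t jM))//.
rewrite (bigD1 (Ordinal (jM : (j < M.+1)%N)))//= addrCA (le_trans (ler_norm _))// lerDl.
by rewrite addr_ge0// sumr_ge0.
Qed.

(** In the inequality of Bessel type the square of the cutoff is the symbol whose transform has to
    decay, so it must itself come with controlled derivatives. *)
Lemma cutoff_sqr M b (B : R) : is_cutoff M b B -> 0 < B ->
  exists C : R, is_cutoff M (fun j => leibniz b b j) C.
Proof.
move=> [cb db bB b2 b1] B0; exists (2 ^+ M * B ^+ 2); split.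
- move=> j jM; apply: cont_sum => i; apply: contM; first exact: cont_cst.
  apply: contM; apply: cb; first by rewrite (leq_trans _ jM)// -ltnS.
  by rewrite (leq_trans (leq_subr _ _)).
- by move=> j t jM; apply: ider_leibniz => i ij; apply: db; exact: leq_ltn_trans ij jM.
- move=> j t jM; rewrite (le_trans (ler_norm_sum _ _ _))//.
  rewrite (@le_trans _ _ (\sum_(i < j.+1) 'C(j, i)%:R * B ^+ 2))//.
    apply: ler_sum => i _; rewrite !normrM normr_nat ler_wpM2l// expr2 ler_pM//; apply: bB.
      by rewrite (leq_trans _ jM)// -ltnS.
    by rewrite (leq_trans (leq_subr _ _)).
  rewrite -mulr_suml ler_wpM2r ?sqr_ge0// -natr_sum.
  have -> : (\sum_(i < j.+1) 'C(j, i) = 2 ^ j)%N.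
    by rewrite -[2%N]/(1 + 1)%N expnDn; apply: eq_bigr => i _; rewrite !exp1n !muln1.
  by rewrite -natrX ler_nat leq_exp2l.
- move=> j t jM t2; rewrite /leibniz big1// => i _; rewrite b2 ?mul0r ?mulr0//.
  by rewrite (leq_trans _ jM)// -ltnS.
- move=> j t jM t1; rewrite /leibniz big_ord_recl/= subn0 bin0 mul1r !b1// mul1r.
  rewrite big1 ?addr0// => i _; rewrite b1 ?lift0 ?mul0r ?mulr0//.
  by rewrite (leq_trans _ jM).
Qed.

End Bump.

(** * Oscillatory integrals with finitely smooth symbols *)

Section Fourier.
Variable R : realType.
Local Notation leb := (@lebesgue_measure R : {sigma_finite_measure set (measurableTypeR R) -> \bar R}).
Local Notation E := (E R).
Implicit Types (c v : nat -> R).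

Lemma in_setb (T : Type) (P : T -> bool) x : (x \in [set y | P y]) = P x.
Proof. by apply/idP/idP; rewrite inE. Qed.

Definition nrm d (c : nat -> R) : R := \big[Num.max/0]_(i < d) `|c i|.

Lemma nrm_ge0 d c : 0 <= nrm d c.
Proof. by rewrite /nrm; elim/big_ind: _ => // x y x0 y0; rewrite le_max x0. Qed.

Lemma nrm_coord d c i : (i < d)%N -> `|c i| <= nrm d c.
Proof. by move=> id; rewrite /nrm; exact: (le_bigmax_cond _ _ (j := Ordinal id)). Qed.

Lemma nrm_leP d c r : 0 <= r -> reflect (forall i, (i < d)%N -> `|c i| <= r) (nrm d c <= r).
Proof.
move=> r0; apply: (iffP idP) => [h i id|h]; first exact: le_trans (nrm_coord _ id) h.
by rewrite /nrm; apply: bigmax_le => // i _; apply: h.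
Qed.

Lemma nrm_attained d c : 0 < nrm d c -> exists2 e, (e < d)%N & nrm d c = `|c e|.
Proof.
move=> n0; apply: contrapT => /forall2NP h.
have : nrm d c < nrm d c; last by rewrite ltxx.
rewrite {1}/nrm; apply: bigmax_lt => // i _.
rewrite lt_neqAle nrm_coord// andbT; apply/eqP => ie.
by have [|] := h i; [apply|apply].
Qed.

Lemma mfr_nrm d v : mfr d (fun c => nrm d (fun i => c i - v i)).
Proof.
rewrite /nrm; elim: (index_enum _) => [|i r IH].
  by rewrite /mfr; under eq_fun do rewrite big_nil; exact: measurable_cst.
rewrite /mfr; under eq_fun do rewrite big_cons.
apply: measurable_maxr => //; apply: measurableT_comp => //.
by apply: measurable_funB => //; exact: mfr_coord.
Qed.

Lemma nrm_ccons d t c : nrm d.+1 (ccons t c) = Num.max `|t| (nrm d c).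
Proof. by rewrite /nrm big_ord_recl. Qed.

Lemma mfr_box d v (r : R) : mfr d (\1_[set c | nrm d (fun i => c i - v i) <= r]).
Proof.
pose A := [set x : E d | nrm d (fun i => co x i - v i) <= r].
have mA : measurable A.
  rewrite (_ : A = (fun x : E d => nrm d (fun i => co x i - v i)) @^-1` [set` `]-oo, r]]).
    by rewrite -[X in measurable X]setTI; apply: mfr_nrm.
  by apply/seteqP; split => y /=; rewrite in_itv.
rewrite /mfr (_ : _ \o _ = \1_A); first exact: measurable_indic.
by apply/funext => x; rewrite /= !indicE; congr ((nat_of_bool _)%:R); apply/idP/idP; rewrite !inE.
Qed.

Lemma integral_itv_indic (a b : R) : a <= b -> (\int[leb]_t (\1_(`[a, b]) t)%:E)%E = (b - a)%:E.
Proof.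
move=> ab; rewrite (@integral_indic _ (measurableTypeR R) R leb setT measurableT `[a, b] (measurable_itv _)).
rewrite setIT/= lebesgue_measure_itv/= lte_fin; case: ltgtP ab => // -> _.
by rewrite subrr.
Qed.

Lemma eint_box d v (r : R) : 0 <= r ->
  eint d (fun c => (\1_[set c | nrm d (fun i => c i - v i) <= r] c)%:E) = ((2 * r) ^+ d)%:E.
Proof.
move=> r0; elim: d v => [|d IH] v.
  by rewrite eint0 expr0 indicE mem_set//= /nrm big_ord0.
have E1 t c : \1_[set c | nrm d.+1 (fun i => c i - v i) <= r] (ccons t c) =
   \1_(`[v 0%N - r, v 0%N + r]) t * \1_[set c | nrm d (fun i => c i - v i.+1) <= r] c :> R.
  rewrite !indicE -natrM mulnb; congr ((nat_of_bool _)%:R).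
  have Ec : (fun i => ccons t c i - v i) = ccons (t - v 0%N) (fun i => c i - v i.+1).
    by apply/funext => -[].
  rewrite !in_setb Ec nrm_ccons ge_max; congr (_ && _).
  by rewrite in_itv/= ler_distl.
rewrite eint_S; last 2 first.
- by apply: mfe_EFin; exact: mfr_box.
- by move=> c; rewrite lee_fin indicE.
rewrite (eq_integral (fun t : measurableTypeR R => (\1_(`[v 0%N - r, v 0%N + r]) t)%:E * ((2 * r) ^+ d)%:E)%E).
  rewrite ge0_integralZr//; last by rewrite lee_fin exprn_ge0// mulr_ge0.
  rewrite integral_itv_indic; last by lra.
  by rewrite -EFinM exprS; congr (_%:E); ring.
  by apply/measurable_EFinP; exact: measurable_indic.
move=> t _; rewrite -(IH (fun i => v i.+1)) /eint -ge0_integralZl_EFin//.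
- by apply: eq_integral => x _; rewrite E1 EFinM.
- by apply: mfe_EFin; exact: mfr_box.
Qed.

Definition supp d (W : R) (a : (nat -> R) -> R) := forall c, W < nrm d c -> a c = 0.

Lemma dom_supp d (W A : R) a : 0 <= A -> mfr d a -> (forall c, `|a c| <= A) -> supp d W a -> dom d a.
Proof.
move=> A0 ma aA aW; split=> //; exists (A * (1 + W ^+ 2) ^+ d) => c.
have w0 : 0 <= wt d c by rewrite ltW ?wt_gt0.
have [cW|cW] := ltP W (nrm d c).
  by rewrite aW// normr0 !mulr_ge0// exprn_ge0// ltW ?sq1_gt0.
rewrite (le_trans (aA c))// -mulrA ler_peMr//.
have {}cW i : (i < d)%N -> `|c i| <= W by move=> id; rewrite (le_trans _ cW)// nrm_coord.
have : \prod_(i < d) (1 + c i ^+ 2) <= (1 + W ^+ 2) ^+ d.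
  rewrite -[X in _ ^+ X]card_ord -prodr_const; apply: ler_prod => i _.
  rewrite ltW ?sq1_gt0//= lerD2l -real_normK ?num_real// ler_sqr ?cW ?nnegrE//.
  by rewrite (le_trans _ (cW i _)).
have h1 : (\prod_(i < d) (1 + c i ^+ 2)) * wt d c = 1.
  rewrite /wt -big_split/= big1// => i _; rewrite mulfV// gt_eqF// sq1_gt0//.
by move=> h; rewrite -[leLHS]h1 ler_wpM2r.
Qed.

Lemma box0 d r : [set c | nrm d (fun i => c i - (fun=> 0) i) <= r] = [set c | nrm d c <= r].
Proof. by apply/seteqP; split => c /=; under eq_fun do rewrite subr0. Qed.

Lemma dom_box d (r : R) : dom d (\1_[set c | nrm d c <= r]).
Proof.
apply: (@dom_supp _ r 1) => //.
- by rewrite -box0; exact: mfr_box.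
- by move=> c; rewrite indicE; case: (_ \in _); rewrite ?normr1 ?normr0.
- by move=> c cr; rewrite indicE memNset//= leNgt cr.
Qed.

Lemma rint_box d (r : R) : 0 <= r -> rint d (\1_[set c | nrm d c <= r]) = (2 * r) ^+ d.
Proof.
move=> r0; have := EFin_rint (dom_box d r).
by rewrite -box0 (eint_box d (fun=> 0) r0) => -[].
Qed.

Lemma rint_supp_bound d (W A : R) a : 0 <= A -> 0 <= W -> dom d a -> (forall c, `|a c| <= A) ->
  supp d W a -> `|rint d a| <= A * (2 * W) ^+ d.
Proof.
move=> A0 W0 da aA aW; rewrite (le_trans (rint_abs da))// -rint_box// -rintZ; last exact: dom_box.
apply: le_rint; [exact: dom_abs|exact/domZ/dom_box|move=> c].
rewrite indicE; have [cW|cW] := leP (nrm d c) W.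
  by rewrite mem_set// mulr1.
by rewrite aW// normr0 memNset ?mulr0//= leNgt cW.
Qed.

Lemma supp_mull d W a g : supp d W a -> supp d W (fun c => a c * g c).
Proof. by move=> h c /h ->; rewrite mul0r. Qed.

Definition chain d e M (a : nat -> (nat -> R) -> R) :=
  [/\ forall i, (i <= M)%N -> dom d (a i), forall i, (i < M)%N -> isd e (a i) (a i.+1) &
      forall i, (i <= M)%N -> slice_cont e (a i)].

Lemma osc_chain d e M a psi v i : (e < d)%N -> chain d e M a -> (i <= M)%N ->
  osc d (a 0%N) psi v * (2 * pi * v e) ^+ i = osc d (a i) (psi + i%:R * (pi / 2)) v.
Proof.
move=> ed [da aa ca]; elim: i => [|i IH] iM; first by rewrite expr0 mulr1 mul0r addr0.
rewrite exprSr mulrA IH ?(ltnW iM)//.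
rewrite (osc_derive _ _ ed (da i (ltnW iM)) (da _ iM) (aa _ iM) (ca _ (ltnW iM)) (ca _ iM)).
by congr osc; rewrite -natr1; ring.
Qed.

(* Symbols at frequency scale [W] on which each derivative costs a factor [lam]. *)
Definition sym d M (A lam W : R) (a : (nat -> R) -> R) :=
  forall e, (e < d)%N -> exists ch, [/\ ch 0%N = a, chain d e M ch &
    forall i, (i <= M)%N -> (forall c, `|ch i c| <= A * lam ^+ i) /\ supp d W (ch i)].

Lemma osc_bound d (W A : R) a psi v : 0 <= A -> 0 <= W -> dom d a -> (forall c, `|a c| <= A) ->
  supp d W a -> `|osc d a psi v| <= A * (2 * W) ^+ d.
Proof.
move=> A0 W0 da aA aW; apply: rint_supp_bound => //; first exact: dom_cos.
  move=> c; rewrite normrM -[leRHS]mulr1 ler_pM//; exact: normr_cos.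
exact: supp_mull.
Qed.

Lemma pi_ge1 : 1 <= pi :> R.
Proof. by have := @pi_ge2 R; lra. Qed.

(** If |v| <= lam the trivial bound suffices. Otherwise one integrates by parts N times in the
    coordinate where |v| is attained, which gains (lam / (2 pi |v|))^N. *)
Lemma osc_decay d N (A lam W : R) a psi v : (0 < d)%N -> 0 <= A -> 0 < lam -> 0 <= W ->
  sym d N A lam W a ->
  `|osc d a psi v| <= 2 ^+ N * A * (2 * W) ^+ d * ((1 + nrm d v / lam)^-1) ^+ N.
Proof.
move=> d0 A0 l0 W0 sa; have AW0 : 0 <= A * (2 * W) ^+ d by rewrite mulr_ge0// exprn_ge0// mulr_ge0.
have n0 := nrm_ge0 d v; set y := nrm d v in n0 *.
have yl : 0 < 1 + y / lam by rewrite ltr_pwDl// divr_ge0// ltW.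
rewrite (_ : _ * _ ^+ N = A * (2 * W) ^+ d * (2 * (1 + y / lam)^-1) ^+ N); last first.
  by rewrite [(2 * _^-1) ^+ N]exprMn; ring.
have [yl'|yl'] := leP y lam.
  have [ch [<- [dc _ _] bc]] := sa 0%N d0.
  have [b0 s0] := bc 0%N isT.
  rewrite (le_trans (osc_bound _ _ A0 W0 (dc 0%N isT) _ s0))//.
    by move=> c; rewrite (le_trans (b0 c))// expr0 mulr1.
  rewrite ler_peMr// exprn_ege1// ler_pdivlMr// mul1r.
  by rewrite -[2]/(1 + 1) lerD2l ler_pdivrMr// mul1r.
have y0 : 0 < y by exact: lt_trans l0 yl'.
have [e ed ye] := nrm_attained y0.
have [ch [<- cch bc]] := sa e ed; have [dc _ _] := cch.
have [bN sN] := bc N (leqnn N).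
have AN0 : 0 <= A * lam ^+ N by rewrite mulr_ge0// exprn_ge0// ltW.
have := osc_bound (psi + N%:R * (pi / 2)) v AN0 W0 (dc N (leqnn N)) bN sN.
rewrite -(osc_chain psi v ed cch (leqnn N)) normrM normrX !normrM.
rewrite normr_nat (ger0_norm (pi_ge0 R)) -ye -/y.
have p0 : 0 < (2 * pi * y) ^+ N by rewrite exprn_gt0// !mulr_gt0 ?pi_gt0.
rewrite -ler_pdivlMr// => /le_trans; apply.
rewrite (_ : _ * _ * _ / _ = A * (2 * W) ^+ d * (lam / (2 * pi * y)) ^+ N); last first.
  by rewrite [(lam / _) ^+ N]exprMn exprVn; ring.
apply: ler_wpM2l => //.
have y2 : 0 < 2 * pi * y by rewrite !mulr_gt0 ?pi_gt0.
apply: lerXn2r; rewrite ?nnegrE; [by rewrite divr_ge0 ?ltW|by rewrite divr_ge0 ?ltW|].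
rewrite ler_pdivrMr//.
have -> : 2 / (1 + y / lam) = lam * (2 / (lam + y)) by field; rewrite !gt_eqF// addr_gt0.
rewrite -[lam * _ * _]mulrA ler_peMr ?(ltW l0)//.
rewrite mulrAC ler_pdivlMr ?addr_gt0// mul1r.
have := pi_ge1; nra.
Qed.

End Fourier.

(** * L^2 bounds *)

Section Schur.
Context d1 d2 (T : measurableType d1) (X : measurableType d2) (R : realType).
Variables (m : {sigma_finite_measure set T -> \bar R}) (nu : {sigma_finite_measure set X -> \bar R}).

Lemma integrable_prod_mul d3 d4 (T1 : measurableType d3) (T2 : measurableType d4)
    (m1 : {sigma_finite_measure set T1 -> \bar R}) (m2 : {sigma_finite_measure set T2 -> \bar R})
    (f : T1 -> R) (g : T2 -> R) :
  m1.-integrable setT (EFin \o f) -> m2.-integrable setT (EFin \o g) ->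
  (sfprod m1 m2).-integrable setT (fun z => (f z.1 * g z.2)%:E).
Proof.
move=> iF iG.
have mf : measurable_fun setT f by apply/measurable_EFinP; exact: measurable_int iF.
have mg : measurable_fun setT g by apply/measurable_EFinP; exact: measurable_int iG.
apply/(integrable12ltyP m1 m2).
  apply/measurable_EFinP; apply: measurable_funM.
    exact: measurableT_comp mf measurable_fst.
  exact: measurableT_comp mg measurable_snd.
have /integrableP[_ fi] := iF; have /integrableP[_ gi] := iG.
rewrite (eq_integral (fun x => `|(f x)%:E| * \int[m2]_y `|(g y)%:E|)%E); last first.
  move=> x _ /=; rewrite -ge0_integralZl//.
  - by apply: eq_integral => y _; rewrite -EFinM normrM.
  - by apply/measurable_EFinP; exact: measurableT_comp.
rewrite ge0_integralZr//.
- rewrite lte_mul_pinfty//; first by apply: integral_ge0.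
  by rewrite ge0_fin_numE//; apply: integral_ge0.
- by apply/measurable_EFinP; exact: measurableT_comp.
- exact: integral_ge0.
Qed.

Lemma Rintegral_prod_mul d3 d4 (T1 : measurableType d3) (T2 : measurableType d4)
    (m1 : {sigma_finite_measure set T1 -> \bar R}) (m2 : {sigma_finite_measure set T2 -> \bar R})
    (f : T1 -> R) (g : T2 -> R) :
  m1.-integrable setT (EFin \o f) -> m2.-integrable setT (EFin \o g) ->
  Rintegral (sfprod m1 m2) setT (fun z => f z.1 * g z.2) =
  Rintegral m1 setT f * Rintegral m2 setT g.
Proof.
move=> iF iG; rewrite -RintegralZr// /Rintegral; congr fine.
rewrite -(integral12_prod_meas1 (integrable_prod_mul iF iG)).
apply: eq_integral => x _; rewrite /fubini_F/= EFinM fineK.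
  by rewrite -integralZl.
exact: integrable_fin_num.
Qed.

Variables (c : T * X -> R) (w : T -> R) (h : X -> R) (N : R).
Hypotheses (mc : measurable_fun setT c) (iw : m.-integrable setT (EFin \o w))
  (cw : forall t x y, `|c (t, x) * c (t, y)| <= w t) (ih : nu.-integrable setT (EFin \o h)).

Let B x y := Rintegral m setT (fun t => c (t, x) * c (t, y)).

(* T T^* argument: the composition with the adjoint is bounded by Schur's test. *)
Lemma schur_test : 0 <= N ->
  (forall x, \int[nu]_y `|B x y|%:E <= N%:E)%E ->
  (\int[m]_t ((Rintegral nu setT (fun x => c (t, x) * h x)) ^+ 2)%:E
     <= N%:E * \int[nu]_x (h x ^+ 2)%:E)%E.
Proof.
move=> N_ge0 HN.
have mh : measurable_fun setT h by apply/measurable_EFinP; exact: measurable_int ih.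
pose nn := sfprod nu nu.
pose G (z : T * (X * X)) := c (z.1, z.2.1) * c (z.1, z.2.2) * (h z.2.1 * h z.2.2).
have m1 : measurable_fun setT (fun z : T * (X * X) => (z.1, z.2.1)).
  apply: measurable_fun_pair; first exact: measurable_fst.
  exact: measurableT_comp measurable_fst measurable_snd.
have m2 : measurable_fun setT (fun z : T * (X * X) => (z.1, z.2.2)).
  apply: measurable_fun_pair; first exact: measurable_fst.
  exact: measurableT_comp measurable_snd measurable_snd.
have mcc : measurable_fun setT (fun z : T * (X * X) => c (z.1, z.2.1) * c (z.1, z.2.2)).
  by apply: measurable_funM; [exact: measurableT_comp mc m1|exact: measurableT_comp mc m2].
have mG : measurable_fun setT G.
  apply: measurable_funM => //; apply: measurable_funM.
    exact: measurableT_comp (measurableT_comp mh measurable_fst) measurable_snd.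
  exact: measurableT_comp (measurableT_comp mh measurable_snd) measurable_snd.
have iG : (sfprod m nn).-integrable setT (EFin \o G).
  apply: le_integrable (integrable_prod_mul iw (integrable_prod_mul ih ih)) => //.
    exact/measurable_EFinP.
  move=> [t [x y]] _ /=; rewrite lee_fin /G/= normrM [leRHS]normrM ler_wpM2r//.
  by rewrite (le_trans (cw t x y))// ler_norm.
have mct t : measurable_fun setT (fun x => c (t, x)).
  exact: measurableT_comp mc (measurable_pair1 t).
have w0 t : X -> 0 <= w t by move=> x; exact: le_trans (normr_ge0 _) (cw t x x).
have ich t : nu.-integrable setT (EFin \o (fun x => c (t, x) * h x)).
  have i1 : nu.-integrable setT (fun x => ((1 + w t) * h x)%:E).
    by under eq_fun do rewrite EFinM; apply: integrableZl.
  apply: le_integrable i1 => //.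
    by apply/measurable_EFinP; apply: measurable_funM.
  move=> x _ /=; rewrite lee_fin !normrM ler_wpM2r//.
  have := cw t x x; rewrite normrM -expr2 => h1.
  have := w0 t x => h2; rewrite [leRHS]ger0_norm ?addr_ge0//.
  have := normr_ge0 (c (t, x)); nra.
(* The square of an integral over [X] is an integral over [X * X], so that Fubini can move the
   integral over [T] inside and produce [B]. *)
rewrite (eq_integral (fun t => \int[nn]_z (G (t, z))%:E)%E); last first.
  move=> t _; rewrite expr2 -Rintegral_prod_mul// /Rintegral fineK; last first.
    exact: integrable_fin_num (integrable_prod_mul (ich t) (ich t)).
  by apply: eq_integral => -[x y] _; rewrite /G/= mulrACA.
apply: (@le_trans _ _ (\int[nn]_z \int[m]_t (G (t, z))%:E)%E).
  by rewrite (Fubini iG).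
pose Bz (z : X * X) := B z.1 z.2.
have BC x y : B x y = B y x by apply: eq_Rintegral => t _; rewrite mulrC.
have mBz : measurable_fun setT Bz.
  pose sw (z : (X * X) * T) : T * (X * X) := (z.2, z.1).
  have msw : measurable_fun setT sw.
    by apply: measurable_fun_pair; [exact: measurable_snd|exact: measurable_fst].
  exact: (@measurable_Rintegral _ _ _ _ _ m _ (measurableT_comp mcc msw)).
have mhz : measurable_fun setT (fun z : X * X => h z.1 * h z.2).
  apply: measurable_funM; first exact: measurableT_comp mh measurable_fst.
  exact: measurableT_comp mh measurable_snd.
rewrite (eq_integral (fun z => (Bz z * (h z.1 * h z.2))%:E)); last first.
  move=> z _.
  have icc : m.-integrable setT (EFin \o (fun t => c (t, z.1) * c (t, z.2))).
    apply: le_integrable iw => //.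
      apply/measurable_EFinP; exact: measurableT_comp mcc (measurable_pair2 z).
    by move=> t _; rewrite /= lee_fin (le_trans (cw t z.1 z.2))// ler_norm.
  have BE : (Bz z)%:E = (\int[m]_t (c (t, z.1) * c (t, z.2))%:E)%E.
    by rewrite /Bz /B /Rintegral fineK//; exact: integrable_fin_num icc.
  by rewrite EFinM BE -integralZr//; apply: eq_integral => t _; rewrite -EFinM.
have mh2 : measurable_fun setT (fun x => (h x ^+ 2)%:E).
  by apply/measurable_EFinP; exact: measurable_funX.
have half0 : 0 <= 2^-1 :> R by rewrite invr_ge0.
(* By |h(x) h(y)| <= (h(x)^2 + h(y)^2) / 2 the quadratic form splits into two halves. Each one
   integrates [|B|] first in the variable that [h] does not involve, where the hypothesis applies,
   after using the symmetry of [B] in the second half. *)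
pose D1 z := (2^-1 * h z.1 ^+ 2 * `|Bz z|)%:E.
pose D2 z := (2^-1 * h z.2 ^+ 2 * `|Bz z|)%:E.
have D10 z : (0 <= D1 z)%E by rewrite lee_fin mulr_ge0// mulr_ge0// sqr_ge0.
have D20 z : (0 <= D2 z)%E by rewrite lee_fin mulr_ge0// mulr_ge0// sqr_ge0.
have mD1 : measurable_fun setT D1.
  apply/measurable_EFinP; apply: measurable_funM; last exact: measurableT_comp.
  apply: measurable_funM => //; apply: measurable_funX.
  exact: measurableT_comp mh measurable_fst.
have mD2 : measurable_fun setT D2.
  apply/measurable_EFinP; apply: measurable_funM; last exact: measurableT_comp.
  apply: measurable_funM => //; apply: measurable_funX.
  exact: measurableT_comp mh measurable_snd.
have inner x : (\int[nu]_y ((2^-1 * h x ^+ 2 * `|B x y|)%:E) <= (2^-1 * N)%:E * (h x ^+ 2)%:E)%E.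
  under eq_integral do rewrite EFinM.
  rewrite ge0_integralZl//.
  - rewrite (_ : ((2^-1 * N)%:E * _)%E = ((2^-1 * h x ^+ 2)%:E * N%:E)%E); last first.
      by rewrite -!EFinM; congr (_%:E); ring.
    by apply: lee_wpmul2l => //; rewrite lee_fin mulr_ge0// sqr_ge0.
  - apply/measurable_EFinP; apply: measurableT_comp => //.
    exact: measurableT_comp mBz (measurable_pair1 x).
  - by rewrite lee_fin mulr_ge0// sqr_ge0.
have N0 : (0 <= (2^-1 * N)%:E)%E.
  by rewrite lee_fin mulr_ge0.
have tot : (\int[nu]_x ((2^-1 * N)%:E * (h x ^+ 2)%:E) = (2^-1 * N)%:E * \int[nu]_x (h x ^+ 2)%:E)%E.
  rewrite ge0_integralZl// => x _; rewrite lee_fin sqr_ge0//.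
apply: (@le_trans _ _ (\int[nn]_z (D1 z + D2 z))%E).
  apply: (@le_trans _ _ (\int[nn]_z `|(Bz z * (h z.1 * h z.2))%:E|)%E).
    apply: le_trans (lee_abs _) _; apply: le_abse_integral => //.
    by apply/measurable_EFinP; apply: measurable_funM.
  apply: le_integral_nomeas => // z; rewrite -EFinD lee_fin normrM.
  rewrite -mulrDl mulrC ler_wpM2r// -mulrDr ler_norml.
  by apply/andP; split; have := sqr_ge0 (h z.1 - h z.2); have := sqr_ge0 (h z.1 + h z.2); nra.
rewrite ge0_integralD//.
apply: (@le_trans _ _ ((2^-1 * N)%:E * \int[nu]_x (h x ^+ 2)%:E + (2^-1 * N)%:E * \int[nu]_x (h x ^+ 2)%:E)%E).
  apply: leeD.
    rewrite (fubini_tonelli1 (m1 := nu) (m2 := nu) D1)// -tot.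
    by apply: le_integral_nomeas => [x|x]; [apply: integral_ge0|exact: inner].
  rewrite (fubini_tonelli2 (m1 := nu) (m2 := nu) D2)// -tot.
  apply: le_integral_nomeas => [x|x]; first by apply: integral_ge0.
  rewrite (le_trans _ (inner x))//; apply: le_integral_nomeas => y; first exact: D20.
  by rewrite /D2/Bz/= BC.
rewrite -ge0_muleDl// -EFinD (_ : 2^-1 * N + 2^-1 * N = N)//; lra.
Qed.
End Schur.

Section Bessel.
Variable R : realType.
Local Notation mu := (@mu R).
Local Notation E := (E R).
Implicit Types (c v : nat -> R).

Definition boxcut d (b : nat -> R -> R) (W : R) c : R := \prod_(i < d) b 0%N (c i / W).

Lemma mfr_cont d (f : R -> R) g : continuous f -> mfr d g -> mfr d (fun c => f (g c)).
Proof. by move=> cf mg; apply: measurableT_comp => //; exact: continuous_measurable_fun. Qed.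

Lemma mfr_prod d (I : Type) (r : seq I) (P : pred I) (f : I -> (nat -> R) -> R) :
  (forall i, mfr d (f i)) -> mfr d (fun c => \prod_(i <- r | P i) f i c).
Proof.
move=> mf; elim: r => [|i r IH].
  by rewrite /mfr; under eq_fun do rewrite big_nil; exact: measurable_cst.
rewrite /mfr; under eq_fun do rewrite big_cons; case: (P i) => //.
by apply: measurable_funM => //; exact: mf.
Qed.

Lemma mfr_coordV d i (W : R) : mfr d (fun c => c i / W).
Proof. by apply: measurable_funM => //; exact: mfr_coord. Qed.

Lemma mfr_cut d i (W : R) f : continuous f -> mfr d (fun c => f (c i / W)).
Proof. by move=> cf; apply: (mfr_cont cf (g := fun c => c i / W)); exact: mfr_coordV. Qed.

Lemma boxcut_sym d M b (B W : R) : is_cutoff M b B -> 0 <= B -> 0 < W ->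
  sym d M ((1 + B) ^+ d) W^-1 (2 * W) (boxcut d b W).
Proof.
move=> [cb db bB b2 b1] B0 W0 e ed.
pose P c := \prod_(i < d | i != Ordinal ed) b 0%N (c i / W).
have PB c : `|P c| <= (1 + B) ^+ d.-1.
  have := @ler_prod R _ (index_enum _) (predC1 (Ordinal ed)) (fun i : 'I_d => `|b 0%N (c i / W)|) (fun=> 1 + B).
  rewrite prodr_const cardC1 card_ord normr_prod; apply.
  by move=> i _; rewrite normr_ge0/= (le_trans (bB 0%N _ isT))// lerDr.
have Pupd c s : P (upd c e s) = P c.
  by apply: eq_bigr => i; rewrite -val_eqE/= /upd => /negbTE ->.
pose ch j c := W^-1 ^+ j * (b j (c e / W) * P c).
have chB j c : (j <= M)%N -> `|ch j c| <= (1 + B) ^+ d * W^-1 ^+ j.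
  have Wj : 0 <= W^-1 ^+ j by rewrite exprn_ge0// invr_ge0 ltW.
  move=> jM; rewrite normrM mulrC (ger0_norm Wj); apply: ler_wpM2r => //.
  rewrite normrM -[d in leRHS](ltn_predK ed) exprS ler_pM//.
  by rewrite (le_trans (bB j _ jM))// lerDr.
have chW j : (j <= M)%N -> supp d (2 * W) (ch j).
  move=> jM c cW; have n0 : 0 < nrm d c by rewrite (le_lt_trans _ cW)// mulr_ge0 ?(ltW W0).
  have [e' ed' he'] := nrm_attained n0.
  have c2 : 2 <= `|c e' / W| by rewrite normrM normfV (gtr0_norm W0) ler_pdivlMr// -he' ltW.
  rewrite /ch; have [ee|ee] := eqVneq e' e.
    by rewrite -ee b2// mul0r mulr0.
  rewrite /P (bigD1 (Ordinal ed'))//= (b2 0%N _ isT c2) mul0r !mulr0//.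
have mch j : (j <= M)%N -> mfr d (ch j).
  move=> jM; apply: measurable_funM => //; apply: measurable_funM.
    by apply: mfr_cut; exact: cb.
  by apply: (@mfr_prod d _ _ _ (fun (i : 'I_d) c => b 0%N (c i / W))) => i; apply: mfr_cut; exact: cb.
exists ch; split.
- by apply/funext => c; rewrite /ch expr0 mul1r /boxcut (bigD1 (Ordinal ed)).
- split.
  + move=> i iM; apply: (@dom_supp _ _ (2 * W) ((1 + B) ^+ d * W^-1 ^+ i)).
    * by rewrite mulr_ge0// exprn_ge0// ?invr_ge0 ?(ltW W0)// addr_ge0.
    * exact: mch.
    * by move=> c; exact: chB.
    * exact: chW.
  + move=> i iM c t.
    rewrite (_ : (fun s => _) = fun s => W^-1 ^+ i * (b i (W^-1 * s + 0) * P c)); last first.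
      by apply/funext => s; rewrite /ch Pupd /upd eqxx addr0 [W^-1 * s]mulrC.
    have H := iderZ (W^-1 ^+ i) (iderM (@ider_comp _ (b i) (fun s => W^-1 * s + 0) t _ _ (db i (W^-1 * t + 0) iM) (ider_lin W^-1 0 t)) (ider_cst (P c) t)).
    apply: ider_eq H _; rewrite mulr0 !addr0 /ch Pupd /upd eqxx exprSr [t / W]mulrC.
    by ring.
  + move=> i iM c; rewrite (_ : (fun s => _) = fun s => W^-1 ^+ i * (b i (W^-1 * s + 0) * P c)); last first.
      by apply/funext => s; rewrite /ch Pupd /upd eqxx addr0 [W^-1 * s]mulrC.
    apply: contM; first exact: cont_cst.
    by apply: contM; [apply: cont_comp; [exact: cb|exact: cont_lin]|exact: cont_cst].
- by move=> i iM; split=> [c|]; [exact: chB|exact: chW].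
Qed.

Lemma nrmC d c v : nrm d (fun i => c i - v i) = nrm d (fun i => v i - c i).
Proof. by rewrite /nrm; apply: eq_bigr => i _; rewrite distrC. Qed.

Lemma eint_decay d N v (t : R) : (d < N)%N -> 0 < t ->
  (eint d (fun c => (((1 + nrm d (fun i => c i - v i) / t)^-1) ^+ N)%:E)
    <= (2 ^+ N.+1 * 2 ^+ d * t ^+ d)%:E)%E.
Proof.
move=> dN t0.
have := @shell R _ (E d) (mu d) (fun=> 1%E) (fun x => nrm d (fun i => co x i - v i)) (2 ^+ d) t d N.
under eq_integral do rewrite mul1e.
apply=> //.
- exact: mfr_nrm.
- by move=> x; exact: nrm_ge0.
- move=> r r0; under eq_integral do rewrite mul1e.
  rewrite -exprMn -(eint_box d v (ltW r0)) /eint le_eqVlt; apply/orP; left; apply/eqP.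
  by apply: eq_integral => x _; rewrite !indicE !in_setb.
Qed.

Lemma mfr_decay d v (k : R) N : 0 <= k ->
  mfr d (fun c => ((1 + nrm d (fun i => c i - v i) * k)^-1) ^+ N).
Proof.
move=> k0; have cf : continuous (fun x : R => ((1 + `|x| * k)^-1) ^+ N).
  apply: (cont_comp (f := fun x : R => x ^+ N)); first exact: exprn_continuous.
  move=> x; apply: (cvgV (f := fun y : R => 1 + `|y| * k)).
    by rewrite gt_eqF// ltr_pwDl// mulr_ge0.
  apply: (contD (@cont_cst R 1) (contM (g := fun=> k) _ (@cont_cst R k))).
  exact: norm_continuous.
have := mfr_cont cf (@mfr_nrm R d v); congr mfr; apply/funext => c.
by rewrite ger0_norm// nrm_ge0.
Qed.

Lemma cosM x y : cos x * cos y = 2^-1 * (cos (x - y) + cos (x + y)) :> R.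
Proof. by rewrite cosB cosD; field. Qed.

Lemma dotB d c v v' : dot d c (fun i => v i - v' i) = dot d c v - dot d c v'.
Proof. by rewrite /dot -sumrB; apply: eq_bigr => i _; rewrite mulrBr. Qed.

Lemma dotD d c v v' : dot d c (fun i => v i + v' i) = dot d c v + dot d c v'.
Proof. by rewrite /dot -big_split; apply: eq_bigr => i _; rewrite mulrDr. Qed.

Lemma dotC d c v : dot d c v = dot d v c.
Proof. by rewrite /dot; apply: eq_bigr => i _; rewrite mulrC. Qed.

Lemma measurable_dot d : measurable_fun setT (fun z : E d * E d => dot d (co z.1) (co z.2)).
Proof.
apply: measurable_sum => i; apply: measurable_funM.
  exact: (measurableT_comp (@measurable_co R d i) measurable_fst).
exact: (measurableT_comp (@measurable_co R d i) measurable_snd).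
Qed.

Lemma measurable_cosf dd (T : measurableType dd) (f : T -> R) :
  measurable_fun setT f -> measurable_fun setT (fun x => cos (f x)).
Proof. by move=> mf; apply: measurableT_comp => //; apply: continuous_measurable_fun; exact: continuous_cos. Qed.

(** A one-sided substitute for Plancherel. The indicator is replaced by a smooth cutoff g equal to 1
    on the box; Schur's test then involves the transform of g^2, a bump of height W^d and width 1/W,
    hence of mass bounded independently of W. *)
Lemma bessel d : (0 < d)%N -> exists C : R, 0 < C /\ forall W F psi, 0 < W -> dom d F ->
  (eint d (fun xi => (\1_[set c | nrm d c <= W] xi * osc d F psi xi ^+ 2)%:E)
   <= C%:E * eint d (fun u => (F u ^+ 2)%:E))%E.
Proof.
move=> d0; have [b [B [B0 cb]]] := cutoff_exists R d.+1.
have [C cbb] := cutoff_sqr cb B0.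
pose A := (1 + `|C|) ^+ d; pose N := d.+1.
have A0 : 0 < A by rewrite exprn_gt0// ltr_pwDl.
pose K W : R := 2 ^+ N * A * (2 * (2 * W)) ^+ d.
(* Height [K W] of the kernel times the mass of its decay profile at scale 1/W: the powers of W
   cancel. *)
pose CC : R := 2 ^+ N * A * 4 ^+ d * (2 ^+ N.+1 * 2 ^+ d).
have p2 k : 0 < 2 ^+ k :> R by rewrite exprn_gt0.
have p4 k : 0 < 4 ^+ k :> R by rewrite exprn_gt0.
have CC0 : 0 < CC by exact: (mulr_gt0 (mulr_gt0 (mulr_gt0 (p2 N) A0) (p4 d)) (mulr_gt0 (p2 N.+1) (p2 d))).
exists CC; split=> // W F psi W0 dF.
pose g := boxcut d b W; pose g2 := boxcut d (fun j => leibniz b b j) W.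
have g2E c : g2 c = g c ^+ 2.
  rewrite /g2 /g /boxcut -prodrXl; apply: eq_bigr => i _.
  by rewrite /leibniz big_ord1/= bin0 mul1r expr2.
have [cb0 _ bB b2 b1] := cb.
have sg2 : sym d N A W^-1 (2 * W) g2.
  have cbb' : is_cutoff d.+1 (fun j => leibniz b b j) `|C|.
    by have [h1 h2 h3 h4 h5] := cbb; split=> // j t jM; exact: le_trans (h3 j t jM) (ler_norm _).
  exact: boxcut_sym cbb' _ W0.
have dg2 : dom d g2.
  by have [ch [<- [dch _ _] _]] := sg2 0%N d0; exact: dch.
have mg : mfr d g.
  by apply: (@mfr_prod d _ _ _ (fun (i : 'I_d) c => b 0%N (c i / W))) => i; apply: mfr_cut; exact: cb0.
pose c (z : E d * E d) := g (co z.1) * cos (2 * pi * dot d (co z.1) (co z.2) + psi).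
have mc : measurable_fun setT c.
  apply: measurable_funM; first exact: (measurableT_comp mg measurable_fst).
  apply: measurable_cosf; apply: measurable_funD => //.
  by apply: measurable_funM => //; exact: measurable_dot.
have := @schur_test _ _ (E d) (E d) R (mu d) (mu d) c (fun x => g2 (co x)) (fun x => F (co x)) CC mc
  (dom_integrable dg2) _ (dom_integrable dF) (ltW CC0) _.
have decay v psi' : `|osc d g2 psi' v| <= K W * ((1 + nrm d v * W)^-1) ^+ N.
  have := @osc_decay R d N A W^-1 (2 * W) g2 psi' v d0 (ltW A0).
  by rewrite invrK invr_gt0; apply => //; rewrite mulr_ge0// ltW.
move=> H; apply: le_trans (H _ _).
- apply: le_integral_nomeas => x.
    by rewrite lee_fin mulr_ge0 ?sqr_ge0// indicE.
  rewrite lee_fin /c/= indicE in_setb; have [xW|xW] := leP (nrm d (co x)) W; last first.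
    by rewrite mul0r sqr_ge0.
  have gx : g (co x) = 1.
    rewrite /g /boxcut big1// => i _; rewrite b1//.
    by rewrite normrM normfV (gtr0_norm W0) ler_pdivrMr// mul1r (le_trans _ xW)// nrm_coord.
  rewrite mul1r le_eqVlt; apply/orP; left; apply/eqP; congr (_ ^+ 2).
  by apply: eq_Rintegral => y _; rewrite gx mul1r mulrC dotC.
- move=> x y z; rewrite g2E /c/= mulrACA -expr2 normrM ger0_norm ?sqr_ge0//.
  rewrite ler_piMr ?sqr_ge0// normrM -[leRHS]mulr1 ler_pM//; exact: normr_cos.
- move=> u.
  (* The product of two cosines gives a difference term concentrated near v = u and a sum term
     concentrated near v = -u; both have the same mass, and the factors 1/2 add up to one. *)
  have BE (v : E d) : Rintegral (mu d) setT (fun t => c (t, u) * c (t, v)) =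
    2^-1 * (osc d g2 0 (fun i => co v i - co u i) + osc d g2 (2 * psi) (fun i => co v i + co u i)).
    rewrite -rintD; [|exact: dom_cos|exact: dom_cos].
    rewrite -rintZ; last by apply: domD; exact: dom_cos.
    apply: eq_Rintegral => t _; rewrite /c/= mulrACA -expr2 -g2E cosM dotB dotD mulrCA; congr (_ * _).
    rewrite -mulrDr; congr (_ * (_ + _)); last by congr cos; ring.
    by rewrite -cosN; congr cos; ring.
  pose D v' c' := (K W * ((1 + nrm d (fun i => c' i - v' i) * W)^-1) ^+ N : R).
  have K0 : 0 <= K W by rewrite !mulr_ge0 ?exprn_ge0// ?mulr_ge0// ?(ltW A0)// ltW.
  have D0 v' c' : 0 <= D v' c' by rewrite mulr_ge0// exprn_ge0// invr_ge0 addr_ge0// mulr_ge0 ?nrm_ge0// ltW.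
  have mD v' : mfr d (D v').
    by apply: measurable_funM => //; apply: mfr_decay; exact: ltW.
  have intD v' : (eint d (fun c' => (D v' c')%:E) <= CC%:E)%E.
    have := eint_decay v' (leqnn N) (t := W^-1); rewrite invrK invr_gt0 => /(_ W0).
    rewrite /eint; under [X in (_ -> X <= _)%E]eq_integral do rewrite EFinM.
    rewrite ge0_integralZl_EFin//.
    + move=> h; apply: le_trans (lee_wpmul2l _ h) _; first by rewrite lee_fin.
      rewrite -EFinM lee_fin /K /CC !exprMn exprVn le_eqVlt; apply/orP; left; apply/eqP.
      rewrite (_ : 4 = 2 * 2) ?exprMn; last by ring.
      by field; rewrite expf_neq0// gt_eqF.
    + by move=> x _; rewrite lee_fin exprn_ge0// invr_ge0 addr_ge0// mulr_ge0 ?nrm_ge0// ltW.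
    + exact: (mfe_EFin (@mfr_decay d v' W N (ltW W0))).
  apply: (@le_trans _ _ (\int[mu d]_v ((2^-1 * D (co u) (co v))%:E + (2^-1 * D (fun i => - co u i) (co v))%:E))%E).
    apply: le_integral_nomeas => v; first by rewrite lee_fin.
    rewrite BE -EFinD lee_fin normrM ger0_norm ?invr_ge0// -mulrDr ler_wpM2l ?invr_ge0//.
    rewrite (le_trans (ler_normD _ _))// lerD//; rewrite (le_trans (decay _ _))// /D.
    by under [X in nrm d X]eq_fun do rewrite -[X in _ + X]opprK.
  have half0 : 0 <= 2^-1 :> R by rewrite invr_ge0.
  have mD2 v' : measurable_fun setT (fun v : E d => (2^-1 * D v' (co v))%:E).
    by apply/measurable_EFinP; apply: measurable_funM => //; exact: mD.
  rewrite ge0_integralD//; try by move=> *; rewrite lee_fin mulr_ge0.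
  have I v' : (\int[mu d]_v ((2^-1 * D v' (co v))%:E) <= (2^-1 * CC)%:E)%E.
    under eq_integral do rewrite EFinM.
    rewrite ge0_integralZl_EFin//; [|by move=> x _; rewrite lee_fin|exact/mfe_EFin/mD].
    by rewrite EFinM; apply: lee_wpmul2l; [rewrite lee_fin|exact: intD].
  apply: (@le_trans _ _ ((2^-1 * CC)%:E + (2^-1 * CC)%:E)%E); first by apply: leeD; exact: I.
  by rewrite -EFinD lee_fin; lra.
Qed.

End Bessel.

(** * Pointwise and averaged bounds for frequency-localised operators *)

Section Operators.
Variable R : realType.
Local Notation mu := (@mu R).
Local Notation E := (E R).
Implicit Types (c v p : nat -> R) (a b F : (nat -> R) -> R).

Lemma rint_swap d1 d2 (f : (nat -> R) -> (nat -> R) -> R) a b :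
  dom d1 a -> dom d2 b ->
  measurable_fun setT (fun z : E d1 * E d2 => f (co z.1) (co z.2)) ->
  (forall x y, `|f x y| <= `|a x| * `|b y|) ->
  rint d1 (fun x => rint d2 (f x)) = rint d2 (fun y => rint d1 (f ^~ y)).
Proof.
move=> da db mf fab; rewrite /rint /Rintegral; congr fine.
have iF : (sfprod (mu d1) (mu d2)).-integrable setT (fun z => (f (co z.1) (co z.2))%:E).
  apply: le_integrable (integrable_prod_mul (dom_integrable (dom_abs da)) (dom_integrable (dom_abs db))) => //.
    exact/measurable_EFinP.
  move=> [x y] _ /=; rewrite lee_fin (le_trans (fab _ _))// ler_norm//.
have i1 (x : E d1) : (mu d2).-integrable setT (fun y => (f (co x) (co y))%:E).
  have h : (mu d2).-integrable setT (fun y => (`|a (co x)| * `|b (co y)|)%:E).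
    by have := dom_integrable (domZ `|a (co x)| (dom_abs db)).
  apply: le_integrable h => //.
    apply/measurable_EFinP; exact: measurableT_comp mf (measurable_pair1 x).
  by move=> y _ /=; rewrite lee_fin (le_trans (fab _ _))// ler_norm.
have i2 (y : E d2) : (mu d1).-integrable setT (fun x => (f (co x) (co y))%:E).
  have h : (mu d1).-integrable setT (fun x => (`|b (co y)| * `|a (co x)|)%:E).
    by have := dom_integrable (domZ `|b (co y)| (dom_abs da)).
  apply: le_integrable h => //.
    apply/measurable_EFinP; exact: measurableT_comp mf (measurable_pair2 y).
  by move=> x _ /=; rewrite lee_fin (le_trans (fab _ _))// mulrC ler_norm.
rewrite (eq_integral (fun x => \int[mu d2]_y (f (co x) (co y))%:E)%E); last first.
  by move=> x _; rewrite fineK//; exact: integrable_fin_num (i1 x).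
rewrite [in RHS](eq_integral (fun y => \int[mu d1]_x (f (co x) (co y))%:E)%E); last first.
  by move=> x _; rewrite fineK//; exact: integrable_fin_num (i2 x).
exact: (Fubini iF).
Qed.

(** The operator with frequency symbol [a], in convolution form: its kernel at p - u is the
    transform of the symbol. [Sop_fub] gives the frequency side. *)
Definition Sop d a psi F p := rint d (fun u => F u * osc d a psi (fun i => p i - u i)).

Lemma mfr_rint d1 d2 (f : (nat -> R) -> (nat -> R) -> R) :
  measurable_fun setT (fun z : E d1 * E d2 => f (co z.1) (co z.2)) ->
  mfr d1 (fun x => rint d2 (f x)).
Proof. by move=> mf; exact: (measurable_Rintegral (mu d2) mf). Qed.

Lemma mfr_osc d F psi : dom d F -> mfr d (osc d F psi).
Proof.
move=> dF; apply: (@mfr_rint d d (fun xi u => F u * cos (2 * pi * dot d u xi + psi))).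
apply: measurable_funM; first exact: (measurableT_comp (dom_mfr dF) measurable_snd).
apply: measurable_cosf; apply: measurable_funD => //; apply: measurable_funM => //.
by under eq_fun do rewrite dotC; exact: measurable_dot.
Qed.

Lemma osc_le d F psi xi : dom d F -> `|osc d F psi xi| <= rint d (fun u => `|F u|).
Proof.
move=> dF; rewrite (le_trans (rint_abs (dom_cos _ _ dF)))//.
apply: le_rint; [exact/dom_abs/dom_cos|exact: dom_abs|move=> c].
rewrite normrM -[leRHS]mulr1 ler_pM//; exact: normr_cos.
Qed.

Lemma dom_osc d a F psi : dom d a -> dom d F -> dom d (fun xi => a xi * osc d F psi xi).
Proof. by move=> da dF; apply: dom_bmul da (mfr_osc psi dF) _ => c; exact: osc_le. Qed.

Lemma dom_oscc d a F psi g : dom d a -> dom d F -> mfr d g -> (forall c, `|g c| <= 1) ->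
  dom d (fun xi => a xi * (g xi * osc d F psi xi)).
Proof.
move=> da dF mg g1; apply: (@dom_bmul R d a _ (rint d (fun u => `|F u|))) => //.
  by apply: measurable_funM => //; exact: mfr_osc.
by move=> c; rewrite normrM (le_trans (ler_pM _ _ (g1 c) (osc_le psi c dF)))// mul1r.
Qed.

(** Fubini and cos(x - y) = cos x cos y + sin x sin y separate p from u, the sines being written as
    cosines delayed by pi/2. On this side Bessel and Schur bounds apply. *)
Lemma Sop_fub d a psi F p : dom d a -> dom d F -> Sop d a psi F p =
  rint d (fun xi => a xi * (cos (2 * pi * dot d xi p + psi) * osc d F 0 xi)) +
  rint d (fun xi => a xi * (cos (2 * pi * dot d xi p + (psi - pi / 2)) * osc d F (- (pi / 2)) xi)).
Proof.
move=> da dF; rewrite /Sop.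
transitivity (rint d (fun u => rint d (fun xi =>
    F u * (a xi * cos (2 * pi * dot d xi (fun i => p i - u i) + psi))))).
  by congr rint; apply/funext => u; rewrite rintZ//; exact: dom_cos.
rewrite (@rint_swap d d _ F a)//; last 2 first.
- apply: measurable_funM; first exact: (measurableT_comp (dom_mfr dF) measurable_fst).
  apply: measurable_funM; first exact: (measurableT_comp (dom_mfr da) measurable_snd).
  apply: measurable_cosf; apply: measurable_funD => //; apply: measurable_funM => //.
  under eq_fun do rewrite dotB.
  apply: measurable_funB.
    exact: (measurableT_comp (@mfr_dot R d p) measurable_snd).
  by under eq_fun do rewrite dotC; exact: measurable_dot.
- by move=> u xi; rewrite !normrM ler_wpM2l// ler_piMr//; exact: normr_cos.
have mc q : mfr d (fun c => cos (2 * pi * dot d c p + q)) by apply: mfr_cos; exact: mfr_phase.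
rewrite -rintD; [|by apply: dom_oscc => // c; exact: normr_cos..].
congr rint; apply/funext => xi.
rewrite -mulrDr /osc -rintZ; last exact: dom_cos.
rewrite -[cos _ * rint d _]rintZ; last exact: dom_cos.
rewrite -rintD; [|exact/domZ/dom_cos..].
rewrite -rintZ; last by apply: domD; exact/domZ/dom_cos.
congr rint; apply/funext => u.
rewrite mulrCA; congr (_ * _).
rewrite [X in cos (X + psi)](_ : _ = 2 * pi * dot d xi p - 2 * pi * dot d u xi); last first.
  by rewrite dotB mulrBr [dot d u xi]dotC.
set al := 2 * pi * dot d xi p; set be := 2 * pi * dot d u xi.
rewrite addr0 (_ : al - be + psi = (al + psi) - be); last by ring.
rewrite cosB addrA.
have cm x : cos (x - pi / 2) = sin x :> R.
  by rewrite -cosN opprB cosB cos_pihalf sin_pihalf mul0r add0r mul1r.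
by rewrite !cm; ring.
Qed.

Lemma powR_split (x y z : R) : 0 < x -> x `^ (y + z) = x `^ y * x `^ z.
Proof. by move=> x0; rewrite powRD//; apply/implyP => _; rewrite gt_eqF. Qed.

(** Where |F| > k one has |F| <= k^(1-r) |F|^r; where |F| <= k one has |F|^2 <= k^(2-r) |F|^r. The
    condition 1 < r <= 2 gives both exponents the right sign. *)
Lemma truncate d F (r Rp k : R) : 1 < r <= 2 -> dom d F -> 0 < k -> 0 <= Rp ->
  (eint d (fun u => (`|F u| `^ r)%:E) <= Rp%:E)%E ->
  exists Fs Fl, [/\ dom d Fs, dom d Fl, forall u, F u = Fs u + Fl u,
    rint d (fun u => `|Fl u|) <= k `^ (1 - r) * Rp &
    (eint d (fun u => (Fs u ^+ 2)%:E) <= (k `^ (2 - r) * Rp)%:E)%E].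
Proof.
move=> /andP[r1 r2] dF k0 Rp0 FR.
have mF : mfr d (fun u => `|F u|) by apply: measurableT_comp => //; exact: dom_mfr dF.
have ms : mfr d (\1_[set u | `|F u| <= k]).
  have mA : measurable [set x : E d | `|F (co x)| <= k].
    rewrite (_ : [set x | _] = (fun x : E d => `|F (co x)|) @^-1` [set` `]-oo, k]]).
      by rewrite -[X in measurable X]setTI; apply: mF.
    by apply/seteqP; split => y /=; rewrite in_itv.
  rewrite /mfr (_ : _ \o _ = \1_[set x : E d | `|F (co x)| <= k]); first exact: measurable_indic.
  by apply/funext => x; rewrite /= !indicE !in_setb.
pose Fs u := F u * \1_[set u | `|F u| <= k] u.
have i1 u : `|\1_[set u | `|F u| <= k] u : R| <= 1.
  by rewrite indicE; case: (_ \in _); rewrite ?normr1 ?normr0.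
have dFs : dom d Fs by exact: dom_bmul dF ms i1.
have dFl : dom d (fun u => F u - Fs u) by exact: domB.
have mFr : mfr d (fun u => `|F u| `^ r) by apply: (measurableT_comp (measurable_powR r)).
have FsE u : Fs u = if `|F u| <= k then F u else 0.
  by rewrite /Fs indicE in_setb; case: ifP => _; rewrite ?mulr1 ?mulr0.
exists Fs, (fun u => F u - Fs u); split=> //.
- by move=> u; rewrite addrC subrK.
- rewrite -lee_fin EFin_rint; last exact: dom_abs.
  rewrite EFinM; apply: le_trans (lee_wpmul2l _ FR); last by rewrite lee_fin powR_ge0.
  rewrite /eint -ge0_integralZl_EFin ?powR_ge0//; last exact: (mfe_EFin mFr).
  apply: le_integral_nomeas => x; first by rewrite lee_fin.
  rewrite -EFinM lee_fin FsE.
  case: ifPn => [_|]; first by rewrite subrr normr0 mulr_ge0// powR_ge0.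
  rewrite -ltNge subr0 => kF; have F0 : 0 < `|F (co x)| by exact: lt_trans kF.
  rewrite -[leLHS]powRr1// -[X in _ `^ X](subrK r) powR_split// ler_wpM2r ?powR_ge0//.
  rewrite -[1 - r]opprB !powRN lef_pV2 ?posrE ?powR_gt0//.
  by rewrite ge0_ler_powR ?nnegrE ?subr_ge0 ?(ltW r1) ?(ltW k0) ?(ltW kF).
- rewrite EFinM; apply: le_trans (lee_wpmul2l _ FR); last by rewrite lee_fin powR_ge0.
  rewrite /eint -ge0_integralZl_EFin ?powR_ge0//; last exact: (mfe_EFin mFr).
  apply: le_integral_nomeas => x; first by rewrite lee_fin sqr_ge0.
  rewrite -EFinM lee_fin FsE.
  case: ifPn => [Fk|_]; last by rewrite expr0n mulr_ge0// powR_ge0.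
  have [->|F0] := eqVneq (F (co x)) 0; first by rewrite expr0n mulr_ge0// powR_ge0.
  have F1 : 0 < `|F (co x)| by rewrite normr_gt0.
  rewrite -real_normK ?num_real// -powR_mulrn// -[X in _ `^ X](subrK r) powR_split//.
  rewrite ler_wpM2r ?powR_ge0// ge0_ler_powR ?nnegrE ?subr_ge0// ?(ltW k0)//.
Qed.

Lemma rintbox_sq d F W psi : dom d F -> dom d (fun xi => \1_[set c | nrm d c <= W] xi * osc d F psi xi ^+ 2).
Proof.
move=> dF; apply: (dom_bmul (K := rint d (fun u => `|F u|) ^+ 2) (dom_box d W)).
  by apply: measurable_funX; exact: mfr_osc.
by move=> c; rewrite normrX lerXn2r ?nnegrE ?rint_ge0// osc_le.
Qed.

(* Substitute for the Hausdorff-Young inequality: real interpolation between L^1 and L^2. *)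
Lemma Sop_pointwise d : (0 < d)%N -> exists C : R, 0 < C /\
  forall (r : R) a A W F Rp lam psi p, 1 < r <= 2 -> dom d a -> 0 <= A -> 0 < W ->
    (forall c, `|a c| <= A) -> supp d W a -> dom d F -> 0 <= Rp -> 0 < lam ->
    (eint d (fun u => (`|F u| `^ r)%:E) <= Rp%:E)%E -> (2 * W) ^+ d * Rp <= lam `^ r ->
    `|Sop d a psi F p| <= C * A * lam.
Proof.
move=> d0; have [C [C0 HC]] := bessel R d0.
exists (2 + C); split; first by rewrite addr_gt0.
move=> r a A W F Rp lam psi p r12 da A0 W0 aA aW dF Rp0 l0 FR lamR.
(* At height [lam] both parts balance: the large values, in L^1, meet the supremum A (2 W)^d of the
   kernel, the small ones, in L^2, meet Bessel, and each side yields A lam. *)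
have [Fs [Fl [dFs dFl FE Fl1 Fs2]]] := truncate r12 dF l0 Rp0 FR.
have W2 : 0 < (2 * W) ^+ d by rewrite exprn_gt0// mulr_gt0.
have oscA q v : `|osc d a q v| <= A * (2 * W) ^+ d by apply: osc_bound => //; exact: ltW.
have moscp q : mfr d (fun u => osc d a q (fun i => p i - u i)).
  apply: (@mfr_rint d d (fun u xi => a xi * cos (2 * pi * dot d xi (fun i => p i - u i) + q))).
  apply: measurable_funM; first exact: (measurableT_comp (dom_mfr da) measurable_snd).
  apply: measurable_cosf; apply: measurable_funD => //; apply: measurable_funM => //.
  under eq_fun do rewrite dotB.
  apply: measurable_funB; first exact: (measurableT_comp (@mfr_dot R d p) measurable_snd).
  by under eq_fun do rewrite dotC; exact: measurable_dot.
have dS G : dom d G -> dom d (fun u => G u * osc d a psi (fun i => p i - u i)).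
  by move=> dG; exact: dom_bmul dG (moscp psi) (fun c => oscA psi _).
have SE : Sop d a psi F p = Sop d a psi Fs p + Sop d a psi Fl p.
  rewrite /Sop -rintD; [|exact: dS..].
  by congr rint; apply/funext => u; rewrite FE mulrDl.
have bl : `|Sop d a psi Fl p| <= A * lam.
  rewrite (le_trans (rint_abs (dS _ dFl)))//.
  apply: (@le_trans _ _ (rint d (fun u => (A * (2 * W) ^+ d) * `|Fl u|))).
    apply: le_rint; [exact/dom_abs/dS|exact/domZ/dom_abs|move=> c].
    by rewrite normrM mulrC ler_wpM2r.
  rewrite rintZ; last exact: dom_abs.
  rewrite -mulrA ler_wpM2l//; apply: le_trans (ler_wpM2l (ltW W2) Fl1) _.
  rewrite mulrCA (le_trans (ler_wpM2l (powR_ge0 _ _) lamR))//.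
  by rewrite -powR_split// subrK powRr1// ltW.
(* Weight of the inequality 2 x <= tau + x^2 / tau, which stands in for Cauchy-Schwarz on the
   frequency box; this choice makes the first term integrate to [lam]. *)
pose tau := lam / (2 * W) ^+ d.
have tau0 : 0 < tau by rewrite divr_gt0.
have bs psi' q : `|rint d (fun xi => a xi * (cos (2 * pi * dot d xi p + q) * osc d Fs psi' xi))|
    <= A * ((1 + C) / 2 * lam).
  have mc : mfr d (fun c => cos (2 * pi * dot d c p + q)) by apply: mfr_cos; exact: mfr_phase.
  have dd : dom d (fun xi => a xi * (cos (2 * pi * dot d xi p + q) * osc d Fs psi' xi)).
    by apply: dom_oscc => // c; exact: normr_cos.
  rewrite (le_trans (rint_abs dd))//.
  pose g xi := A / 2 * (tau * \1_[set c | nrm d c <= W] xi + tau^-1 * (\1_[set c | nrm d c <= W] xi * osc d Fs psi' xi ^+ 2)).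
  have dg1 : dom d (fun xi => tau * \1_[set c | nrm d c <= W] xi) by apply: domZ; exact: dom_box.
  have dg2 : dom d (fun xi => tau^-1 * (\1_[set c | nrm d c <= W] xi * osc d Fs psi' xi ^+ 2)).
    by apply: domZ; exact: rintbox_sq.
  apply: (@le_trans _ _ (rint d g)).
    apply: le_rint; [exact: dom_abs|by apply: domZ; exact: domD|move=> xi].
    rewrite /g indicE in_setb; have [xW|xW] := leP (nrm d xi) W; last first.
      by rewrite aW// mul0r normr0 !(mulr0, mul0r) addr0 mulr0.
    rewrite mulr1 mul1r normrM -[A / 2 * _]mulrA; apply: ler_pM => //.
    rewrite normrM (@le_trans _ _ `|osc d Fs psi' xi|)//.
      by rewrite ler_piMl//; exact: normr_cos.
    rewrite -[osc _ _ _ _ ^+ 2]real_normK ?num_real//; set x := `|_|.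
    rewrite ler_pdivlMl// -subr_ge0.
    have -> : tau + tau^-1 * x ^+ 2 - 2 * x = tau^-1 * (tau - x) ^+ 2 by field; rewrite gt_eqF.
    by rewrite mulr_ge0 ?sqr_ge0// invr_ge0 ltW.
  rewrite rintZ ?rintD//; last exact: domD.
  rewrite !rintZ; [|exact: rintbox_sq|exact: dom_box].
  rewrite rint_box ?(ltW W0)//.
  have t1 : tau * (2 * W) ^+ d = lam by rewrite divfK// gt_eqF.
  have t2 : rint d (fun xi => \1_[set c | nrm d c <= W] xi * osc d Fs psi' xi ^+ 2)
      <= C * (lam `^ (2 - r) * Rp).
    rewrite -lee_fin EFin_rint; last exact: rintbox_sq.
    apply: le_trans (HC W Fs psi' W0 dFs) _; rewrite EFinM.
    by apply: lee_wpmul2l => //; rewrite lee_fin ltW.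
  have t3 : tau^-1 * (C * (lam `^ (2 - r) * Rp)) <= C * lam.
    have -> : tau^-1 * (C * (lam `^ (2 - r) * Rp)) = C * lam^-1 * lam `^ (2 - r) * ((2 * W) ^+ d * Rp).
      by rewrite /tau invfM invrK; ring.
    have k0 : 0 <= C * lam^-1 * lam `^ (2 - r) by rewrite !mulr_ge0 ?powR_ge0 ?invr_ge0 ?(ltW C0) ?(ltW l0).
    apply: le_trans (ler_wpM2l k0 lamR) _.
    rewrite (_ : _ * lam `^ r = C / lam * (lam `^ (2 - r) * lam `^ r)); last by rewrite mulrA.
    rewrite -powR_split// subrK powR_mulrn ?(ltW l0)//.
    by rewrite le_eqVlt; apply/orP; left; apply/eqP; field; rewrite gt_eqF.
  have tV0 : 0 <= tau^-1 by rewrite invr_ge0 ltW.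
  have t5 := le_trans (ler_wpM2l tV0 t2) t3.
  rewrite t1; set X := tau^-1 * _ in t5 *; have := A0; nra.
rewrite SE (le_trans (ler_normD _ _))// Sop_fub//.
rewrite (le_trans (lerD (ler_normD _ _) (lexx _)))//.
apply: (le_trans (lerD (lerD (bs _ _) (bs _ _)) bl)).
by rewrite le_eqVlt; apply/orP; left; apply/eqP; field.
Qed.

End Operators.

(** * Averages along a segment: Schur's test and integration by parts in the position *)

Section Averages.
Variable R : realType.
Local Notation leb := (@lebesgue_measure R : {sigma_finite_measure set (measurableTypeR R) -> \bar R}).
Local Notation mu := (@mu R).
Local Notation E := (E R).
Local Notation TR := (measurableTypeR R).
Implicit Types (c v p : nat -> R) (b F : (nat -> R) -> R).

Lemma cont_itv_integrable (f : R -> R) (a b : R) : continuous f ->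
  leb.-integrable `[a, b] (EFin \o f).
Proof.
move=> cf; apply: continuous_compact_integrable; first exact: segment_compact.
exact: continuous_subspaceT.
Qed.

Lemma FTC_itv (f f' : R -> R) (a b : R) : a < b -> (forall t, ider f t (f' t)) -> continuous f' ->
  Rintegral leb `[a, b] f' = f b - f a.
Proof.
move=> ab ff' cf'; have cf := ider_continuous ff'.
rewrite /Rintegral (@continuous_FTC2 R f' f a b)//.
- exact: continuous_subspaceT.
- split.
  + by move=> x _; have [] := ff' x.
  + by apply: cvg_at_right_filter; exact: cf.
  + by apply: cvg_at_left_filter; exact: cf.
- by move=> x _; rewrite derive1E; have [] := ff' x.
Qed.

Lemma Rintegral_itv_cst (a b k : R) : a <= b -> Rintegral leb `[a, b] (fun=> k) = k * (b - a).
Proof.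
move=> ab; rewrite Rintegral_cst//= lebesgue_measure_itv/= lte_fin; case: ltgtP ab => //= -> _.
by rewrite subrr.
Qed.

Lemma itv_bound (f : R -> R) (a b K : R) : a <= b -> continuous f -> (forall t, `|f t| <= K) ->
  `|Rintegral leb `[a, b] f| <= K * (b - a).
Proof.
move=> ab cf fK; have iF := cont_itv_integrable a b cf.
rewrite (le_trans (le_normr_Rintegral _ iF))//.
rewrite -Rintegral_itv_cst//; apply: le_Rintegral => //.
- by apply: (@cont_itv_integrable (fun t => `|f t|)); apply: cont_comp cf; exact: norm_continuous.
- exact/(@cont_itv_integrable (fun=> K))/cont_cst.
Qed.

Lemma cont_cos_lin (w b : R) : continuous (fun t : R => cos (w * t + b)).
Proof. by apply: cont_comp; [exact: continuous_cos|exact: cont_lin]. Qed.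

Lemma cont_sin_lin (w b : R) : continuous (fun t : R => sin (w * t + b)).
Proof. by apply: cont_comp; [exact: continuous_sin|exact: cont_lin]. Qed.

(** One integration by parts against the sine: the two boundary values cost at most 2 G and the
    integral of the derivative at most G' s. *)
Lemma oscillatory_itv (g g' : R -> R) (t0 s w b G G' : R) : 0 < s ->
  (forall t, ider g t (g' t)) -> continuous g' ->
  (forall t, `|g t| <= G) -> (forall t, `|g' t| <= G') ->
  `|w| * `|Rintegral leb `[t0, t0 + s] (fun t => g t * cos (w * t + b))| <= 2 * G + G' * s.
Proof.
move=> s0 gg' cg' gG gG'; have cg := ider_continuous gg'.
have c1 := contM cg' (@cont_sin_lin w b).
have c2 : continuous (fun t => w * (g t * cos (w * t + b))).
  by apply: contM; [exact: cont_cst|apply: contM cg (@cont_cos_lin w b)].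
have ab : t0 < t0 + s by rewrite ltrDl.
have := @FTC_itv (fun t => g t * sin (w * t + b))
  (fun t => g' t * sin (w * t + b) + w * (g t * cos (w * t + b))) _ _ ab.
rewrite RintegralD//; [|exact: cont_itv_integrable..].
rewrite RintegralZl//; last exact/cont_itv_integrable/(contM cg (@cont_cos_lin w b)).
move=> H; rewrite -normrM.
pose I1 := Rintegral leb `[t0, t0 + s] (fun t => g' t * sin (w * t + b)).
have -> : w * Rintegral leb `[t0, t0 + s] (fun t => g t * cos (w * t + b)) =
    g (t0 + s) * sin (w * (t0 + s) + b) - g t0 * sin (w * t0 + b) - I1.
  rewrite /I1 -H; [by ring| |exact: contD].
  move=> t; apply: ider_eq (iderM (gg' t) (ider_sin (ider_lin w b t))) _; ring.
rewrite (le_trans (ler_normB _ _))// lerD//.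
  rewrite (le_trans (ler_normB _ _))// mulr2n mulrDl mul1r lerD// normrM;
  by rewrite -[leRHS]mulr1 ler_pM//; exact: normr_sin.
have := @itv_bound (fun t => g' t * sin (w * t + b)) t0 (t0 + s) G' (ltW ab) c1.
rewrite addrAC subrr add0r; apply => t.
by rewrite normrM -[leRHS]mulr1 ler_pM//; exact: normr_sin.
Qed.

Lemma mfr_dist d (th : (nat -> R) -> R) (q k : R) : mfr d th -> mfr d (\1_[set c | `|th c - q| <= k]).
Proof.
move=> mth.
have mf : mfr d (fun c => `|th c - q|).
  by apply: measurableT_comp => //; apply: measurable_funB.
have mA : measurable [set x : E d | `|th (co x) - q| <= k].
  rewrite (_ : [set x | _] = (fun x : E d => `|th (co x) - q|) @^-1` [set` `]-oo, k]]).
    by rewrite -[X in measurable X]setTI; apply: mf.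
  by apply/seteqP; split => y /=; rewrite in_itv.
rewrite /mfr (_ : _ \o _ = \1_[set x : E d | `|th (co x) - q| <= k]); first exact: measurable_indic.
by apply/funext => x; rewrite /= !indicE !in_setb.
Qed.

(** [th] moves at unit speed along the first coordinate, so for fixed other coordinates the slab
    confines that coordinate to an interval of length 2 k. *)
Lemma eint_slab d (th : (nat -> R) -> R) (W k q : R) : 0 <= k -> 0 <= W ->
  mfr d.+1 th -> (forall t c, th (ccons t c) = t + th (ccons 0 c)) ->
  (eint d.+1 (fun c => (\1_[set c | nrm d.+1 c <= W] c * \1_[set c | `|th c - q| <= k] c)%:E)
    <= (2 * k * (2 * W) ^+ d)%:E)%E.
Proof.
move=> k0 W0 mth thE.
have mS := mfr_dist q k mth.
have i0 (S : set (nat -> R)) c : 0 <= \1_S c :> R by rewrite indicE.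
rewrite eint_S2; last 2 first.
- by apply: mfe_EFin; apply: measurable_funM => //; exact: dom_mfr (dom_box _ W).
- by move=> c; rewrite lee_fin mulr_ge0.
apply: (@le_trans _ _ (eint d (fun c => (2 * k)%:E * (\1_[set c | nrm d c <= W] c)%:E)%E)).
  apply: le_integral_nomeas => x; first by apply: integral_ge0 => t _; rewrite lee_fin mulr_ge0.
  have E1 t : \1_[set c | nrm d.+1 c <= W] (ccons t (co x)) * \1_[set c | `|th c - q| <= k] (ccons t (co x))
      <= \1_(`[q - th (ccons 0 (co x)) - k, q - th (ccons 0 (co x)) + k]) t * \1_[set c | nrm d c <= W] (co x) :> R.
    rewrite !indicE !in_setb nrm_ccons thE ge_max in_itv/= -!natrM !mulnb ler_nat.
    case: (nrm d (co x) <= W); rewrite ?andbT ?andbF//=.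
    case: (`|t| <= W) => //=.
    rewrite ler_norml; case: andP => //= -[h1 h2].
    by rewrite (_ : _ && _ = true)//; apply/andP; split; lra.
  apply: (@le_trans _ _ (\int[leb]_t ((\1_(`[q - th (ccons 0 (co x)) - k, q - th (ccons 0 (co x)) + k]) t)%:E *
     (\1_[set c | nrm d c <= W] (co x))%:E))%E).
    by apply: le_integral_nomeas => t; rewrite ?lee_fin ?mulr_ge0// -EFinM lee_fin.
  rewrite ge0_integralZr//.
  - rewrite integral_itv_indic; last by lra.
    by rewrite lee_wpmul2r ?lee_fin//; lra.
  - by apply/measurable_EFinP; exact: measurable_indic.
rewrite /eint ge0_integralZl_EFin//.
- have := @eint_box R d (fun=> 0) W W0; rewrite box0 /eint => ->.
  by rewrite -EFinM.
- by apply: mfe_EFin; exact: dom_mfr (dom_box _ W).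
- by rewrite mulr_ge0.
Qed.


Lemma sqrD_le (x y : R) : (x + y) ^+ 2 <= 2 * x ^+ 2 + 2 * y ^+ 2.
Proof. by have := sqr_ge0 (x - y); nra. Qed.

(* One-dimensional averages of a frequency-localised oscillatory operator: a Schur test in the
   frequency variable, where integrating by parts in [t] beats the trivial bound. *)
Lemma schur_average d : exists C : R, 0 < C /\
  forall (a a' : R -> (nat -> R) -> R) (th be : (nat -> R) -> R) A W s t0 H,
    0 <= A -> 0 < W -> 0 < s ->
    measurable_fun setT (fun z : TR * E d.+1 => a z.1 (co z.2)) ->
    (forall t, supp d.+1 W (a t)) -> (forall t c, `|a t c| <= A) ->
    (forall c t, ider (a ^~ c) t (a' t c)) -> (forall c, continuous (a' ^~ c)) ->
    (forall t c, `|a' t c| <= A / s) ->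
    mfr d.+1 th -> mfr d.+1 be -> (forall t c, th (ccons t c) = t + th (ccons 0 c)) ->
    dom d.+1 H -> supp d.+1 W H ->
    (\int[leb]_t ((\1_(`[t0, t0 + s]) t *
        rint d.+1 (fun xi => a t xi * cos (2 * pi * (t * th xi) + be xi) * H xi)) ^+ 2)%:E
     <= (C * A ^+ 2 * s * (2 * W) ^+ d.+1 / Num.sqrt (W * s))%:E * eint d.+1 (fun xi => (H xi ^+ 2)%:E))%E.
Proof.
exists 4; split=> // a a' th be A W s t0 H A0 W0 s0 ma aW aA aa' ca' a'A mth mbe thE dH HW.
pose I := `[t0, t0 + s]%classic : set TR.
have mI : measurable I by exact: measurable_itv.
pose c (z : TR * E d.+1) := \1_I z.1 * (a z.1 (co z.2) * cos (2 * pi * (z.1 * th (co z.2)) + be (co z.2))).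
have mc : measurable_fun setT c.
  apply: measurable_funM.
    exact: (measurableT_comp (measurable_indic mI) measurable_fst).
  apply: measurable_funM => //; apply: measurable_cosf; apply: measurable_funD.
    apply: measurable_funM => //; apply: measurable_funM; first exact: measurable_fst.
    exact: (measurableT_comp mth measurable_snd).
  exact: (measurableT_comp mbe measurable_snd).
pose N := 4 * A ^+ 2 * s * (2 * W) ^+ d.+1 / Num.sqrt (W * s).
(* Half-width of the slab. Up to the factor A^2, the slab costs s k (2 W)^d by the trivial bound and
   the rest of the box (2 W)^(d+1) / k after integration by parts; the two are comparable when k^2 =
   W / s. *)
pose k := Num.sqrt (W / s).
have k0 : 0 < k by rewrite sqrtr_gt0 divr_gt0.
have N0 : 0 <= N by rewrite !mulr_ge0 ?sqr_ge0 ?exprn_ge0 ?invr_ge0 ?sqrtr_ge0 ?(ltW s0)// mulr_ge0// ltW.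
have indI : leb.-integrable setT (EFin \o (fun t => A ^+ 2 * \1_I t)).
  have iI : leb.-integrable setT (fun t => (\1_I t)%:E).
    apply/integrableP; split; first by apply/measurable_EFinP; exact: measurable_indic.
    under eq_integral do rewrite gee0_abs ?lee_fin//.
    by rewrite integral_itv_indic ?ltry// lerDl ltW.
  rewrite (_ : _ \o _ = (fun t => (A ^+ 2)%:E * (\1_I t)%:E)%E); first exact: integrableZl.
  by apply/funext => t; rewrite /= EFinM.
have := @schur_test _ _ TR (E d.+1) R leb (mu d.+1) c _ (fun x => H (co x)) N mc indI _ (dom_integrable dH) N0 _.
move=> SCH; apply: le_trans (SCH _ _).
- apply: le_integral_nomeas => t; first by rewrite lee_fin sqr_ge0.
  rewrite lee_fin le_eqVlt; apply/orP; left; apply/eqP; congr (_ ^+ 2).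
  rewrite /rint -RintegralZl//.
    by apply: eq_Rintegral => x _; rewrite /c/= !mulrA.
  apply: (@dom_integrable R d.+1 (fun xi => a t xi * cos (2 * pi * (t * th xi) + be xi) * H xi)).
  under eq_fun do rewrite mulrC.
  apply: (@dom_bmul R d.+1 H _ A) => //.
    apply: measurable_funM; first exact: (measurableT_comp ma (measurable_pair1 (t : TR))).
    apply: measurable_cosf; apply: measurable_funD => //; apply: measurable_funM => //.
    by apply: measurable_funM.
  by move=> xi; rewrite normrM -[leRHS]mulr1 ler_pM//; exact: normr_cos.
- move=> t x y; rewrite /c/= mulrACA normrM ger0_norm ?mulr_ge0 ?indicE//.
  rewrite -natrM mulnb andbb [leRHS]mulrC ler_wpM2l// !normrM expr2 ler_pM// -[leRHS]mulr1;
  by rewrite ler_pM//; exact: normr_cos.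
- move=> x.
  have BE (y : E d.+1) : `|Rintegral leb setT (fun t => c (t, x) * c (t, y))| <=
      A ^+ 2 * s * (\1_[set c | nrm d.+1 c <= W] (co y) * \1_[set c | `|th c - th (co x)| <= k] (co y)) +
      A ^+ 2 * s * (\1_[set c | nrm d.+1 c <= W] (co y) * \1_[set c | `|th c - - th (co x)| <= k] (co y)) +
      A ^+ 2 / k * \1_[set c | nrm d.+1 c <= W] (co y).
    rewrite indicE in_setb; have [yW|yW] := leP (nrm d.+1 (co y)) W; last first.
      rewrite !(mul0r, mulr0) !addr0 (_ : (fun t => _) = fun=> 0).
        by rewrite Rintegral_cst// mul0r normr0.
      by apply/funext => t; rewrite /c/= (aW t (co y))// !(mul0r, mulr0).
    rewrite !mul1r mulr1.
    pose g t := a t (co x) * a t (co y).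
    pose g' t := a' t (co x) * a t (co y) + a t (co x) * a' t (co y).
    have gg' t : ider g t (g' t) by exact: iderM.
    have ca y' : continuous (a ^~ y') by exact: ider_continuous (aa' y').
    have cg' : continuous g' by apply: contD; apply: contM.
    have gG t : `|g t| <= A ^+ 2 by rewrite normrM expr2 ler_pM.
    have gG' t : `|g' t| <= 2 * A ^+ 2 / s.
      rewrite (le_trans (ler_normD _ _))// !normrM (_ : 2 * A ^+ 2 / s = A / s * A + A * (A / s)); last by ring.
      by rewrite lerD// ler_pM.
    (* Inside the slab the integral is bounded by its length. Outside, the phase has speed at least
       2 pi k >= 4 k, while boundary and derivative terms total 4 A^2. *)
    have J (q b : R) : `|Rintegral leb I (fun t => g t * cos (2 * pi * (th (co y) - q) * t + b))| <=
        A ^+ 2 * s * \1_[set c | `|th c - q| <= k] (co y) + A ^+ 2 / k.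
      rewrite indicE in_setb; have [qk|qk] := leP `|th (co y) - q| k.
        rewrite mulr1 (@le_trans _ _ (A ^+ 2 * s))//; last by rewrite lerDl divr_ge0 ?sqr_ge0 ?(ltW k0).
        have := @itv_bound (fun t => g t * cos (2 * pi * (th (co y) - q) * t + b)) t0 (t0 + s) (A ^+ 2) _ _.
        rewrite addrAC subrr add0r; apply; first by rewrite lerDl ltW.
          by apply: contM (@cont_cos_lin _ b); exact: ider_continuous gg'.
        by move=> t; rewrite normrM -[leRHS]mulr1 ler_pM//; exact: normr_cos.
      rewrite mulr0 add0r.
      have := oscillatory_itv t0 (2 * pi * (th (co y) - q)) b s0 gg' cg' gG gG'.
      rewrite divfK ?gt_eqF// !normrM normr_nat (ger0_norm (pi_ge0 R)).
      pose J := `|Rintegral leb I (fun t => g t * cos (2 * pi * (th (co y) - q) * t + b))|; rewrite -/J.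
      move=> h; rewrite ler_pdivlMr// -(ler_pM2l (_ : 0 < 4))//.
      have J0 : 0 <= J by exact: normr_ge0.
      have p4 : 4 * k <= 2 * pi * `|th (co y) - q| by have := @pi_ge2 R; nra.
      have := ler_wpM2r J0 p4; nra.
    have cg := ider_continuous gg'.
    have -> : Rintegral leb setT (fun t => c (t, x) * c (t, y)) = Rintegral leb I (fun t =>
        2^-1 * (g t * cos (2 * pi * (th (co y) - th (co x)) * t + (be (co y) - be (co x)))
              + g t * cos (2 * pi * (th (co y) - - th (co x)) * t + (be (co y) + be (co x))))).
      rewrite [RHS]Rintegral_mkcond; apply: eq_Rintegral => t _.
      rewrite /c/= patchE indicE; case: (t \in I); last by rewrite !mul0r.
      rewrite !mul1r mulrACA [cos _ * cos _]mulrC cosM mulrCA -mulrDr; congr (_ * (_ * (_ + _))); congr cos; ring.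
    have ic (w b : R) : leb.-integrable I (EFin \o (fun t => g t * cos (w * t + b))).
      by apply: cont_itv_integrable; apply: contM (@cont_cos_lin w b).
    rewrite RintegralZl//; last first.
      by apply: cont_itv_integrable; apply: contD; apply: contM (@cont_cos_lin _ _).
    rewrite RintegralD// normrM ger0_norm ?invr_ge0//.
    have := le_trans (ler_normD _ _) (lerD (J (th (co x)) (be (co y) - be (co x))) (J (- th (co x)) (be (co y) + be (co x)))).
    set z1 : R := \1_[set c0 | `|th c0 - th (co x)| <= k] (co y).
    set z2 : R := \1_[set c0 | `|th c0 - - th (co x)| <= k] (co y) => h.
    have z10 : 0 <= A ^+ 2 * s * z1 by rewrite !mulr_ge0 ?sqr_ge0 ?(ltW s0)// indicE.
    have z20 : 0 <= A ^+ 2 * s * z2 by rewrite !mulr_ge0 ?sqr_ge0 ?(ltW s0)// indicE.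
    rewrite mulrC ler_pdivrMr//; apply: le_trans h _; lra.
  have mS q := mfr_dist q k mth.
  have i0 (S : set (nat -> R)) v : 0 <= \1_S v :> R by rewrite indicE.
  pose G1 (q : R) (y : nat -> R) : \bar R := ((A ^+ 2 * s)%:E * (\1_[set c | nrm d.+1 c <= W] y * \1_[set c | `|th c - q| <= k] y)%:E)%E.
  pose G2 (y : nat -> R) : \bar R := ((A ^+ 2 / k)%:E * (\1_[set c | nrm d.+1 c <= W] y)%:E)%E.
  have As0 : 0 <= A ^+ 2 * s by rewrite mulr_ge0 ?sqr_ge0// ltW.
  have Ak0 : 0 <= A ^+ 2 / k by rewrite divr_ge0 ?sqr_ge0// ltW.
  have mb : mfr d.+1 (\1_[set c | nrm d.+1 c <= W]) by exact: dom_mfr (dom_box _ W).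
  have mG0 q : mfe d.+1 (fun y => (\1_[set c | nrm d.+1 c <= W] y * \1_[set c | `|th c - q| <= k] y)%:E).
    by apply: mfe_EFin; apply: measurable_funM => //; exact: mS.
  have mG1 q : measurable_fun setT (fun y : E d.+1 => G1 q (co y)).
    by apply: emeasurable_funM => //; exact: mG0.
  have mG2 : measurable_fun setT (fun y : E d.+1 => G2 (co y)).
    by apply: emeasurable_funM => //; exact: mfe_EFin.
  have G10 q y : (0 <= G1 q y)%E by rewrite /G1 -EFinM lee_fin; exact: mulr_ge0 As0 (mulr_ge0 (i0 _ _) (i0 _ _)).
  have G20 y : (0 <= G2 y)%E by rewrite /G2 -EFinM lee_fin; exact: mulr_ge0 Ak0 (i0 _ _).
  apply: (@le_trans _ _ (\int[mu d.+1]_y (G1 (th (co x)) (co y) + G1 (- th (co x))%R (co y) + G2 (co y))%E)%E).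
    apply: le_integral_nomeas => y; first by rewrite lee_fin.
    by rewrite /G1 /G2 -!EFinM -!EFinD lee_fin; exact: BE.
  rewrite ge0_integralD//; [|by move=> y _; rewrite adde_ge0|exact: emeasurable_funD].
  rewrite ge0_integralD//.
  have B1 q : (\int[mu d.+1]_y G1 q (co y) <= (A ^+ 2 * s * (2 * k * (2 * W) ^+ d))%:E)%E.
    rewrite (ge0_integralZl_EFin (mu d.+1) measurableT _ (mG0 q) As0); last first.
      by move=> y _; rewrite lee_fin; exact: mulr_ge0.
    rewrite [leRHS]EFinM; apply: lee_wpmul2l; first by rewrite lee_fin.
    exact: eint_slab (ltW k0) (ltW W0) mth thE.
  have B2 : (\int[mu d.+1]_y G2 (co y) <= (A ^+ 2 / k * (2 * W) ^+ d.+1)%:E)%E.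
    rewrite (ge0_integralZl_EFin (mu d.+1) measurableT _ (mfe_EFin mb) Ak0); last first.
      by move=> y _; rewrite lee_fin.
    rewrite [leRHS]EFinM; apply: lee_wpmul2l; first by rewrite lee_fin.
    by have := @eint_box R d.+1 (fun=> 0) W (ltW W0); rewrite box0 /eint => ->.
  apply: le_trans (leeD (leeD (B1 _) (B1 _)) B2) _.
  have kk : Num.sqrt (W * s) = s * k.
    apply/eqP; rewrite -(eqrXn2 (n := 2))// ?sqrtr_ge0 ?mulr_ge0 ?(ltW s0) ?(ltW k0)//.
    rewrite exprMn !sqr_sqrtr ?mulr_ge0 ?invr_ge0 ?(ltW s0) ?(ltW W0)//.
    by apply/eqP; field; rewrite gt_eqF.
  have k2 : k * k * s = W by rewrite -expr2 sqr_sqrtr ?divr_ge0 ?(ltW s0) ?(ltW W0)// divfK ?gt_eqF.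
  rewrite -!EFinD lee_fin /N kk.
  have -> : 4 * A ^+ 2 * s * (2 * W) ^+ d.+1 / (s * k) =
    A ^+ 2 * s * (2 * k * (2 * W) ^+ d) + A ^+ 2 * s * (2 * k * (2 * W) ^+ d) +
     A ^+ 2 / k * (2 * W) ^+ d.+1 + A ^+ 2 / k * (2 * W) ^+ d.+1.
    have alg (k' P s' W' : R) : k' != 0 -> s' != 0 -> k' * k' * s' = W' ->
        4 * A ^+ 2 * s' * (2 * W' * P) / (s' * k') = A ^+ 2 * s' * (2 * k' * P) +
        A ^+ 2 * s' * (2 * k' * P) + A ^+ 2 / k' * (2 * W' * P) + A ^+ 2 / k' * (2 * W' * P).
      by move=> k'0 s'0 <-; field; rewrite k'0.
    by rewrite [(2 * W) ^+ d.+1]exprS; apply: alg; rewrite ?gt_eqF.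
  by rewrite lerDl mulr_ge0// exprn_ge0// mulr_ge0// ltW.
Qed.

End Averages.

Section Average.
Variable R : realType.
Local Notation leb := (@lebesgue_measure R : {sigma_finite_measure set (measurableTypeR R) -> \bar R}).
Local Notation mu := (@mu R).
Local Notation E := (E R).
Local Notation TR := (measurableTypeR R).
Implicit Types (c v p : nat -> R) (F : (nat -> R) -> R).

(** Indicator of the first coordinate in each block of length [n]. Adding t times it to a point of
    the diagonal is the motion of x by t along the first axis of R^n. *)
Definition every (n e : nat) : R := (e %% n == 0)%N%:R.

Definition moved n p (t : R) : nat -> R := fun e => p e + t * every n e.

Lemma dot_moved d n c p (t : R) : dot d c (moved n p t) = dot d c p + t * dot d c (every n).
Proof. by rewrite /dot mulr_sumr -big_split /=; apply: eq_bigr => i _; rewrite /moved; ring. Qed.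

Lemma every_ccons d n (t : R) c :
  dot d.+1 (ccons t c) (every n) = t + dot d.+1 (ccons 0 c) (every n).
Proof. by rewrite /dot !big_ord_recl /= /every mod0n eqxx mulr1 mul0r add0r. Qed.

(** Trades a q-th power for a square, so that an L^2 average is enough: with y = x / Y, (1 + y)^q <=
    1 + y <= 2 + y^2. *)
Lemma powR_small_bound (x Y q : R) : 0 < q <= 1 -> 0 < Y -> 0 <= x ->
  (Y + x) `^ q <= Y `^ q * (2 + (x / Y) ^+ 2).
Proof.
move=> /andP[q0 q1] Y0 x0; have xY : 0 <= x / Y by rewrite divr_ge0// ltW.
have -> : Y + x = Y * (1 + x / Y) by field; rewrite gt_eqF.
rewrite powRM ?(ltW Y0) ?addr_ge0// ler_wpM2l ?powR_ge0//.
apply: (@le_trans _ _ ((1 + x / Y) `^ 1)).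
  by apply: ler_powR => //; rewrite lerDl.
rewrite powRr1 ?addr_ge0//; have := sqr_ge0 (x / Y - 1); set y := x / Y; nra.
Qed.

(** The truncation height is raised from lam to lam (W s)^(1/4). The large values then gain (W
    s)^(-(r-1)/4) in the pointwise bound; for the small ones the averaged square gains (W s)^(-1/2)
    and loses only (W s)^((2-r)/4). As W s >= 1, both are covered by the exponent -(r-1)/8. *)
Lemma Sop_average d n : (0 < n)%N -> exists C : R, 0 < C /\
  forall (r q : R) (a a' : R -> (nat -> R) -> R) A W F Rp lam psi p0 s t0,
    1 < r <= 2 -> 0 < q <= 1 -> 0 < A -> 0 < W -> 0 < s -> 1 <= W * s ->
    measurable_fun setT (fun z : TR * E d.+1 => a z.1 (co z.2)) ->
    (forall t, supp d.+1 W (a t)) -> (forall t c, `|a t c| <= A) ->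
    (forall c t, ider (a ^~ c) t (a' t c)) -> (forall c, continuous (a' ^~ c)) ->
    (forall t c, `|a' t c| <= A / s) ->
    dom d.+1 F -> 0 <= Rp -> 0 < lam ->
    (eint d.+1 (fun u => (`|F u| `^ r)%:E) <= Rp%:E)%E -> (2 * W) ^+ d.+1 * Rp <= lam `^ r ->
    (\int[leb]_t (\1_(`[t0, t0 + s]) t * `|Sop d.+1 (a t) psi F (moved n p0 t)| `^ q)%:E
     <= (C * s * (A * lam * (W * s) `^ (- ((r - 1) / 8))) `^ q)%:E)%E.
Proof.
move=> n0; have [C0 [C00 HB]] := @bessel R d.+1 isT.
have [C1 [C10 HS]] := @schur_average R d.
exists (2 + 4 * C1 * C0); split; first by rewrite addr_gt0// !mulr_gt0.
move=> r q a a' A W F Rp lam psi p0 s t0 r12 q01 A0 W0 s0 Ws1 ma aW aA aa' ca' a'A dF Rp0 l0 FR lamR.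
have /andP[r1 r2] := r12; have Ws0 : 0 < W * s by rewrite mulr_gt0.
pose D := (2 * W) ^+ d.+1.
have D0 : 0 < D by rewrite exprn_gt0// mulr_gt0.
pose g := (W * s) `^ (4^-1); have g0 : 0 < g by rewrite powR_gt0.
pose k := lam * g; have k0 : 0 < k by rewrite mulr_gt0.
pose Y := A * lam * (W * s) `^ (- ((r - 1) / 8)).
have Y0 : 0 < Y by rewrite !mulr_gt0// powR_gt0.
have [Fs [Fl [dFs dFl FE Fl1 Fs2]]] := truncate r12 dF k0 Rp0 FR.
have mat t : mfr d.+1 (a t) by exact: (measurableT_comp ma (measurable_pair1 (t : TR))).
have dat t : dom d.+1 (a t).
  by apply: (@dom_supp R d.+1 W A) => //; exact: ltW.
have Dlam e : D * (k `^ e * Rp) <= lam `^ (e + r) * g `^ e.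
  rewrite mulrCA (le_trans (ler_wpM2l (powR_ge0 _ _) lamR))//.
  by rewrite powRM ?(ltW l0) ?(ltW g0)// powR_split// mulrAC.
have oscA t q' v : `|osc d.+1 (a t) q' v| <= A * D by apply: osc_bound => //; exact: ltW.
pose p t := moved n p0 t.
have mosc t q' : mfr d.+1 (fun u => osc d.+1 (a t) q' (fun i => p t i - u i)).
  apply: (@mfr_rint R d.+1 d.+1 (fun u xi => a t xi * cos (2 * pi * dot d.+1 xi (fun i => p t i - u i) + q'))).
  apply: measurable_funM; first exact: (measurableT_comp (mat t) measurable_snd).
  apply: measurable_cosf; apply: measurable_funD => //; apply: measurable_funM => //.
  under eq_fun do rewrite dotB.
  apply: measurable_funB; first exact: (measurableT_comp (@mfr_dot R d.+1 (p t)) measurable_snd).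
  by under eq_fun do rewrite dotC; exact: measurable_dot.
have dS t G : dom d.+1 G -> dom d.+1 (fun u => G u * osc d.+1 (a t) psi (fun i => p t i - u i)).
  by move=> dG; exact: dom_bmul dG (mosc t psi) (fun c => oscA t psi _).
have SE t : Sop d.+1 (a t) psi F (p t) = Sop d.+1 (a t) psi Fs (p t) + Sop d.+1 (a t) psi Fl (p t).
  rewrite /Sop -rintD; [|exact: dS..].
  by congr rint; apply/funext => u; rewrite FE mulrDl.
have powg e : g `^ e = (W * s) `^ (e / 4) by rewrite /g -powRrM [4^-1 * e]mulrC.
have lepow e e' : e <= e' -> (W * s) `^ e <= (W * s) `^ e' by move=> ee; exact: ler_powR.
have bl t : `|Sop d.+1 (a t) psi Fl (p t)| <= Y.
  rewrite (le_trans (rint_abs (dS t _ dFl)))//.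
  apply: (@le_trans _ _ (rint d.+1 (fun u => (A * D) * `|Fl u|))).
    apply: le_rint; [exact/dom_abs/dS|exact/domZ/dom_abs|move=> c].
    by rewrite normrM mulrC ler_wpM2r.
  rewrite rintZ; last exact: dom_abs.
  rewrite /Y -!mulrA ler_wpM2l ?(ltW A0)//; apply: le_trans (ler_wpM2l (ltW D0) Fl1) _.
  rewrite (le_trans (Dlam _))// subrK powRr1 ?(ltW l0)// ler_wpM2l ?(ltW l0)// powg.
  by apply: lepow; lra.
pose th c := dot d.+1 c (every n).
have mth : mfr d.+1 th by exact: mfr_dot.
pose box : (nat -> R) -> R := \1_[set c | nrm d.+1 c <= W].
(* The symbol vanishes outside the box, so inserting the indicator changes nothing, and [H] acquires
   the bounded support that [schur_average] asks for. *)
pose H q' xi := box xi * osc d.+1 Fs q' xi.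
have dH q' : dom d.+1 (H q') by apply: dom_osc => //; exact: dom_box.
have boxE c : box c = (nrm d.+1 c <= W)%R%:R by rewrite /box indicE in_setb.
have HW q' : supp d.+1 W (H q').
  by move=> c cW; rewrite /H boxE leNgt cW mul0r.
pose be q' xi := 2 * pi * dot d.+1 xi p0 + q'.
have mbe q' : mfr d.+1 (be q') by exact: mfr_phase.
pose Z q1 q2 t := rint d.+1 (fun xi => a t xi * cos (2 * pi * (t * th xi) + be q1 xi) * H q2 xi).
pose I := `[t0, t0 + s]%classic : set TR.
have msI : measurable I by exact: measurable_itv.
have mZ q1 q2 : measurable_fun setT (fun t : TR => (\1_I t * Z q1 q2 t)%R).
  apply: measurable_funM; first exact: measurable_indic.
  apply: (@measurable_Rintegral R _ _ TR (E d.+1) (mu d.+1)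
   (fun z : TR * E d.+1 => a z.1 (co z.2) * cos (2 * pi * (z.1 * th (co z.2)) + be q1 (co z.2)) * H q2 (co z.2))).
  apply: measurable_funM; last exact: (measurableT_comp (dom_mfr (dH q2)) measurable_snd).
  apply: measurable_funM => //; apply: measurable_cosf; apply: measurable_funD.
    apply: measurable_funM => //; apply: measurable_funM; first exact: measurable_fst.
    exact: (measurableT_comp mth measurable_snd).
  exact: (measurableT_comp (mbe q1) measurable_snd).
have ZE t : Sop d.+1 (a t) psi Fs (p t) = Z psi 0 t + Z (psi - pi / 2) (- (pi / 2)) t.
  rewrite Sop_fub// /Z; congr (_ + _); congr rint; apply/funext => xi;
    rewrite /H boxE /p dot_moved /be /th; (have [xW|xW] := leP (nrm d.+1 xi) W;
    last by rewrite (aW t xi)// !mul0r); rewrite mul1r mulrA; congr (_ * cos _ * _); ring.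
pose KK := 2 * C1 * C0 * s * Y ^+ 2.
have bZ q1 q2 : (\int[leb]_t (2 * (\1_I t * Z q1 q2 t) ^+ 2)%:E <= KK%:E)%E.
  have mZ2 : measurable_fun setT (fun t : TR => ((\1_I t * Z q1 q2 t) ^+ 2)%:E).
    by apply/measurable_EFinP; exact: measurable_funX.
  rewrite (eq_integral (fun t : TR => (2%:E * ((\1_I t * Z q1 q2 t) ^+ 2)%:E)%E)); last by move=> t _; rewrite EFinM.
  rewrite ge0_integralZl_EFin//; last by move=> t _; rewrite lee_fin sqr_ge0.
  have h1 := HS a a' th (be q1) A W s t0 (H q2) (ltW A0) W0 s0 ma aW aA aa' ca' a'A mth (mbe q1) (every_ccons d n) (dH q2) (HW q2).
  have h2 : (eint d.+1 (fun xi => (H q2 xi ^+ 2)%:E) <= (C0 * (k `^ (2 - r) * Rp))%:E)%E.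
    have -> : (fun xi => (H q2 xi ^+ 2)%:E) = (fun xi => (box xi * osc d.+1 Fs q2 xi ^+ 2)%:E).
      by apply/funext => xi; rewrite /H boxE; case: (_ <= _); rewrite ?mul1r// !mul0r expr0n.
    apply: le_trans (HB W Fs q2 W0 dFs) _; rewrite EFinM.
    by apply: lee_wpmul2l => //; rewrite lee_fin ltW.
  have N0 : 0 <= C1 * A ^+ 2 * s * D / Num.sqrt (W * s).
    by apply: divr_ge0 (sqrtr_ge0 _); apply: mulr_ge0 (mulr_ge0 (mulr_ge0 (ltW C10) (sqr_ge0 _)) (ltW s0)) (ltW D0).
  have h3 := le_trans h1 (lee_wpmul2l (_ : 0%:E <= (C1 * A ^+ 2 * s * D / Num.sqrt (W * s))%:E)%E h2).
  rewrite -EFinM in h3.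
  apply: le_trans (lee_wpmul2l _ (h3 _)) _; rewrite ?lee_fin//.
  have sq0 : 0 < Num.sqrt (W * s) by rewrite sqrtr_gt0.
  have := Dlam (2 - r); rewrite subrK powR_mulrn ?(ltW l0)// powg => hD.
  have B0 : 0 <= 2 * C1 * C0 * A ^+ 2 * s / Num.sqrt (W * s).
    by apply: divr_ge0 (ltW sq0); apply: mulr_ge0 (mulr_ge0 (mulr_ge0 (mulr_ge0 (ler0n _ 2) (ltW C10)) (ltW C00)) (sqr_ge0 _)) (ltW s0).
  have -> : 2 * (C1 * A ^+ 2 * s * D / Num.sqrt (W * s) * (C0 * (k `^ (2 - r) * Rp))) =
     2 * C1 * C0 * A ^+ 2 * s / Num.sqrt (W * s) * (D * (k `^ (2 - r) * Rp)) by ring.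
  apply: le_trans (ler_wpM2l B0 hD) _.
  (* The exponent on the left is (2 - r)/4 - 1/2 = - r/4, below the - (r - 1)/4 of the right
     side. *)
  have pw : (W * s) `^ ((2 - r) / 4) / Num.sqrt (W * s) <= (W * s) `^ (- ((r - 1) / 8)) ^+ 2.
    rewrite -powR12_sqrt ?(ltW Ws0)// -powRN -powR_split// -powR_mulrn ?powR_ge0// -powRrM.
    apply: lepow; lra.
  rewrite /KK /Y !exprMn.
  have B1 : 0 <= 2 * C1 * C0 * A ^+ 2 * s * lam ^+ 2.
    by apply: mulr_ge0 (mulr_ge0 (mulr_ge0 (mulr_ge0 (mulr_ge0 (ler0n _ 2) (ltW C10)) (ltW C00)) (sqr_ge0 _)) (ltW s0)) (sqr_ge0 _).
  have := ler_wpM2l B1 pw; set u := _ `^ _; set v := _ ^+ 2; set w := Num.sqrt _.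
  have -> : 2 * C1 * C0 * A ^+ 2 * s * lam ^+ 2 * (u / w) = 2 * C1 * C0 * A ^+ 2 * s / w * (lam ^+ 2 * u) by ring.
  by move=> h; apply: le_trans h _; rewrite le_eqVlt; apply/orP; left; apply/eqP; ring.
have ptw t : \1_I t * `|Sop d.+1 (a t) psi F (p t)| `^ q <=
   Y `^ q * (2 * \1_I t + Y ^- 2 * (2 * (\1_I t * Z psi 0 t) ^+ 2 + 2 * (\1_I t * Z (psi - pi / 2) (- (pi / 2)) t) ^+ 2)).
  have /andP[q0 q1] := q01.
  rewrite indicE; case: (t \in I); last by rewrite !mul0r expr0n !mulr0 addr0 mulr0.
  rewrite !mul1r mulr1.
  apply: (@le_trans _ _ ((Y + `|Sop d.+1 (a t) psi Fs (p t)|) `^ q)).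
    apply: ge0_ler_powR; rewrite ?nnegrE ?(ltW q0)//; first by rewrite addr_ge0// ltW.
    by rewrite SE (le_trans (ler_normD _ _))// addrC lerD2r.
  apply: le_trans (powR_small_bound q01 Y0 (normr_ge0 _)) _.
  rewrite ler_wpM2l ?powR_ge0// lerD2l expr_div_n mulrC ler_wpM2l ?invr_ge0 ?sqr_ge0//.
  by rewrite real_normK ?num_real// ZE; exact: sqrD_le.
have mI : measurable_fun setT (\1_I : TR -> R) by exact: measurable_indic.
have mG q1 q2 : measurable_fun setT (fun t : TR => (2 * (\1_I t * Z q1 q2 t) ^+ 2)%:E).
  by apply/measurable_EFinP; apply: measurable_funM => //; exact: measurable_funX.
have G0 q1 q2 t : (0 <= (2 * (\1_I t * Z q1 q2 t) ^+ 2)%:E)%E by rewrite lee_fin mulr_ge0// sqr_ge0.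
have I0 t : 0 <= \1_I t :> R by rewrite indicE.
apply: (@le_trans _ _ (\int[leb]_t ((Y `^ q)%:E * ((2 * \1_I t)%:E + (Y ^- 2)%:E *
   ((2 * (\1_I t * Z psi 0 t) ^+ 2)%:E + (2 * (\1_I t * Z (psi - pi / 2)%R (- (pi / 2))%R t) ^+ 2)%:E)))%E)%E).
  apply: le_integral_nomeas => t; first by rewrite lee_fin mulr_ge0// powR_ge0.
  by have := ptw t; rewrite -lee_fin.
have Y2 : 0 <= Y ^- 2 by rewrite invr_ge0 sqr_ge0.
have m2 : measurable_fun setT (fun t : TR => ((Y ^- 2)%:E * ((2 * (\1_I t * Z psi 0 t) ^+ 2)%:E + (2 * (\1_I t * Z (psi - pi / 2) (- (pi / 2)) t) ^+ 2)%:E))%E).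
  by apply: emeasurable_funM => //; apply: emeasurable_funD; exact: mG.
have m1 : measurable_fun setT (fun t : TR => (2 * \1_I t : R)%:E).
  by apply/measurable_EFinP; apply: measurable_funM.
have hI : (\int[leb]_t (2 * \1_I t : R)%:E = (2%:E * s%:E))%E.
  under eq_integral do rewrite EFinM.
  rewrite ge0_integralZl_EFin//; last exact/measurable_EFinP.
  by rewrite integral_itv_indic ?lerDl ?(ltW s0)// addrAC subrr add0r.
have h1 t : (0 <= (2 * \1_I t : R)%:E)%E by rewrite lee_fin mulr_ge0.
have h2 t : (0 <= (Y ^- 2)%:E * ((2 * (\1_I t * Z psi 0 t) ^+ 2)%:E + (2 * (\1_I t * Z (psi - pi / 2) (- (pi / 2)) t) ^+ 2)%:E))%E.
  by apply: mule_ge0; [rewrite lee_fin|exact: adde_ge0 (G0 _ _ _) (G0 _ _ _)].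
rewrite ge0_integralZl_EFin ?powR_ge0//; last 2 first.
- by move=> t _; exact: adde_ge0 (h1 t) (h2 t).
- by apply: emeasurable_funD.
rewrite ge0_integralD//.
rewrite ge0_integralZl_EFin//; last 2 first.
- by move=> t _; exact: adde_ge0 (G0 _ _ _) (G0 _ _ _).
- by apply: emeasurable_funD; exact: mG.
rewrite ge0_integralD//.
rewrite hI.
apply: (@le_trans _ _ ((Y `^ q)%:E * (2%:E * s%:E + (Y ^- 2)%:E * (KK%:E + KK%:E)))%E).
  apply: lee_wpmul2l; first by rewrite lee_fin powR_ge0.
  apply: leeD; first by [].
  by apply: lee_wpmul2l; [rewrite lee_fin|exact: leeD (bZ _ _) (bZ _ _)].
have fin : Y `^ q * (2 * s + Y ^- 2 * (KK + KK)) <= (2 + 4 * C1 * C0) * s * Y `^ q.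
  rewrite le_eqVlt; apply/orP; left; apply/eqP.
  rewrite /KK; have Yn : Y != 0 by rewrite gt_eqF.
  by move: Yn; set y := Y; set z := y `^ q => Yn; field.
by have := fin; rewrite -lee_fin.
Qed.

End Average.

(** * Spatial weights *)

Section Weights.
Variable R : realType.
Local Notation leb := (@lebesgue_measure R : {sigma_finite_measure set (measurableTypeR R) -> \bar R}).
Local Notation mu := (@mu R).
Local Notation E := (E R).
Local Notation TR := (measurableTypeR R).
Implicit Types (c v p z u : nat -> R) (F : (nat -> R) -> R).

Lemma measurable_osc d dO (O : measurableType dO) (A : O -> (nat -> R) -> R) (v : O -> nat -> R) psi :
  measurable_fun setT (fun w : O * E d => A w.1 (co w.2)) ->
  (forall i, measurable_fun setT (fun w => v w i)) ->
  measurable_fun setT (fun w => osc d (A w) psi (v w)).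
Proof.
move=> mA mv; apply: (@measurable_Rintegral R _ _ O (E d) (mu d)
  (fun w : O * E d => A w.1 (co w.2) * cos (2 * pi * dot d (co w.2) (v w.1) + psi))).
apply: measurable_funM => //; apply: measurable_cosf; apply: measurable_funD => //.
apply: measurable_funM => //; apply: measurable_sum => i; apply: measurable_funM.
  exact: (measurableT_comp (@measurable_co R d i) measurable_snd).
exact: (measurableT_comp (mv i) measurable_fst).
Qed.

Lemma measurable_Sop d dO (O : measurableType dO) (A : O -> (nat -> R) -> R) (p : O -> nat -> R) psi F :
  measurable_fun setT (fun w : O * E d => A w.1 (co w.2)) ->
  (forall i, measurable_fun setT (fun w => p w i)) -> mfr d F ->
  measurable_fun setT (fun w => Sop d (A w) psi F (p w)).
Proof.
move=> mA mp mF; apply: (@measurable_Rintegral R _ _ O (E d) (mu d)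
  (fun w : O * E d => F (co w.2) * osc d (A w.1) psi (fun i => p w.1 i - co w.2 i))).
apply: measurable_funM; first exact: (measurableT_comp mF measurable_snd).
apply: (@measurable_osc d _ (O * E d)%type (fun w => A w.1) (fun w i => p w.1 i - co w.2 i)).
  have h : measurable_fun setT (fun w : O * E d * E d => (w.1.1, w.2)).
    apply: measurable_fun_pair; last exact: measurable_snd.
    exact: measurableT_comp measurable_fst measurable_fst.
  exact: (measurableT_comp mA h).
move=> i; apply: measurable_funB; first exact: (measurableT_comp (mp i) measurable_fst).
exact: (measurableT_comp (@measurable_co R d i) measurable_snd).
Qed.

Lemma mfr_oscB d a psi p : mfr d a -> mfr d (fun u => osc d a psi (fun i => p i - u i)).
Proof.
move=> ma; apply: (@measurable_osc d _ (E d) (fun=> a) (fun w i => p i - co w i)).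
  exact: (measurableT_comp ma measurable_snd).
by move=> i; apply: measurable_funB => //; exact: measurable_co.
Qed.

Lemma dom_Sop d a psi F p : dom d a -> dom d F ->
  dom d (fun u => F u * osc d a psi (fun i => p i - u i)).
Proof.
move=> da dF; apply: dom_bmul dF (mfr_oscB _ _ (dom_mfr da)) _ => c; exact: osc_le.
Qed.

Lemma dom0 d : dom d (fun=> 0 : R).
Proof.
split; first exact: measurable_cst.
by exists 1 => c; rewrite normr0 mul1r ltW// wt_gt0.
Qed.

Lemma rint_sum d (I : Type) (s : seq I) (f : I -> (nat -> R) -> R) : (forall i, dom d (f i)) ->
  dom d (fun c => \sum_(i <- s) f i c) /\
  rint d (fun c => \sum_(i <- s) f i c) = \sum_(i <- s) rint d (f i).
Proof.
move=> df; elim: s => [|i s [ds IH]].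
  under eq_fun do rewrite big_nil.
  by rewrite big_nil; split; [exact: dom0|rewrite /rint Rintegral_cst// mul0r].
under eq_fun do rewrite big_cons.
by rewrite big_cons -IH; split; [exact: domD|exact: rintD].
Qed.

(** [S e i] is the i-th pure derivative in direction [e] of one and the same symbol [S 0 0]. *)
Definition jet d M (S : nat -> nat -> (nat -> R) -> R) :=
  forall e, (e < d)%N -> S e 0%N = S 0%N 0%N /\ chain d e M (S e).

(** For even [M] this dominates (1 + |u - z| / k)^M up to a constant, yet it is a polynomial, so
    that multiplying a kernel by it amounts to differentiating the symbol. *)
Definition weight d M z (k : R) u : R := 1 + \sum_(e < d) ((u e - z e) / k) ^+ M.


Lemma weight_ge1 d M z k u : ~~ odd M -> 1 <= weight d M z k u.
Proof. by move=> oM; rewrite lerDl sumr_ge0// => e _; rewrite exprn_even_ge0. Qed.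

Lemma mfr_invge1 d g : mfr d g -> (forall u, 1 <= g u) -> mfr d (fun u => (g u)^-1).
Proof.
move=> mg g1; have cf : continuous (fun x : R => (1 + `|x|)^-1).
  move=> x; apply: (cvgV (f := fun y : R => 1 + `|y|)); first by rewrite gt_eqF// ltr_pwDl.
  by apply: cvgD; [exact: cvg_cst|exact: norm_continuous].
have : mfr d (fun u => (1 + `|g u - 1|)^-1).
  by apply: (mfr_cont cf (g := fun u => g u - 1)); apply: measurable_funB.
congr mfr; apply/funext => u; rewrite ger0_norm ?subr_ge0//; congr (_^-1); ring.
Qed.

Lemma mfr_weight d M z k : ~~ odd M -> mfr d (fun u => (weight d M z k u)^-1).
Proof.
move=> oM; apply: mfr_invge1; last by move=> u; exact: weight_ge1.
apply: measurable_funD => //; apply: measurable_sum => e; apply: measurable_funX.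
by apply: measurable_funM => //; apply: measurable_funB => //; exact: measurable_co.
Qed.

Lemma dom_weight d M z k F : ~~ odd M -> dom d F -> dom d (fun u => F u * (weight d M z k u)^-1).
Proof.
move=> oM dF; apply: (@dom_bmul R d F _ 1 dF (@mfr_weight d M z k oM)) => c.
rewrite ger0_norm ?invr_ge0 ?invf_le1//; first exact: weight_ge1.
  exact: lt_le_trans ltr01 (@weight_ge1 d M z k c oM).
exact: le_trans ler01 (@weight_ge1 d M z k c oM).
Qed.

(** Binomial coefficient of ((u_e - z_e) / k)^M expanded about p_e, where each factor u_e - p_e has
    been traded for a derivative of the symbol, with its constant -1 / (2 pi). *)
Definition wcoef M z k p e i : R :=
  'C(M, i)%:R * ((p e - z e) / k) ^+ (M - i) * (- (2 * pi * k)^-1) ^+ i.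

(* Multiplying the kernel by [u_e - p_e] differentiates the symbol. *)
Lemma Sop_weight d M S psi F z (k : R) p : (0 < d)%N -> jet d M S -> dom d F -> 0 < k -> ~~ odd M ->
  let Ft u := F u * (weight d M z k u)^-1 in
  Sop d (S 0%N 0%N) psi F p = Sop d (S 0%N 0%N) psi Ft p +
    \sum_(e < d) \sum_(i < M.+1) wcoef M z k p e i * Sop d (S e i) (psi + i%:R * (pi / 2)) Ft p.
Proof.
move=> d0 jS dF k0 oM Ft; have dFt : dom d Ft by exact: dom_weight.
have dS e i : (e < d)%N -> (i < M.+1)%N -> dom d (S e i).
  by move=> ed iM; have [_ [dc _ _]] := jS e ed; exact: dc.
have dS0 : dom d (S 0%N 0%N) by exact: dS.
pose g (e : 'I_d) (i : 'I_M.+1) u := wcoef M z k p e i *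
  (Ft u * osc d (S e i) (psi + i%:R * (pi / 2)) (fun j => p j - u j)).
have dg e i : dom d (g e i) by apply: domZ; apply: dom_Sop => //; exact: dS.
have H e := rint_sum (index_enum 'I_M.+1) (dg e).
have [H1 H2] := rint_sum (index_enum 'I_d) (fun e => (H e).1).
have -> : \sum_(e < d) \sum_(i < M.+1) wcoef M z k p e i * Sop d (S e i) (psi + i%:R * (pi / 2)) Ft p =
   rint d (fun u => \sum_(e < d) \sum_(i < M.+1) g e i u).
  rewrite H2; apply: eq_bigr => e _; rewrite (H e).2; apply: eq_bigr => i _.
  by rewrite rintZ//; apply: dom_Sop => //; exact: dS.
rewrite /Sop -rintD//; last exact: dom_Sop.
congr rint; apply/funext => u.
set o := osc d (S 0%N 0%N) psi (fun j => p j - u j).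
have w1 := weight_ge1 d z k u oM.
have -> : F u = Ft u * weight d M z k u by rewrite divfK// gt_eqF// (lt_le_trans ltr01).
rewrite /weight mulrDr mulr1 mulrDl; congr (_ + _).
rewrite mulrAC mulr_sumr; apply: eq_bigr => e _.
have -> : (u e - z e) / k = (p e - z e) / k + - (2 * pi * k)^-1 * (2 * pi * (p e - u e)).
  have p0 : pi != 0 :> R by rewrite gt_eqF ?pi_gt0.
  have kn : k != 0 by rewrite gt_eqF.
  have alg (P a b c : R) : P != 0 -> (a - c) / k = (b - c) / k + - (2 * P * k)^-1 * (2 * P * (b - a)).
    by move=> Pn; field; rewrite Pn kn.
  exact: alg.
rewrite exprDn mulr_sumr; apply: eq_bigr => i _.
have [e0 cS] := jS e (ltn_ord e).
have := osc_chain psi (fun j => p j - u j) (ltn_ord e) cS (ltn_ord i : (i <= M)%N).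
rewrite e0 -/o /g => <-; rewrite /wcoef [(- _ * _) ^+ i]exprMn -mulr_natl.
set x := (_ / k) ^+ _; set y := _ ^+ i; set w := (2 * _ * _) ^+ i; ring.
Qed.

Lemma wcoef_le d M z k p e i : 0 < k -> (e < d)%N -> (forall e, (e < d)%N -> `|p e - z e| <= k) -> (i <= M)%N ->
  `|wcoef M z k p e i| <= 2 ^+ M * k^-1 ^+ i.
Proof.
move=> k0 ed pz iM; rewrite !normrM !normrX normrN.
have kV : 0 <= k^-1 by rewrite invr_ge0 ltW.
apply: ler_pM; rewrite ?mulr_ge0 ?exprn_ge0//.
  apply: (@le_trans _ _ ('C(M, i)%:R * 1)).
    rewrite normr_nat ler_wpM2l// exprn_ile1// normrM (ger0_norm kV).
    by rewrite ler_pdivrMr// mul1r pz.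
  rewrite mulr1 -natrX ler_nat.
  have := expnDn 1 1 M; rewrite (bigD1 (inord i))//=.
  by rewrite inordK// !exp1n !muln1 -[2%N]/(1 + 1)%N => ->; rewrite leq_addr.
rewrite lerXn2r ?nnegrE// ger0_norm ?invr_ge0 ?mulr_ge0 ?pi_ge0 ?(ltW k0)//.
rewrite lef_pV2 ?posrE ?mulr_gt0 ?pi_gt0// ler_peMl ?(ltW k0)//.
have := @pi_ge1 R; nra.
Qed.

(** For w <= x + y the ratio w / (x + y) is at most its own q-th power; the two ratios add up to
    1. *)
Lemma powRD_le (x y q : R) : 0 < q <= 1 -> 0 <= x -> 0 <= y -> (x + y) `^ q <= x `^ q + y `^ q.
Proof.
move=> /andP[q0 q1] x0 y0; have [xy|xy] := eqVneq (x + y) 0.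
  by rewrite xy powR0 ?gt_eqF// addr_ge0// powR_ge0.
have s0 : 0 < x + y by rewrite lt_neqAle eq_sym xy addr_ge0.
have H w : 0 <= w -> w <= x + y -> w / (x + y) * (x + y) `^ q <= w `^ q.
  move=> w0 ws; have {2}-> : w = w / (x + y) * (x + y) by rewrite divfK.
  rewrite powRM ?divr_ge0// ?(ltW s0)// ler_wpM2r ?powR_ge0//.
  have [->|wn] := eqVneq w 0; first by rewrite mul0r powR_ge0.
  have w1 : 0 < w / (x + y) <= 1.
    have wp : 0 < w by rewrite lt_neqAle eq_sym wn.
    by rewrite divr_gt0//= ler_pdivrMr// mul1r.
  by rewrite -[leLHS]powRr1 ?(ltW (andP w1).1)// ger_powR.
have := lerD (H x x0 _) (H y y0 _); rewrite -mulrDl -mulrDl divff// mul1r.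
by apply; rewrite ?lerDl ?lerDr.
Qed.

Lemma powR_sum_le (I : Type) (s : seq I) (f : I -> R) (q : R) : 0 < q <= 1 -> (forall i, 0 <= f i) ->
  (\sum_(i <- s) f i) `^ q <= \sum_(i <- s) f i `^ q.
Proof.
move=> q01 f0; elim: s => [|i s IH]; first by rewrite !big_nil powR0// gt_eqF//; case/andP: q01.
rewrite !big_cons (le_trans (powRD_le q01 _ _))// ?sumr_ge0// lerD2l//.
Qed.

(** The cost [k] of a frequency derivative is also the spatial scale of [weight]: in [wcoef] the
    factor k^-i cancels the k^i of this bound. *)
Definition jbound d M (A k : R) (S : nat -> nat -> (nat -> R) -> R) :=
  forall e i c, (e < d)%N -> (i <= M)%N -> `|S e i c| <= A * k ^+ i.
Definition jsupp d M W (S : nat -> nat -> (nat -> R) -> R) :=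
  forall e i, (e < d)%N -> (i <= M)%N -> supp d W (S e i).

(** [Sop_weight] rewrites the value as finitely many operators applied to F / weight, to each of
    which the unweighted bound applies; thus only the L^r norm of F near z, with tails, is used. *)
Lemma Sop_wpointwise d M : (0 < d)%N -> ~~ odd M -> exists C : R, 0 < C /\
  forall (r : R) S A k W F Rp lam psi p z, 1 < r <= 2 -> jet d M S -> 0 <= A -> 0 < k -> 0 < W ->
    jbound d M A k S -> jsupp d M W S -> dom d F -> 0 <= Rp -> 0 < lam ->
    (forall e, (e < d)%N -> `|p e - z e| <= k) ->
    (eint d (fun u => (`|F u * (weight d M z k u)^-1| `^ r)%:E) <= Rp%:E)%E ->
    (2 * W) ^+ d * Rp <= lam `^ r ->
    `|Sop d (S 0%N 0%N) psi F p| <= C * A * lam.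
Proof.
move=> d0 oM; have [C [C0 HC]] := @Sop_pointwise R d d0.
exists (C * (1 + d%:R * (M.+1%:R * 2 ^+ M))); split.
  by rewrite mulr_gt0// ltr_pwDl// mulr_ge0.
move=> r S A k W F Rp lam psi p z r12 jS A0 k0 W0 SA SW dF Rp0 l0 pz FR lamR.
have dFt := dom_weight z k oM dF.
rewrite (Sop_weight psi z p d0 jS dF k0 oM)/=; set Ft := fun u => _.
have b e i q : (e < d)%N -> (i <= M)%N -> `|Sop d (S e i) q Ft p| <= C * (A * k ^+ i) * lam.
  move=> ed iM; have [_ [dc _ _]] := jS e ed.
  apply: (HC r _ _ W _ Rp) => //; [exact: dc|by rewrite mulr_ge0// exprn_ge0// ltW|..].
    by move=> c; exact: SA.
  exact: SW.
have -> : C * (1 + d%:R * (M.+1%:R * 2 ^+ M)) * A * lam = C * A * lam + C * A * lam * d%:R * M.+1%:R * 2 ^+ M by ring.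
rewrite (le_trans (ler_normD _ _))// lerD//.
  by have := b 0%N 0%N psi d0 isT; rewrite expr0 mulr1.
rewrite (le_trans (ler_norm_sum _ _ _))//.
apply: (@le_trans _ _ (\sum_(e < d) \sum_(i < M.+1) C * A * lam * 2 ^+ M)); last first.
  have sc (x : R) : \sum_(e < d) \sum_(i < M.+1) x = x * M.+1%:R * d%:R.
    by rewrite !sumr_const !card_ord !mulr_natr.
  by rewrite sc; set y := 2 ^+ M; set x := C * A * lam; rewrite le_eqVlt; apply/orP; left; apply/eqP; ring.
apply: ler_sum => e _; rewrite (le_trans (ler_norm_sum _ _ _))//; apply: ler_sum => i _.
rewrite normrM; apply: (le_trans (ler_pM _ _ (wcoef_le k0 (ltn_ord e) pz (ltn_ord i : (i <= M)%N))
  (b e i (psi + i%:R * (pi / 2)) (ltn_ord e) (ltn_ord i : (i <= M)%N)))) => //.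
rewrite exprVn le_eqVlt; apply/orP; left; apply/eqP; field.
by rewrite expf_neq0// gt_eqF.
Qed.

Lemma indic_sum_le (I J : finType) (b : bool) (x y : R) (c w : I -> J -> R) :
  (b -> x <= y + \sum_i \sum_j c i j * w i j) ->
  b%:R * x <= b%:R * y + \sum_i \sum_j c i j * (b%:R * w i j).
Proof.
case: b => [/(_ isT)|_]; rewrite ?mul1r ?mul0r ?add0r.
  by move=> /le_trans; apply; rewrite lerD2l; under [leRHS]eq_bigr do under eq_bigr do rewrite mul1r.
by under eq_bigr do under eq_bigr do rewrite mul0r mulr0; rewrite sumr_ge0// => i _; rewrite sumr_ge0.
Qed.

(** The averaged analogue: since q <= 1, the q-th power of the sum produced by [Sop_weight] is at
    most the sum of q-th powers, and each term is averaged separately. *)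
Lemma Sop_waverage d n M : (0 < n)%N -> ~~ odd M -> exists C : R, 0 < C /\
  forall (r q : R) (S S' : R -> nat -> nat -> (nat -> R) -> R) A k W F Rp lam psi p0 z s t0,
    1 < r <= 2 -> 0 < q <= 1 -> 0 < A -> 0 < k -> 0 < W -> 0 < s -> 1 <= W * s ->
    (forall e i, (e < d.+1)%N -> (i <= M)%N ->
       measurable_fun setT (fun w : TR * E d.+1 => S w.1 e i (co w.2))) ->
    (forall t, jet d.+1 M (S t)) -> (forall t, jbound d.+1 M A k (S t)) ->
    (forall t, jsupp d.+1 M W (S t)) ->
    (forall e i c t, (e < d.+1)%N -> (i <= M)%N -> ider (fun t => S t e i c) t (S' t e i c)) ->
    (forall e i c, (e < d.+1)%N -> (i <= M)%N -> continuous (fun t => S' t e i c)) ->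
    (forall t, jbound d.+1 M (A / s) k (S' t)) ->
    dom d.+1 F -> 0 <= Rp -> 0 < lam ->
    (forall t e, t0 <= t <= t0 + s -> (e < d.+1)%N -> `|moved n p0 t e - z e| <= k) ->
    (eint d.+1 (fun u => (`|F u * (weight d.+1 M z k u)^-1| `^ r)%:E) <= Rp%:E)%E ->
    (2 * W) ^+ d.+1 * Rp <= lam `^ r ->
    (\int[leb]_t (\1_(`[t0, t0 + s]) t * `|Sop d.+1 (S t 0%N 0%N) psi F (moved n p0 t)| `^ q)%:E
     <= (C * s * (A * lam * (W * s) `^ (- ((r - 1) / 8))) `^ q)%:E)%E.
Proof.
move=> n0 oM; have [C [C0 HC]] := @Sop_average R d n n0.
pose K : R := 1 + 2 ^+ M * M.+1%:R * d.+1%:R.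
exists (C * K); split; first by rewrite mulr_gt0// ltr_pwDl// !mulr_ge0// exprn_ge0.
move=> r q S S' A k W F Rp lam psi p0 z s t0 r12 q01 A0 k0 W0 s0 Ws mS jS SA SW SS' cS' S'A dF Rp0 l0 pz FR lamR.
have dFt := dom_weight z k oM dF.
pose Ft u := F u * (weight d.+1 M z k u)^-1.
pose I := `[t0, t0 + s]%classic : set TR.
pose Y := A * lam * (W * s) `^ (- ((r - 1) / 8)).
have Y0 : 0 <= Y by rewrite !mulr_ge0 ?powR_ge0 ?(ltW A0) ?(ltW l0).
pose h e i ps t : R := \1_I t * `|Sop d.+1 (S t e i) ps Ft (moved n p0 t)| `^ q.
have ki i : 0 < k ^+ i by rewrite exprn_gt0.
have B e i ps : (e < d.+1)%N -> (i <= M)%N -> (\int[leb]_t (h e i ps t)%:E <= (C * s * (k ^+ i * Y) `^ q)%:E)%E.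
  move=> ed iM; have := HC r q (fun t => S t e i) (fun t => S' t e i) (A * k ^+ i) W Ft Rp lam ps p0 s t0.
  rewrite (_ : A * k ^+ i * lam * _ = k ^+ i * Y); last by rewrite /Y; ring.
  apply=> //.
  - by rewrite mulr_gt0.
  - exact: mS.
  - by move=> t; exact: SW.
  - by move=> t c; exact: SA.
  - by move=> c t; exact: SS'.
  - by move=> c; exact: cS'.
  - by move=> t c; rewrite mulrAC; exact: S'A.
have mh e i ps : (e < d.+1)%N -> (i <= M)%N -> measurable_fun setT (h e i ps : TR -> R).
  move=> ed iM; apply: measurable_funM; first by apply: measurable_indic; exact: measurable_itv.
  apply: (measurableT_comp (measurable_powR q)); apply: measurableT_comp => //.
  apply: (@measurable_Sop d.+1 _ TR (fun t => S t e i)); [exact: mS| |exact: dom_mfr dFt].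
  by move=> j; apply: measurable_funD => //; apply: measurable_funM.
have h0 e i ps t : 0 <= h e i ps t by rewrite mulr_ge0 ?powR_ge0// indicE.
have [q0 q1] := andP q01.
pose g (e : 'I_d.+1) (i : 'I_M.+1) t : \bar R := (((2 ^+ M * k^-1 ^+ i) `^ q)%:E * (h e i (psi + i%:R * (pi / 2)) t)%:E)%E.
have g0 e i t : (0 <= g e i t)%E by rewrite mule_ge0// lee_fin ?powR_ge0.
have mg e i : measurable_fun setT (g e i : TR -> \bar R).
  apply: emeasurable_funM => //; apply/measurable_EFinP; apply: mh => //; exact: (ltn_ord i : (i <= M)%N).
apply: (@le_trans _ _ (\int[leb]_t ((h 0%N 0%N psi t)%:E + \sum_(e < d.+1) \sum_(i < M.+1) g e i t)%E)%E).
  apply: le_integral_nomeas => t; first by rewrite lee_fin mulr_ge0 ?powR_ge0// indicE.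
  rewrite /g; under eq_bigr do under eq_bigr do rewrite -EFinM; under eq_bigr do rewrite sumEFin.
  rewrite sumEFin -EFinD lee_fin /h indicE; apply: indic_sum_le => tI.
  have tI' : t0 <= t <= t0 + s by move: tI; rewrite inE /I /= in_itv.
  rewrite (Sop_weight psi z (moved n p0 t) (ltn0Sn d) (jS t) dF k0 oM)/= -/Ft.
  apply: le_trans (le_trans (powRD_le q01 (normr_ge0 _) (normr_ge0 (\sum_(e < d.+1) \sum_(i < M.+1)
    wcoef M z k (moved n p0 t) e i * Sop d.+1 (S t e i) (psi + i%:R * (pi / 2)) Ft (moved n p0 t)))) _).
    apply: ge0_ler_powR; rewrite ?nnegrE ?(ltW q0)//; first by rewrite addr_ge0.
    exact: ler_normD.
  rewrite lerD2l.
  apply: (@le_trans _ _ (\sum_(e < d.+1) \sum_(i < M.+1)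
    `|wcoef M z k (moved n p0 t) e i * Sop d.+1 (S t e i) (psi + i%:R * (pi / 2)) Ft (moved n p0 t)| `^ q)).
    apply: le_trans (ge0_ler_powR (ltW q0) _ _ (ler_norm_sum _ _ _)) _; rewrite ?nnegrE ?sumr_ge0//.
    apply: le_trans (powR_sum_le _ q01 (fun=> normr_ge0 _)) _; apply: ler_sum => e _.
    apply: le_trans (ge0_ler_powR (ltW q0) _ _ (ler_norm_sum _ _ _)) _; rewrite ?nnegrE ?sumr_ge0//.
    exact: powR_sum_le.
  apply: ler_sum => e _; apply: ler_sum => i _; rewrite normrM powRM// ler_wpM2r ?powR_ge0//.
  apply: ge0_ler_powR; rewrite ?nnegrE ?(ltW q0)//.
    by rewrite mulr_ge0 ?exprn_ge0 ?invr_ge0 ?(ltW k0).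
  by apply: (@wcoef_le d.+1) => //; [move=> e' ed; exact: pz|exact: (ltn_ord i : (i <= M)%N)].
have ms (e : 'I_d.+1) : measurable_fun setT ((fun t => \sum_(i < M.+1) g e i t)%E : TR -> \bar R).
  by apply: emeasurable_sum => i; exact: mg.
have s0' (e : 'I_d.+1) t : (0 <= \sum_(i < M.+1) g e i t)%E by apply: sume_ge0.
rewrite ge0_integralD//; last 4 first.
- by move=> t _; rewrite lee_fin.
- by apply/measurable_EFinP; exact: mh.
- by move=> t _; rewrite sume_ge0.
- by apply: emeasurable_sum => e; exact: ms.
rewrite ge0_integral_sum//.
have Bg e i : (\int[leb]_t g e i t <= (C * s * Y `^ q * (2 ^+ M) `^ q)%:E)%E.
  rewrite ge0_integralZl_EFin ?powR_ge0//; last 2 first.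
  - by move=> t _; rewrite lee_fin.
  - by apply/measurable_EFinP; apply: mh => //; exact: (ltn_ord i : (i <= M)%N).
  apply: le_trans (lee_wpmul2l _ (B e i _ (ltn_ord e) (ltn_ord i : (i <= M)%N))) _; first by rewrite lee_fin powR_ge0.
  have kV : 0 <= k^-1 ^+ i by rewrite exprn_ge0// invr_ge0 ltW.
  have e1 : (2 ^+ M * k^-1 ^+ i) `^ q = (2 ^+ M) `^ q * (k^-1 ^+ i) `^ q by apply: powRM => //; exact: exprn_ge0.
  have e2 : (k ^+ i * Y) `^ q = (k ^+ i) `^ q * Y `^ q by apply: powRM => //; exact: ltW.
  rewrite -EFinM lee_fin e1 e2.
  have kk : (k^-1 ^+ i) `^ q * (k ^+ i) `^ q = 1.
    by rewrite -powRM ?(ltW (ki i))// exprVn mulVf ?powR1// gt_eqF.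
  rewrite le_eqVlt; apply/orP; left; apply/eqP; rewrite -[RHS]mulr1 -kk.
  by set x := (2 ^+ M) `^ q; set y := Y `^ q; set u := (k^-1 ^+ i) `^ q; set v := (k ^+ i) `^ q; ring.
have B0 := B 0%N 0%N psi isT isT; rewrite expr0 mul1r in B0.
apply: (@le_trans _ _ ((C * s * Y `^ q)%:E + \sum_(e < d.+1) \sum_(i < M.+1) (C * s * Y `^ q * (2 ^+ M) `^ q)%:E)%E).
  apply: leeD => //; apply: lee_sum => e _; rewrite ge0_integral_sum//.
  by apply: lee_sum => i _; exact: Bg.
have sc (x : R) : (\sum_(e < d.+1) \sum_(i < M.+1) x%:E = (x * M.+1%:R * d.+1%:R)%:E)%E.
  by under eq_bigr do rewrite sumEFin; rewrite sumEFin !sumr_const !card_ord !mulr_natr.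
rewrite sc -EFinD lee_fin.
have P2 : (2 ^+ M) `^ q <= 2 ^+ M.
  rewrite -[leRHS]powRr1 ?exprn_ge0//; apply: ler_powR => //; apply: exprn_ege1; lra.
rewrite -/Y /K; have CY : 0 <= C * s * Y `^ q by rewrite !mulr_ge0 ?powR_ge0 ?(ltW C0) ?(ltW s0).
rewrite (_ : C * _ * s * _ = C * s * Y `^ q + C * s * Y `^ q * 2 ^+ M * M.+1%:R * d.+1%:R).
  by rewrite lerD2l ler_wpM2r// ler_wpM2r// ler_wpM2l.
by set y := 2 ^+ M; set x := Y `^ q; ring.
Qed.

End Weights.

(** * Cubes below and above the critical scale *)

Section Segments.
Variable R : realType.
Local Notation leb := (@lebesgue_measure R : {sigma_finite_measure set (measurableTypeR R) -> \bar R}).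
Local Notation E := (E R).
Local Notation TR := (measurableTypeR R).
Implicit Types (c v p z u x y a : nat -> R) (F : (nat -> R) -> R).

(** The diagonal point (y, ..., y) of (R^n)^l, as a periodic sequence. *)
Definition rep n y : nat -> R := fun e => y (e %% n)%N.

Lemma rep_ccons n t z : (0 < n)%N -> rep n (ccons t z) = moved n (rep n (ccons 0 z)) t.
Proof.
move=> n0; apply/funext => e; rewrite /rep /moved /every.
by case: (e %% n)%N => [|m] /=; rewrite ?mulr1 ?mulr0 ?addr0 ?add0r.
Qed.

Definition cubei n a (s : R) y : R := \prod_(i < n) \1_(`[a i, a i + s]) (y i).

Lemma cubei_ccons n a s t z :
  cubei n.+1 a s (ccons t z) = \1_(`[a 0%N, a 0%N + s]) t * cubei n (fun i => a i.+1) s z.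
Proof. by rewrite /cubei big_ord_recl. Qed.

Lemma cubei_ge0 n a s y : 0 <= cubei n a s y.
Proof. by apply: prodr_ge0 => i _; rewrite indicE. Qed.

Lemma cubeiP n a s y : cubei n a s y = 0 \/
  (cubei n a s y = 1 /\ forall i, (i < n)%N -> a i <= y i <= a i + s).
Proof.
have [H|] := pselect (forall i, (i < n)%N -> a i <= y i <= a i + s).
  right; split=> //; rewrite /cubei big1// => i _; rewrite indicE mem_set//= in_itv/=.
  exact: H.
move=> /existsNP[i /not_implyP[ni /negP H]]; left.
by rewrite /cubei (bigD1 (Ordinal ni))//= indicE memNset ?mul0r//= in_itv/=; exact/negP.
Qed.

Lemma mfr_cubei n a s : mfr n (cubei n a s).
Proof.
apply: (@mfr_prod R n _ _ _ (fun (i : 'I_n) y => \1_(`[a i, a i + s]) (y i))) => i.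
apply: (measurableT_comp (f := \1_(`[a i, a i + s]) : TR -> R)); last exact: measurable_co.
by apply: measurable_indic; exact: measurable_itv.
Qed.

Lemma eint_cubei n a s : 0 <= s -> eint n (fun y => (cubei n a s y)%:E) = (s ^+ n)%:E.
Proof.
move=> s0; elim: n a => [|n IH] a; first by rewrite eint0 /cubei big_ord0 expr0.
rewrite eint_S; [|exact/mfe_EFin/mfr_cubei|by move=> c; rewrite lee_fin cubei_ge0].
rewrite (eq_integral (fun t : TR => ((\1_(`[a 0%N, a 0%N + s]) t)%:E * (s ^+ n)%:E)%E)); last first.
  move=> t _; rewrite -(IH (fun i => a i.+1)) /eint -ge0_integralZl_EFin//.
  - by apply: eq_integral => w _; rewrite cubei_ccons EFinM.
  - by move=> w _; rewrite lee_fin cubei_ge0.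
  - exact/mfe_EFin/mfr_cubei.
have mI : measurable_fun setT (fun t : TR => (\1_(`[a 0%N, a 0%N + s]) t : R)%:E).
  by apply/measurable_EFinP; apply: measurable_indic; exact: measurable_itv.
rewrite ge0_integralZr ?lee_fin ?exprn_ge0//.
rewrite integral_itv_indic ?lerDl// -EFinM exprS; congr (_%:E); ring.
Qed.

(** The third clause concerns only the first coordinate of x, the one along which averages are
    taken; a derivative there costs 1/k, as k is the scale on which the symbol varies in x. *)
Definition goodsym n d M (A W k : R) (Sy : (nat -> R) -> nat -> nat -> (nat -> R) -> R) :=
  [/\ (forall e i, (e < d)%N -> (i <= M)%N ->
        measurable_fun setT (fun w : E n.+1 * E d => Sy (co w.1) e i (co w.2))),
      (forall x, [/\ jet d M (Sy x), jbound d M A k (Sy x) & jsupp d M W (Sy x)]) &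
      exists Sy', forall z e i c, (e < d)%N -> (i <= M)%N ->
        [/\ forall t, ider (fun t => Sy (ccons t z) e i c) t (Sy' (ccons t z) e i c),
            continuous (fun t => Sy' (ccons t z) e i c) &
            forall t, `|Sy' (ccons t z) e i c| <= A / k * k ^+ i]].

(** Linearisation of the multilinear operator: symbol frozen at y, function on R^d, value taken at
    the diagonal point over y. *)
Definition Top n d (Sy : (nat -> R) -> nat -> nat -> (nat -> R) -> R) psi F y : R :=
  Sop d (Sy y 0%N 0%N) psi F (rep n y).

Lemma mfr_Top n d M A W k Sy psi F : (0 < d)%N -> goodsym n d M A W k Sy -> dom d F ->
  mfr n.+1 (Top n.+1 d Sy psi F).
Proof.
move=> d0 [mS _ _] dF.
apply: (@measurable_Sop R d _ (E n.+1) (fun w => Sy (co w) 0%N 0%N) (fun w => rep n.+1 (co w))).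
- exact: mS.
- by move=> i; exact: measurable_co.
- exact: dom_mfr dF.
Qed.

(** The hypothesis on [K1] is the scale invariance of the critical order: although A, W and k change
    from piece to piece, A lam is bounded through K1 and the density H alone. *)
Lemma lam_exists d (r A W k K1 H : R) : 1 < r <= 2 -> 0 < A -> 0 < W -> 0 < k -> 0 < H ->
  A `^ r * (2 * W) ^+ d * k ^+ d <= K1 ->
  exists lam, [/\ 0 < lam, (2 * W) ^+ d * (k ^+ d * H) <= lam `^ r & A * lam <= (K1 * H) `^ r^-1].
Proof.
move=> /andP[r1 _] A0 W0 k0 H0 AK; have r0 : 0 < r by exact: lt_trans ltr01 r1.
have X0 : 0 < (2 * W) ^+ d * (k ^+ d * H) by rewrite mulr_gt0 ?exprn_gt0 ?mulr_gt0// exprn_gt0.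
exists (((2 * W) ^+ d * (k ^+ d * H)) `^ r^-1); split.
- by rewrite powR_gt0.
- by rewrite -powRrM mulVf ?gt_eqF// powRr1 ?(ltW X0).
- have -> : A = (A `^ r) `^ r^-1 by rewrite -powRrM divff ?gt_eqF// powRr1 ?(ltW A0).
  rewrite -powRM ?powR_ge0 ?(ltW X0)//; apply: ge0_ler_powR; rewrite ?invr_ge0 ?(ltW r0) ?nnegrE//.
  + by apply: mulr_ge0; [exact: powR_ge0|exact: ltW].
  + apply: mulr_ge0 (ltW H0); apply: le_trans AK; apply: mulr_ge0; last by rewrite exprn_ge0 ?(ltW k0).
    by apply: mulr_ge0; [exact: powR_ge0|rewrite exprn_ge0// mulr_ge0// ltW].
  + by rewrite !mulrA; apply: ler_wpM2r; [exact: ltW|exact: AK].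
Qed.

Lemma segment_average n d M : ~~ odd M -> exists C : R, 0 < C /\
  forall (r q A W k K1 H : R) Sy F psi (x : E n) zc t0 s,
    1 < r <= 2 -> 0 < q <= 1 -> 0 < A -> 0 < W -> 0 < k -> 0 < s <= k -> 1 <= W * s -> 0 < H ->
    A `^ r * (2 * W) ^+ d.+1 * k ^+ d.+1 <= K1 -> goodsym n d.+1 M A W k Sy -> dom d.+1 F ->
    (forall t e, t0 <= t <= t0 + s -> (e < d.+1)%N -> `|rep n.+1 (ccons t (co x)) e - zc e| <= k) ->
    (eint d.+1 (fun u => (`|F u * (weight d.+1 M zc k u)^-1| `^ r)%:E) <= (k ^+ d.+1 * H)%:E)%E ->
    (\int[leb]_t (\1_(`[t0, t0 + s]) t * `|Top n.+1 d.+1 Sy psi F (ccons t (co x))| `^ q)%:E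
     <= (C * s * ((K1 * H) `^ r^-1 * (W * s) `^ (- ((r - 1) / 8))) `^ q)%:E)%E.
Proof.
move=> oM; have [C [C0 HC]] := @Sop_waverage R d n.+1 M isT oM.
exists C; split=> // r q A W k K1 H Sy F psi x zc t0 s r12 q01 A0 W0 k0 /andP[s0 sk] Ws H0 AK [mS gS [Sy' dS]] dF pz FR.
have [lam [l0 lamR lamK]] := lam_exists r12 A0 W0 k0 H0 AK.
have Rp0 : 0 <= k ^+ d.+1 * H by apply: mulr_ge0; [exact/exprn_ge0/ltW|exact: ltW].
have h := HC r q (fun t => Sy (ccons t (co x))) (fun t => Sy' (ccons t (co x))) A k W F _ lam psi
  (rep n.+1 (ccons 0 (co x))) zc s t0 r12 q01 A0 k0 W0 s0 Ws.
have E1 t : Top n.+1 d.+1 Sy psi F (ccons t (co x)) =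
  Sop d.+1 (Sy (ccons t (co x)) 0%N 0%N) psi F (moved n.+1 (rep n.+1 (ccons 0 (co x))) t).
  by rewrite /Top rep_ccons.
under eq_integral do rewrite E1.
apply: le_trans (h _ _ _ _ _ _ _ _ dF Rp0 l0 _ FR lamR) _.
- move=> e i ed iM; have hm : measurable_fun setT (fun w : TR * E d.+1 => ((w.1, x) : E n.+1, w.2)).
    apply: measurable_fun_pair; last exact: measurable_snd.
    apply: (@measurable_fun_pair _ _ _ _ TR (E n)); first exact: measurable_fst.
    exact: measurable_cst.
  exact: (measurableT_comp (mS e i ed iM) hm).
- by move=> t; case: (gS (ccons t (co x))).
- by move=> t; case: (gS (ccons t (co x))).
- by move=> t; case: (gS (ccons t (co x))).
- by move=> e i c t ed iM; case: (dS (co x) e i c ed iM) => + _ _; exact.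
- by move=> e i c ed iM; case: (dS (co x) e i c ed iM).
(* A derivative in x costs 1/k, which is at most the 1/s wanted here because s <= k. *)
- move=> t e i c ed iM; case: (dS (co x) e i c ed iM) => _ _ /(_ t)/le_trans; apply.
  rewrite ler_wpM2r ?exprn_ge0 ?(ltW k0)// ler_wpM2l ?(ltW A0)// lef_pV2//.
- by move=> t e tI ed; rewrite -rep_ccons//; exact: pz.
rewrite lee_fin ler_wpM2l ?mulr_ge0 ?(ltW C0) ?(ltW s0)//.
have /andP[q0 _] := q01.
apply: ge0_ler_powR; rewrite ?nnegrE ?(ltW q0)//.
- by apply: mulr_ge0; [apply: mulr_ge0; exact: ltW|exact: powR_ge0].
- by apply: mulr_ge0; exact: powR_ge0.
- by rewrite ler_wpM2r ?powR_ge0.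
Qed.

(** Fubini slices the cube into segments parallel to the first axis. The cube is no larger than the
    scale k, so the weight centred at the single point x serves for all of them. *)
Lemma small_cube n d M : ~~ odd M -> exists C : R, 0 < C /\
  forall (r q A W k K1 H : R) Sy F psi a x s,
    1 < r <= 2 -> 0 < q <= 1 -> 0 < A -> 0 < W -> 0 < k -> 0 < s <= k -> 1 <= W * s -> 0 < H ->
    A `^ r * (2 * W) ^+ d.+1 * k ^+ d.+1 <= K1 -> goodsym n d.+1 M A W k Sy -> dom d.+1 F ->
    (forall i, (i < n.+1)%N -> a i <= x i <= a i + s) ->
    (eint d.+1 (fun u => (`|F u * (weight d.+1 M (rep n.+1 x) k u)^-1| `^ r)%:E) <= (k ^+ d.+1 * H)%:E)%E ->
    (eint n.+1 (fun y => (cubei n.+1 a s y * `|Top n.+1 d.+1 Sy psi F y| `^ q)%:E)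
     <= (C * s ^+ n.+1 * ((K1 * H) `^ r^-1 * (W * s) `^ (- ((r - 1) / 8))) `^ q)%:E)%E.
Proof.
move=> oM; have [C [C0 HC]] := segment_average n d oM.
exists C; split=> // r q A W k K1 H Sy F psi a x s r12 q01 A0 W0 k0 s0k Ws H0 AK gS dF ax FR.
have /andP[s0 sk] := s0k.
set Y := (_ * _) `^ q; have Y0 : 0 <= Y by exact: powR_ge0.
have mT : mfr n.+1 (fun y => `|Top n.+1 d.+1 Sy psi F y| `^ q).
  by apply: (measurableT_comp (measurable_powR q)); apply: measurableT_comp => //; exact: mfr_Top gS dF.
rewrite eint_S2; last 2 first.
- by apply: mfe_EFin; apply: measurable_funM => //; exact: mfr_cubei.
- by move=> c; rewrite lee_fin mulr_ge0 ?cubei_ge0 ?powR_ge0.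
apply: (@le_trans _ _ (eint n (fun z => (C * s * Y)%:E * (cubei n (fun i => a i.+1) s z)%:E)%E)); last first.
  have CsY : 0 <= C * s * Y by apply: mulr_ge0 Y0; apply: mulr_ge0; exact: ltW.
  rewrite /eint ge0_integralZl_EFin//.
  - rewrite [X in (_ * X)%E](eint_cubei n _ (ltW s0)) -EFinM lee_fin exprS le_eqVlt; apply/orP; left; apply/eqP.
    by set w := s ^+ n; ring.
  - by move=> w _; rewrite lee_fin cubei_ge0.
  - exact/mfe_EFin/mfr_cubei.
apply: le_integral_nomeas => w.
  by apply: integral_ge0 => t _; rewrite lee_fin mulr_ge0 ?cubei_ge0 ?powR_ge0.
have [Q0|[Q1 wQ]] := cubeiP n (fun i => a i.+1) s (co w).
  rewrite Q0 mule0 (eq_integral (fun=> 0%:E)) ?integral0// => t _.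
  by rewrite cubei_ccons Q0 mulr0 mul0r.
rewrite Q1 mule1; apply: le_trans (HC r q A W k K1 H Sy F psi w (rep n.+1 x) (a 0%N) s r12 q01 A0 W0 k0 s0k Ws H0 AK gS dF _ FR).
  by apply: le_integral_nomeas => t; rewrite cubei_ccons Q1 mulr1// lee_fin mulr_ge0 ?powR_ge0// indicE.
move=> t e tI ed; rewrite /rep; have em : (e %% n.+1 < n.+1)%N by rewrite ltn_mod.
have xe := ax _ em; apply: le_trans sk.
have te : a (e %% n.+1)%N <= ccons t (co w) (e %% n.+1)%N <= a (e %% n.+1)%N + s.
  by move: em; case: (e %% n.+1)%N => [|m] //= mn; exact: wQ.
by rewrite ler_norml; lra.
Qed.

End Segments.

(** * Cubes larger than the critical scale, covered by short segments *)

Section LargeCubes.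
Variable R : realType.
Local Notation leb := (@lebesgue_measure R : {sigma_finite_measure set (measurableTypeR R) -> \bar R}).
Local Notation E := (E R).
Local Notation TR := (measurableTypeR R).
Implicit Types (c v p z u x y a : nat -> R) (F : (nat -> R) -> R).

(** Each t of the long interval lies in the window of length k around w for a set of w, inside that
    interval, of measure at least k / 2; hence the factor 2 / k. *)
Lemma spread (h : R -> R) (a s k : R) : 0 < k <= s -> measurable_fun setT (h : TR -> R) ->
  (forall t, 0 <= h t) ->
  (\int[leb]_t (\1_(`[a, a + s]) t * h t)%:E <= (2 / k)%:E *
    \int[leb]_w (\int[leb]_t (\1_(`[a, a + s]) w * (\1_(`[w - k / 2, w - k / 2 + k]) t * h t))%:E))%E.
Proof.
move=> /andP[k0 ks] mh h0.
pose f (z : TR * TR) : \bar R := (\1_(`[a, a + s]) z.1 * (\1_(`[z.1 - k / 2, z.1 - k / 2 + k]) z.2 * h z.2))%:E.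
have i0 (S : set R) t : 0 <= \1_S t :> R by rewrite indicE.
have mI (x y : R) : measurable_fun setT (\1_(`[x, y]) : TR -> R).
  by apply: measurable_indic; exact: measurable_itv.
have E1 (w t : R) : \1_(`[w - k / 2, w - k / 2 + k]) t = \1_(`[0, k]) (t - w + k / 2) :> R.
  by rewrite !indicE; congr (nat_of_bool _)%:R; apply/idP/idP => /set_mem/=; rewrite in_itv/= => ?;
    rewrite mem_set//= in_itv/=; lra.
have mf : measurable_fun setT f.
  apply/measurable_EFinP; apply: measurable_funM; first exact: (measurableT_comp (mI _ _) measurable_fst).
  apply: measurable_funM; last exact: (measurableT_comp mh measurable_snd).
  under eq_fun do rewrite E1.
  apply: (measurableT_comp (mI _ _)); apply: measurable_funD => //.
  by apply: measurable_funB; [exact: measurable_snd|exact: measurable_fst].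
have f0 (z : TR * TR) : (0 <= f z)%E by rewrite lee_fin mulr_ge0// mulr_ge0.
rewrite (fubini_tonelli (m1 := leb) (m2 := leb) f mf f0)/=.
have k2 : 0 < 2 / k by rewrite divr_gt0.
rewrite -ge0_integralZl_EFin ?(ltW k2)//; last 2 first.
- by move=> t _; apply: integral_ge0.
- exact: (@measurable_fun_fubini_tonelli_G _ _ TR TR R leb f mf f0).
apply: le_integral_nomeas => t; first by rewrite lee_fin mulr_ge0.
have [tI|tI] := boolP (t \in `[a, a + s]%classic); last first.
  rewrite indicE (negbTE tI) mul0r; apply: mule_ge0; first by rewrite lee_fin ltW.
  by apply: integral_ge0.
rewrite indicE tI mul1r; move: tI => /set_mem/=; rewrite in_itv/= => /andP[at1 at2].
suff H : exists b, forall w, \1_(`[b, b + k / 2]) w <= \1_(`[a, a + s]) w * \1_(`[w - k / 2, w - k / 2 + k]) t :> R.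
  have [b Hb] := H.
  apply: (@le_trans _ _ ((2 / k)%:E * \int[leb]_w ((h t)%:E * (\1_(`[b, b + k / 2]) w)%:E)))%E; last first.
    apply: lee_wpmul2l; first by rewrite lee_fin ltW.
    apply: le_integral_nomeas => w; first by rewrite -EFinM lee_fin mulr_ge0.
    by rewrite -EFinM lee_fin mulrA mulrC; apply: ler_wpM2r => //; exact: Hb.
  rewrite ge0_integralZl_EFin//; last by apply/measurable_EFinP; exact: mI.
  rewrite integral_itv_indic; last by rewrite lerDl divr_ge0 ?(ltW k0).
  rewrite -!EFinM lee_fin le_eqVlt; apply/orP; left; apply/eqP; field.
  by rewrite gt_eqF.
(* Near an end only one side is available: w is taken to the right of t in the left half of the
   interval and to the left otherwise. Since k <= s, the half window stays inside. *)
exists (if t <= a + s / 2 then t else t - k / 2) => w.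
case: ifP => [ta|/negbT]; [|rewrite -ltNge => ta]; rewrite !indicE;
  case: (boolP (w \in _)) => [/set_mem/=|_]; rewrite ?in_itv/= => *; rewrite ?mulr_ge0//;
  rewrite !mem_set ?mulr1//= in_itv/=; lra.
Qed.

(** The exponents r / q, 1 / r and q multiply to 1, so a local density entering as e^(r/q) leaves as
    e itself, which can be averaged. *)
Lemma powR_pull (K H e X r q : R) : 0 <= K -> 0 <= H -> 0 < e -> 0 <= X -> 0 < r -> 0 < q ->
  ((K * (H * e `^ (r / q))) `^ r^-1 * X) `^ q = ((K * H) `^ r^-1 * X) `^ q * e.
Proof.
move=> K0 H0 e0 X0 r0 q0; rewrite mulrA; have KH := mulr_ge0 K0 H0.
rewrite (powRM r^-1 KH (powR_ge0 e _)) -[(e `^ _) `^ _]powRrM mulrAC.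
rewrite (powRM q (mulr_ge0 (powR_ge0 _ _) X0) (powR_ge0 _ _)) -[(e `^ _) `^ q]powRrM.
have -> : r / q * r^-1 * q = 1 by field; rewrite !gt_eqF.
by rewrite powRr1// ltW.
Qed.

(** [En] measures how much denser F is around z than the normalisation H. Segments of length k pick
    up a factor [En] at their centre, and averaging over the centres integrates [En] over the cube,
    where its mean is at most 2. *)
Lemma large_cube n d M : ~~ odd M -> exists C : R, 0 < C /\
  forall (r q A W k K1 H : R) Sy F psi a s En,
    1 < r <= 2 -> 0 < q <= 1 -> 0 < A -> 0 < W -> 0 < k <= s -> 1 <= W * k -> 0 < H ->
    A `^ r * (2 * W) ^+ d.+1 * k ^+ d.+1 <= K1 -> goodsym n d.+1 M A W k Sy -> dom d.+1 F ->
    mfr n.+1 En -> (forall z, 1 <= En z) ->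
    (forall z, eint d.+1 (fun u => (`|F u * (weight d.+1 M (rep n.+1 z) k u)^-1| `^ r)%:E)
       <= (k ^+ d.+1 * (H * En z `^ (r / q)))%:E)%E ->
    (eint n.+1 (fun z => (cubei n.+1 a s z * En z)%:E) <= (2 * s ^+ n.+1)%:E)%E ->
    (eint n.+1 (fun y => (cubei n.+1 a s y * `|Top n.+1 d.+1 Sy psi F y| `^ q)%:E)
     <= (C * s ^+ n.+1 * ((K1 * H) `^ r^-1 * (W * k) `^ (- ((r - 1) / 8))) `^ q)%:E)%E.
Proof.
move=> oM; have [C [C0 HC]] := @segment_average R n d M oM.
exists (4 * C); split; first by rewrite mulr_gt0.
move=> r q A W k K1 H Sy F psi a s En r12 q01 A0 W0 /andP[k0 ks] Wk H0 AK gS dF mE E1 FR EQ.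
have s0 : 0 < s by exact: lt_le_trans ks.
set Y := (_ * _) `^ q; have Y0 : 0 <= Y by exact: powR_ge0.
have K10 : 0 <= K1.
  apply: le_trans AK; apply: mulr_ge0; last by rewrite exprn_ge0 ?(ltW k0).
  by apply: mulr_ge0; [exact: powR_ge0|rewrite exprn_ge0// mulr_ge0// ltW].
have En0 z : 0 < En z by exact: lt_le_trans (E1 z).
have mT : mfr n.+1 (fun y => `|Top n.+1 d.+1 Sy psi F y| `^ q).
  by apply: (measurableT_comp (measurable_powR q)); apply: measurableT_comp => //; exact: mfr_Top gS dF.
have mQE : mfr n.+1 (fun z => cubei n.+1 a s z * En z) by apply: measurable_funM => //; exact: mfr_cubei.
have QE0 z : 0 <= cubei n.+1 a s z * En z by rewrite mulr_ge0 ?cubei_ge0 ?(ltW (En0 z)).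
rewrite eint_S2; last 2 first.
- by apply: mfe_EFin; apply: measurable_funM => //; exact: mfr_cubei.
- by move=> c; rewrite lee_fin mulr_ge0 ?cubei_ge0 ?powR_ge0.
apply: (@le_trans _ _ (eint n (fun z => (2 * C * Y)%:E *
   \int[leb]_w (cubei n.+1 a s (ccons w z) * En (ccons w z))%:E)%E)); last first.
  have CY : 0 <= 2 * C * Y by apply: mulr_ge0 Y0; rewrite mulr_ge0 ?(ltW C0).
  rewrite {1}/eint ge0_integralZl_EFin//.
  - have -> : 4 * C * s ^+ n.+1 * Y = 2 * C * Y * (2 * s ^+ n.+1) by set w := s ^+ n.+1; ring.
    rewrite [leRHS]EFinM; apply: lee_wpmul2l; first by rewrite lee_fin.
    by move: EQ; rewrite eint_S2//; exact: mfe_EFin.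
  - by move=> w _; apply: integral_ge0 => t _; rewrite lee_fin.
  - exact: (@measurable_fun_fubini_tonelli_G _ _ TR (E n) R leb (fun w : E n.+1 => (cubei n.+1 a s (co w) * En (co w))%:E) (mfe_EFin mQE) (fun _ => QE0 _)).
apply: le_integral_nomeas => x.
  by apply: integral_ge0 => t _; rewrite lee_fin mulr_ge0 ?cubei_ge0 ?powR_ge0.
have [Q0|[Q1 wQ]] := cubeiP n (fun i => a i.+1) s (co x).
  rewrite (eq_integral (fun=> 0%:E)); last by move=> t _; rewrite cubei_ccons Q0 mulr0 mul0r.
  rewrite integral0; apply: mule_ge0; first by rewrite lee_fin mulr_ge0// mulr_ge0// ltW.
  by apply: integral_ge0 => t _; rewrite lee_fin.
pose h t := `|Top n.+1 d.+1 Sy psi F (ccons t (co x))| `^ q.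
have mh : measurable_fun setT (h : TR -> R) by exact: (measurableT_comp mT (measurable_pair2 x)).
have h0 t : 0 <= h t by exact: powR_ge0.
have kss : 0 < k <= s by rewrite k0.
apply: (@le_trans _ _ (\int[leb]_t (\1_(`[a 0%N, a 0%N + s]) t * h t)%:E)%E).
  apply: le_integral_nomeas => t; first by rewrite lee_fin mulr_ge0 ?cubei_ge0 ?powR_ge0.
  by rewrite cubei_ccons Q1 mulr1.
apply: le_trans (@spread h (a 0%N) s k kss mh h0) _.
have q0 : 0 < q by case/andP: q01.
have r0 : 0 < r by case/andP: r12 => r1 _; exact: lt_trans ltr01 r1.
(* Each segment is estimated with the weight centred at its own midpoint, so all its points are
   within k of the centre. *)
have seg (w : R) : (\int[leb]_t (\1_(`[(w - k / 2)%R, (w - k / 2 + k)%R]) t * h t)%:E <= (C * k * Y * En (ccons w (co x)))%:E)%E.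
  have HE0 : 0 < H * En (ccons w (co x)) `^ (r / q) by rewrite mulr_gt0// powR_gt0.
  have kk : 0 < k <= k by rewrite k0 lexx.
  have := HC r q A W k K1 _ Sy F psi x (rep n.+1 (ccons w (co x))) (w - k / 2) k r12 q01 A0 W0 k0 kk Wk HE0 AK gS dF _ (FR _).
  rewrite (powR_pull K10 (ltW H0) (En0 _) (powR_ge0 _ _) r0 q0) -/Y mulrA.
  apply=> t e tI ed; rewrite /rep; case: (e %% n.+1)%N => [|m] /=; last by rewrite subrr normr0 ltW.
  by rewrite ler_norml; lra.
apply: (@le_trans _ _ ((2 / k)%:E * \int[leb]_w ((C * k * Y)%:E * (cubei n.+1 a s (ccons w (co x)) * En (ccons w (co x)))%:E))%E).
  apply: lee_wpmul2l; first by rewrite lee_fin divr_ge0// ltW.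
  apply: le_integral_nomeas => w.
    by apply: integral_ge0 => t _; rewrite lee_fin mulr_ge0 ?indicE// mulr_ge0.
  rewrite cubei_ccons Q1 mulr1 indicE; case: (w \in _); last first.
    by rewrite mul0r mule0 (eq_integral (fun=> 0%:E)) ?integral0// => t _; rewrite mul0r.
  rewrite mul1r -EFinM; apply: le_trans (seg w).
  by apply: le_integral_nomeas => t; rewrite mul1r// lee_fin mulr_ge0// indicE.
have CkY : 0 <= C * k * Y by rewrite !mulr_ge0 ?(ltW C0) ?(ltW k0).
rewrite ge0_integralZl_EFin//; last 2 first.
- by move=> w _; rewrite lee_fin.
- by apply/measurable_EFinP; exact: (measurableT_comp mQE (measurable_pair2 x)).
rewrite muleA -EFinM (_ : 2 / k * (C * k * Y) = 2 * C * Y)//.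
by set yy := Y; field; rewrite gt_eqF.
Qed.

End LargeCubes.

(** * Products of densities controlled by the maximal function *)

Section Majorants.
Variable R : realType.
Local Notation mu := (@mu R).
Local Notation E := (E R).
Local Notation TR := (measurableTypeR R).
Implicit Types (c v p z u x y a : nat -> R) (F : (nat -> R) -> R).

Lemma measurable_nrm d dO (O : measurableType dO) (v : O -> nat -> R) :
  (forall i, measurable_fun setT (fun w => v w i)) -> measurable_fun setT (fun w => nrm d (v w)).
Proof.
move=> mv; rewrite /nrm; elim: (index_enum _) => [|i r IH].
  by under eq_fun do rewrite big_nil; exact: measurable_cst.
under eq_fun do rewrite big_cons.
by apply: measurable_maxr => //; apply: measurableT_comp.
Qed.

Definition ker n (k : R) N z v : R := ((1 + nrm n (fun i => v i - z i) / k)^-1) ^+ N.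

Lemma ker_ge1 n k z v : 0 < k -> 1 <= 1 + nrm n (fun i => v i - z i) / k.
Proof. by move=> k0; rewrite lerDl divr_ge0 ?nrm_ge0// ltW. Qed.

Lemma ker_gt0 n k N z v : 0 < k -> 0 < ker n k N z v.
Proof. by move=> k0; rewrite exprn_gt0// invr_gt0 (lt_le_trans ltr01)// ker_ge1. Qed.

Lemma ker_le1 n k N z v : 0 < k -> ker n k N z v <= 1.
Proof.
move=> k0; have h := ker_ge1 n z v k0; have h0 := lt_le_trans ltr01 h.
by rewrite exprn_ile1// ?invr_ge0 ?(ltW h0)// invf_le1.
Qed.

Lemma measurable_ker n k N dO (O : measurableType dO) (z v : O -> nat -> R) : 0 < k ->
  (forall i, measurable_fun setT (fun w => z w i)) ->
  (forall i, measurable_fun setT (fun w => v w i)) ->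
  measurable_fun setT (fun w => ker n k N (z w) (v w)).
Proof.
move=> k0 mz mv; pose f (y : R) := ((1 + `|y| / k)^-1) ^+ N.
have cf : continuous f.
  apply: (cont_comp (f := fun x : R => x ^+ N)); first exact: exprn_continuous.
  move=> y; apply: (cvgV (f := fun y : R => 1 + `|y| / k)).
    by rewrite gt_eqF// ltr_pwDl// divr_ge0// ltW.
  by apply: cvgD; [exact: cvg_cst|apply: cvgM; [exact: norm_continuous|exact: cvg_cst]].
have -> : (fun w => ker n k N (z w) (v w)) = f \o (fun w => nrm n (fun i => v w i - z w i)).
  by apply/funext => w; rewrite /f /ker /= ger0_norm ?nrm_ge0.
apply: measurableT_comp; first exact: continuous_measurable_fun.
by apply: measurable_nrm => i; apply: measurable_funB.
Qed.

(** When y = |u - z| / k exceeds 1, the summand of the largest coordinate alone is y^M, and 1 + y <=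
    2 y; when y <= 1, the factor 2^M suffices. *)
Lemma weight_decay d M z (k : R) u : (0 < M)%N -> ~~ odd M -> 0 < k ->
  (weight d M z k u)^-1 <= 2 ^+ M * ker d k M z u.
Proof.
move=> M0 oM k0; set y := nrm d (fun i => u i - z i) / k.
have y0 : 0 <= y by rewrite divr_ge0 ?nrm_ge0// ltW.
have y1 : 0 < 1 + y by rewrite ltr_pwDl.
have w1 := weight_ge1 d z k u oM; have w0 := lt_le_trans ltr01 w1.
rewrite /ker -/y exprVn -[leLHS]mul1r ler_pdivrMr// mulrAC ler_pdivlMr ?exprn_gt0// mul1r.
have [yl|yl] := leP y 1.
  apply: (@le_trans _ _ (2 ^+ M)); first by rewrite lerXn2r ?nnegrE ?(ltW y1)//; lra.
  by rewrite ler_peMr// exprn_ge0.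
have n0 : 0 < nrm d (fun i => u i - z i).
  by rewrite lt_neqAle nrm_ge0 andbT; apply/eqP => h; move: yl; rewrite /y -h mul0r ltNge ler01.
have [e ed he] := nrm_attained n0.
apply: (@le_trans _ _ (2 ^+ M * y ^+ M)).
  rewrite -exprMn; have := yl; move: (y) y0 => b b0 b1; apply: lerXn2r; rewrite ?nnegrE; lra.
rewrite ler_wpM2l ?exprn_ge0// /weight (bigD1 (Ordinal ed))//= /y he.
have -> : (`|u e - z e| / k) ^+ M = ((u e - z e) / k) ^+ M.
  by rewrite !exprMn -normrX ger0_norm// exprn_even_ge0.
rewrite [X in _ <= 1 + X]addrC addrA lerDr addr_ge0// sumr_ge0// => i _; exact: exprn_even_ge0.
Qed.

(** The inverse weight is at most 1, so for r >= 1 its r-th power is at most itself, which lies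
    below the decaying kernel. *)
Lemma weighted_le d M (r k : R) F (Phi : (nat -> R) -> R) z : 1 <= r -> (0 < M)%N -> ~~ odd M -> 0 < k ->
  (forall u, `|F u| `^ r <= Phi u) ->
  (eint d (fun u => (`|F u * (weight d M z k u)^-1| `^ r)%:E) <=
   eint d (fun u => (2 ^+ M * (Phi u * ker d k M z u))%:E))%E.
Proof.
move=> r1 M0 oM k0 FP; apply: le_integral_nomeas => w; first by rewrite lee_fin powR_ge0.
have w1 := @weight_ge1 _ d M z k (co w) oM; have w0 := lt_le_trans ltr01 w1.
have v0 : 0 < (weight d M z k (co w))^-1 by rewrite invr_gt0.
rewrite lee_fin normrM powRM// mulrCA.
apply: ler_pM; rewrite ?powR_ge0//.
rewrite (ger0_norm (ltW v0)); apply: le_trans (weight_decay d z (co w) M0 oM k0).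
rewrite -[leRHS]powRr1 ?(ltW v0)//; apply: ger_powR => //.
by rewrite v0 invf_le1.
Qed.

(** Dependence on the first [n] coordinates only. Functions live on infinite sequences, so this has
    to be known before one can be evaluated on a block, whose later entries belong to other
    blocks. *)
Definition local n (T : Type) (g : (nat -> R) -> T) :=
  forall c c', (forall i, (i < n)%N -> c i = c' i) -> g c = g c'.

Fixpoint pt n (c : nat -> R) : E n :=
  match n return E n with
  | 0 => tt
  | n'.+1 => (c 0%N, pt n' (fun k => c k.+1))
  end.

Lemma co_pt n c i : (i < n)%N -> co (pt n c) i = c i.
Proof. by elim: n c i => [|n IH] c [|i] //= /IH ->. Qed.

Lemma measurable_pt n dO (O : measurableType dO) (c : O -> nat -> R) :
  (forall i, measurable_fun setT (fun w => c w i)) -> measurable_fun setT (fun w => pt n (c w)).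
Proof.
elim: n c => [|n IH] c mc /=; first exact: measurable_cst.
by apply: (@measurable_fun_pair _ _ _ _ TR (E n)); [exact: (mc 0%N)|exact: (IH (fun w k => c w k.+1) (fun i => mc i.+1))].
Qed.

Lemma measurable_local n dO (O : measurableType dO) (c : O -> nat -> R) (g : (nat -> R) -> R) :
  local n g -> mfr n g -> (forall i, measurable_fun setT (fun w => c w i)) ->
  measurable_fun setT (fun w => g (c w)).
Proof.
move=> lg mg mc; have := measurableT_comp mg (@measurable_pt n _ O c mc); congr measurable_fun.
by apply/funext => w /=; apply: lg => i ni; rewrite co_pt.
Qed.

Lemma ccat_lt n c c' i : (i < n)%N -> ccat n c c' i = c i.
Proof. by elim: n c i => [|n IH] c [|i] //= /(IH (fun k => c k.+1)). Qed.

Lemma mfr_blocks l n (g : nat -> (nat -> R) -> R) d : (forall j, mfr n (g j)) -> (forall j, local n (g j)) ->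
  mfr d (fun u => \prod_(j < l) g j (shift (j * n) u)).
Proof.
move=> mg lg; apply: (@mfr_prod R d _ _ _ (fun (j : 'I_l) u => g j (shift (j * n) u))) => j.
apply: (@measurable_local n _ (E d) (fun w => shift (j * n) (co w)) (g j)) => // i.
exact: measurable_co.
Qed.

Lemma eint_blocks l n (g : nat -> (nat -> R) -> R) (I : nat -> R) :
  (forall j c, 0 <= g j c) -> (forall j, mfr n (g j)) -> (forall j, local n (g j)) ->
  (forall j, eint n (fun c => (g j c)%:E) = (I j)%:E) ->
  eint (l * n) (fun u => (\prod_(j < l) g j (shift (j * n) u))%:E) = (\prod_(j < l) I j)%:E.
Proof.
elim: l g I => [|l IH] g I g0 mg lg gI; first by rewrite mul0n eint0 !big_ord0.
rewrite mulSn eint_cat; last 2 first.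
- exact/mfe_EFin/mfr_blocks.
- by move=> c; rewrite lee_fin prodr_ge0.
transitivity (eint n (fun c => (g 0%N c)%:E * (\prod_(j < l) I j.+1)%:E)%E).
  apply: eq_integral => c _; rewrite -(IH (fun j => g j.+1) (fun j => I j.+1))//.
  rewrite /eint -ge0_integralZl_EFin//; last 2 first.
  - by move=> w _; rewrite lee_fin prodr_ge0.
  - exact: (mfe_EFin (@mfr_blocks l n (fun j => g j.+1) (l * n) (fun j => mg j.+1) (fun j => lg j.+1))).
  apply: eq_integral => w _; rewrite big_ord_recl EFinM; congr (_%:E * _%:E)%E.
    apply: lg => i ni; rewrite /shift mul0n add0n ccat_lt//.
  apply: eq_bigr => j _; congr (g j.+1); apply/funext => i.
  rewrite lift0 mulSn /shift -addnA; have := shift_ccat n (co c) (co w).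
  by move=> /(congr1 (fun f => f (j * n + i)%N)); rewrite /shift.
have I0 j : 0 <= I j by rewrite -lee_fin -gI; apply: integral_ge0 => w _; rewrite lee_fin.
rewrite /eint ge0_integralZr//.
- by rewrite -/(eint n (fun c => (g 0%N c)%:E)) gI -EFinM big_ord_recl.
- exact/mfe_EFin/mg.
- by move=> w _; rewrite lee_fin.
- by rewrite lee_fin prodr_ge0.
Qed.

Lemma nrm_block l n j u x : (0 < n)%N -> (j < l)%N ->
  nrm n (fun i => shift (j * n) u i - x i) <= nrm (l * n) (fun i => u i - rep n x i).
Proof.
move=> n0 jl; apply/nrm_leP => [|i ni]; first exact: nrm_ge0.
have := @nrm_coord R (l * n) (fun i => u i - rep n x i) (j * n + i) _.
rewrite /rep /shift modnMDl (modn_small ni); apply.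
by rewrite -ltn_subRL -mulnBl (leq_trans ni)// leq_pmull// subn_gt0.
Qed.

(** All factors are at most 1, and the factor of the block that contains the largest coordinate is
    already the full kernel. *)
Lemma ker_blocks_le l n k N x u : (0 < n)%N -> 0 < k ->
  \prod_(j < l) ker n k N x (shift (j * n) u) <= ker (l * n) k N (rep n x) u.
Proof.
move=> n0 k0; have [h|h] := leP (nrm (l * n) (fun i => u i - rep n x i)) 0.
  have -> : ker (l * n) k N (rep n x) u = 1.
    by rewrite /ker (_ : nrm _ _ = 0) ?mul0r ?addr0 ?invr1 ?expr1n//; apply/le_anti; rewrite h nrm_ge0.
  by apply: prodr_ile1 => j _; rewrite ltW ?ker_gt0//= ker_le1.
have [e ed he] := nrm_attained h.
have jl : (e %/ n < l)%N by rewrite ltn_divLR.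
rewrite (bigD1 (Ordinal jl))//= -[leRHS]mulr1; apply: ler_pM.
- exact/ltW/ker_gt0.
- by apply: prodr_ge0 => j _; exact/ltW/ker_gt0.
- rewrite lerXn2r ?nnegrE ?invr_ge0 ?(le_trans ler01 (ker_ge1 _ _ _ k0))//.
  rewrite lef_pV2 ?posrE ?(lt_le_trans ltr01 (ker_ge1 _ _ _ k0))// lerD2l ler_pM2r ?invr_gt0//.
  rewrite he; have := @nrm_coord R n (fun i => shift (e %/ n * n) u i - x i) (e %% n)%N (ltn_pmod e n0).
  by rewrite /shift -divn_eq /rep.
- by apply: prodr_ile1 => j _; rewrite ltW ?ker_gt0//= ker_le1.
Qed.

(** No block is farther away than the whole point, so one full kernel of order N is below each
    factor; splitting over l blocks uses up order N l. *)
Lemma ker_blocks_ge l n k N x u : (0 < n)%N -> 0 < k ->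
  ker (l * n) k (N * l) (rep n x) u <= \prod_(j < l) ker n k N x (shift (j * n) u).
Proof.
move=> n0 k0; rewrite /ker exprM; set X := _^-1 ^+ N.
have -> : X ^+ l = \prod_(j < l) X by rewrite prodr_const card_ord.
rewrite {}/X.
have p0 m w w' : 0 < 1 + nrm m (fun i => w i - w' i) / k by exact: lt_le_trans ltr01 (ker_ge1 _ _ _ k0).
apply: ler_prod => j _; rewrite exprn_ge0 ?invr_ge0 ?(ltW (p0 _ _ _))//=.
rewrite lerXn2r ?nnegrE ?invr_ge0 ?(ltW (p0 _ _ _))// lef_pV2 ?posrE ?p0//.
by rewrite lerD2l ler_pM2r ?invr_gt0//; apply: nrm_block.
Qed.

Lemma shell_ker d (Phi : (nat -> R) -> R) x (k L : R) N : mfr d Phi -> (forall u, 0 <= Phi u) -> 0 < k -> 0 <= L ->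
  (d < N)%N ->
  (forall t, 0 < t -> (eint d (fun u => (Phi u * \1_[set c | nrm d (fun i => c i - x i) <= t] u)%:E) <= (L * t ^+ d)%:E)%E) ->
  (eint d (fun u => (Phi u * ker d k N x u)%:E) <= (2 ^+ N.+1 * L * k ^+ d)%:E)%E.
Proof.
move=> mP P0 k0 L0 dN HL.
have := @shell R _ (E d) (mu d) (fun w => (Phi (co w))%:E) (fun w => nrm d (fun i => co w i - x i)) L k d N.
rewrite /eint => H; under eq_integral do rewrite EFinM.
apply: (H (mfe_EFin mP) (fun w => P0 (co w)) (@mfr_nrm R d x) (fun w => nrm_ge0 _ _) k0 L0 dN).
move=> t t0; apply: le_trans (HL t t0); rewrite /eint le_eqVlt; apply/orP; left; apply/eqP.
by apply: eq_integral => w _; rewrite -EFinM !indicE !in_setb.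
Qed.

(** The bounds are going to be divisors, hence must be positive. If one factor is 0, it receives
    whatever room X leaves once the other factors have been increased by 1. *)
Lemma prod_enlarge l (b : nat -> R) (X : R) : (0 < l)%N -> (forall j, 0 <= b j) -> 0 < X ->
  \prod_(j < l) b j <= X ->
  exists B : nat -> R, [/\ forall j, 0 < B j, forall j, (j < l)%N -> b j <= B j & \prod_(j < l) B j <= X].
Proof.
move=> l0 b0 X0 bX; have [[j0 bj0]|/forallNP H] := pselect (exists j : 'I_l, b j = 0).
  pose P := \prod_(j < l | j != j0) (b j + 1).
  have b1 j : 0 < b j + 1 by rewrite ltr_wpDl.
  have P0 : 0 < P by rewrite prodr_gt0.
  exists (fun j => if j == j0 :> nat then X / P else b j + 1); split.
  - by move=> j; case: ifP => _ //; rewrite divr_gt0.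
  - move=> j _; case: eqP => [->|_]; last by rewrite lerDl.
    by rewrite bj0 divr_ge0// ltW.
  - rewrite (bigD1 j0)//= eqxx (_ : \prod_(_ < l | _) _ = P) ?divfK ?gt_eqF//.
    by apply: eq_bigr => j /negbTE; rewrite -val_eqE/= => ->.
exists (fun j => if (j < l)%N then b j else 1); split.
- move=> j; case: ifP => // jl; rewrite lt_neqAle b0 andbT eq_sym.
  by apply/eqP => h; exact: (H (Ordinal jl)).
- by move=> j ->.
- by rewrite (eq_bigr (fun j : 'I_l => b j))// => j _; rewrite ltn_ord.
Qed.

End Majorants.

(** * Local means over blocks and their majorant by a single density *)

Section KernelAverages.
Variable R : realType.
Local Notation mu := (@mu R).
Local Notation E := (E R).
Implicit Types (c v p z u x y a : nat -> R) (F : (nat -> R) -> R).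

(** For z in the cube, |v - x| <= |v - z| + s, and s >= k, so distance to x in units of s is at most
    distance to z in units of k, plus 1. *)
Lemma kernel_shift n N a (s k : R) x z v : 0 < k <= s -> (forall i, (i < n)%N -> a i <= x i <= a i + s) ->
  cubei n a s z * ker n k (2 * N) z v <= 2 ^+ N * ker n s N x v * ker n k N v z.
Proof.
move=> /andP[k0 ks] ax; have s0 := lt_le_trans k0 ks.
have RHS0 : 0 <= 2 ^+ N * ker n s N x v * ker n k N v z.
  apply: mulr_ge0; last exact/ltW/ker_gt0.
  by apply: mulr_ge0; [exact: exprn_ge0|exact/ltW/ker_gt0].
have [->|[-> zQ]] := cubeiP n a s z; first by rewrite mul0r.
(* Half of the decay pays for replacing z at scale k by x at scale s; the other half keeps the
   kernel integrable in z. *)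
rewrite mul1r; have -> : ker n k (2 * N) z v = ker n k N z v * ker n k N v z.
  by rewrite /ker mulnC exprM expr2 [nrm n (fun i => z i - v i)]nrmC -exprMn.
rewrite ler_wpM2r ?(ltW (ker_gt0 _ _ _ _ k0))// /ker -exprMn.
have zp := ker_ge1 n z v k0; have xp := ker_ge1 n x v s0.
have z0 := lt_le_trans ltr01 zp; have x0 := lt_le_trans ltr01 xp.
rewrite lerXn2r ?nnegrE ?mulr_ge0 ?invr_ge0 ?(ltW z0) ?(ltW x0)//.
rewrite ler_pdivlMr// ler_pdivrMl//.
have nz : nrm n (fun i => v i - x i) <= nrm n (fun i => v i - z i) + s.
  apply/nrm_leP => [|i ni]; first by rewrite addr_ge0 ?nrm_ge0 ?(ltW s0).
  have := @nrm_coord R n (fun i => v i - z i) i ni; have := zQ i ni; have := ax i ni.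
  move=> h1 h2 h3; rewrite (_ : v i - x i = v i - z i + (z i - x i)); last by ring.
  by rewrite (le_trans (ler_normD _ _))// lerD// ler_norml; lra.
have h1 : nrm n (fun i => v i - x i) / s <= nrm n (fun i => v i - z i) / k + 1.
  apply: (@le_trans _ _ ((nrm n (fun i => v i - z i) + s) / s)); first by rewrite ler_pM2r ?invr_gt0.
  rewrite mulrDl divff ?gt_eqF// lerD2r ler_wpM2l ?nrm_ge0// lef_pV2//.
move: h1; set y1 := nrm _ _ / s; have : 0 <= nrm n (fun i => v i - z i) / k by rewrite divr_ge0 ?nrm_ge0// ltW.
by set y2 := nrm _ _ / k => *; lra.
Qed.

Lemma kernel_average n N a (s k : R) x v : (n < N)%N -> 0 < k <= s ->
  (forall i, (i < n)%N -> a i <= x i <= a i + s) ->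
  (eint n (fun z => (cubei n a s z * ker n k (2 * N) z v)%:E) <=
    (2 ^+ N * (2 ^+ N.+1 * 2 ^+ n * k ^+ n) * ker n s N x v)%:E)%E.
Proof.
move=> nN k0s ax; have /andP[k0 ks] := k0s; have s0 := lt_le_trans k0 ks.
have c0 : 0 <= 2 ^+ N * ker n s N x v by apply: mulr_ge0; [exact: exprn_ge0|exact/ltW/ker_gt0].
apply: (@le_trans _ _ (eint n (fun z => (2 ^+ N * ker n s N x v)%:E * (ker n k N v z)%:E)%E)).
  apply: le_integral_nomeas => w; first by rewrite lee_fin mulr_ge0 ?cubei_ge0// ltW ?ker_gt0.
  by rewrite -EFinM lee_fin; exact: kernel_shift.
have mk : mfr n (ker n k N v).
  apply: (@measurable_ker R n k N _ (E n) (fun=> v) (@co R n)) => // i; exact: measurable_co.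
rewrite /eint ge0_integralZl_EFin//; last 2 first.
- by move=> w _; rewrite lee_fin ltW ?ker_gt0.
- exact: mfe_EFin mk.
apply: le_trans (lee_wpmul2l _ (@eint_decay R n N v k nN k0)) _; first by rewrite lee_fin.
by rewrite -EFinM lee_fin mulrAC.
Qed.

Definition kmean n (k : R) N (g : (nat -> R) -> R) z : R := rint n (fun v => g v * ker n k N z v).

Lemma dom_ker n k N g z : 0 < k -> dom n g -> dom n (fun v => g v * ker n k N z v).
Proof.
move=> k0 dg; apply: (@dom_bmul R n g _ 1) => //.
  by apply: (@measurable_ker R n k N _ (E n) (fun=> z) (@co R n)) => // i; exact: measurable_co.
by move=> c; rewrite ger0_norm ?ker_le1// ltW ?ker_gt0.
Qed.

Lemma mfr_kmean n k N g : 0 < k -> mfr n g -> mfr n (kmean n k N g).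
Proof.
move=> k0 mg; apply: (@mfr_rint R n n (fun z v => g v * ker n k N z v)).
apply: measurable_funM; first exact: (measurableT_comp mg measurable_snd).
apply: (@measurable_ker R n k N _ (E n * E n)%type (fun w => co w.1) (fun w => co w.2)) => // i.
  exact: (measurableT_comp (@measurable_co R n i) measurable_fst).
exact: (measurableT_comp (@measurable_co R n i) measurable_snd).
Qed.

Lemma kmean_ge0 n k N g z : 0 < k -> (forall v, 0 <= g v) -> 0 <= kmean n k N g z.
Proof. by move=> k0 g0; apply: rint_ge0 => v; rewrite mulr_ge0// ltW ?ker_gt0. Qed.

(** By Tonelli the cube average falls on the kernel alone: local means at scale k, integrated over
    z, are bounded by k^n times the mean at scale s about x. *)
Lemma kmean_average n N a (s k : R) x g : (n < N)%N -> 0 < k <= s ->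
  (forall i, (i < n)%N -> a i <= x i <= a i + s) -> dom n g -> (forall v, 0 <= g v) ->
  (eint n (fun z => (cubei n a s z * kmean n k (2 * N) g z)%:E) <=
    (2 ^+ N * (2 ^+ N.+1 * 2 ^+ n * k ^+ n) * kmean n s N g x)%:E)%E.
Proof.
move=> nN k0s ax dg g0; have /andP[k0 ks] := k0s; have s0 := lt_le_trans k0 ks.
pose f (w : E n * E n) : \bar R := (cubei n a s (co w.1) * (g (co w.2) * ker n k (2 * N) (co w.1) (co w.2)))%:E.
have f0 (w : E n * E n) : (0 <= f w)%E by rewrite lee_fin mulr_ge0 ?cubei_ge0 ?mulr_ge0// ltW ?ker_gt0.
have mf : measurable_fun setT f.
  apply/measurable_EFinP; apply: measurable_funM; first exact: (measurableT_comp (@mfr_cubei R n a s) measurable_fst).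
  apply: measurable_funM; first exact: (measurableT_comp (dom_mfr dg) measurable_snd).
  apply: (@measurable_ker R n k _ _ (E n * E n)%type (fun w => co w.1) (fun w => co w.2)) => // i.
    exact: (measurableT_comp (@measurable_co R n i) measurable_fst).
  exact: (measurableT_comp (@measurable_co R n i) measurable_snd).
have k1 z v : 0 <= ker n k (2 * N) z v by exact/ltW/ker_gt0.
have -> : eint n (fun z => (cubei n a s z * kmean n k (2 * N) g z)%:E) = (\int[mu n]_z \int[mu n]_v f (z, v))%E.
  apply: eq_integral => w _; rewrite EFinM /kmean EFin_rint; last exact: dom_ker.
  rewrite /eint -ge0_integralZl_EFin ?cubei_ge0//.
  - by move=> v _; rewrite lee_fin mulr_ge0.
  - exact: mfe_EFin (dom_mfr (dom_ker _ _ k0 dg)).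
rewrite (fubini_tonelli (m1 := mu n) (m2 := mu n) f mf f0).
pose K := 2 ^+ N * (2 ^+ N.+1 * 2 ^+ n * k ^+ n) : R.
have K0 : 0 <= K.
  by apply: mulr_ge0; [exact: exprn_ge0|apply: mulr_ge0; [apply: mulr_ge0; exact: exprn_ge0|exact/exprn_ge0/ltW]].
apply: (@le_trans _ _ (\int[mu n]_v (K%:E * (g (co v) * ker n s N x (co v))%:E))%E).
  apply: le_integral_nomeas => v; first by apply: integral_ge0.
  have -> : (\int[mu n]_z f (z, v) = (g (co v))%:E * eint n (fun z => (cubei n a s z * ker n k (2 * N) z (co v))%:E))%E.
    rewrite /eint -ge0_integralZl_EFin//.
    - by apply: eq_integral => z _; rewrite /f/= -EFinM; congr EFin; ring.
    - by move=> z _; rewrite lee_fin mulr_ge0 ?cubei_ge0.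
    - apply/measurable_EFinP; apply: measurable_funM; first exact: mfr_cubei.
      apply: (@measurable_ker R n k _ _ (E n) (@co R n) (fun=> co v)) => // i; exact: measurable_co.
  apply: le_trans (lee_wpmul2l _ (kernel_average (co v) nN k0s ax)) _; first by rewrite lee_fin.
  by rewrite -!EFinM lee_fin mulrCA.
rewrite ge0_integralZl_EFin//; last 2 first.
- by move=> v _; rewrite lee_fin mulr_ge0// ltW ?ker_gt0.
- exact: mfe_EFin (dom_mfr (dom_ker _ _ s0 dg)).
by rewrite -/(eint n (fun v => (g v * ker n s N x v)%:E)) -EFin_rint -?EFinM//; exact: dom_ker.
Qed.

Lemma local_ker n k N g z : local n g -> local n (fun v => g v * ker n k N z v).
Proof.
move=> lg c c' cc; rewrite (lg c c' cc) /ker; congr (_ * (1 + _ / _)^-1 ^+ _).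
by apply: eq_bigr => i _; rewrite cc.
Qed.

(** Let h_j be the local mean of the j-th factor at scale k. Only the product of the means about x
    is controlled, so h_j is divided by a bound B_j of its cube average, the product of the B_j
    being bounded; the arithmetic-geometric mean inequality then bounds the product of the h_j / B_j
    by [En^l]. In the order M = 2 N l, the factor l pays for splitting the kernel into blocks and
    the factor 2 for [kernel_shift]. *)
Lemma blocks_majorant n l : (0 < n)%N -> (0 < l)%N ->
  let d := (l * n)%N in let N := d.+1 in let M := (2 * N * l)%N in
  exists C : R, 0 < C /\ forall (r : R) F (g : nat -> (nat -> R) -> R) x L,
    1 <= r -> (forall j, local n (g j)) -> (forall j, dom n (g j)) -> (forall j c, 0 <= g j c) ->
    (forall u, `|F u| `^ r <= \prod_(j < l) g j (shift (j * n) u)) -> 0 < L ->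
    (forall t, 0 < t -> (eint d (fun u => (\prod_(j < l) g j (shift (j * n) u) *
       \1_[set c | nrm d (fun i => c i - rep n x i) <= t] u)%:E) <= (L * t ^+ d)%:E)%E) ->
    (forall k, 0 < k -> (eint d (fun u => (`|F u * (weight d M (rep n x) k u)^-1| `^ r)%:E)
       <= (k ^+ d * (C * L))%:E)%E) /\
    (forall a s k, (forall i, (i < n)%N -> a i <= x i <= a i + s) -> 0 < k <= s ->
      exists En, [/\ mfr n En, forall z, 1 <= En z,
        forall z, (eint d (fun u => (`|F u * (weight d M (rep n z) k u)^-1| `^ r)%:E)
          <= (k ^+ d * (C * L * En z ^+ l))%:E)%E &
        (eint n (fun z => (cubei n a s z * En z)%:E) <= (2 * s ^+ n)%:E)%E]).
Proof.
move=> n0 l0 d N M; have d0 : (0 < d)%N by rewrite muln_gt0 l0.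
have oM : ~~ odd M by rewrite /M -mulnA oddM.
have M0 : (0 < M)%N by rewrite /M !muln_gt0 l0.
have nN : (n < N)%N by rewrite ltnS /d leq_pmull.
have dN : (d < N)%N by [].
have dM : (d < M)%N by apply: (leq_trans dN); rewrite /M -mulnA mulnCA leq_pmulr// muln_gt0.
pose K : R := 2 ^+ N * (2 ^+ N.+1 * 2 ^+ n).
have p2 m : 0 < 2 ^+ m :> R by exact: exprn_gt0.
have K0 : 0 < K by exact: mulr_gt0 (p2 _) (mulr_gt0 (p2 _) (p2 _)).
pose C : R := 2 ^+ M * (K ^+ l * 2 ^+ N.+1 + 2 ^+ M.+1).
have twoM : 0 < 2 ^+ M :> R by rewrite exprn_gt0.
exists C; split.
  by apply: mulr_gt0 twoM (addr_gt0 (mulr_gt0 _ (p2 _)) (p2 _)); exact: exprn_gt0.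
move=> r F g x L r1 lg dg g0 FP L0 HL.
pose Phi u := \prod_(j < l) g j (shift (j * n) u).
have P0 u : 0 <= Phi u by apply: prodr_ge0 => j _; exact: g0.
have mP : mfr d Phi by apply: mfr_blocks => // j; exact: dom_mfr.
split=> [k k0|a s k ax /andP[k0 ks]].
  apply: le_trans (weighted_le d (rep n x) r1 M0 oM k0 FP) _.
  have mk : mfr d (fun u => Phi u * ker d k M (rep n x) u).
    apply: measurable_funM => //.
    by apply: (@measurable_ker R d k M _ (E d) (fun=> rep n x) (@co R d)) => // i; exact: measurable_co.
  have -> : eint d (fun u => (2 ^+ M * (Phi u * ker d k M (rep n x) u))%:E) =
     ((2 ^+ M)%:E * eint d (fun u => (Phi u * ker d k M (rep n x) u)%:E))%E.
    rewrite /eint -ge0_integralZl_EFin ?(ltW twoM)//; last exact: mfe_EFin mk.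
    by move=> w _; rewrite lee_fin mulr_ge0// ltW ?ker_gt0.
  apply: le_trans (lee_wpmul2l _ (shell_ker mP P0 k0 (ltW L0) dM HL)) _; first by rewrite lee_fin ltW.
  rewrite -EFinM lee_fin /C; set X := k ^+ d; have X0 : 0 <= X by exact/exprn_ge0/ltW.
  have -> : X * (2 ^+ M * (K ^+ l * 2 ^+ N.+1 + 2 ^+ M.+1) * L) =
    2 ^+ M * (2 ^+ M.+1 * L * X) + X * (2 ^+ M * (K ^+ l * 2 ^+ N.+1) * L) by ring.
  rewrite lerDl; apply: mulr_ge0 => //; apply: mulr_ge0 (ltW L0); apply: mulr_ge0 (ltW twoM) _.
  by apply: mulr_ge0; apply: exprn_ge0 => //; exact: ltW.
have s0 := lt_le_trans k0 ks; have kss : 0 < k <= s by rewrite k0.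
pose h j := kmean n k (2 * N) (g j); pose I j := kmean n s N (g j) x.
have h0 j z : 0 <= h j z by exact: kmean_ge0.
have I0 j : 0 <= I j by exact: kmean_ge0.
have eh (k' : R) N' z j : 0 < k' -> eint n (fun v => (g j v * ker n k' N' z v)%:E) = (kmean n k' N' (g j) z)%:E.
  by move=> k'0; rewrite EFin_rint//; exact: dom_ker.
have blocks (k' : R) N' z : 0 < k' -> eint d (fun u => (Phi u * \prod_(j < l) ker n k' N' z (shift (j * n) u))%:E) =
    (\prod_(j < l) kmean n k' N' (g j) z)%:E.
  move=> k'0; rewrite -(@eint_blocks R l n (fun j v => g j v * ker n k' N' z v) (fun j => kmean n k' N' (g j) z)).
  - by apply: eq_integral => w _; rewrite -big_split.
  - by move=> j c; rewrite mulr_ge0// ltW ?ker_gt0.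
  - by move=> j; exact: dom_mfr (dom_ker _ _ k'0 (dg j)).
  - by move=> j; exact: local_ker.
  - by move=> j; exact: eh.
have mkp (k' : R) N' z : 0 < k' -> mfr d (fun u => Phi u * \prod_(j < l) ker n k' N' z (shift (j * n) u)).
  move=> k'0.
  have h1 j : mfr n (fun v => g j v * ker n k' N' z v) by exact: dom_mfr (dom_ker _ _ k'0 (dg j)).
  have h2 j : local n (fun v => g j v * ker n k' N' z v) by exact: local_ker.
  have := @mfr_blocks R l n (fun j v => g j v * ker n k' N' z v) d h1 h2.
  by congr mfr; apply/funext => u; rewrite -big_split.
have kp0 (k' : R) N' z u : 0 < k' -> 0 <= \prod_(j < l) ker n k' N' z (shift (j * n) u).
  by move=> k'0; apply: prodr_ge0 => j _; exact/ltW/ker_gt0.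
(* At the scale s of the cube and about x itself, the product of the block means is dominated by one
   kernel on R^d, to which the hypothesis on concentric boxes applies. *)
have II : \prod_(j < l) I j <= 2 ^+ N.+1 * L * s ^+ d.
  rewrite -lee_fin -blocks//; apply: le_trans (shell_ker mP P0 s0 (ltW L0) dN HL).
  apply: le_integral_nomeas => w; first by rewrite lee_fin mulr_ge0// kp0.
  by rewrite lee_fin ler_wpM2l//; exact: ker_blocks_le.
have hh z : (eint d (fun u => (`|F u * (weight d M (rep n z) k u)^-1| `^ r)%:E) <=
    (2 ^+ M * \prod_(j < l) h j z)%:E)%E.
  apply: le_trans (weighted_le d (rep n z) r1 M0 oM k0 FP) _.
  rewrite EFinM -blocks// /eint -ge0_integralZl_EFin ?(ltW twoM)//; last 2 first.
  - by move=> w _; rewrite lee_fin mulr_ge0// kp0.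
  - exact: mfe_EFin (mkp _ _ _ k0).
  apply: le_integral_nomeas => w; first by rewrite lee_fin; exact: mulr_ge0 (ltW twoM) (mulr_ge0 (P0 _) (ltW (ker_gt0 _ _ _ _ k0))).
  rewrite -EFinM lee_fin; apply: (ler_wpM2l (ltW twoM)); apply: ler_wpM2l; first exact: P0.
  exact: (@ker_blocks_ge R l n k (2 * N) z (co w) n0 k0).
(* Bound of the average of [h j] over the cube, as given by [kmean_average]. *)
pose b j := K * k ^+ n / s ^+ n * I j.
have kn0 : 0 < k ^+ n by rewrite exprn_gt0.
have sn0 : 0 < s ^+ n by rewrite exprn_gt0.
have b0 j : 0 <= b j by apply: mulr_ge0 (I0 j); apply: divr_ge0 (ltW sn0); apply: mulr_ge0; exact: ltW.
(* In the product of the [b j] the factor (k / s)^d meets the s^d of [II], so the side of the cube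
   disappears. *)
pose X := K ^+ l * 2 ^+ N.+1 * L * k ^+ d.
have X0 : 0 < X by exact: mulr_gt0 (mulr_gt0 (mulr_gt0 (exprn_gt0 _ K0) (p2 _)) L0) (exprn_gt0 _ k0).
have bX : \prod_(j < l) b j <= X.
  rewrite /b big_split/= prodr_const card_ord.
  have c0 : 0 <= (K * k ^+ n / s ^+ n) ^+ l.
    by apply: exprn_ge0; apply: divr_ge0 (ltW sn0); apply: mulr_ge0; exact: ltW.
  apply: le_trans (ler_wpM2l c0 II) _; rewrite /X le_eqVlt; apply/orP; left; apply/eqP.
  rewrite expr_div_n exprMn -!exprM [(n * l)%N]mulnC -/d.
  by set w := s ^+ d; field; rewrite /w gt_eqF// exprn_gt0.
have [B [B0 bB BX]] := prod_enlarge l0 b0 X0 bX.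
(* The 1 keeps [En] at least 1; the arithmetic mean has cube average at most 1 because each
   [h j / B j] does. Together they give the constant 2. *)
pose En z := 1 + (\sum_(j < l) h j z / B j) / l%:R.
have lR : 0 < l%:R :> R by rewrite ltr0n.
have hB z j : 0 <= h j z / B j by rewrite divr_ge0// ltW.
have S0 z : 0 <= \sum_(j < l) h j z / B j by apply: sumr_ge0 => j _; exact: hB.
have E1 z : 1 <= En z by rewrite lerDl divr_ge0// ltW.
have mh j : mfr n (h j) by apply: mfr_kmean => //; exact: dom_mfr.
exists En; split=> //.
- apply: measurable_funD => //; apply: measurable_funM => //; apply: measurable_sum => j.
  by apply: measurable_funM => //; exact: mh.
- move=> z; apply: le_trans (hh z) _; rewrite lee_fin.
  have amgm : \prod_(j < l) (h j z / B j) <= En z ^+ l.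
    have [+ _] := @leif_AGM R 'I_l predT (fun j => h j z / B j) (fun j _ => hB z j).
    rewrite cardT size_enum_ord => /le_trans; apply.
    apply: lerXn2r; rewrite ?nnegrE; first by rewrite divr_ge0// ltW.
      exact: le_trans ler01 (E1 z).
    by rewrite /En lerDr.
  have -> : \prod_(j < l) h j z = \prod_(j < l) B j * \prod_(j < l) (h j z / B j).
    by rewrite -big_split; apply: eq_bigr => j _ /=; rewrite mulrC divfK// gt_eqF.
  have p1 : 0 <= \prod_(j < l) (h j z / B j) by apply: prodr_ge0 => j _; exact: hB.
  have p3 : 0 <= \prod_(j < l) B j by apply: prodr_ge0 => j _; exact: ltW.
  apply: le_trans (ler_wpM2l (ltW twoM) (ler_pM p3 p1 BX amgm)) _.
  rewrite /X /C; set e := En z ^+ l; have e0 : 0 <= e by apply: exprn_ge0; exact: le_trans ler01 (E1 z).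
  set kd := k ^+ d; have kd0 : 0 <= kd by exact/exprn_ge0/ltW.
  rewrite [leRHS](_ : _ = 2 ^+ M * (K ^+ l * 2 ^+ N.+1 * L * kd * e) + kd * (2 ^+ M * 2 ^+ M.+1 * L * e)).
    rewrite lerDl; apply: mulr_ge0 kd0 (mulr_ge0 (mulr_ge0 (mulr_ge0 (ltW twoM) _) (ltW L0)) e0).
    exact: exprn_ge0.
  by ring.
- rewrite (_ : (fun z => _) = (fun z => ((cubei n a s z)%:E + \sum_(j < l) ((B j * l%:R)^-1 * (cubei n a s z * h j z))%:E)%E)); last first.
    apply/funext => z; rewrite sumEFin -EFinD; congr EFin; rewrite /En mulrDr mulr1; congr (_ + _).
    rewrite mulrA mulr_sumr mulr_suml; apply: eq_bigr => j _; field.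
    by rewrite !gt_eqF.
  have BV j : 0 <= (B j * l%:R)^-1 by rewrite invr_ge0 mulr_ge0// ltW.
  have q0 j z : (0 <= ((B j * l%:R)^-1 * (cubei n a s z * h j z))%:E)%E.
    by rewrite lee_fin; apply: mulr_ge0 (BV j) (mulr_ge0 (cubei_ge0 _ _ _ _) (h0 j z)).
  have mq0 j : mfe n (fun z => (cubei n a s z * h j z)%:E).
    by apply: mfe_EFin; apply: measurable_funM; [exact: mfr_cubei|exact: mh].
  have mq j : mfe n (fun z => ((B j * l%:R)^-1 * (cubei n a s z * h j z))%:E).
    by apply: mfe_EFin; apply: measurable_funM => //; apply: measurable_funM; [exact: mfr_cubei|exact: mh].
  rewrite /eint ge0_integralD//; last 4 first.
  - by move=> w _; rewrite lee_fin cubei_ge0.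
  - exact: (mfe_EFin (@mfr_cubei R n a s)).
  - by move=> w _; apply: sume_ge0 => j _; exact: q0.
  - by apply: emeasurable_sum => j; exact: mq.
  rewrite [X in (X + _)%E](eint_cubei n a (ltW s0)).
  rewrite ge0_integral_sum//; last by move=> j; exact: mq.
  apply: (@le_trans _ _ ((s ^+ n)%:E + \sum_(j < l) (s ^+ n / l%:R)%:E)%E); last first.
    by rewrite sumEFin sumr_const card_ord -[_ *+ l]mulr_natr divfK ?gt_eqF// -EFinD lee_fin; lra.
  apply: leeD => //; apply: lee_sum => j _.
  under eq_integral do rewrite EFinM.
  rewrite ge0_integralZl_EFin//; last 2 first.
  - by move=> w _; rewrite lee_fin; exact: mulr_ge0 (cubei_ge0 _ _ _ _) (h0 j _).
  - exact: mq0.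
  apply: le_trans (lee_wpmul2l _ (kmean_average nN kss ax (dg j) (g0 j))) _; first by rewrite lee_fin.
  rewrite -EFinM lee_fin; have bj := bB j (ltn_ord j).
  have -> : (B j * l%:R)^-1 * (2 ^+ N * (2 ^+ N.+1 * 2 ^+ n * k ^+ n) * kmean n s N (g j) x) =
     b j / B j * (s ^+ n / l%:R).
    by rewrite /b /K /I; set y := s ^+ n; field; rewrite /y !gt_eqF.
  by rewrite ler_piMl ?divr_ge0 ?(ltW sn0) ?(ltW lR)// ler_pdivrMr// mul1r.
Qed.

End KernelAverages.

(** * Low frequencies *)

Section Families.
Variable R : realType.
Local Notation E := (E R).
Implicit Types (c v p z u x y a : nat -> R) (F : (nat -> R) -> R) (S D : nat -> nat -> (nat -> R) -> R).

Lemma lipschitz_ider (f f' : R -> R) (B x y : R) : (forall t, ider f t (f' t)) ->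
  (forall t, `|f' t| <= B) -> `|f y - f x| <= B * `|y - x|.
Proof.
move=> ff' B'; wlog xy : x y / x <= y => [H|].
  have [/H//|/ltW/H] := leP x y; by rewrite distrC [`|x - y|]distrC.
have [->|nxy] := eqVneq x y; first by rewrite !subrr normr0 mulr0.
have lxy : x < y by rewrite lt_neqAle nxy.
have cf := ider_continuous ff'.
have [t _ ->] := @MVT R f f' x y lxy (fun t _ => ff' t) (continuous_subspaceT cf).
by rewrite normrM ler_wpM2r.
Qed.

Lemma normr_cosB1 (t : R) : `|cos t - 1| <= `|t|.
Proof.
have := @lipschitz_ider cos (fun t => - sin t) 1 0 t _ _; rewrite cos0 subr0 mul1r; apply.
  by move=> u; have := ider_cos (ider_id u); rewrite mul1r.
by move=> u; rewrite normrN normr_sin.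
Qed.

Lemma normr_sin_le (t : R) : `|sin t| <= `|t|.
Proof.
have := @lipschitz_ider sin cos 1 0 t _ _; rewrite sin0 !subr0 mul1r; apply.
  by move=> u; have := ider_sin (ider_id u); rewrite mul1r.
by move=> u; rewrite normr_cos.
Qed.

(** Like [jet], but with measurability in place of domination, so that trigonometric factors belong
    to it and products can be formed; [sfam_jet] recovers domination from bounds and a bounded
    support. *)
Definition sfam d M S := forall e, (e < d)%N ->
  [/\ S e 0%N = S 0%N 0%N, forall i, (i <= M)%N -> mfr d (S e i),
      forall i, (i < M)%N -> isd e (S e i) (S e i.+1) &
      forall i, (i <= M)%N -> slice_cont e (S e i)].

Lemma sfam_jet d M A (k W : R) S : 0 <= A -> 0 < k -> sfam d M S -> jbound d M A k S -> jsupp d M W S -> jet d M S.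
Proof.
move=> A0 k0 sS bS wS e ed; have [e0 mS iS cS] := sS e ed; split=> //; split=> // i iM.
apply: (@dom_supp R d W (A * k ^+ i)); [|exact: mS|by move=> c; exact: bS|exact: wS].
by rewrite mulr_ge0// exprn_ge0// ltW.
Qed.

(** Leibniz formula, so that the family of a product is the product of the families. *)
Definition fmul S D e i c : R := \sum_(j < i.+1) 'C(i, j)%:R * (S e j c * D e (i - j)%N c).
Definition fadd S D e i c : R := S e i c + D e i c.
Definition fsub S D e i c : R := S e i c - D e i c.

Lemma fmul0 S D e c : fmul S D e 0%N c = S e 0%N c * D e 0%N c.
Proof. by rewrite /fmul big_ord1 bin0 mul1r. Qed.

Lemma sfam_mul d M S D : sfam d M S -> sfam d M D -> sfam d M (fmul S D).
Proof.
move=> sS sD e ed; have [eS mS iS cS] := sS e ed; have [eD mD iD cD] := sD e ed.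
split.
- by apply/funext => c; rewrite !fmul0 eS eD.
- move=> i iM; apply: measurable_sum => j; apply: measurable_funM => //; apply: measurable_funM.
    by apply: mS; rewrite (leq_trans _ iM)// -ltnS.
  by apply: mD; rewrite (leq_trans (leq_subr _ _)).
- move=> i iM c t; apply: (@ider_leibniz R (fun j s => S e j (upd c e s)) (fun j s => D e j (upd c e s))).
    by move=> j ji; apply: iS; exact: leq_ltn_trans iM.
  by move=> j ji; apply: iD; exact: leq_ltn_trans iM.
- move=> i iM c; apply: cont_sum => j; apply: contM; first exact: cont_cst.
  apply: contM; first by apply: cS; rewrite (leq_trans _ iM)// -ltnS.
  by apply: cD; rewrite (leq_trans (leq_subr _ _)).
Qed.

Lemma sfam_add d M S D : sfam d M S -> sfam d M D -> sfam d M (fadd S D).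
Proof.
move=> sS sD e ed; have [eS mS iS cS] := sS e ed; have [eD mD iD cD] := sD e ed.
split.
- by apply/funext => c; rewrite /fadd eS eD.
- by move=> i iM; apply: measurable_funD; [exact: mS|exact: mD].
- by move=> i iM c t; apply: iderD; [exact: iS|exact: iD].
- by move=> i iM c; apply: contD; [exact: cS|exact: cD].
Qed.

Lemma sfam_opp d M S : sfam d M S -> sfam d M (fun e i c => - S e i c).
Proof.
move=> sS e ed; have [eS mS iS cS] := sS e ed; split.
- by apply/funext => c; rewrite eS.
- by move=> i iM; have := measurable_funM (@measurable_cst _ _ (E d) R setT (-1)) (mS i iM);
    congr measurable_fun; apply/funext => w /=; rewrite mulN1r.
- move=> i iM c t; apply: ider_eq (_ : ider _ t (-1 * S e i.+1 (upd c e t))) _; last by rewrite mulN1r.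
  by have := iderZ (-1) (iS i iM c t); under eq_fun do rewrite mulN1r.
- by move=> i iM c t; apply: cvgN; exact: cS.
Qed.

Lemma sfam_sub d M S D : sfam d M S -> sfam d M D -> sfam d M (fsub S D).
Proof. by move=> sS sD; exact: sfam_add sS (sfam_opp sD). Qed.

Lemma fmul_bound M (A B k : R) S D e i c : 0 <= A -> 0 <= B -> 0 <= k -> (i <= M)%N ->
  (forall j, (j <= M)%N -> `|S e j c| <= A * k ^+ j) ->
  (forall j, (j <= M)%N -> `|D e j c| <= B * k ^+ j) ->
  `|fmul S D e i c| <= 2 ^+ M * A * B * k ^+ i.
Proof.
move=> A0 B0 k0 iM SA DB; rewrite (le_trans (ler_norm_sum _ _ _))//.
apply: (@le_trans _ _ (\sum_(j < i.+1) 'C(i, j)%:R * (A * B * k ^+ i))).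
  apply: ler_sum => j _; rewrite normrM normr_nat ler_wpM2l// normrM.
  have ji : (j <= i)%N by rewrite -ltnS.
  have := ler_pM (normr_ge0 _) (normr_ge0 _) (SA j (leq_trans ji iM)) (DB (i - j)%N (leq_trans (leq_subr _ _) iM)).
  by rewrite mulrACA -exprD subnKC.
rewrite -mulr_suml -natr_sum.
have -> : (\sum_(j < i.+1) 'C(i, j) = 2 ^ i)%N.
  by rewrite -[2%N]/(1 + 1)%N expnDn; apply: eq_bigr => j _; rewrite !exp1n !muln1.
rewrite natrX -!mulrA; apply: ler_pM => //.
- exact: mulr_ge0 A0 (mulr_ge0 B0 (exprn_ge0 _ k0)).
- by rewrite ler_eXn2l// ltr1n.
Qed.

Lemma fmul_supp d M W S D : jsupp d M W S -> jsupp d M W (fmul S D).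
Proof.
move=> sS e i ed iM c cW; rewrite /fmul big1// => j _.
by rewrite (sS e j ed _ c cW) ?mul0r ?mulr0// (leq_trans _ iM)// -ltnS.
Qed.

(* The [j]-th derivative in [c e] of [cos (2 pi c.v + phi) - kap]. *)
Definition trg d v (phi kap : R) e j c : R :=
  (2 * pi * v e) ^+ j * cos (2 * pi * dot d c v + (phi + j%:R * (pi / 2))) - (j == 0%N)%:R * kap.

Lemma trg_isd d v phi kap e j : (e < d)%N -> isd e (trg d v phi kap e j) (trg d v phi kap e j.+1).
Proof.
move=> ed c t; have H := iderD (iderZ ((2 * pi * v e) ^+ j) (ider_cos (ider_phase c v (phi + j%:R * (pi / 2)) t ed)))
  (ider_cst (- ((j == 0%N)%:R * kap)) t).
apply: ider_eq H _; rewrite addr0 /trg mul0r subr0 exprS.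
have -> : phi + j.+1%:R * (pi / 2) = phi + j%:R * (pi / 2) + pi / 2 by rewrite -natr1; ring.
rewrite [2 * pi * dot d (upd c e t) v + (_ + pi / 2)]addrA cosDpihalf; ring.
Qed.

Lemma trg_sfam d M v phi kap : sfam d M (trg d v phi kap).
Proof.
move=> e ed; split.
- by apply/funext => c; rewrite /trg !expr0.
- move=> i _; apply: measurable_funB => //; apply: measurable_funM => //.
  exact: (mfr_cos (@mfr_phase R d v _)).
- by move=> i _; exact: trg_isd.
- by move=> i _ c; exact: (ider_continuous (fun t => @trg_isd d v phi kap e i ed c t)).
Qed.

Lemma dot_le d c v (W s : R) : 0 <= s -> nrm d c <= W -> (forall e, (e < d)%N -> `|v e| <= s) ->
  `|dot d c v| <= d%:R * (W * s).
Proof.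
move=> s0 cW vs; rewrite (le_trans (ler_norm_sum _ _ _))//.
rewrite -[d in d%:R]card_ord mulr_natl -sumr_const; apply: ler_sum => i _.
by rewrite normrM ler_pM ?vs// (le_trans (nrm_coord c (ltn_ord i))).
Qed.

Lemma pi_le4 : pi <= 4 :> R.
Proof. by have := @pihalf_lt2 R; lra. Qed.

(** The order 0 term is small by cancellation, |cos t - kap| <= |t| with t of size d W s. From order
    1 on, each derivative brings a factor of size s; one of them becomes W s k since W k >= 1, the
    others are at most k. *)
Lemma trg_bound d M v (phi kap W s k : R) e j c : (0 < d)%N -> 0 < s -> s <= k -> 1 <= W * k ->
  nrm d c <= W -> (e < d)%N -> (forall e, (e < d)%N -> `|v e| <= s) -> (j <= M)%N ->
  (forall t, `|cos (t + phi) - kap| <= `|t|) ->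
  `|trg d v phi kap e j c| <= d%:R * 8 ^+ M.+1 * (W * s) * k ^+ j.
Proof.
move=> d0 s0 sk Wk cW ed vs jM H; have k0 := lt_le_trans s0 sk.
have W0 : 0 < W by rewrite -(pmulr_lgt0 _ k0) (lt_le_trans ltr01).
have Ws : 0 <= W * s by rewrite mulr_ge0// ltW.
have p4 := pi_le4; have p0 := pi_ge0 R.
have d1 : 1 <= d%:R :> R by rewrite ler1n.
case: j jM => [|j] jM.
  rewrite /trg expr0 mul1r mul1r mul0r addr0 expr0 mulr1.
  apply: le_trans (H _) _; rewrite !normrM normr_nat (ger0_norm p0).
  apply: (@le_trans _ _ (8 * (d%:R * (W * s)))).
    by apply: ler_pM => //; [rewrite mulr_ge0|lra|exact: dot_le (ltW s0) cW vs].
  rewrite mulrCA mulrA ler_wpM2r// ler_wpM2l// exprS ler_peMr//; apply: exprn_ege1; lra.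
rewrite /trg mul0r subr0 normrM.
apply: (@le_trans _ _ ((8 * s) ^+ j.+1)).
  rewrite -[leRHS]mulr1; apply: ler_pM => //; last exact: normr_cos.
  rewrite normrX; apply: lerXn2r; rewrite ?nnegrE ?mulr_ge0 ?(ltW s0)//.
  rewrite !normrM normr_nat (ger0_norm p0); apply: ler_pM => //; [by rewrite mulr_ge0|lra|exact: vs].
rewrite exprMn.
have a1 : 8 ^+ j.+1 <= 8 ^+ M.+1 :> R by rewrite ler_eXn2l ?ltr1n// ltnW.
have a2 : s ^+ j.+1 <= W * s * k ^+ j.+1.
  rewrite !exprS; have -> : W * s * (k * k ^+ j) = (W * k) * (s * k ^+ j) by set kj := k ^+ j; ring.
  apply: (@le_trans _ _ (s * k ^+ j)).
    by rewrite ler_wpM2l ?(ltW s0)// lerXn2r ?nnegrE ?(ltW s0) ?(ltW k0).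
  by rewrite ler_peMl// mulr_ge0 ?exprn_ge0 ?(ltW s0) ?(ltW k0).
rewrite -[leRHS]mulrA; apply: ler_pM; [exact: exprn_ge0|by rewrite exprn_ge0// ltW| |exact: a2].
by apply: le_trans a1 _; rewrite ler_peMl// exprn_ge0.
Qed.

(** Translating the kernel by v modulates the symbol: the phase 2 pi c.v is split off by the
    addition formula and absorbed into the symbol. *)
Lemma osc_translate d al psi w v : dom d al ->
  osc d al psi (fun i => w i + v i) =
  osc d (fun c => al c * trg d v 0 0 0 0 c) psi w + osc d (fun c => al c * trg d v (- (pi / 2)) 0 0 0 c) (psi + pi / 2) w.
Proof.
move=> da; have mt phi : mfr d (trg d v phi 0 0 0).
  by apply: measurable_funB => //; apply: measurable_funM => //; exact: (mfr_cos (@mfr_phase R d v _)).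
have dt phi : dom d (fun c => al c * trg d v phi 0 0 0 c).
  apply: (dom_bmul (K := 1) da (mt phi)) => c.
  by rewrite /trg expr0 mul1r mul1r subr0; exact: normr_cos.
rewrite /osc -rintD; [|exact: dom_cos..]; congr rint; apply/funext => c.
rewrite dotD /trg !expr0 !mul1r !mul0r !addr0 !subr0.
set t := 2 * pi * dot d c v; set w' := 2 * pi * dot d c w.
rewrite (_ : 2 * pi * (dot d c w + dot d c v) + psi = (w' + psi) + t); last by rewrite /w' /t; ring.
rewrite addrA cosDpihalf cosD.
have -> : cos (t - pi / 2) = sin t by rewrite -cosN opprB cosB cos_pihalf sin_pihalf mul0r add0r mul1r.
ring.
Qed.

Definition lipsym n d M (A k : R) (Sy : (nat -> R) -> nat -> nat -> (nat -> R) -> R) :=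
  forall x y e i c, (e < d)%N -> (i <= M)%N ->
    `|Sy y e i c - Sy x e i c| <= A / k * (\sum_(a < n) `|y a - x a|) * k ^+ i.

Lemma Sop_symD d (al be : (nat -> R) -> R) psi F p : dom d al -> dom d be -> dom d F ->
  Sop d (fun c => al c + be c) psi F p = Sop d al psi F p + Sop d be psi F p.
Proof.
move=> da db dF; rewrite /Sop -rintD; [|exact: dom_Sop..].
congr rint; apply/funext => u; rewrite -mulrDr /osc -rintD; [|exact: dom_cos..].
by congr (_ * rint d _); apply/funext => c; rewrite mulrDl.
Qed.

(** Moving from x to y changes the symbol, which is Lipschitz at scale k, and translates the kernel,
    which modulates the symbol. Both changes are symbols of the original type with a bound smaller
    by a factor of order W s, so the pointwise estimate at x applies to them. *)
Lemma low_frequency n d M : (0 < n)%N -> (0 < d)%N -> ~~ odd M -> exists C : R, 0 < C /\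
  forall (r A W k K1 H : R) Sy F psi x y s,
    1 < r <= 2 -> 0 < A -> 0 < W -> 0 < s <= k -> 1 <= W * k -> 0 < H ->
    A `^ r * (2 * W) ^+ d * k ^+ d <= K1 ->
    (forall x, [/\ sfam d M (Sy x), jbound d M A k (Sy x) & jsupp d M W (Sy x)]) ->
    lipsym n d M A k Sy -> dom d F ->
    (forall i, (i < n)%N -> `|y i - x i| <= s) ->
    (eint d (fun u => (`|F u * (weight d M (rep n x) k u)^-1| `^ r)%:E) <= (k ^+ d * H)%:E)%E ->
    `|Top n d Sy psi F y - Top n d Sy psi F x| <= C * (W * s) * (K1 * H) `^ r^-1.
Proof.
move=> n0 d0 oM; have [C [C0 HC]] := @Sop_wpointwise R d M d0 oM.
pose B : R := d%:R * 8 ^+ M.+1.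
have B0 : 0 < B by apply: mulr_gt0; [rewrite ltr0n|exact: exprn_gt0].
pose C' : R := n%:R + 2 ^+ M * B; have C'0 : 0 < C' by rewrite ltr_pwDl ?ltr0n// ltW// mulr_gt0// exprn_gt0.
exists (2 * (C * C')); split; first by rewrite !mulr_gt0.
move=> r A W k K1 H Sy F psi x y s r12 A0 W0 /andP[s0 sk] Wk H0 AK gS lS dF yx FR.
have k0 := lt_le_trans s0 sk; have Ws0 : 0 < W * s by rewrite mulr_gt0.
have [sy by' wy] := gS y; have [sx bx wx] := gS x.
pose v e := rep n y e - rep n x e.
have vs e : (e < d)%N -> `|v e| <= s by move=> _; apply: yx; rewrite ltn_mod.
have [lam [l0 lamR lamK]] := lam_exists r12 A0 W0 k0 H0 AK.
have Rp0 : 0 <= k ^+ d * H by apply: mulr_ge0; [exact/exprn_ge0/ltW|exact: ltW].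
(* Cosine and sine parts of the change: (Sy y - Sy x) + Sy y (cos - 1), and Sy y sin, the latter
   with the outer phase advanced by pi/2. *)
pose J1 := fadd (fsub (Sy y) (Sy x)) (fmul (Sy y) (trg d v 0 1)).
pose J2 := fmul (Sy y) (trg d v (- (pi / 2)) 0).
have AB0 : 0 <= A * (W * s) by rewrite mulr_ge0// ltW.
have tb phi kap : (forall t, `|cos (t + phi) - kap| <= `|t|) -> forall e i c, (e < d)%N -> (i <= M)%N -> nrm d c <= W ->
    `|fmul (Sy y) (trg d v phi kap) e i c| <= 2 ^+ M * A * (B * (W * s)) * k ^+ i.
  move=> Hp e i c ed iM cW; apply: (@fmul_bound M) => //; [exact: ltW|by rewrite mulr_ge0// ltW|exact: ltW|..].
    by move=> j jM; exact: by'.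
  by move=> j jM; exact: trg_bound.
have c1 t : `|cos (t + 0) - 1| <= `|t| :> R by rewrite addr0; exact: normr_cosB1.
have c2 t : `|cos (t + - (pi / 2)) - 0| <= `|t| :> R.
  have -> : cos (t + - (pi / 2)) = sin t by rewrite -cosN opprD opprK addrC cosB cos_pihalf sin_pihalf mul0r add0r mul1r.
  by rewrite subr0; exact: normr_sin_le.
have w1 : jsupp d M W J1.
  move=> e i ed iM c cW; rewrite /J1 /fadd /fsub (wy e i ed iM c cW) (wx e i ed iM c cW) subrr add0r.
  exact: (fmul_supp _ wy ed iM cW).
have w2 : jsupp d M W J2 by exact: fmul_supp wy.
have outside S' e i c : jsupp d M W S' -> (e < d)%N -> (i <= M)%N -> ~~ (nrm d c <= W) -> `|S' e i c| <= A * (W * s) * C' * k ^+ i.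
  move=> wS ed iM; rewrite -ltNge => cW; rewrite (wS e i ed iM c cW) normr0.
  by rewrite !mulr_ge0 ?exprn_ge0 ?(ltW A0) ?(ltW W0) ?(ltW s0) ?(ltW k0) ?(ltW C'0).
have b1 : jbound d M (A * (W * s) * C') k J1.
  move=> e i c ed iM; have [cW|cW] := boolP (nrm d c <= W); last exact: outside.
  rewrite /J1 /fadd (le_trans (ler_normD _ _))//.
  have -> : A * (W * s) * C' * k ^+ i = A * (n%:R * (W * s)) * k ^+ i + 2 ^+ M * A * (B * (W * s)) * k ^+ i.
    by rewrite /C'; set P := 2 ^+ M; set q := k ^+ i; set b := B; ring.
  apply: lerD; last exact: tb.
  apply: le_trans (lS x y e i c ed iM) _; rewrite ler_wpM2r ?exprn_ge0 ?(ltW k0)// -mulrA ler_wpM2l ?(ltW A0)//.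
  rewrite ler_pdivrMl//; apply: (@le_trans _ _ (n%:R * s)).
    rewrite -[n in n%:R]card_ord mulr_natl -sumr_const; apply: ler_sum => a _; exact: yx.
  have -> : k * (n%:R * (W * s)) = (W * k) * (n%:R * s) by ring.
  by rewrite ler_peMl// mulr_ge0// ltW.
have b2 : jbound d M (A * (W * s) * C') k J2.
  move=> e i c ed iM; have [cW|cW] := boolP (nrm d c <= W); last exact: outside.
  apply: le_trans (tb _ _ c2 e i c ed iM cW) _; rewrite ler_wpM2r ?exprn_ge0 ?(ltW k0)//.
  rewrite /C' [leRHS](_ : _ = A * (W * s) * n%:R + 2 ^+ M * A * (B * (W * s))); last first.
    by set P := 2 ^+ M; set b := B; ring.
  by rewrite lerDr mulr_ge0.
have AC0 : 0 <= A * (W * s) * C' by rewrite mulr_ge0// ltW.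
have s1 : sfam d M J1 := sfam_add (sfam_sub sy sx) (sfam_mul sy (@trg_sfam d M v 0 1)).
have s2 : sfam d M J2 := sfam_mul sy (@trg_sfam d M v (- (pi / 2)) 0).
have j1 := sfam_jet AC0 k0 s1 b1 w1; have j2 := sfam_jet AC0 k0 s2 b2 w2.
have jx := sfam_jet (ltW A0) k0 sx bx wx; have jy := sfam_jet (ltW A0) k0 sy by' wy.
have dj S : jet d M S -> dom d (S 0%N 0%N) by move=> jS; have [_ [dc _ _]] := jS 0%N d0; exact: dc.
have TE : Top n d Sy psi F y = Top n d Sy psi F x + Sop d (J1 0%N 0%N) psi F (rep n x) +
    Sop d (J2 0%N 0%N) (psi + pi / 2) F (rep n x).
  rewrite /Top -Sop_symD; [|exact: dj..|exact: dF].
  rewrite /Sop -rintD; [|by apply: dom_Sop dF => //; apply: domD; exact: dj|by apply: dom_Sop dF; exact: dj].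
  congr rint; apply/funext => u; rewrite -mulrDr; congr (_ * _).
  have := @osc_translate d (Sy y 0%N 0%N) psi (fun i => rep n x i - u i) v (dj _ jy).
  rewrite (_ : (fun i => _ + v i) = (fun i => rep n y i - u i)); last first.
    by apply/funext => i; rewrite /v; ring.
  move=> ->; congr (osc d _ _ _ + osc d _ _ _); apply/funext => c.
    rewrite /J1 /fadd /fsub fmul0 /trg !expr0 !mul1r !mul0r; ring.
  by rewrite /J2 fmul0.
have fin S ps : jet d M S -> jbound d M (A * (W * s) * C') k S -> jsupp d M W S ->
    `|Sop d (S 0%N 0%N) ps F (rep n x)| <= C * C' * (W * s) * (K1 * H) `^ r^-1.
  move=> jS bS wS.
  have := HC r S _ k W F _ lam ps (rep n x) (rep n x) r12 jS AC0 k0 W0 bS wS dF Rp0 l0 _ FR lamR.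
  move=> h; apply: le_trans (h _) _; first by move=> e ed; rewrite subrr normr0 ltW.
  have -> : C * (A * (W * s) * C') * lam = C * C' * (W * s) * (A * lam) by ring.
  by rewrite ler_wpM2l// !mulr_ge0 ?(ltW C0) ?(ltW C'0) ?(ltW W0) ?(ltW s0).
have f1 := fin J1 psi j1 b1 w1; have f2 := fin J2 (psi + pi / 2) j2 b2 w2.
have alg (t t1 t2 : R) : t + t1 + t2 - t = t1 + t2 by ring.
rewrite TE alg (le_trans (ler_normD _ _))//.
rewrite (_ : 2 * (C * C') * (W * s) * _ = C * C' * (W * s) * (K1 * H) `^ r^-1 + C * C' * (W * s) * (K1 * H) `^ r^-1).
  exact: lerD.
by set w := _ `^ r^-1; ring.
Qed.

End Families.

(** * Littlewood-Paley pieces of a symbol *)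

Section Symbols.
Variable R : realType.
Local Notation E := (E R).
Implicit Types (c v p z u x y a : nat -> R) (F : (nat -> R) -> R) (S D : nat -> nat -> (nat -> R) -> R).

Definition cutfam d (b : nat -> R -> R) (W : R) e j c : R :=
  W^-1 ^+ j * (b j (c e / W) * \prod_(i < d | i != e :> nat) b 0%N (c i / W)).

Section Cutoffs.
Variables (d M : nat) (b : nat -> R -> R) (B : R).
Hypotheses (cut : is_cutoff M b B) (B0 : 0 <= B).

Lemma cutfam00 W e c : (e < d)%N -> cutfam d b W e 0 c = boxcut d b W c.
Proof.
by move=> ed; rewrite /cutfam expr0 mul1r /boxcut [RHS](bigD1 (Ordinal ed)).
Qed.

Lemma cutfam_sfam W : (0 < d)%N -> 0 < W -> sfam d M (cutfam d b W).
Proof.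
have [cb db bB b2 b1] := cut.
move=> d0 W0 e ed; pose P c := \prod_(i < d | i != e :> nat) b 0%N (c i / W).
have Pupd c s : P (upd c e s) = P c by apply: eq_bigr => i; rewrite /upd => /negbTE ->.
split.
- by apply/funext => c; rewrite !cutfam00.
- move=> j jM; apply: measurable_funM => //; apply: measurable_funM.
    by apply: mfr_cut; exact: cb.
  by apply: (@mfr_prod R d _ _ _ (fun (i : 'I_d) c => b 0%N (c i / W))) => i; apply: mfr_cut; exact: cb.
- move=> i iM c t.
  rewrite (_ : (fun s => _) = fun s => W^-1 ^+ i * (b i (W^-1 * s + 0) * P c)); last first.
    by apply/funext => s; rewrite /cutfam -/(P _) Pupd /upd eqxx addr0 [W^-1 * s]mulrC.
  have H := iderZ (W^-1 ^+ i) (iderM (@ider_comp _ (b i) (fun s => W^-1 * s + 0) t _ _ (db i (W^-1 * t + 0) iM) (ider_lin W^-1 0 t)) (ider_cst (P c) t)).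
  apply: ider_eq H _; rewrite mulr0 !addr0 /cutfam -/(P _) Pupd /upd eqxx exprSr [t / W]mulrC.
  by ring.
- move=> i iM c; rewrite (_ : (fun s => _) = fun s => W^-1 ^+ i * (b i (W^-1 * s + 0) * P c)); last first.
    by apply/funext => s; rewrite /cutfam -/(P _) Pupd /upd eqxx addr0 [W^-1 * s]mulrC.
  apply: contM; first exact: cont_cst.
  by apply: contM; [apply: cont_comp; [exact: cb|exact: cont_lin]|exact: cont_cst].
Qed.

Lemma cutfam_bound W e j c : (e < d)%N -> (j <= M)%N -> 0 < W -> `|cutfam d b W e j c| <= (1 + B) ^+ d * W^-1 ^+ j.
Proof.
have [cb db bB b2 b1] := cut.
move=> ed jM W0; have Wj : 0 <= W^-1 ^+ j by rewrite exprn_ge0// invr_ge0 ltW.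
rewrite normrM mulrC (ger0_norm Wj); apply: ler_wpM2r => //; rewrite normrM.
rewrite -[d in leRHS](ltn_predK ed) exprS; apply: ler_pM => //.
  by rewrite (le_trans (bB j _ jM))// lerDr.
have := @ler_prod R _ (index_enum _) (predC1 (Ordinal ed)) (fun i : 'I_d => `|b 0%N (c i / W)|) (fun=> 1 + B).
rewrite prodr_const cardC1 card_ord normr_prod; apply.
by move=> i _; rewrite normr_ge0/= (le_trans (bB 0%N _ isT))// lerDr.
Qed.

Lemma cutfam_supp W : 0 < W -> jsupp d M (2 * W) (cutfam d b W).
Proof.
have [cb db bB b2 b1] := cut.
move=> W0 e j ed jM c cW; have n0 : 0 < nrm d c by rewrite (le_lt_trans _ cW)// mulr_ge0 ?(ltW W0).
have [e' ed' he'] := nrm_attained n0.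
have c2 : 2 <= `|c e' / W| by rewrite normrM normfV (gtr0_norm W0) ler_pdivlMr// -he' ltW.
rewrite /cutfam; have [ee|ee] := eqVneq e' e.
  by rewrite -ee b2// mul0r mulr0.
by rewrite (bigD1 (Ordinal ed'))//= (b2 0%N _ isT c2) mul0r !mulr0.
Qed.

Lemma cutfam_one W e j c : (e < d)%N -> (j <= M)%N -> 0 < W -> nrm d c <= W -> cutfam d b W e j c = (j == 0%N)%:R.
Proof.
have [cb db bB b2 b1] := cut.
move=> ed jM W0 cW; have cl i : (i < d)%N -> `|c i / W| <= 1.
  move=> id; rewrite normrM normfV (gtr0_norm W0) ler_pdivrMr// mul1r.
  by rewrite (le_trans (nrm_coord c id)).
rewrite /cutfam b1 ?cl// big1 ?mulr1; last by move=> i _; rewrite b1 ?cl.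
by case: j jM => [|j] _; rewrite ?expr0 ?mulr1// mulr0.
Qed.

(** Differences of consecutive dyadic cutoffs: their sum telescopes to a cutoff at 2^K, and each
    lives on an annulus. *)
Definition ring k e j c : R :=
  if k is k'.+1 then fsub (cutfam d b (2 ^+ k)) (cutfam d b (2 ^+ k')) e j c else cutfam d b 1 e j c.

(** The lower bound is half of 2^k, the radius up to which both cutoffs equal 1; the piece k = 0
    contains the origin and has none. *)
Definition annulus (k : nat) c := (nrm d c <= 2 * 2 ^+ k) /\ ((0 < k)%N -> 2 ^+ k <= 2 * nrm d c).

Lemma ring_sfam k : (0 < d)%N -> sfam d M (ring k).
Proof.
case: k => [|k] d0; first exact: cutfam_sfam.
by apply: (@sfam_sub R d M (cutfam d b (2 ^+ k.+1)) (cutfam d b (2 ^+ k))); apply: cutfam_sfam => //; exact: exprn_gt0.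
Qed.

Lemma ring_supp k e j c : (e < d)%N -> (j <= M)%N -> ~ annulus k c -> ring k e j c = 0.
Proof.
move=> ed jM /not_andP[/negP|/not_implyP[k0 /negP]]; rewrite -ltNge => h.
  case: k h => [|k] h /=; first by apply: cutfam_supp => //; move: h; rewrite expr0.
  rewrite /fsub cutfam_supp ?exprn_gt0// cutfam_supp ?subrr ?exprn_gt0//.
  by apply: lt_trans h; rewrite ltr_pM2l// ltr_eXn2l// ltr1n.
case: k k0 h => // k _ h; have hk : nrm d c <= 2 ^+ k by move: h; rewrite exprS ltr_pM2l// => /ltW.
rewrite /ring /fsub !cutfam_one ?exprn_gt0 ?subrr//.
by apply: le_trans hk _; rewrite ler_eXn2l// ltr1n.
Qed.

Lemma ring_bound k e j c : (e < d)%N -> (j <= M)%N ->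
  `|ring k e j c| <= (1 + B) ^+ d * (1 + 2 ^+ M) * (2 ^+ k)^-1 ^+ j.
Proof.
move=> ed jM; have B1 : 0 <= (1 + B) ^+ d by rewrite exprn_ge0// addr_ge0.
have M1 : 1 <= 1 + 2 ^+ M :> R by rewrite lerDl exprn_ge0.
case: k => [|k] /=.
  apply: le_trans (cutfam_bound _ _ _ _) _ => //; rewrite expr0 invr1 expr1n !mulr1.
  by rewrite ler_peMr.
rewrite /fsub (le_trans (ler_normB _ _))// mulrDr mulr1 mulrDl lerD ?cutfam_bound ?exprn_gt0//.
apply: le_trans (cutfam_bound _ _ _ _) _; rewrite ?exprn_gt0// -mulrA ler_wpM2l//.
(* The inner cutoff has half the scale, so its j-th derivative is larger by 2^j <= 2^M; this is the
   second summand of 1 + 2^M. *)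
have -> : (2 ^+ k : R)^-1 ^+ j = 2 ^+ j * (2 ^+ k.+1)^-1 ^+ j.
  by rewrite -exprMn; congr (_ ^+ j); rewrite exprS invfM mulrA divff// mul1r.
by rewrite ler_wpM2r ?exprn_ge0 ?invr_ge0 ?exprn_ge0// ler_eXn2l ?ltr1n.
Qed.

Lemma ring_sum K c : \sum_(k < K.+1) ring k 0 0 c = cutfam d b (2 ^+ K) 0 0 c.
Proof.
elim: K => [|K IH]; first by rewrite big_ord1 expr0.
by rewrite big_ord_recr IH /= /fsub addrC subrK.
Qed.

End Cutoffs.

(** The matrix is rounded down to the dyadic grid: the rounded map takes countably many values, each
    on a measurable set, and continuity gives pointwise convergence of f along it. *)
Lemma measurable_contmx (p q : nat) dO (O : measurableType dO) (f : 'M[R]_(p, q) -> R) (X : O -> 'M[R]_(p, q)) :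
  (forall M, {for M, continuous f}) -> (forall i j, measurable_fun setT (fun w => X w i j)) ->
  measurable_fun setT (fun w => f (X w)).
Proof.
move=> cf mX.
pose Z (k : nat) w : 'M[int]_(p, q) := \matrix_(i, j) Num.floor (2 ^+ k * X w i j).
pose emb (k : nat) (m : 'M[int]_(p, q)) : 'M[R]_(p, q) := \matrix_(i, j) (2 ^- k * (m i j)%:~R).
have k0 (k : nat) : 0 < 2 ^+ k :> R by exact: exprn_gt0.
apply: (@measurable_fun_cvg _ O R setT (fun k w => f (emb k (Z k w)))).
- move=> k _ A mA; rewrite setTI.
  rewrite (_ : _ @^-1` A = \bigcup_(m in setT) (if `[< A (f (emb k m)) >] then [set w | Z k w = m] else set0)); last first.
    apply/seteqP; split=> w /=; first by move=> h; exists (Z k w) => //; rewrite asboolT.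
    by move=> [m _]; case: asboolP => // h ->.
  apply: countable_bigcupT_measurable => [|m]; first exact: countableP.
  case: ifP => _ //.
  rewrite (_ : [set w | _] = \bigcap_(ij in [set: 'I_p * 'I_q])
     ((fun w => X w ij.1 ij.2) @^-1` `[2 ^- k * (m ij.1 ij.2)%:~R, 2 ^- k * (m ij.1 ij.2 + 1)%:~R[)); last first.
    apply/seteqP; split=> w /=.
      move=> <- [i j] _ /=; rewrite in_itv/= !mxE ler_pdivrMl// ltr_pdivlMl//.
      exact: floor_itv.
    move=> h; apply/matrixP => i j; rewrite !mxE; apply: floor_def.
    by have := h (i, j) I; rewrite /= in_itv/= ler_pdivrMl// ltr_pdivlMl.
  apply: fin_bigcap_measurable => // -[i j] _; rewrite -[X in measurable X]setTI.
  by apply: mX => //; exact: measurable_itv.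
- move=> w _; apply/cvgrPdist_lt => e e0.
  have /cvgrPdist_lt/(_ e e0)/nbhs_ballP[r /= r0 hr] := cf (X w).
  near=> k; apply: hr; split=> // i j; rewrite /ball/= !mxE.
  have /andP[h1 h2] := floor_itv (2 ^+ k * X w i j).
  have rk : 1 / 2 ^+ k < r by near: k; exact: (near_infty_natSinv_expn_lt (PosNum r0)).
  have := k0 k; set t := 2 ^+ k in h1 h2 rk *; set fl := (Num.floor _)%:~R in h1 h2 *.
  move: h2; rewrite intrD -/fl => h2 t0.
  have e1 : X w i j - t^-1 * fl = t^-1 * (t * X w i j - fl) by field; rewrite gt_eqF.
  rewrite e1 ger0_norm; last by rewrite mulr_ge0 ?subr_ge0 ?invr_ge0 ?(ltW t0).
  apply: lt_trans rk; rewrite mul1r -[ltRHS]mulr1 ltr_pM2l ?invr_gt0//; lra.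
Unshelve. all: by end_near. Qed.

Lemma ider_line (p q : nat) (f : 'M[R]_(p, q) -> R) (v : 'M[R]_(p, q)) (P : R -> 'M[R]_(p, q)) t :
  (forall s h, P (h + s) = h *: v + P s) -> derivable f (P t) v -> ider (fun s => f (P s)) t ('D_v f (P t)).
Proof.
move=> HP df.
have EE : (fun h : R => h^-1 *: (f (P (h *: (1 : R) + t)) - f (P t))) =
    (fun h : R => h^-1 *: (f (h *: v + P t) - f (P t))).
  by apply/funext => h /=; rewrite [h *: _]mulr1 HP.
have d1 : derivable (fun s => f (P s)) t 1.
  by rewrite /derivable; change (cvg ((fun h : R => h^-1 *: (f (P (h *: (1 : R) + t)) - f (P t))) @ 0^')); rewrite EE.
apply: DeriveDef => //; rewrite /derive.
change (lim ((fun h : R => h^-1 *: (f (P (h *: (1 : R) + t)) - f (P t))) @ 0^') = lim ((fun h : R => h^-1 *: (f (h *: v + P t) - f (P t))) @ 0^')).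
by rewrite EE.
Qed.

Variables (l' n' : nat).
Local Notation l := l'.+1.
Local Notation n := n'.+1.

(** Passage from coordinate sequences to the argument of [pack]: x in row 0, the blocks of the
    frequency sequence in the following rows. *)
Definition mxc x c : 'M[R]_(l.+1, n) :=
  \matrix_(k, i) if unlift ord0 k is Some j then c (j * n + i)%N else x i.

Definition ix e : 'I_l.+1 * 'I_n := (lift ord0 (inord (e %/ n)), inord (e %% n)).

Lemma mxc_xi x c e h s : (e < l * n)%N ->
  mxc x (upd c e (h + s)) = h *: delta_mx (ix e).1 (ix e).2 + mxc x (upd c e s).
Proof.
move=> ed; apply/matrixP => k i; rewrite !mxE /ix/=; case: unliftP => [j ->|->]; last first.
  by rewrite (negbTE (neq_lift _ _)) /= mulr0 add0r.
rewrite (inj_eq lift_inj) /upd -!val_eqE/= inordK; last by rewrite ltn_divLR.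
rewrite inordK ?ltn_mod//; case: (eqVneq (j * n + i)%N e) => [<-|ne].
  by rewrite divnMDl// divn_small// addn0 modnMDl modn_small// !eqxx mulr1.
rewrite (_ : _ && _ = false) ?mulr0 ?add0r//.
by apply/negbTE/negP => /andP[/eqP h1 /eqP h2]; move: ne; rewrite h1 h2 -divn_eq eqxx.
Qed.

Lemma mxc_x x c (a : nat) h s : (a < n)%N ->
  mxc (upd x a (h + s)) c = h *: delta_mx ord0 (inord a) + mxc (upd x a s) c.
Proof.
move=> an; apply/matrixP => k i; rewrite !mxE; case: unliftP => [j ->|->].
  by rewrite eq_sym (negbTE (neq_lift _ _)) /= mulr0 add0r.
rewrite eqxx/= -val_eqE/= inordK// /upd.
by case: (nat_of_ord i == a); rewrite ?mulr1// mulr0 add0r.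
Qed.

Lemma measurable_mxc d k i : measurable_fun setT (fun w : E n * E d => mxc (co w.1) (co w.2) k i).
Proof.
under eq_fun do rewrite mxE; case: (unlift ord0 k) => [j|].
  exact: (measurableT_comp (@measurable_co R d _) measurable_snd).
exact: (measurableT_comp (@measurable_co R n _) measurable_fst).
Qed.

Lemma flatten_nseq1 (T : eqType) (s : seq T) (g : T -> nat) t : uniq s ->
  (forall t', t' \in s -> t' != t -> g t' = 0%N) ->
  flatten [seq nseq (g t') t' | t' <- s] = if t \in s then nseq (g t) t else [::].
Proof.
elim: s => [|t0 s IH] //= /andP[ts us] H.
rewrite in_cons IH//; last by move=> t' st; apply: H; rewrite in_cons st orbT.
have [->|tt] := eqVneq t t0; first by rewrite (negbTE ts) cats0.
by rewrite H ?mem_head 1?eq_sym.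
Qed.

Definition xidx (al : option 'I_n) : seq ('I_l.+1 * 'I_n) := if al is Some a then [:: (ord0, a)] else [::].

(** [mder] lists row 0 first, so one derivative in x after a pure derivative in a frequency
    coordinate already has the order used here, and no exchange of partial derivatives occurs. *)
Lemma mder_join (al : option 'I_n) (t : 'I_l * 'I_n) i (s : 'M[R]_(l.+1, n) -> R) :
  mder (joinidx (fun a : 'I_n => nat_of_bool (al == Some a)) (fun j b => if (j, b) == t then i else 0%N)) s =
  pder (xidx al ++ nseq i (lift ord0 t.1, t.2)) s.
Proof.
rewrite /mder; congr pder; rewrite (enum_ordSl l) /= map_cat flatten_cat; congr (_ ++ _).
  case: al => [a|] /=.
    have := @flatten_nseq1 _ [seq (ord0 : 'I_l.+1, j) | j <- enum 'I_n] (fun d => joinidx (fun b => nat_of_bool (Some a == Some b)) (fun (j : 'I_l) b => if (j, b) == t then i else 0%N) d.1 d.2) (ord0, a).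
    move=> ->.
    - rewrite mem_map ?mem_enum/=; last by move=> u1 u2 [].
      by rewrite /joinidx unlift_none eqxx.
    - by rewrite map_inj_uniq ?enum_uniq// => u1 u2 [].
    - move=> t' /mapP[b _ ->]; rewrite /joinidx /= unlift_none xpair_eqE eqxx/= => ba.
      by rewrite (_ : Some a == Some b = false)//; apply/negbTE; rewrite eq_sym.
  rewrite -map_comp (eq_map (g := fun=> [::])); first by elim: (enum 'I_n).
  by move=> b /=; rewrite /joinidx unlift_none.
rewrite (@flatten_nseq1 _ _ (fun d => joinidx (fun a : 'I_n => nat_of_bool (al == Some a)) (fun j b => if (j, b) == t then i else 0%N) d.1 d.2) (lift ord0 t.1, t.2)).
- rewrite allpairs_f//; last by rewrite mem_enum.
    by rewrite /joinidx /= liftK; case: t => t1 t2; rewrite eqxx.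
  by rewrite mem_map ?mem_enum//; exact: lift_inj.
- apply: allpairs_uniq; [|exact: enum_uniq|].
    by rewrite map_inj_uniq ?enum_uniq//; exact: lift_inj.
  by move=> [u1 u2] [v1 v2] _ _ [-> ->].
- move=> t' /allpairsP[[u1 u2] /= [/mapP[j _ ->] _ ->]]; rewrite /joinidx /= liftK xpair_eqE (inj_eq lift_inj) => tt.
  by case: t tt => t1 t2; rewrite xpair_eqE => /negbTE ->.
Qed.

End Symbols.

(** * Size of the dyadic pieces and of their derivatives *)

Section SymbolJets.
Variable R : realType.
Local Notation E := (E R).
Implicit Types (c v p z u x y : nat -> R).

(** Both quotients b / t and t / b are at most D, so whatever the sign of e the power changes by at
    most D^|e|. *)
Lemma pow_compare (b t D e em : R) : 1 <= D -> 0 < t -> 0 < b -> t <= D * b -> b <= D * t -> `|e| <= em ->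
  b `^ e <= D `^ em * t `^ e.
Proof.
move=> D1 t0 b0 tb bt eem; have D0 : 0 < D by exact: lt_le_trans ltr01 D1.
have q0 : 0 < b / t by rewrite divr_gt0.
have -> : b `^ e = (b / t) `^ e * t `^ e by rewrite -powRM ?(ltW q0) ?(ltW t0)// divfK// gt_eqF.
rewrite ler_wpM2r ?powR_ge0//; apply: (@le_trans _ _ (D `^ `|e|)); last exact: ler_powR.
have [e0|e0] := leP 0 e.
  rewrite ger0_norm//; apply: ge0_ler_powR; rewrite ?nnegrE ?(ltW q0) ?(ltW D0)//.
  by rewrite ler_pdivrMr.
rewrite ltr0_norm// -[e in leLHS]opprK powRN -[leLHS]mul1r ler_pdivrMr ?powR_gt0//.
rewrite -powRM ?(ltW q0) ?(ltW D0)// (_ : 1 = 1 `^ (- e)); last by rewrite powR1.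
apply: ge0_ler_powR; rewrite ?nnegrE ?mulr_ge0 ?invr_ge0 ?(ltW b0) ?(ltW t0) ?(ltW D0) ?oppr_ge0 ?(ltW e0)//.
by rewrite mulrA ler_pdivlMr// mul1r.
Qed.

Lemma eucl_coord n (w : 'rV[R]_n) i : `|w 0 i| <= eucl w.
Proof.
rewrite /eucl -sqrtr_sqr; apply: ler_wsqrtr.
by rewrite (bigD1 i)//= lerDl sumr_ge0// => j _; exact: sqr_ge0.
Qed.

Lemma eucl_le n (w : 'rV[R]_n) (t : R) : 0 <= t -> (forall i, `|w 0 i| <= t) -> eucl w <= n%:R * t.
Proof.
move=> t0 wt; have nt : 0 <= n%:R * t by rewrite mulr_ge0.
rewrite /eucl -[leRHS]ger0_norm// -sqrtr_sqr; apply: ler_wsqrtr.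
case: n w wt nt => [|n] w wt nt; first by rewrite big_ord0 sqr_ge0.
apply: (@le_trans _ _ (\sum_(i < n.+1) t ^+ 2)).
  by apply: ler_sum => i _; rewrite -[w 0 i ^+ 2]real_normK ?num_real// lerXn2r ?nnegrE.
rewrite sumr_const card_ord exprMn -[leLHS]mulr_natl ler_wpM2r ?sqr_ge0//.
by rewrite -natrX ler_nat expnS expn1 leq_pmulr.
Qed.

Variables (l' n' : nat).
Local Notation l := l'.+1.
Local Notation n := n'.+1.
Local Notation d := (l * n)%N.
Variables (m rho : R) (s : 'M[R]_(l.+1, n) -> R).
Hypotheses (rho01 : 0 < rho < 1) (smooth : smoothR s).
Hypothesis bounds : forall (alpha : 'I_n -> nat) (beta : 'I_l -> 'I_n -> nat),
  exists K : R, forall M : 'M[R]_(l.+1, n), `|mder (joinidx alpha beta) s M| <=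
    K * powR (1 + \sum_j eucl (row (lift ord0 j) M))
      (m + rho * (\sum_i alpha i)%:R - rho * (\sum_j \sum_i beta j i)%:R).

Lemma row_mxc x c j : row (lift ord0 j) (mxc l' n' x c) = blk n c j.
Proof. by apply/rowP => i; rewrite !mxE liftK. Qed.

Lemma japanese_ge x c : 1 <= 1 + \sum_j eucl (row (lift ord0 j) (mxc l' n' x c)).
Proof. by rewrite lerDl sumr_ge0// => j _; exact: sqrtr_ge0. Qed.

(** On the k-th annulus the weight of the symbol class is comparable to 2^k: some coordinate has
    size about 2^k, and none is larger; for k = 0 the summand 1 gives the lower bound. *)
Lemma annulus_compare k x c : annulus d k c ->
  let b := 1 + \sum_j eucl (row (lift ord0 j) (mxc l' n' x c)) in
  let D := (2 + 2 * d%:R) in 2 ^+ k <= D * b /\ b <= D * 2 ^+ k.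
Proof.
move=> [c1 c2] b D; have b1 : 1 <= b by exact: japanese_ge.
have D2 : 2 <= D by rewrite lerDl mulr_ge0.
have k1 : 1 <= 2 ^+ k :> R by apply: exprn_ege1; lra.
split.
  case: k c1 c2 k1 => [|k] c1 c2 k1; first by rewrite expr0; nra.
  apply: (le_trans (c2 isT)); apply: ler_pM => //; first exact: nrm_ge0.
  have n0 : 0 < nrm d c by rewrite -(pmulr_rgt0 _ (ltr0n R 2)) (lt_le_trans _ (c2 isT))// exprn_gt0.
  have [e ed ->] := nrm_attained n0.
  have jl : (e %/ n < l)%N by rewrite ltn_divLR.
  rewrite /b (bigD1 (Ordinal jl))//=; have := @eucl_coord n (blk n c (Ordinal jl)) (inord (e %% n)).
  rewrite row_mxc mxE inordK ?ltn_mod//= -divn_eq => /le_trans; apply.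
  by rewrite addrCA lerDl addr_ge0// sumr_ge0// => j _; exact: sqrtr_ge0.
have h : \sum_j eucl (row (lift ord0 j) (mxc l' n' x c)) <= d%:R * (2 * 2 ^+ k).
  apply: (@le_trans _ _ (\sum_(j < l) n%:R * (2 * 2 ^+ k))).
    apply: ler_sum => j _; apply: eucl_le; first by rewrite mulr_ge0// exprn_ge0.
    move=> i; rewrite row_mxc mxE (le_trans _ c1)//; apply: nrm_coord.
    by rewrite -ltn_subRL -mulnBl (leq_trans (ltn_ord i))// leq_pmull// subn_gt0.
  by rewrite sumr_const card_ord -[_ *+ l]mulr_natl mulrA -natrM.
rewrite /b /D mulrDl; move: h; set t := 2 ^+ k in k1 *; set S := \sum_j _.
have -> : d%:R * (2 * t) = 2 * d%:R * t by ring.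
by move=> h; lra.
Qed.

(** Pure derivative of order i in the frequency coordinate [e]; [dtau] adds one derivative in the
    coordinate [a] of x. *)
Definition tau x e i c : R := pder (nseq i (ix l' n' e)) s (mxc l' n' x c).
Definition dtau (a : nat) x e i c : R := pder ((ord0, inord a) :: nseq i (ix l' n' e)) s (mxc l' n' x c).

Lemma tau_isd_xi x e i : (e < d)%N -> isd e (tau x e i) (tau x e i.+1).
Proof.
move=> ed c t; apply: (@ider_line R _ _ (pder (nseq i (ix l' n' e)) s) _ (fun s0 => mxc l' n' x (upd c e s0))).
  by move=> s0 h; exact: mxc_xi.
exact/diff_derivable/smooth.
Qed.

Lemma pder_isd_x q c (a : nat) : (a < n)%N ->
  isd a (fun x => pder q s (mxc l' n' x c)) (fun x => pder ((ord0, inord a) :: q) s (mxc l' n' x c)).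
Proof.
move=> an x t; apply: (@ider_line R _ _ (pder q s) _ (fun s0 => mxc l' n' (upd x a s0) c)).
  by move=> s0 h; exact: mxc_x.
exact/diff_derivable/smooth.
Qed.

Lemma measurable_pder q D : measurable_fun setT (fun w : E n * E D => pder q s (mxc l' n' (co w.1) (co w.2))).
Proof.
apply: measurable_contmx => [M|i j]; first exact/differentiable_continuous/smooth.
exact: measurable_mxc.
Qed.

Lemma tau_sfam M x : sfam d M (tau x).
Proof.
move=> e ed; split=> //.
- move=> i _; apply: measurable_contmx => [N|k j]; first exact/differentiable_continuous/smooth.
  under eq_fun do rewrite mxE; case: (unlift ord0 k) => [q|]; [exact: measurable_co|exact: measurable_cst].
- by move=> i _; exact: tau_isd_xi.
- move=> i _ c; exact: (ider_continuous (fun t => @tau_isd_xi x e i ed c t)).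
Qed.

(** Only finitely many derivatives occur, indexed by the order, the direction and an optional
    coordinate of x, so their constants can be summed; on the annulus powers of the weight become
    powers of 2^k. *)
Lemma tau_bound M : exists K : R, 0 < K /\ forall k x e i c, (e < d)%N -> (i <= M)%N -> annulus d k c ->
  `|tau x e i c| <= K * (2 ^+ k) `^ m * ((2 ^+ k) `^ (- rho)) ^+ i /\
  forall a, (a < n)%N -> `|dtau a x e i c| <= K * (2 ^+ k) `^ m / (2 ^+ k) `^ (- rho) * ((2 ^+ k) `^ (- rho)) ^+ i.
Proof.
have /andP[r0 r1] := rho01.
have H (q : 'I_M.+1 * ('I_l * 'I_n) * option 'I_n) : exists K : R, forall N : 'M[R]_(l.+1, n),
    `|pder (xidx l' q.2 ++ nseq q.1.1 (lift ord0 q.1.2.1, q.1.2.2)) s N| <=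
    K * powR (1 + \sum_j eucl (row (lift ord0 j) N)) (m + rho * (q.2 != None)%:R - rho * (q.1.1)%:R).
  have [K HK] := bounds (fun a : 'I_n => nat_of_bool (q.2 == Some a)) (fun j b => if (j, b) == q.1.2 then nat_of_ord q.1.1 else 0%N).
  exists K => N; have := HK N; rewrite mder_join.
  have -> : (\sum_i (q.2 == Some i) = (q.2 != None))%N.
    case: q.2 => [a|]; last by rewrite big1.
    by rewrite (bigD1 a)//= eqxx big1// => i ia; apply/eqP; rewrite eqb0; apply: contra ia => /eqP[->].
  have -> : (\sum_j \sum_i (if (j, i) == q.1.2 then nat_of_ord q.1.1 else 0) = q.1.1)%N.
    rewrite pair_big/= (bigD1 q.1.2)//= -surjective_pairing eqxx big1 ?addn0// => -[j i] /negbTE ji.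
    by rewrite ji.
  exact.
have [Kf HK] := choice H.
pose D : R := 2 + 2 * d%:R; have D1 : 1 <= D by rewrite /D; have : 0 <= d%:R :> R by []; lra.
(* Bounds the modulus of every exponent that occurs, with at most one derivative in x and at most M
   in frequency. *)
pose em : R := `|m| + rho + rho * M%:R.
pose K0 : R := \sum_q `|Kf q|.
have K00 : 0 <= K0 by apply: sumr_ge0.
have D0 : 0 < D `^ em by rewrite powR_gt0// (lt_le_trans ltr01).
exists ((K0 + 1) * D `^ em); split; first by rewrite mulr_gt0// ltr_wpDl.
have main k x e i c (al : option 'I_n) : (e < d)%N -> (i <= M)%N -> annulus d k c ->
    `|pder (xidx l' al ++ nseq i (ix l' n' e)) s (mxc l' n' x c)| <=
    (K0 + 1) * D `^ em * (2 ^+ k) `^ (m + rho * (al != None)%:R - rho * i%:R).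
  move=> ed iM ck; have t0 : 0 < 2 ^+ k :> R by exact: exprn_gt0.
  have := HK (inord i, (inord (e %/ n), inord (e %% n)), al) (mxc l' n' x c); rewrite /= inordK//.
  move/le_trans; apply; set b := 1 + _; set ee := _ - _.
  have b0 : 0 < b by exact: lt_le_trans ltr01 (japanese_ge x c).
  have [h1 h2] := annulus_compare x ck.
  have eem : `|ee| <= em.
    rewrite /ee /em (le_trans (ler_normB _ _))// lerD ?(le_trans (ler_normD _ _))// ?lerD//.
      by rewrite normrM (gtr0_norm r0) ger0_norm ?ler0n// ler_piMr ?(ltW r0)// lern1 leq_b1.
    by rewrite normrM (gtr0_norm r0) ger0_norm ?ler0n// ler_wpM2l ?(ltW r0)// ler_nat.
  rewrite -mulrA; apply: (@le_trans _ _ ((K0 + 1) * b `^ ee)).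
    rewrite ler_wpM2r ?powR_ge0// (le_trans (ler_norm _))// /K0 (bigD1 (inord i, (inord (e %/ n), inord (e %% n)), al))//=.
    by rewrite -addrA lerDl addr_ge0// sumr_ge0.
  rewrite ler_wpM2l ?addr_ge0//; exact: pow_compare.
have pw k i : (2 ^+ k) `^ (- (rho * i%:R)) = ((2 ^+ k) `^ (- rho)) ^+ i :> R.
  by rewrite -mulNr powRrM powR_mulrn// powR_ge0.
move=> k x e i c ed iM ck; have t0 : 0 < 2 ^+ k :> R by exact: exprn_gt0.
split=> [|a an].
  have := main k x e i c None ed iM ck; rewrite /= mulr0 addr0 powR_split// pw -/(tau x e i c).
  by rewrite mulrA.
have := main k x e i c (Some (inord a)) ed iM ck; rewrite /= mulr1 [(2 ^+ k) `^ (_ - _)]powR_split// [(2 ^+ k) `^ (m + rho)]powR_split// pw -/(dtau a x e i c).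
by rewrite [(2 ^+ k) `^ (- rho)]powRN invrK !mulrA.
Qed.

(** From x to y one coordinate at a time, with the mean value theorem on each step. *)
Lemma path_bound (f : (nat -> R) -> R) (fa : nat -> (nat -> R) -> R) N (B : R) x y : local N f ->
  (forall a, (a < N)%N -> isd a f (fa a)) -> (forall a z, (a < N)%N -> `|fa a z| <= B) ->
  `|f y - f x| <= B * \sum_(a < N) `|y a - x a|.
Proof.
move=> lf If Bf; pose z k := fun a => if (a < k)%N then y a else x a.
have -> : f y = f (z N) by apply: lf => i iN; rewrite /z iN.
have -> : f x = f (z 0%N) by apply: lf.
rewrite -(telescope_sumr (fun k => f (z k)) (leq0n N)) big_mkord (le_trans (ler_norm_sum _ _ _))//.
rewrite mulr_sumr; apply: ler_sum => a _; pose g t := f (upd (z a) a t).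
have e1 : z a.+1 = upd (z a) a (y a).
  by apply/funext => i; rewrite /z /upd ltnS leq_eqVlt; case: eqVneq => [->|].
have e2 : z a = upd (z a) a (x a).
  by apply/funext => i; rewrite /z /upd; case: eqVneq => [->|//]; rewrite ltnn.
have -> : f (z a.+1) = g (y a) by rewrite e1.
have -> : f (z a) = g (x a) by rewrite /g -e2.
apply: (@lipschitz_ider R g (fun t => fa a (upd (z a) a t)) B (x a) (y a)).
  by move=> t; exact: If.
by move=> t; exact: Bf.
Qed.

Definition piece (b : nat -> R -> R) k x := fmul (ring d b k) (tau x).

Lemma pieces_good M b B : is_cutoff M b B -> 0 <= B -> exists K : R, 0 < K /\ forall k,
  let A := K * (2 ^+ k) `^ m in let W := 2 * 2 ^+ k in let del := (2 ^+ k) `^ (- rho) in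
  [/\ goodsym n' d M A W del (piece b k),
      forall x, [/\ sfam d M (piece b k x), jbound d M A del (piece b k x) & jsupp d M W (piece b k x)] &
      lipsym n d M A del (piece b k)].
Proof.
move=> cut B0; have [K [K0 HK]] := tau_bound M.
have /andP[r0 r1] := rho01.
pose Cb : R := (1 + B) ^+ d * (1 + 2 ^+ M).
have Cb0 : 0 < Cb.
  by apply: mulr_gt0; [apply: exprn_gt0; rewrite ltr_pwDl|rewrite ltr_pwDl// exprn_ge0].
have M0 : 0 < 2 ^+ M :> R by exact: exprn_gt0.
have KK0 : 0 < 2 ^+ M * Cb * K by exact: mulr_gt0 (mulr_gt0 M0 Cb0) K0.
exists (2 ^+ M * Cb * K); split=> //.
move=> k A W del; have t0 : 0 < 2 ^+ k :> R by exact: exprn_gt0.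
have t1 : 1 <= 2 ^+ k :> R by apply: exprn_ege1; lra.
have d0 : (0 < d)%N by [].
have del0 : 0 < del by exact: powR_gt0.
have tm0 : 0 < (2 ^+ k) `^ m :> R by exact: powR_gt0.
have A0 : 0 < A by exact: mulr_gt0 KK0 tm0.
(* A derivative of the cutoff costs 2^-k, which is at most [del] because rho < 1. *)
have rb e j c : (e < d)%N -> (j <= M)%N -> `|ring d b k e j c| <= Cb * del ^+ j.
  move=> ed jM; apply: le_trans (ring_bound cut B0 k c ed jM) _; rewrite ler_wpM2l ?(ltW Cb0)//.
  apply: lerXn2r; rewrite ?nnegrE ?invr_ge0 ?(ltW t0) ?(ltW del0)//.
  by rewrite -powR_inv1 ?(ltW t0)//; apply: ler_powR => //; lra.
have rs := @ring_sfam R d M b B cut k d0.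
have rW : jsupp d M W (ring d b k).
  move=> e j ed jM c cW; apply: (ring_supp cut ed jM) => -[c1 _].
  by move: cW; rewrite ltNge c1.
have bnd (T : nat -> nat -> (nat -> R) -> R) (X : R) e i c : 0 <= X -> (e < d)%N -> (i <= M)%N ->
    (annulus d k c -> forall j, (j <= M)%N -> `|T e j c| <= X * del ^+ j) ->
    `|fmul (ring d b k) T e i c| <= 2 ^+ M * Cb * X * del ^+ i.
  move=> X0 ed iM TX; have [ck|ck] := pselect (annulus d k c).
    by apply: fmul_bound => //; rewrite ?(ltW Cb0) ?(ltW del0)//; [move=> j jM; exact: rb|exact: TX].
  rewrite /fmul big1 ?normr0.
    by apply: mulr_ge0; [apply: mulr_ge0 => //; apply: mulr_ge0; exact: ltW|exact/exprn_ge0/ltW].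
  move=> j _; rewrite (ring_supp cut ed _ ck) ?mul0r ?mulr0// (leq_trans _ iM)// -ltnS.
  exact: ltn_ord.
have KX : 0 <= K * (2 ^+ k) `^ m by rewrite mulr_ge0// ltW.
have KX' : 0 <= K * (2 ^+ k) `^ m / del by rewrite divr_ge0// ltW.
have fams x : [/\ sfam d M (piece b k x), jbound d M A del (piece b k x) & jsupp d M W (piece b k x)].
  split.
  - exact: (sfam_mul rs (@tau_sfam M x)).
  - move=> e i c ed iM; rewrite /A -[2 ^+ M * Cb * K * _]mulrA; apply: bnd => // ck j jM.
    by have [] := HK k x e j c ed jM ck.
  - exact: (fmul_supp (tau x) rW).
have dbnd x e i c (a : nat) : (e < d)%N -> (i <= M)%N -> (a < n)%N ->
    `|fmul (ring d b k) (dtau a x) e i c| <= A / del * del ^+ i.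
  move=> ed iM an; have -> : A / del = 2 ^+ M * Cb * (K * (2 ^+ k) `^ m / del) by rewrite /A !mulrA.
  apply: bnd => // ck j jM.
  by have [_ /(_ a an)] := HK k x e j c ed jM ck.
have dd e i c (a : nat) : (a < n)%N -> isd a (fun x => piece b k x e i c) (fun x => fmul (ring d b k) (dtau a x) e i c).
  move=> an x t; apply: ider_sum => j; apply: iderZ; apply: iderZ.
  exact: (@pder_isd_x (nseq (i - j) (ix l' n' e)) c a an x t).
have ddc e i c z : continuous (fun t => fmul (ring d b k) (dtau 0 (ccons t z)) e i c).
  apply: cont_sum => j; apply: contM; first exact: cont_cst; apply: contM; first exact: cont_cst.
  apply: (@ider_continuous R _ (fun t => pder ((ord0, inord 0) :: (ord0, inord 0) :: nseq (i - j) (ix l' n' e)) s (mxc l' n' (ccons t z) c))) => t.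
  have := @pder_isd_x ((ord0, inord 0) :: nseq (i - j) (ix l' n' e)) c 0 isT (ccons 0 z) t.
  by under eq_fun do rewrite upd0; rewrite upd0.
split=> //.
- split.
  + move=> e i ed iM; apply: measurable_sum => j; apply: measurable_funM => //; apply: measurable_funM.
      have [_ mr _ _] := rs e ed; apply: (measurableT_comp (mr j _) measurable_snd).
      by rewrite (leq_trans _ iM)// -ltnS; exact: ltn_ord.
    exact: measurable_pder.
  + move=> x; have [f1 f2 f3] := fams x; split=> //.
    exact: (sfam_jet (ltW A0) del0 f1 f2 f3).
  + exists (fun x => fmul (ring d b k) (dtau 0 x)) => z e i c ed iM; split.
    * move=> t; have := dd e i c 0%N isT (ccons 0 z) t.
      by under eq_fun do rewrite upd0; rewrite upd0.
    * exact: ddc.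
    * by move=> t; exact: dbnd.
- move=> x y e i c ed iM; rewrite mulrAC.
  apply: (@path_bound (fun x => piece b k x e i c) (fun a x => fmul (ring d b k) (dtau a x) e i c)).
  + move=> c1 c2 cc; rewrite /piece /fmul; apply: eq_bigr => j _; rewrite /tau; congr (_ * (_ * pder _ s _)).
    by apply/matrixP => q w; rewrite !mxE; case: (unlift ord0 q) => // ; exact: cc.
  + by move=> a an; exact: dd.
  + by move=> a z an; exact: dbnd.
Qed.

(** The value of m enters here: the exponents of 2^k are -d (1 - rho), d and -rho d, with sum 0, so
    the constant is independent of the piece. *)
Lemma piece_scale (K r : R) k : 1 < r -> 0 < K -> m * r = - (d%:R * (1 - rho)) ->
  (K * (2 ^+ k) `^ m) `^ r * (2 * (2 * 2 ^+ k)) ^+ d * ((2 ^+ k) `^ (- rho)) ^+ d = K `^ r * 4 ^+ d.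
Proof.
move=> r1 K0 mr; have t0 : 0 < 2 ^+ k :> R by exact: exprn_gt0.
rewrite powRM ?(ltW K0) ?powR_ge0// -powRrM mr.
have -> : 2 * (2 * 2 ^+ k) = 4 * 2 ^+ k :> R by ring.
rewrite exprMn -[((2 ^+ k) `^ (- rho)) ^+ d]powR_mulrn ?powR_ge0// -powRrM -[(2 ^+ k) ^+ d]powR_mulrn ?(ltW t0)//.
set t := 2 ^+ k in t0 *.
have -> : K `^ r * t `^ (- (d%:R * (1 - rho))) * (4 ^+ d * t `^ d%:R) * t `^ (- rho * d%:R) =
   K `^ r * 4 ^+ d * (t `^ (- (d%:R * (1 - rho))) * t `^ d%:R * t `^ (- rho * d%:R)).
  by set a := K `^ r; set p1 := t `^ _; set p2 := t `^ d%:R; set p3 := t `^ _; set q := 4 ^+ _; ring.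
rewrite -!powR_split// (_ : _ + _ + _ = 0) ?powRr0 ?mulr1//; ring.
Qed.

End SymbolJets.

(** * From complex multilinear operators to real linear ones *)

Section Complex.
Variable R : realType.
Local Notation E := (E R).
Implicit Types (c v p u x y xi : nat -> R) (z w : R[i]).

Lemma Re_mul z w : complex.Re (z * w) = complex.Re z * complex.Re w - complex.Im z * complex.Im w.
Proof. by case: z w => a b [c d]. Qed.
Lemma Im_mul z w : complex.Im (z * w) = complex.Re z * complex.Im w + complex.Im z * complex.Re w.
Proof. by case: z w => a b [c d]. Qed.
Lemma Re_add z w : complex.Re (z + w) = complex.Re z + complex.Re w.
Proof. by case: z w => a b [c d]. Qed.
Lemma Im_add z w : complex.Im (z + w) = complex.Im z + complex.Im w.
Proof. by case: z w => a b [c d]. Qed.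
Lemma Re_opp z : complex.Re (- z) = - complex.Re z. Proof. by case: z. Qed.
Lemma Im_opp z : complex.Im (- z) = - complex.Im z. Proof. by case: z. Qed.

Lemma complex_ext z w : complex.Re z = complex.Re w -> complex.Im z = complex.Im w -> z = w.
Proof. by case: z w => a b [c d] /= -> ->. Qed.

Lemma cabs_ge0 z : 0 <= cabs z. Proof. exact: sqrtr_ge0. Qed.

Lemma cabsM z w : cabs (z * w) = cabs z * cabs w.
Proof.
rewrite /cabs -sqrtrM ?addr_ge0 ?sqr_ge0// Re_mul Im_mul; congr Num.sqrt; ring.
Qed.

Lemma cabs_prod (I : Type) (s : seq I) (f : I -> R[i]) : cabs (\prod_(i <- s) f i) = \prod_(i <- s) cabs (f i).
Proof.
elim: s => [|i s IH]; last by rewrite !big_cons cabsM IH.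
by rewrite !big_nil /cabs /= expr0n expr1n addr0 sqrtr1.
Qed.

Lemma normr_Re z : `|complex.Re z| <= cabs z.
Proof. by rewrite -sqrtr_sqr /cabs; apply: ler_wsqrtr; rewrite lerDl sqr_ge0. Qed.
Lemma normr_Im z : `|complex.Im z| <= cabs z.
Proof. by rewrite -sqrtr_sqr /cabs; apply: ler_wsqrtr; rewrite lerDr sqr_ge0. Qed.

Lemma cabs_le z : cabs z <= `|complex.Re z| + `|complex.Im z|.
Proof.
rewrite /cabs -[leRHS]ger0_norm ?addr_ge0// -sqrtr_sqr; apply: ler_wsqrtr.
rewrite sqrrD !real_normK ?num_real// -addrA lerD2l lerDr mulrn_wge0// mulr_ge0//.
Qed.

Lemma expiD (a b : R) : expi (a + b) = expi a * expi b.
Proof. by apply: complex_ext; rewrite ?Re_mul ?Im_mul /= ?cosD ?sinD; ring. Qed.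

Definition cint d (G : (nat -> R) -> R[i]) : R[i] :=
  Complex (rint d (fun c => complex.Re (G c))) (rint d (fun c => complex.Im (G c))).

Definition domC d (G : (nat -> R) -> R[i]) :=
  dom d (fun c => complex.Re (G c)) /\ dom d (fun c => complex.Im (G c)).

Definition ephase d xi u : R[i] := expi (- (2 * pi * dot d u xi)).

Lemma ccat_shift n u : ccat n u (shift n u) = u.
Proof.
elim: n u => [|n IH] u; first by apply/funext.
apply/funext => -[|k] //=; have := IH (fun k => u k.+1).
by move=> /(congr1 (fun f => f k)) <-; congr (ccat n _ _ k).
Qed.

Lemma local_mull n m (g h : (nat -> R) -> R[i]) : local n g -> local m h ->
  local (n + m) (fun u => g u * h (shift n u)).
Proof.
move=> lg lh c c' cc; congr (_ * _).
  by apply: lg => i ni; apply: cc; rewrite ltn_addr.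
by apply: lh => i mi; rewrite /shift cc// ltn_add2l.
Qed.

Lemma local_comp n (T T' : Type) (g : (nat -> R) -> T) (f : T -> T') : local n g -> local n (fun u => f (g u)).
Proof. by move=> lg c c' /lg ->. Qed.

Lemma dom_tensor n m (a b : (nat -> R) -> R) : local n a -> local m b -> dom n a -> dom m b ->
  dom (n + m) (fun u => a u * b (shift n u)).
Proof.
move=> la lb [ma [K aK]] [mb [L bL]]; split.
  apply: measurable_funM.
    by apply: (@measurable_local R n _ (E (n + m)) (@co R (n + m)) a) => // i; exact: measurable_co.
  by apply: (@measurable_local R m _ (E (n + m)) (fun w : E (n + m) => shift n (co w)) b) => // i; exact: measurable_co.
exists (K * L) => u; rewrite normrM -{3}[u](ccat_shift n) wt_ccat mulrACA.
by apply: ler_pM.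
Qed.

Lemma rint_tensor n m (a b : (nat -> R) -> R) : local n a -> local m b -> dom n a -> dom m b ->
  rint (n + m) (fun u => a u * b (shift n u)) = rint n a * rint m b.
Proof.
move=> la lb da db; rewrite rint_cat; last exact: dom_tensor.
rewrite mulrC -rintZ//; congr rint; apply/funext => c; rewrite mulrC -rintZ//.
congr rint; apply/funext => c'; rewrite shift_ccat; congr (_ * _).
by apply: la => i ni; rewrite ccat_lt.
Qed.

Lemma cint_tensor n m g h : local n g -> local m h -> domC n g -> domC m h ->
  domC (n + m) (fun u => g u * h (shift n u)) /\
  cint (n + m) (fun u => g u * h (shift n u)) = cint n g * cint m h.
Proof.
move=> lg lh [g1 g2] [h1 h2].
have lr T (f : R[i] -> T) := local_comp f lg; have lh' T (f : R[i] -> T) := local_comp f lh.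
have t11 := dom_tensor (lr _ (@complex.Re R)) (lh' _ (@complex.Re R)) g1 h1.
have t22 := dom_tensor (lr _ (@complex.Im R)) (lh' _ (@complex.Im R)) g2 h2.
have t12 := dom_tensor (lr _ (@complex.Re R)) (lh' _ (@complex.Im R)) g1 h2.
have t21 := dom_tensor (lr _ (@complex.Im R)) (lh' _ (@complex.Re R)) g2 h1.
have E1 : (fun u => complex.Re (g u * h (shift n u))) = (fun u => complex.Re (g u) * complex.Re (h (shift n u)) - complex.Im (g u) * complex.Im (h (shift n u))).
  by apply/funext => u; rewrite Re_mul.
have E2 : (fun u => complex.Im (g u * h (shift n u))) = (fun u => complex.Re (g u) * complex.Im (h (shift n u)) + complex.Im (g u) * complex.Re (h (shift n u))).
  by apply/funext => u; rewrite Im_mul.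
split; first by split; rewrite ?E1 ?E2; [exact: domB|exact: domD].
apply: complex_ext; rewrite ?Re_mul ?Im_mul /cint /= ?E1 ?E2.
  by rewrite rintB// (rint_tensor (lr _ (@complex.Re R)) (lh' _ (@complex.Re R)) g1 h1)
    (rint_tensor (lr _ (@complex.Im R)) (lh' _ (@complex.Im R)) g2 h2).
by rewrite rintD// (rint_tensor (lr _ (@complex.Re R)) (lh' _ (@complex.Im R)) g1 h2)
    (rint_tensor (lr _ (@complex.Im R)) (lh' _ (@complex.Re R)) g2 h1).
Qed.

Lemma domC_mulB d g (h : (nat -> R) -> R[i]) (K : R) : domC d g ->
  mfr d (fun c => complex.Re (h c)) -> mfr d (fun c => complex.Im (h c)) -> (forall c, cabs (h c) <= K) ->
  domC d (fun c => g c * h c).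
Proof.
move=> [g1 g2] m1 m2 hK.
have k1 c : `|complex.Re (h c)| <= K by exact: le_trans (normr_Re _) (hK c).
have k2 c : `|complex.Im (h c)| <= K by exact: le_trans (normr_Im _) (hK c).
split; [under eq_fun do rewrite Re_mul|under eq_fun do rewrite Im_mul].
  by apply: domB; [exact: dom_bmul g1 m1 k1|exact: dom_bmul g2 m2 k2].
by apply: domD; [exact: dom_bmul g1 m2 k2|exact: dom_bmul g2 m1 k1].
Qed.

Lemma cabs_expi (t : R) : cabs (expi t) = 1.
Proof. by rewrite /cabs /= cos2Dsin2 sqrtr1. Qed.

Lemma domC_ephase d g xi : domC d g -> domC d (fun u => g u * ephase d xi u).
Proof.
move=> dg; have mp : mfr d (fun u => - (2 * pi * dot d u xi)).
  have := @mfr_dot R d xi => md; have := measurable_funM (@measurable_cst _ _ (E d) R setT (- (2 * pi))) md.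
  by congr measurable_fun; apply/funext => u /=; rewrite mulNr.
by apply: (@domC_mulB d g _ 1 dg); [exact: mfr_cos|exact: mfr_sin|move=> c; rewrite cabs_expi].
Qed.

Lemma dot_cat n m u xi : dot (n + m) u xi = dot n u xi + dot m (shift n u) (shift n xi).
Proof. by rewrite /dot big_split_ord. Qed.

Lemma local_ephase d xi : local d (ephase d xi).
Proof.
by move=> c c' cc; rewrite /ephase; congr (expi (- (_ * _))); apply: eq_bigr => i _; rewrite cc.
Qed.

Lemma local_mul d g h : local d g -> local d h -> local d (fun u => g u * h u : R[i]).
Proof. by move=> lg lh c c' cc; rewrite (lg _ _ cc) (lh _ _ cc). Qed.

Definition tensor l n (g : nat -> (nat -> R) -> R[i]) u : R[i] := \prod_(j < l) g j (shift (j * n) u).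

Lemma tensorS l n g u : tensor l.+1 n g u = g 0%N u * tensor l n (fun j => g j.+1) (shift n u).
Proof.
rewrite /tensor big_ord_recl; congr (_ * _).
by apply: eq_bigr => j _; congr (g _ _); apply/funext => i; rewrite /shift lift0 mulSn addnA.
Qed.

Lemma cint_blocks l n (g : nat -> (nat -> R) -> R[i]) : (forall j, local n (g j)) -> (forall j, domC n (g j)) ->
  [/\ local (l * n) (tensor l n g), domC (l * n) (tensor l n g) &
      forall xi, cint (l * n) (fun u => tensor l n g u * ephase (l * n) xi u) =
        \prod_(j < l) cint n (fun u => g j u * ephase n (shift (j * n) xi) u)].
Proof.
elim: l g => [|l IH] g lg dg.
  have t0 : tensor 0 n g = fun=> 1 by apply/funext => u; rewrite /tensor big_ord0.
  rewrite mul0n; split; rewrite ?t0//.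
    by split; split; [exact: measurable_cst|exists 1 => c; rewrite /wt big_ord0 normr1 mulr1|
      exact: measurable_cst|exists 1 => c; rewrite /wt big_ord0 normr0 mulr1].
  move=> xi; rewrite big_ord0; apply: complex_ext; rewrite /cint /= rint0 /ephase /= /dot big_ord0 mulr0 oppr0.
    by rewrite mul1r mul0r subr0 cos0.
  by rewrite mul1r mul0r addr0 sin0.
have [lT dT cT] := IH (fun j => g j.+1) (fun j => lg j.+1) (fun j => dg j.+1).
have TE : tensor l.+1 n g = fun u => g 0%N u * tensor l n (fun j => g j.+1) (shift n u).
  by apply/funext => u; rewrite tensorS.
have [dT' _] := cint_tensor (lg 0%N) lT (dg 0%N) dT.
rewrite mulSn; split; rewrite ?TE//; first exact: local_mull.
move=> xi; rewrite big_ord_recl /= -(_ : cint (l * n) (fun u => tensor l n (fun j => g j.+1) u * ephase (l * n) (shift n xi) u) = \prod_(j < l) _); last first.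
  rewrite cT; apply: eq_bigr => j _; congr cint; apply/funext => u; congr (_ * ephase _ _ _).
  by apply/funext => i; rewrite /shift /bump add1n mulSn addnA.
have [_ <-] := cint_tensor (local_mul (lg 0%N) (@local_ephase n (shift (0 * n) xi)))
  (local_mul lT (@local_ephase (l * n) (shift n xi))) (domC_ephase (shift (0 * n) xi) (dg 0%N)) (domC_ephase (shift n xi) dT).
congr cint; apply/funext => u.
rewrite [in LHS]/ephase dot_cat mulrDr opprD expiD -/(ephase n xi u) -/(ephase (l * n) (shift n xi) (shift n u)).
by rewrite mulrACA.
Qed.

(** The complex Fourier integral through four real cosine integrals, a sine being a cosine delayed
    by pi/2. *)
Lemma cint_osc d g xi : domC d g -> cint d (fun u => g u * ephase d xi u) =
  Complex (osc d (fun u => complex.Re (g u)) 0 xi + osc d (fun u => complex.Im (g u)) (- (pi / 2)) xi)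
    (osc d (fun u => complex.Im (g u)) 0 xi - osc d (fun u => complex.Re (g u)) (- (pi / 2)) xi).
Proof.
move=> [d1 d2]; have cm (x : R) : cos (x - pi / 2) = sin x :> R.
  by rewrite -cosN opprB cosB cos_pihalf sin_pihalf mul0r add0r mul1r.
apply: complex_ext; rewrite /cint /osc /=.
  rewrite -rintD; [|exact: dom_cos..]; congr rint; apply/funext => u.
  by rewrite Re_mul /ephase /= cosN sinN cm addr0; ring.
rewrite -rintB; [|exact: dom_cos..]; congr rint; apply/funext => u.
by rewrite Im_mul /ephase /= cosN sinN cm addr0; ring.
Qed.

Lemma wt_ge n v (P : R) : 1 <= P -> nrm n v <= P -> (2 * P ^+ 2)^-1 ^+ n <= wt n v.
Proof.
move=> P1 vP; rewrite -[n in leLHS]card_ord -prodr_const; apply: ler_prod => i _.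
have P0 : 0 < P by exact: lt_le_trans ltr01 P1.
have P2 : 0 < 2 * P ^+ 2 by rewrite mulr_gt0// exprn_gt0.
rewrite invr_ge0 (ltW P2)/= lef_pV2 ?posrE ?sq1_gt0//.
have vi : v i ^+ 2 <= P ^+ 2.
  rewrite -real_normK ?num_real// lerXn2r ?nnegrE ?(ltW P0)//.
  by rewrite (le_trans (nrm_coord v (ltn_ord i))).
have : 1 <= P ^+ 2 by exact: exprn_ege1.
by move: vi; set y := v i ^+ 2; set q := P ^+ 2; lra.
Qed.

(** Integrating by parts 2 n times in the largest coordinate gives decay |v|^(-2n), and [wt n v] is
    at least a constant times max(1, |v|)^(-2n). *)
Lemma osc_dom n (a : (nat -> R) -> R) psi : (0 < n)%N -> dom n a ->
  (forall e, (e < n)%N -> exists ch, ch 0%N = a /\ chain n e (2 * n) ch) -> dom n (osc n a psi).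
Proof.
move=> n0 da H; have H' (e : 'I_n) : exists K : R, 0 <= K /\ forall v, `|osc n a psi v| * `|v e| ^+ (2 * n) <= K.
  have [ch [<- cch]] := H e (ltn_ord e); have [dc _ _] := cch.
  exists (rint n (fun u => `|ch (2 * n)%N u|)); split; first exact: rint_ge0.
  move=> v; have := osc_le (psi + (2 * n)%:R * (pi / 2)) v (dc _ (leqnn _)).
  rewrite -(osc_chain psi v (ltn_ord e) cch (leqnn _)) normrM normrX => /(le_trans _); apply.
  rewrite ler_wpM2l//; apply: lerXn2r; rewrite ?nnegrE// !normrM normr_nat ger0_norm ?pi_ge0//.
  by rewrite ler_peMl//; have := @pi_ge1 R; lra.
have [Kf HK] := choice H'.
pose K := rint n (fun u => `|a u|) + \sum_e Kf e.
have K0 e : 0 <= Kf e by have [] := HK e.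
have a0 : 0 <= rint n (fun u => `|a u|) by exact: rint_ge0.
split; first exact: mfr_osc.
exists (2 ^+ n * K) => v; pose P := Num.max 1 (nrm n v).
have P1 : 1 <= P by rewrite /P le_max lexx.
have P0 : 0 < P ^+ (2 * n) by apply: exprn_gt0; exact: lt_le_trans P1.
have h : `|osc n a psi v| * P ^+ (2 * n) <= K.
  rewrite /P; have [_|v1] := leP (nrm n v) 1.
    by rewrite expr1n mulr1 (le_trans (osc_le _ _ da))// lerDl sumr_ge0.
  have [e ed ->] := nrm_attained (lt_trans ltr01 v1).
  have [_ /(_ v) /le_trans] := HK (Ordinal ed); apply.
  by rewrite /K (bigD1 (Ordinal ed))//= addrCA lerDl addr_ge0// sumr_ge0.
have w := @wt_ge n v P P1 _; apply: (@le_trans _ _ (2 ^+ n * K * (2 * P ^+ 2)^-1 ^+ n)).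
  rewrite invfM exprMn !exprVn -exprM mulrACA divff ?mul1r; last by rewrite expf_neq0.
  by rewrite ler_pdivlMr.
rewrite ler_wpM2l//; last by apply: w; rewrite /P le_max lexx orbT.
by rewrite mulr_ge0 ?exprn_ge0// addr_ge0// sumr_ge0.
Qed.

End Complex.

(** * Schwartz functions and the decomposition of the operator into dyadic pieces *)

Section Schwartz.
Variable R : realType.
Local Notation E := (E R).
Local Notation mu := (@mu R).
Implicit Types (c v u x y xi : nat -> R).

Section Part.
Variables (n' : nat).
Local Notation n := n'.+1.
Variable (s : 'rV[R]_n -> R).
Hypothesis smooth : smoothR s.
Hypothesis decay : forall (a b : 'I_n -> nat), exists K : R, forall x : 'rV[R]_n,
  `|\prod_i x 0 i ^+ a i| * `|mder (fun _ : 'I_1 => b) s x| <= K.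

Lemma mder_row (e : 'I_n) i : mder (fun _ : 'I_1 => fun j => if j == e then i else 0%N) s = pder (nseq i (ord0, e)) s.
Proof.
rewrite /mder (@flatten_nseq1 _ _ (fun d : 'I_1 * 'I_n => if d.2 == e then i else 0%N) (ord0, e)).
- rewrite (_ : (_ \in _) = true) ?eqxx//; apply/allpairsP; exists (ord0, e).
  by split=> //; rewrite mem_enum.
- by apply: allpairs_uniq; rewrite ?enum_uniq// => -[? ?] [? ?] _ _ [-> ->].
- move=> [t1 t2] _; rewrite /= ord1 xpair_eqE eqxx/=; by case: eqP.
Qed.

Lemma rv_upd c e h t : (e < n)%N -> rv n (upd c e (h + t)) = h *: delta_mx ord0 (inord e) + rv n (upd c e t).
Proof.
move=> en; apply/rowP => j; rewrite !mxE eqxx/= -val_eqE/= inordK// /upd.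
by case: (nat_of_ord j == e); rewrite ?mulr1// mulr0 add0r.
Qed.

Lemma schwartz_dom e i : (e < n)%N -> dom n (fun c => pder (nseq i (ord0, inord e)) s (rv n c)).
Proof.
move=> en; split.
  apply: measurable_contmx => [N|k j]; first exact/differentiable_continuous/smooth.
  by under eq_fun do rewrite mxE; exact: measurable_co.
have H (a : {ffun 'I_n -> bool}) : exists K : R, forall x : 'rV[R]_n,
    `|\prod_j x 0 j ^+ (2 * a j)| * `|pder (nseq i (ord0, inord e)) s x| <= K.
  have [K HK] := decay (fun j => (2 * a j)%N) (fun j => if j == inord e then i else 0%N).
  by exists K => x; have := HK x; rewrite mder_row.
have [Kf HK] := choice H.
exists (2 ^+ n * \sum_a `|Kf a|) => c.
(* Only coordinates of modulus at least 1 are multiplied in: there 1 + c_j^2 <= 2 c_j^2, elsewhere 1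
   + c_j^2 <= 2. There are finitely many such subsets, so their constants can be added. *)
pose a := [ffun j : 'I_n => 1 <= `|c j|].
have h := HK a (rv n c).
have P0 : 0 < \prod_(j < n) (1 + c j ^+ 2) by apply: prodr_gt0 => j _; exact: sq1_gt0.
have -> : wt n c = (\prod_(j < n) (1 + c j ^+ 2))^-1 by rewrite /wt prodfV.
rewrite ler_pdivlMr//; apply: (@le_trans _ _ (2 ^+ n * (`|\prod_j (rv n c) 0 j ^+ (2 * a j)| * `|pder (nseq i (ord0, inord e)) s (rv n c)|))); last first.
  rewrite ler_wpM2l ?exprn_ge0//; apply: (le_trans h); apply: (le_trans (ler_norm _)).
  by rewrite (bigD1 a)//= lerDl sumr_ge0.
rewrite mulrC mulrA ler_wpM2r// -[n in 2 ^+ n]card_ord -prodr_const normr_prod -big_split/=.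
apply: ler_prod => j _; rewrite (ltW (sq1_gt0 _))/= mxE /a ffunE.
case: (boolP (1 <= `|c j|)) => c1; rewrite ?muln1 ?muln0.
  have := lerXn2r 2 (_ : 1 \in Num.nneg) (_ : `|c j| \in Num.nneg) c1.
  rewrite !nnegrE ler01 normr_ge0 expr1n => /(_ isT isT); rewrite normrX => h1.
  by rewrite -[c j ^+ 2]real_normK ?num_real//; lra.
rewrite expr0 normr1 mulr1 -[c j ^+ 2]real_normK ?num_real//.
have : `|c j| ^+ 2 <= 1 by rewrite exprn_ile1// ltW// ltNge.
by lra.
Qed.

Lemma schwartz_chain e M : (e < n)%N -> chain n e M (fun i c => pder (nseq i (ord0, inord e)) s (rv n c)).
Proof.
move=> en; have I i : isd e (fun c => pder (nseq i (ord0, inord e)) s (rv n c)) (fun c => pder (nseq i.+1 (ord0, inord e)) s (rv n c)).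
  move=> c t; apply: (@ider_line R _ _ (pder (nseq i (ord0, inord e)) s) _ (fun s0 => rv n (upd c e s0))).
    by move=> s0 h; exact: rv_upd.
  exact/diff_derivable/smooth.
split=> [i _|i _|i _ c]; [exact: schwartz_dom|exact: I|exact: (ider_continuous (fun t => I i c t))].
Qed.

Lemma schwartz_osc psi : dom n (osc n (fun c => s (rv n c)) psi).
Proof.
apply: osc_dom => //; first exact: (@schwartz_dom 0 0 isT).
move=> e en; exists (fun i c => pder (nseq i (ord0, inord e)) s (rv n c)); split=> //.
exact: schwartz_chain.
Qed.

End Part.

Variables (n' : nat).
Local Notation n := n'.+1.

Lemma schwartz_parts (f : 'rV[R]_n -> R[i]) : schwartz f ->
  let P := fun s : 'rV[R]_n -> R => smoothR s /\ forall (a b : 'I_n -> nat), exists K : R, forall x : 'rV[R]_n,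
    `|\prod_i x 0 i ^+ a i| * `|mder (fun _ : 'I_1 => b) s x| <= K in
  P (fun x : 'rV[R]_n => complex.Re (f x)) /\ P (fun x : 'rV[R]_n => complex.Im (f x)).
Proof.
move=> [[s1 s2] H] P; split; split=> // a b; have [K HK] := H a b; exists K => x; apply: le_trans (HK x);
  rewrite ler_wpM2l//.
  exact: (normr_Re (mderC (fun _ : 'I_1 => b) f x)).
exact: (normr_Im (mderC (fun _ : 'I_1 => b) f x)).
Qed.

Lemma schwartz_domC f : schwartz f -> domC n (fun c => f (rv n c)).
Proof.
move=> /schwartz_parts[[s1 d1] [s2 d2]].
by split; [exact: (schwartz_dom s1 d1 0 (ltn0Sn n'))|exact: (schwartz_dom s2 d2 0 (ltn0Sn n'))].
Qed.

Lemma fourier_cint (f : 'rV[R]_n -> R[i]) xi : schwartz f ->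
  fourier f (rv n xi) = cint n (fun c => f (rv n c) * ephase n xi c).
Proof.
move=> sf; have [d1 d2] := domC_ephase xi (schwartz_domC sf).
have de c : dotp (rv n c) (rv n xi) = dot n c xi by apply: eq_bigr => i _; rewrite !mxE.
have EE c : f (rv n c) * expi (- (2 * pi * dotp (rv n c) (rv n xi))) = f (rv n c) * ephase n xi c.
  by rewrite de.
rewrite /fourier /Cintn /cint; congr (Complex _ _).
  by rewrite Rintn_rint0; [congr rint; apply/funext => c; rewrite EE|under eq_fun do rewrite EE].
by rewrite Rintn_rint0; [congr rint; apply/funext => c; rewrite EE|under eq_fun do rewrite EE].
Qed.

Lemma fourier_domC (f : 'rV[R]_n -> R[i]) : schwartz f -> domC n (fun xi => fourier f (rv n xi)).
Proof.
move=> sf; have [[s1 d1] [s2 d2]] := schwartz_parts sf.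
have EE xi := etrans (fourier_cint xi sf) (cint_osc xi (schwartz_domC sf)).
split.
  rewrite (_ : (fun xi => _) = (fun xi => osc n (fun u => complex.Re (f (rv n u))) 0 xi + osc n (fun u => complex.Im (f (rv n u))) (- (pi / 2)) xi)).
    by apply: domD; [exact: (schwartz_osc s1 d1)|exact: (schwartz_osc s2 d2)].
  by apply/funext => xi; rewrite EE.
rewrite (_ : (fun xi => _) = (fun xi => osc n (fun u => complex.Im (f (rv n u))) 0 xi - osc n (fun u => complex.Re (f (rv n u))) (- (pi / 2)) xi)).
  by apply: domB; [exact: (schwartz_osc s2 d2)|exact: (schwartz_osc s1 d1)].
by apply/funext => xi; rewrite EE.
Qed.

Lemma local_rv (T : Type) (f : 'rV[R]_n -> T) : local n (fun c => f (rv n c)).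
Proof. by move=> c c' cc; congr f; apply/rowP => i; rewrite !mxE cc. Qed.

Variables (l' : nat).
Local Notation l := l'.+1.
Local Notation d := (l * n)%N.
Variables (sigma : 'rV[R]_n -> ('I_l -> 'rV[R]_n) -> R[i]) (f : 'I_l -> 'rV[R]_n -> R[i]).
Hypothesis (sf : forall j, schwartz (f j)).
Hypothesis smooth : smoothC (pack sigma).
Variable Ks : R.
Hypothesis sigmaK : forall M, cabs (pack sigma M) <= Ks.

Definition fblk (j : nat) c : R[i] := f (inord j) (rv n c).
Definition Fprod : (nat -> R) -> R[i] := tensor l n fblk.
Definition Fhat (c : nat -> R) : R[i] := \prod_(j < l) fourier (f j) (blk n c j).

Lemma Fprod_facts : local d Fprod /\ domC d Fprod.
Proof.
have [h1 h2 _] := @cint_blocks R l n fblk (fun j => @local_rv _ (f (inord j))) (fun j => schwartz_domC (sf (inord j))).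
by split.
Qed.

Lemma Fhat_domC : domC d Fhat.
Proof.
have [_ h _] := @cint_blocks R l n (fun j c => fourier (f (inord j)) (rv n c))
  (fun j => @local_rv _ (fourier (f (inord j)))) (fun j => fourier_domC (sf (inord j))).
by move: h; congr domC; apply/funext => c; apply: eq_bigr => j _; rewrite inord_val.
Qed.

Lemma Fhat_osc c : Fhat c =
  Complex (osc d (fun u => complex.Re (Fprod u)) 0 c + osc d (fun u => complex.Im (Fprod u)) (- (pi / 2)) c)
    (osc d (fun u => complex.Im (Fprod u)) 0 c - osc d (fun u => complex.Re (Fprod u)) (- (pi / 2)) c).
Proof.
have [_ dT cT] := @cint_blocks R l n fblk (fun j => @local_rv _ (f (inord j))) (fun j => schwartz_domC (sf (inord j))).
rewrite -(cint_osc c dT) cT; apply: eq_bigr => j _.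
by rewrite -(fourier_cint _ (sf (inord j))) inord_val.
Qed.

Definition integrand y c : R[i] := pack sigma (mxc l' n' y c) * Fhat c * expi (2 * pi * dot d c (rep n y)).

Lemma mfr_sigma y : mfr d (fun c => complex.Re (pack sigma (mxc l' n' y c))) /\
  mfr d (fun c => complex.Im (pack sigma (mxc l' n' y c))).
Proof.
have mx k i : measurable_fun setT (fun w : E d => mxc l' n' y (co w) k i).
  under eq_fun do rewrite mxE; case: (unlift ord0 k) => [q|]; [exact: measurable_co|exact: measurable_cst].
have [s1 s2] := smooth.
split.
  apply: (@measurable_contmx R _ _ _ (E d) (fun M => complex.Re (pack sigma M)) (fun w => mxc l' n' y (co w))) => // M.
  exact/differentiable_continuous/(s1 [::]).
apply: (@measurable_contmx R _ _ _ (E d) (fun M => complex.Im (pack sigma M)) (fun w => mxc l' n' y (co w))) => // M.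
exact/differentiable_continuous/(s2 [::]).
Qed.

Lemma integrand_domC y : domC d (integrand y).
Proof.
have [m1 m2] := mfr_sigma y.
have h : domC d (fun c => Fhat c * pack sigma (mxc l' n' y c)).
  by apply: (@domC_mulB R d _ _ Ks Fhat_domC).
rewrite (_ : integrand y = fun c => (Fhat c * pack sigma (mxc l' n' y c)) * expi (2 * pi * dot d c (rep n y))); last first.
  by apply/funext => c; rewrite /integrand [Fhat c * _]mulrC.
have mp : mfr d (fun c => 2 * pi * dot d c (rep n y)).
  by apply: measurable_funM => //; exact: mfr_dot.
by apply: (@domC_mulB R d _ _ 1 h); [exact: mfr_cos|exact: mfr_sin|move=> c; rewrite cabs_expi].
Qed.

Lemma dot_blocks q c y : \sum_(j < q) dot n (shift (j * n) c) y = dot (q * n) c (rep n y).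
Proof.
elim: q c => [|q IH] c; first by rewrite big_ord0 mul0n /dot big_ord0.
rewrite big_ord_recl mulSn dot_cat; congr (_ + _).
  by apply: eq_bigr => i _; rewrite /rep modn_small// /shift mul0n add0n.
have -> : shift n (rep n y) = rep n y by apply/funext => i; rewrite /shift /rep modnDl.
rewrite -IH; apply: eq_bigr => j _; congr (dot n _ y).
by apply/funext => i; rewrite /shift lift0 mulSn addnA.
Qed.

Lemma dotp_rep y c : dotp (rv n y) (\sum_(j < l) blk n c j) = dot d c (rep n y).
Proof.
rewrite -dot_blocks /dotp; under eq_bigr do rewrite summxE mulr_sumr.
rewrite exchange_big /=; apply: eq_bigr => j _; apply: eq_bigr => i _.
by rewrite !mxE mulrC /shift.
Qed.

Lemma Tsigma_cint y : Tsigma sigma f (rv n y) = cint d (integrand y).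
Proof.
have [d1 d2] := integrand_domC y.
have row0 c : row ord0 (mxc l' n' y c) = rv n y.
  by apply/rowP => i; rewrite !mxE unlift_none.
have rowj c : (fun j => row (lift ord0 j) (mxc l' n' y c)) = blk n c :> ('I_l -> _).
  by apply/funext => j; exact: row_mxc.
have EE c : sigma (rv n y) (blk n c) * (\prod_j fourier (f j) (blk n c j))
    * expi (2 * pi * dotp (rv n y) (\sum_(j < l) blk n c j)) = integrand y c.
  by rewrite (dotp_rep y c) /integrand /pack row0 rowj.
rewrite /Tsigma /CintL /cint; congr (Complex _ _).
  by rewrite RintL_rint; [congr rint; apply/funext => c; rewrite EE|under eq_fun do rewrite EE].
by rewrite RintL_rint; [congr rint; apply/funext => c; rewrite EE|under eq_fun do rewrite EE].
Qed.

Definition part (p : bool) : 'M[R]_(l.+1, n) -> R :=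
  fun M => if p then complex.Re (pack sigma M) else complex.Im (pack sigma M).
Definition Fpart (w : bool) u : R := if w then complex.Re (Fprod u) else complex.Im (Fprod u).
(* [p] and [w] select the real or imaginary part of the symbol and of the product of the
   [f_j]; [h] shifts the phase by a quarter period, turning [cos] into [- sin]. *)
Definition TT b (p h w : bool) k y : R :=
  Top n d (piece (part p) b k) (if h then pi / 2 else 0) (Fpart w) y.

Lemma Fpart_dom w : dom d (Fpart w).
Proof. by have [_ [d1 d2]] := Fprod_facts; case: w. Qed.

Lemma Sop_one (a F : (nat -> R) -> R) psi p : dom d a -> dom d F ->
  dom d (fun c => a c * (cos (2 * pi * dot d c p + psi) * osc d F 0 c)) /\
  dom d (fun c => a c * (cos (2 * pi * dot d c p + (psi - pi / 2)) * osc d F (- (pi / 2)) c)).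
Proof.
move=> da dF; have mc q : mfr d (fun c => cos (2 * pi * dot d c p + q)) by apply: mfr_cos; exact: mfr_phase.
by split; apply: dom_oscc => // c; exact: normr_cos.
Qed.

Lemma piece_dom M b B k p y : is_cutoff M b B -> 0 <= B -> dom d (piece (part p) b k y 0%N 0%N).
Proof.
move=> cut B0; have [m1 m2] := mfr_sigma y.
have [_ mr _ _] := @ring_sfam R d M b B cut k isT 0%N isT.
have db : dom d (ring d b k 0%N 0%N).
  apply: (@dom_supp R d (2 * 2 ^+ k) ((1 + B) ^+ d * (1 + 2 ^+ M) * (2 ^+ k)^-1 ^+ 0)).
  - by rewrite expr0 mulr1; apply: mulr_ge0; rewrite ?addr_ge0 ?exprn_ge0 ?addr_ge0.
  - exact: mr.
  - by move=> c; exact: (ring_bound cut B0 k c (isT : (0 < d)%N) (leq0n M)).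
  - move=> c cW; apply: (ring_supp cut (isT : (0 < d)%N) (leq0n M)) => -[c1 _].
    by move: cW; rewrite ltNge c1.
have -> : piece (part p) b k y 0%N 0%N = fun c => ring d b k 0%N 0%N c * part p (mxc l' n' y c).
  by apply/funext => c; rewrite /piece fmul0.
apply: (@dom_bmul R d _ _ Ks db); first by case: p.
by move=> c; case: p; [exact: le_trans (normr_Re _) (sigmaK _)|exact: le_trans (normr_Im _) (sigmaK _)].
Qed.

(** Real and imaginary parts of symbol times transform times exponential: after [cint_osc], each of
    the four real products is the frequency form of one operator [TT], the shift [h] supplying the
    sine of the exponential. *)
Lemma pieces_rint M b B k y : is_cutoff M b B -> 0 <= B ->
  rint d (fun c => ring d b k 0%N 0%N c * complex.Re (integrand y c)) =
    TT b true false true k y - TT b false false false k y + TT b true true false k y + TT b false true true k y /\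
  rint d (fun c => ring d b k 0%N 0%N c * complex.Im (integrand y c)) =
    TT b true false false k y - TT b true true true k y + TT b false false true k y + TT b false true false k y.
Proof.
move=> cut B0; have da p := piece_dom k p y cut B0.
have S q ps w := @Sop_one _ _ ps (rep n y) (da q) (Fpart_dom w).
pose G q ps w c := piece (part q) b k y 0%N 0%N c * (cos (2 * pi * dot d c (rep n y) + ps) * osc d (Fpart w) 0 c) +
  piece (part q) b k y 0%N 0%N c * (cos (2 * pi * dot d c (rep n y) + (ps - pi / 2)) * osc d (Fpart w) (- (pi / 2)) c).
have dG q ps w : dom d (G q ps w) by have [h1 h2] := S q ps w; exact: domD.
have TE q (h w : bool) : TT b q h w k y = rint d (G q (if h then pi / 2 else 0) w).
  rewrite /TT /Top Sop_fub; [|exact: da|exact: Fpart_dom].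
  by have [h1 h2] := S q (if h then pi / 2 else 0) w; rewrite /G rintD.
have pE q c : piece (part q) b k y 0%N 0%N c = ring d b k 0%N 0%N c * part q (mxc l' n' y c).
  by rewrite /piece fmul0.
have c1 (t : R) : cos (t + (0 - pi / 2)) = sin t by rewrite sub0r -cosN opprD opprK addrC cosB cos_pihalf sin_pihalf mul0r add0r mul1r.
have c2 (t : R) : cos (t + (pi / 2 - pi / 2)) = cos t by rewrite subrr addr0.
have c3 (t : R) : cos (t + pi / 2) = - sin t by exact: cosDpihalf.
rewrite !TE -!(rintB, rintD); try by do ?[exact: dG|apply: domB|apply: domD].
split; congr rint; apply/funext => c; rewrite /G !pE !c1 !c2 !c3 !addr0 /integrand Fhat_osc /part /Fpart.
  rewrite Re_mul Re_mul Im_mul /=; ring.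
rewrite Im_mul Re_mul Im_mul /=; ring.
Qed.

(** Dominated convergence: each point leaves the set where nrm > 2^K once K is large. Starting
    beyond [K1] keeps the choice cofinal. *)
Lemma tail_small (H : (nat -> R) -> R) D : dom D H -> (forall c, 0 <= H c) -> forall e : R, 0 < e -> forall K1 : nat,
  exists K, (K1 <= K)%N /\ rint D (fun c => H c * \1_[set c | 2 ^+ K < nrm D c] c) <= e.
Proof.
move=> dH H0 e e0 K1.
pose I (K : nat) (c : nat -> R) : R := \1_[set c | 2 ^+ K < nrm D c] c.
have mI K : mfr D (I K).
  rewrite /mfr (_ : _ \o _ = \1_[set w : E D | 2 ^+ K < nrm D (co w)]).
    apply: measurable_indic; rewrite -[X in measurable X]setTI.
    have := @measurable_nrm R D _ (E D) (@co R D) (fun i => @measurable_co R D i) measurableT `]2 ^+ K, +oo[%classic (measurable_itv _).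
    by congr measurable; apply/seteqP; split => w /=; rewrite in_itv/= andbT.
  by apply/funext => w; rewrite /I /= !indicE !in_setb.
have I1 K c : `|I K c| <= 1 by rewrite /I indicE; case: (_ \in _); rewrite ?normr1 ?normr0.
have dI K : dom D (fun c => H c * I K c) by exact: dom_bmul dH (mI K) (I1 K).
have cv : (\int[mu D]_w (H (co w) * I K (co w))%:E @[K --> \oo] --> \int[mu D]_w (0 : \bar R))%E.
  apply: (@dominated_cvg _ _ _ (mu D) setT measurableT (fun K w => (H (co w) * I K (co w))%:E) (fun=> 0%E) (fun w => (H (co w))%:E)).
  - by move=> K; exact: mfe_EFin (dom_mfr (dI K)).
  - move=> w _; apply: cvg_near_cst; near=> K.
    rewrite /I indicE in_setb ltNge (_ : _ <= _) ?mulr0//.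
    near: K; exists (Num.bound (nrm D (co w))) => // K /= hK.
    rewrite (le_trans (ltW (archi_boundP (nrm_ge0 _ _))))// (le_trans (_ : _ <= K%:R))// ?ler_nat//.
    by rewrite -natrX ler_nat ltnW// ltn_expl.
  - by [].
  - exact: dom_integrable.
  - move=> K w _; rewrite abse_EFin lee_fin ger0_norm ?mulr_ge0 ?indicE//.
    by rewrite ler_piMr// lern1 leq_b1.
rewrite integral0 in cv.
have /fine_cvgP[_ /cvgrPdist_le/(_ e e0)[K2 _ HK2]] : (\int[mu D]_w (H (co w) * I K (co w))%:E @[K --> \oo] --> (0 : R)%:E)%E by [].
exists (maxn K1 K2); split; first exact: leq_maxl.
have := HK2 (maxn K1 K2) (leq_maxr _ _); rewrite /= sub0r normrN => /(le_trans _); apply.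
exact: ler_norm.
Unshelve. all: by end_near. Qed.

(** The part of the frequency integral cut away is at most the tail of the transform of the f_j
    times a bound of the symbol, hence small uniformly in y. The number of pieces depends on the
    f_j, so later bounds must be summable over all k. *)
Lemma Tsigma_pieces M b B (e : R) K1 : is_cutoff M b B -> 0 <= B -> 0 < e -> exists K, (K1 <= K)%N /\
  forall y,
  `|complex.Re (Tsigma sigma f (rv n y)) - \sum_(k < K.+1) (TT b true false true k y - TT b false false false k y + TT b true true false k y + TT b false true true k y)| <= e /\
  `|complex.Im (Tsigma sigma f (rv n y)) - \sum_(k < K.+1) (TT b true false false k y - TT b true true true k y + TT b false false true k y + TT b false true false k y)| <= e.
Proof.
move=> cut B0 e0; have Ks0 : 0 <= Ks by apply: le_trans (sigmaK 0); exact: cabs_ge0.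
pose H c := `|complex.Re (Fhat c)| + `|complex.Im (Fhat c)|.
have [f1 f2] := Fhat_domC.
have dH : dom d H by apply: domD; exact: dom_abs.
have H0 c : 0 <= H c by rewrite addr_ge0.
pose Q := (1 + (1 + B) ^+ d) * (1 + Ks).
have Q0 : 0 < Q by apply: mulr_gt0; rewrite ltr_pwDl// exprn_ge0// addr_ge0.
have eQ : 0 < e / Q by rewrite divr_gt0.
have [K [K1K HK]] := tail_small dH H0 eQ K1.
exists K; split=> // y.
have d0 : (0 < d)%N by [].
pose cutK c := \sum_(k < K.+1) ring d b k 0%N 0%N c.
have cE c : cutK c = cutfam d b (2 ^+ K) 0%N 0%N c by exact: ring_sum.
have two0 : 0 < 2 ^+ K :> R by exact: exprn_gt0.
have mI : dom d (fun c => H c * \1_[set c | 2 ^+ K < nrm d c] c).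
  apply: (@dom_bmul R d H _ 1 dH).
    have h := dom_mfr (@dom_box R d (2 ^+ K)).
    rewrite (_ : \1_ _ = fun c => 1 - \1_[set c | nrm d c <= 2 ^+ K] c); first exact: measurable_funB.
    by apply/funext => c; rewrite !indicE !in_setb ltNge; case: (_ <= _); rewrite ?subrr ?subr0.
  by move=> c; rewrite indicE; case: (_ \in _); rewrite ?normr1 ?normr0.
have rd k : mfr d (ring d b k 0%N 0%N) by have [_ mr _ _] := @ring_sfam R d M b B cut k d0 0%N d0; exact: mr.
have main (X : (nat -> R) -> R) : dom d X -> (forall c, `|X c| <= Ks * H c) ->
    `|rint d X - \sum_(k < K.+1) rint d (fun c => ring d b k 0%N 0%N c * X c)| <= e.
  move=> dX XH; have dk k : dom d (fun c => ring d b k 0%N 0%N c * X c).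
    have := @dom_bmul R d X _ _ dX (rd k) (fun c => ring_bound cut B0 k c d0 (leq0n M)).
    by congr dom; apply/funext => c; rewrite mulrC.
  have [ds es] := rint_sum (index_enum 'I_K.+1) (fun k : 'I_K.+1 => dk k).
  rewrite -es -rintB//; apply: le_trans (rint_abs (domB dX ds)) _.
  apply: (@le_trans _ _ (rint d (fun c => Q * (H c * \1_[set c | 2 ^+ K < nrm d c] c)))).
    apply: le_rint; [exact/dom_abs/domB|exact: domZ|move=> c].
    rewrite -mulr_suml -/(cutK c) -{1}[X c]mul1r -mulrBl normrM cE indicE in_setb.
    have [cK|cK] := leP (nrm d c) (2 ^+ K).
      by rewrite (cutfam_one cut d0 (leq0n M) two0 cK) subrr normr0 mul0r !mulr0.
    have h : `|cutfam d b (2 ^+ K) 0%N 0%N c| <= (1 + B) ^+ d.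
      have := cutfam_bound cut c d0 (leq0n M) two0.
      by rewrite expr0 mulr1.
    rewrite mulr1 /Q -mulrA; apply: ler_pM => //.
      by rewrite (le_trans (ler_normB _ _))// normr1 lerD2l.
    by apply: le_trans (XH c) _; rewrite ler_wpM2r// lerDr.
  by rewrite rintZ// mulrC -ler_pdivlMr.
have Xb c : cabs (integrand y c) <= Ks * H c.
  rewrite /integrand !cabsM cabs_expi mulr1; apply: ler_pM; rewrite ?cabs_ge0//.
  exact: cabs_le.
have [x1 x2] := integrand_domC y.
rewrite Tsigma_cint /cint /=; split.
  under eq_bigr do rewrite -(pieces_rint _ y cut B0).1.
  by apply: main => // c; exact: le_trans (normr_Re _) (Xb c).
under eq_bigr do rewrite -(pieces_rint _ y cut B0).2.
by apply: main => // c; exact: le_trans (normr_Im _) (Xb c).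
Qed.

End Schwartz.

(** * Summation over the frequency pieces *)

Section Assembly.
Variable R : realType.
Local Notation E := (E R).
Implicit Types (c u : nat -> R).

Section Geometric.
Variables (eta s : R).
Hypotheses (eta0 : 0 < eta) (s0 : 0 < s).
Let th : R := 2 `^ (- eta).

Lemma th_lt1 : 0 < th < 1.
Proof.
rewrite powR_gt0//= /th powRN invf_lt1 ?powR_gt0//.
have := @gt0_ltr_powR R eta eta0 1 2; rewrite !nnegrE ler01 ler0n powR1 => h.
by apply: h => //; rewrite ltr1n.
Qed.

Lemma powR_double (x e : R) : 0 < x -> (2 * x) `^ e = 2 `^ e * x `^ e.
Proof. by move=> x0; rewrite powRM// ltW. Qed.

Lemma scaleS k : 2 ^+ k.+1 * s = 2 * (2 ^+ k * s). Proof. by rewrite exprS mulrA. Qed.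

Lemma scale_gt0 k : 0 < 2 ^+ k * s. Proof. by rewrite mulr_gt0// exprn_gt0. Qed.

Lemma thS (x : R) : 0 < x -> th * (2 * x) `^ eta = x `^ eta.
Proof. by move=> x0; rewrite powR_double// mulrA /th powRN mulVf ?mul1r// gt_eqF// powR_gt0. Qed.

Lemma thN (x : R) : 0 < x -> (2 * x) `^ (- eta) = th * x `^ (- eta).
Proof. by move=> x0; rewrite powR_double. Qed.

Lemma powR_le1 (x e : R) : 0 < x -> x <= 1 -> 0 <= e -> x `^ e <= 1.
Proof.
move=> x0 x1 e0; have := @ge0_ler_powR R e e0 x 1; rewrite !nnegrE (ltW x0) ler01 powR1 => h.
exact: h.
Qed.

Lemma powR_ge1 (x e : R) : 1 <= x -> 0 <= e -> 1 <= x `^ e.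
Proof. by move=> x1 e0; rewrite -[leLHS](powRr0 x) ler_powR. Qed.

Lemma powRN_ge1 (x e : R) : 0 < x -> x <= 1 -> 0 <= e -> 1 <= x `^ (- e).
Proof. by move=> x0 x1 e0; rewrite powRN invf_ge1 ?powR_gt0// powR_le1. Qed.

(** A geometric sum dominated by its last term. The minimum records both that term and the threshold
    1, which is what makes the induction close when 2^K s crosses 1. *)
Lemma sum_low K : (1 - th) * \sum_(k < K) (if 2 ^+ k * s < 1 then (2 ^+ k * s) `^ eta else 0) <=
  Num.min 1 ((2 ^+ K * s / 2) `^ eta).
Proof.
have /andP[t0 t1] := th_lt1; have u0 : 0 <= 1 - th by rewrite subr_ge0 ltW.
elim: K => [|K IH]; first by rewrite big_ord0 mulr0 le_min ler01 powR_ge0.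
rewrite big_ord_recr /= mulrDr scaleS [2 * _ / 2]mulrAC divff// mul1r.
case: ltP => h.
  apply: (@le_trans _ _ ((2 ^+ K * s) `^ eta)); last by rewrite le_min lexx andbT powR_le1 ?scale_gt0// ltW.
  have e1 : th * (2 ^+ K * s) `^ eta = (2 ^+ K * s / 2) `^ eta.
    by rewrite -[RHS]thS ?divr_gt0 ?scale_gt0// [2 * (_ / 2)]mulrC divfK.
  rewrite [(1 - th) * (2 ^+ K * s) `^ eta]mulrBl mul1r e1.
  move: IH; rewrite le_min => /andP[_]; lra.
rewrite mulr0 addr0; apply: le_trans IH _; rewrite le_min ge_min lexx/=.
by rewrite ge_min powR_ge1// ltW.
Qed.

(** Geometric decay starting where 2^k s reaches 1; the bound is kept in telescoping form,
    subtracting what later terms will still add. *)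
Lemma sum_high K : (1 - th) * \sum_(k < K) (if 2 ^+ k * s < 1 then 0 else (2 ^+ k * s) `^ (- eta)) <=
  1 - Num.min 1 ((2 ^+ K * s) `^ (- eta)).
Proof.
have /andP[t0 t1] := th_lt1; have u0 : 0 <= 1 - th by rewrite subr_ge0 ltW.
elim: K => [|K IH]; first by rewrite big_ord0 mulr0 subr_ge0 ge_min lexx.
rewrite big_ord_recr /= mulrDr scaleS thN ?scale_gt0//.
set x := (2 ^+ K * s) `^ (- eta) in IH *; have x0 : 0 <= x by exact: powR_ge0.
case: ltP => h.
  rewrite mulr0 addr0; apply: le_trans IH _.
  have -> : Num.min 1 x = 1 by apply/min_idPl; rewrite powRN_ge1 ?scale_gt0 ?(ltW h)// ltW.
  by rewrite subrr subr_ge0 ge_min lexx.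
have x1 : x <= 1.
  rewrite /x powRN invf_le1 ?powR_gt0 ?scale_gt0//.
  exact: powR_ge1 h (ltW eta0).
have e1 : Num.min 1 x = x by apply/min_idPr.
have e2 : Num.min 1 (th * x) <= th * x by rewrite ge_min lexx orbT.
by move: IH; rewrite e1 => IH; nra.
Qed.

Lemma sum_powers K : (1 - th) * \sum_(k < K) (2 ^+ k) `^ (- eta) <= 1.
Proof.
have /andP[t0 t1] := th_lt1.
have E1 k : (2 ^+ k) `^ (- eta) = th ^+ k.
  by rewrite -powR_mulrn// -powRrM mulrC powRrM powR_mulrn ?powR_ge0.
under eq_bigr do rewrite E1.
elim: K => [|K IH]; first by rewrite big_ord0 mulr0.
suff : (1 - th) * \sum_(k < K.+1) th ^+ k = 1 - th ^+ K.+1.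
  by move=> ->; rewrite gerBl exprn_ge0// ltW.
elim: K.+1 => [|j IHj]; first by rewrite big_ord0 mulr0 expr0 subrr.
by rewrite big_ord_recr /= mulrDr IHj exprS; ring.
Qed.

End Geometric.

Lemma co_out n (w : E n) i : (n <= i)%N -> co w i = 0.
Proof. by elim: n w i => [|n IH] w [|i] //= ni; exact: IH. Qed.

(** Only the majorant has to be measurable. It is transported to row vectors by extending their
    coordinates by zero. *)
Lemma Eintn_le n (h : 'rV[R]_n -> R) (G : (nat -> R) -> R) : (forall y : 'rV[R]_n, 0 <= h y) -> mfr n G ->
  (forall c, 0 <= G c) -> (forall c, h (rv n c) <= G c) ->
  (Eintn (fun y => (h y)%:E) <= eint n (fun c => (G c)%:E))%E.
Proof.
move=> h0 mG G0 hG.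
pose cy (y : 'rV[R]_n) i := if insub i is Some j then y 0 j else 0.
have cyE c i : (i < n)%N -> cy (rv n c) i = c i by move=> ni; rewrite /cy insubT mxE.
have rvE y : rv n (cy y) = y by apply/rowP => i; rewrite mxE /cy valK.
have cyco (w : E n) : cy (rv n (co w)) = co w.
  apply/funext => i; have [ni|ni] := ltnP i n; first exact: cyE.
  by rewrite /cy insubF ?co_out// ltnNge ni.
apply: (@le_trans _ _ (Eintn (fun y => (G (cy y))%:E))).
  by apply: le_Eintn => y; rewrite lee_fin// -{1}[y]rvE.
rewrite Eintn_eint0; last 2 first.
- by move=> y; rewrite lee_fin.
- by rewrite /mfe (_ : _ \o _ = fun w : E n => (G (co w))%:E); [exact: mfe_EFin|apply/funext => w /=; rewrite cyco].
by rewrite le_eqVlt; apply/orP; left; apply/eqP; apply: eq_integral => w _; rewrite cyco.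
Qed.

Lemma powR_prod (I : Type) (q : seq I) (f : I -> R) (r : R) : (forall i, 0 <= f i) ->
  (\prod_(i <- q) f i) `^ r = \prod_(i <- q) f i `^ r.
Proof.
move=> f0; elim: q => [|i q IH]; first by rewrite !big_nil powR1.
by rewrite !big_cons powRM ?IH// prodr_ge0.
Qed.

Lemma mfr_cabs n (g : (nat -> R) -> R[i]) : mfr n (fun c => complex.Re (g c)) -> mfr n (fun c => complex.Im (g c)) ->
  mfr n (fun c => cabs (g c)).
Proof.
move=> m1 m2; apply: (mfr_cont (f := Num.sqrt) (g := fun c => complex.Re (g c) ^+ 2 + complex.Im (g c) ^+ 2)).
  exact: sqrt_continuous.
by apply: measurable_funD; apply: measurable_funX.
Qed.

Lemma dom_cabs_powR n (g : (nat -> R) -> R[i]) (r : R) : 1 <= r -> domC n g -> dom n (fun c => cabs (g c) `^ r).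
Proof.
move=> r1 [[m1 [K1 k1]] [m2 [K2 k2]]]; have r0 : 0 <= r by exact: le_trans ler01 r1.
split; first by apply: (measurableT_comp (measurable_powR r)); exact: mfr_cabs.
exists ((K1 + K2) `^ r) => c; have w0 := wt_gt0 n c.
have h : cabs (g c) <= (K1 + K2) * wt n c by rewrite mulrDl (le_trans (cabs_le _))// lerD.
have K0 : 0 <= K1 + K2 by rewrite -(pmulr_lge0 _ w0) (le_trans (cabs_ge0 _) h).
rewrite ger0_norm ?powR_ge0//; apply: (@le_trans _ _ (((K1 + K2) * wt n c) `^ r)).
  by apply: ge0_ler_powR; rewrite ?nnegrE ?cabs_ge0 ?mulr_ge0 ?(ltW w0).
rewrite powRM ?(ltW w0)// ler_wpM2l ?powR_ge0// -[leRHS]powRr1 ?(ltW w0)//.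
by apply: ger_powR => //; rewrite w0 wt_le1.
Qed.

Lemma cabs_real (t : R) : 0 <= t -> cabs (t%:C)%C = t.
Proof. by move=> t0; rewrite /cabs /= expr0n addr0 sqrtr_sqr ger0_norm. Qed.

Section Maximal.
Variables (n' l' : nat).
Local Notation n := n'.+1.
Local Notation l := l'.+1.
Local Notation d := (l * n)%N.
Variables (f : 'I_l -> 'rV[R]_n -> R[i]) (r : R).
Hypotheses (sf : forall j, schwartz (f j)) (r1 : 1 <= r).

Definition gblk (j : nat) c : R := cabs (fblk f j c) `^ r.

Lemma gblk_facts : [/\ forall j, local n (gblk j), forall j, dom n (gblk j), forall j c, 0 <= gblk j c &
  forall w u, `|Fpart f w u| `^ r <= \prod_(j < l) gblk j (shift (j * n) u)].
Proof.
split.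
- by move=> j; exact: (@local_rv R n' _ (fun v => cabs (f (inord j) v) `^ r)).
- by move=> j; apply: dom_cabs_powR => //; exact: schwartz_domC.
- by move=> j c; exact: powR_ge0.
- move=> w u; have r0 : 0 <= r by exact: le_trans ler01 r1.
  rewrite /gblk -(@powR_prod 'I_l (index_enum 'I_l) (fun j : 'I_l => cabs (fblk f j (shift (j * n) u))) r); last by move=> j; exact: cabs_ge0.
  apply: ge0_ler_powR; rewrite ?nnegrE ?prodr_ge0//; first by move=> j _; exact: cabs_ge0.
  by rewrite -cabs_prod; case: w; [exact: normr_Re|exact: normr_Im].
Qed.

(** The l-fold product of the cube centred at x is the cube of R^d centred at the diagonal point
    over x, in the maximum norm. *)
Lemma cube_blocks (x u : nat -> R) t : 0 <= t ->
  \prod_(j < l) \1_(cube (\row_i (x i - t)) (2 * t)) (blk n u j) = \1_[set c | nrm d (fun i => c i - rep n x i) <= t] u :> R.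
Proof.
move=> t0; rewrite [RHS]indicE in_setb; case: nrm_leP => // H.
  rewrite big1// => j _; rewrite indicE mem_set//= => i; rewrite !mxE.
  have := H (j * n + i)%N _; rewrite /rep modnMDl modn_small// ler_norml => h.
  have := h _; rewrite -ltn_subRL -mulnBl (leq_trans (ltn_ord i)) ?leq_pmull ?subn_gt0//.
  by move=> /(_ isT); lra.
move/existsNP: H => [e /not_implyP[ed /negP H]].
have jl : (e %/ n < l)%N by rewrite ltn_divLR.
rewrite (bigD1 (Ordinal jl))//= indicE memNset ?mul0r//= => /(_ (inord (e %% n))).
rewrite !mxE inordK ?ltn_mod// -divn_eq => h; move/negP: H; apply.
by rewrite /rep ler_norml; lra.
Qed.

(** The cube of side 2 t centred at x is one of the competitors in the maximal function, so its
    product average is the required value. *)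
Lemma maximal_value (x : 'rV[R]_n) (xc : nat -> R) t : 0 < t -> x = rv n xc ->
  exists v, [/\ (0 <= v)%E, (v <= multi_max (fun j y => (powR (cabs (f j y)) r)%:C%C) x)%E &
    eint d (fun u => (\prod_(j < l) gblk j (shift (j * n) u) *
       \1_[set c | nrm d (fun i => c i - rep n xc i) <= t] u)%:E) = (((2 * t) ^+ d)%:E * v)%E].
Proof.
move=> t0 xE; have [lg dg g0 _] := gblk_facts.
pose a : 'rV[R]_n := \row_i (xc i - t).
pose v := ((((2 * t) ^+ n) ^+ l)^-1%R%:E * EintL (fun u : 'I_l -> 'rV[R]_n =>
  (\prod_j (\1_(cube a (2 * t)) (u j) * cabs ((powR (cabs (f j (u j))) r)%:C%C)))%R%:E))%E.
have t2 : 0 < 2 * t by rewrite mulr_gt0.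
pose G u : R := \prod_(j < l) gblk j (shift (j * n) u) * \1_[set c | nrm d (fun i => c i - rep n xc i) <= t] u.
have G0 u : 0 <= G u by rewrite mulr_ge0 ?prodr_ge0// => j _; exact: g0.
have mG : mfr d G.
  by apply: measurable_funM; [apply: mfr_blocks => // j; exact: dom_mfr|exact: mfr_box].
have GE u : \prod_j (\1_(cube a (2 * t)) (blk n u j) * cabs ((powR (cabs (f j (blk n u j))) r)%:C%C)) = G u.
  rewrite big_split /= cube_blocks ?(ltW t0)// mulrC; congr (_ * _); apply: eq_bigr => j _.
  by rewrite cabs_real ?powR_ge0// /gblk /fblk inord_val.
have vE : v = (((2 * t) ^+ d)^-1%:E * eint d (fun u => (G u)%:E))%E.
  rewrite /v EintL_eint; last 2 first.
  - by apply: mfe_EFin; move: mG; congr mfr; apply/funext => u; rewrite GE.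
  - move=> u; rewrite lee_fin prodr_ge0// => j _; rewrite mulr_ge0 ?indicE//; exact: cabs_ge0.
  rewrite -exprM mulnC; congr (_ * _)%E.
  by apply: eq_integral => w _; rewrite GE.
have d0 : 0 < (2 * t) ^+ d by rewrite exprn_gt0.
exists v; split.
- rewrite vE mule_ge0//; first by rewrite lee_fin invr_ge0 ltW.
  by apply: integral_ge0 => w _; rewrite lee_fin.
- apply: ereal_sup_ubound; exists a, (2 * t); split=> //; split=> //.
  by move=> i; rewrite xE !mxE; lra.
- by rewrite vE muleA -EFinM divff ?gt_eqF// mul1e.
Qed.

Lemma maximal_bound (x : 'rV[R]_n) (xc : nat -> R) (Lam : R) : x = rv n xc ->
  (multi_max (fun j y => (powR (cabs (f j y)) r)%:C%C) x <= Lam%:E)%E ->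
  forall t, 0 < t -> (eint d (fun u => (\prod_(j < l) gblk j (shift (j * n) u) *
       \1_[set c | nrm d (fun i => c i - rep n xc i) <= t] u)%:E) <= (2 ^+ d * Lam * t ^+ d)%:E)%E.
Proof.
move=> xE mL t t0; have [v [v0 vm ->]] := maximal_value t0 xE.
have -> : 2 ^+ d * Lam * t ^+ d = (2 * t) ^+ d * Lam by rewrite exprMn; ring.
rewrite [leRHS]EFinM; apply: lee_wpmul2l; last exact: le_trans mL.
by rewrite lee_fin exprn_ge0// mulr_ge0// ltW.
Qed.

Lemma maximal_ge0 (x : 'rV[R]_n) : (0 <= multi_max (fun j y => (powR (cabs (f j y)) r)%:C%C) x)%E.
Proof.
pose xc i := x 0 (inord i : 'I_n).
have xE : x = rv n xc by apply/rowP => i; rewrite mxE /xc inord_val.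
by have [v [v0 vm _]] := maximal_value (ltr01 : 0 < 1 :> R) xE; exact: le_trans vm.
Qed.

End Maximal.

End Assembly.

(** * Estimates for a single frequency piece *)

Section Estimates.
Variable R : realType.
Local Notation E := (E R).
Implicit Types (c u : nat -> R).

Variables (n' l' : nat).
Local Notation n := n'.+1.
Local Notation l := l'.+1.
Local Notation d := (l * n)%N.
Local Notation N := (d.+1).
Local Notation M := (2 * N * l)%N.

(** Three ranges for the side t, separated by 2^-k and by the critical scale 2^(- rho k):
    oscillation below the first, [small_cube] between them, [large_cube] above the second. The
    constants do not depend on k because of [piece_scale]. *)
Lemma piece_estimates (m rho r q B : R) (s : 'M[R]_(l.+1, n) -> R) (b : nat -> R -> R) :
  0 < rho < 1 -> 1 < r <= 2 -> 0 < q <= 1 -> q * l%:R = r -> m * r = - (d%:R * (1 - rho)) -> smoothR s ->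
  (forall (alpha : 'I_n -> nat) (beta : 'I_l -> 'I_n -> nat), exists K : R, forall M : 'M[R]_(l.+1, n),
    `|mder (joinidx alpha beta) s M| <= K * powR (1 + \sum_j eucl (row (lift ord0 j) M))
      (m + rho * (\sum_i alpha i)%:R - rho * (\sum_j \sum_i beta j i)%:R)) ->
  is_cutoff M b B -> 0 <= B ->
  exists C : R, 0 < C /\ forall k F (g : nat -> (nat -> R) -> R) x L psi, dom d F ->
    (forall j, local n (g j)) -> (forall j, dom n (g j)) -> (forall j c, 0 <= g j c) ->
    (forall u, `|F u| `^ r <= \prod_(j < l) g j (shift (j * n) u)) -> 0 < L ->
    (forall t, 0 < t -> (eint d (fun u => (\prod_(j < l) g j (shift (j * n) u) *
       \1_[set c | nrm d (fun i => c i - rep n x i) <= t] u)%:E) <= (L * t ^+ d)%:E)%E) ->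
    let T := Top n d (piece s b k) psi F in
    [/\ mfr n T,
      forall t y, 0 < t -> 2 ^+ k * t < 1 -> (forall i, (i < n)%N -> `|y i - x i| <= t) ->
        `|T y - T x| <= C * (2 ^+ k * t) * L `^ r^-1 &
      forall a t, 0 < t -> 1 <= 2 ^+ k * t -> (forall i, (i < n)%N -> a i <= x i <= a i + t) ->
        (eint n (fun y => (cubei n a t y * `|T y| `^ q)%:E) <=
        (C * t ^+ n * ((2 ^+ k * t) `^ (- ((r - 1) / 8 * q)) + (2 ^+ k) `^ (- ((1 - rho) * ((r - 1) / 8 * q)))) * L `^ (l%:R)^-1)%:E)%E].
Proof.
move=> rho01 r12 q01 ql mr sm bd cut B0.
have /andP[r1 r2] := r12; have /andP[q0 q1] := q01; have /andP[rh0 rh1] := rho01.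
have r0 : 0 < r by exact: lt_trans ltr01 r1.
have d0 : (0 < d)%N by [].
have oM : ~~ odd M by rewrite -mulnA oddM.
have [C1 [C10 H1]] := @blocks_majorant R n l (ltn0Sn n') (ltn0Sn l').
have [K [K0 HK]] := pieces_good rho01 sm bd cut B0.
(* The successor of [n' + l' * n] computes to [d]. *)
have [Cs [Cs0 Hs]] := @small_cube R n' (n' + l' * n) M oM.
have [Cl [Cl0 Hl]] := @large_cube R n' (n' + l' * n) M oM.
have [Cw [Cw0 Hw]] := @low_frequency R n d M (ltn0Sn n') d0 oM.
pose K1 : R := K `^ r * 4 ^+ d.
have K10 : 0 < K1 by apply: mulr_gt0; [exact: powR_gt0|exact: exprn_gt0].
pose X0 : R := (K1 * C1) `^ r^-1.
have X00 : 0 < X0 by apply: powR_gt0; exact: mulr_gt0 K10 C10.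
have X0q : 0 < X0 `^ q by exact: powR_gt0.
pose C := 2 * Cw * X0 + (Cs + Cl) * X0 `^ q.
have c1 : 0 < 2 * Cw * X0 by rewrite !mulr_gt0.
have c2 : 0 < Cs * X0 `^ q by rewrite mulr_gt0.
have c3 : 0 < Cl * X0 `^ q by rewrite mulr_gt0.
have CE : C = 2 * Cw * X0 + (Cs * X0 `^ q + Cl * X0 `^ q) by rewrite /C [(Cs + Cl) * _]mulrDl.
exists C; split; first by rewrite CE; exact: addr_gt0 c1 (addr_gt0 c2 c3).
move=> k F g x L psi dF lg dg g0 FP L0 HL T.
have [F1 F2] := H1 r F g x L (ltW r1) lg dg g0 FP L0 HL.
have [gS fS lS] := HK k.
pose t2 : R := 2 ^+ k; have t20 : 0 < t2 by exact: exprn_gt0.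
have t21 : 1 <= t2 by apply: exprn_ege1; rewrite ler1n.
set A := K * t2 `^ m in gS fS lS; set W := 2 * t2 in gS fS lS; set del := t2 `^ (- rho) in gS fS lS.
have A0 : 0 < A by rewrite mulr_gt0// powR_gt0.
have W0 : 0 < W by rewrite mulr_gt0.
have del0 : 0 < del by exact: powR_gt0.
have AK : A `^ r * (2 * W) ^+ d * del ^+ d <= K1.
  by rewrite le_eqVlt; apply/orP; left; apply/eqP; exact: piece_scale.
have CL0 : 0 < C1 * L by rewrite mulr_gt0.
have HX : (K1 * (C1 * L)) `^ r^-1 = X0 * L `^ r^-1.
  by rewrite mulrA (powRM _ (ltW (mulr_gt0 K10 C10)) (ltW L0)).
(* The choice of q is used here: q / r = 1 / l. *)
have Lq : (L `^ r^-1) `^ q = L `^ (l%:R)^-1.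
  have qn : q != 0 by rewrite gt_eqF.
  rewrite -powRrM; congr (_ `^ _); rewrite -ql invfM mulrAC mulVf ?mul1r//.
have tdel : t2 * del = t2 `^ (1 - rho) by rewrite -{1}[t2](powRr1 (ltW t20)) -powR_split.
have td1 : 1 <= t2 `^ (1 - rho) by apply: powR_ge1 t21 _; rewrite subr_ge0 ltW.
have Wdel : W * del = 2 * t2 `^ (1 - rho) by rewrite -mulrA tdel.
have Wd2 : t2 `^ (1 - rho) <= W * del by rewrite Wdel ler_peMl ?powR_ge0// ler1n.
have Wd1 : 1 <= W * del by exact: le_trans td1 Wd2.
have dele : t2^-1 <= del by rewrite -powR_inv1 ?(ltW t20)//; apply: ler_powR t21 _ _ _; rewrite lerN2 ltW.
have anti (u v e : R) : 0 < u -> u <= v -> 0 <= e -> v `^ (- e) <= u `^ (- e).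
  move=> u0 uv e0; have v0 := lt_le_trans u0 uv.
  by rewrite !powRN lef_pV2 ?posrE ?powR_gt0// ge0_ler_powR ?nnegrE ?(ltW u0) ?(ltW v0).
pose ep := (r - 1) / 8; have ep0 : 0 <= ep by rewrite divr_ge0// subr_ge0 ltW.
have epq : 0 <= ep * q by rewrite mulr_ge0// ltW.
have Lp : 0 <= L `^ l%:R^-1 by exact: powR_ge0.
have Xq (u v : R) : 0 < u -> u <= v -> (X0 * L `^ r^-1 * v `^ (- ep)) `^ q <= X0 `^ q * L `^ l%:R^-1 * u `^ (- (ep * q)).
  move=> u0 uv; have v0 := lt_le_trans u0 uv.
  rewrite powRM ?powR_ge0 ?mulr_ge0 ?(ltW X00) ?powR_ge0// powRM ?powR_ge0 ?(ltW X00)// Lq -powRrM mulNr.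
  by rewrite ler_wpM2l ?anti// mulr_ge0// ltW.
split.
- exact: (mfr_Top psi d0 gS dF).
- move=> t y t0 kt yx; have st : 0 < t <= del.
    rewrite t0; apply: le_trans dele; rewrite -[t2^-1]mul1r ler_pdivlMr// mulrC; exact: ltW.
  apply: le_trans (Hw r A W del K1 (C1 * L) _ F psi x y t r12 A0 W0 st Wd1 CL0 AK fS lS dF yx (F1 del del0)) _.
  rewrite HX (_ : Cw * (W * t) * (X0 * L `^ r^-1) = 2 * Cw * X0 * (t2 * t) * L `^ r^-1); last first.
    by rewrite /W; set w := L `^ r^-1; set v := X0; ring.
  rewrite ler_wpM2r ?powR_ge0// ler_wpM2r//; first by rewrite mulr_ge0// ltW.
  by rewrite CE lerDl; exact: ltW (addr_gt0 c2 c3).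
- move=> a t t0 kt ax; rewrite -/t2 -/ep; have tn0 : 0 <= t ^+ n by exact/exprn_ge0/ltW.
  have t2t : 0 < t2 * t by rewrite mulr_gt0.
  have u1 : t2 * t <= W * t by rewrite /W -mulrA ler_peMl ?ler1n// ltW.
  have Wt1 : 1 <= W * t by exact: le_trans u1.
  have P1 : 0 <= (t2 * t) `^ (- (ep * q)) by exact: powR_ge0.
  have P2 : 0 <= t2 `^ (- ((1 - rho) * (ep * q))) by exact: powR_ge0.
  have fin (D p1 p2 : R) : 0 <= D -> D * X0 `^ q <= C -> 0 <= p1 -> 0 <= p2 ->
      D * t ^+ n * (X0 `^ q * L `^ l%:R^-1 * p1) <= C * t ^+ n * (p1 + p2) * L `^ l%:R^-1.
    move=> D0 DC p10 p20.
    rewrite (_ : D * t ^+ n * _ = D * X0 `^ q * (t ^+ n * p1 * L `^ l%:R^-1)); last first.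
      by set w1 := X0 `^ q; set w2 := L `^ _; set w3 := t ^+ n; ring.
    apply: le_trans (ler_wpM2r _ DC) _; first by rewrite mulr_ge0// mulr_ge0.
    have C0 : 0 <= C by rewrite CE; exact: ltW (addr_gt0 c1 (addr_gt0 c2 c3)).
    rewrite -[C * t ^+ n * _ * _]mulrA -[C * t ^+ n * (_ * _)]mulrA ler_wpM2l// -mulrA ler_wpM2l// ler_wpM2r// lerDl.
    exact: p20.
  have [td|td] := leP t del.
    have st : 0 < t <= del by rewrite t0.
    apply: le_trans (Hs r q A W del K1 (C1 * L) _ F psi a x t r12 q01 A0 W0 del0 st Wt1 CL0 AK gS dF ax (F1 del del0)) _.
    rewrite lee_fin HX -/ep; apply: le_trans (ler_wpM2l _ (Xq _ _ t2t u1)) _; first by rewrite mulr_ge0// ltW.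
    apply: fin => //; first exact: ltW.
    by rewrite CE addrCA lerDl; exact: ltW (addr_gt0 c1 c3).
  (* Above the critical scale the gain is frozen at its value for [del]: a power of 2^k del =
     (2^k)^(1 - rho), which is summable in k without reference to t. *)
  have st : 0 < del <= t by rewrite del0 ltW.
  have [En [mE E1 FE QE]] := F2 a t del ax st.
  have FE' z : (eint d (fun u => (`|F u * (weight d M (rep n z) del u)^-1| `^ r)%:E) <=
      (del ^+ d * (C1 * L * En z `^ (r / q)))%:E)%E.
    have -> : r / q = l%:R by rewrite -ql mulrAC divff ?mul1r// gt_eqF.
    by rewrite powR_mulrn ?(le_trans ler01 (E1 z))//; exact: FE.
  apply: le_trans (Hl r q A W del K1 (C1 * L) _ F psi a t En r12 q01 A0 W0 st Wd1 CL0 AK gS dF mE E1 FE' QE) _.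
  rewrite lee_fin HX -/ep; apply: le_trans (ler_wpM2l _ (Xq _ _ _ Wd2)) _.
  - by rewrite mulr_ge0// ltW.
  - by rewrite powR_gt0.
  rewrite -powRrM mulrN [X in _ <= _ * X * _]addrC; apply: fin => //; first exact: ltW.
  by rewrite CE addrA lerDr; exact: ltW (addr_gt0 c1 c2).
Qed.

End Estimates.

(** * Cube averages of the full operator and the sharp maximal function *)

Section Final.
Variable R : realType.
Local Notation E := (E R).

Lemma indic_cube n (a : 'rV[R]_n) (ac : nat -> R) s c : a = rv n ac -> \1_(cube a s) (rv n c) = cubei n ac s c :> R.
Proof.
move=> ->; rewrite indicE; case: (cubeiP n ac s c) => [c0|[-> H]].
  rewrite memNset// => H; move/eqP: c0; rewrite /cubei; apply/negP/prodf_neq0 => i _.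
  by rewrite indicE mem_set ?oner_neq0//= in_itv/=; have := H i; rewrite !mxE.
by rewrite mem_set// => i; rewrite !mxE; exact: H.
Qed.

Lemma eintZ n (Y : R) (g : (nat -> R) -> R) : 0 <= Y -> mfr n g -> (forall c, 0 <= g c) ->
  eint n (fun c => (Y * g c)%:E) = (Y%:E * eint n (fun c => (g c)%:E))%E.
Proof.
move=> Y0 mg g0; rewrite /eint -ge0_integralZl_EFin//; last exact: mfe_EFin.
by move=> w _; rewrite lee_fin.
Qed.

Lemma eint_le n (f g : (nat -> R) -> R) : (forall c, 0 <= f c <= g c) ->
  (eint n (fun c => (f c)%:E) <= eint n (fun c => (g c)%:E))%E.
Proof. by move=> fg; apply: le_integral_nomeas => w; have /andP[h1 h2] := fg (co w); rewrite !lee_fin ?h1. Qed.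

Lemma eint_sum_le n (I : Type) (s : seq I) (f : I -> (nat -> R) -> R) (Y : I -> R) :
  (forall i, mfr n (f i)) -> (forall i c, 0 <= f i c) -> (forall i, (eint n (fun c => (f i c)%:E) <= (Y i)%:E)%E) ->
  (eint n (fun c => (\sum_(i <- s) f i c)%:E) <= (\sum_(i <- s) Y i)%:E)%E.
Proof.
move=> mf f0 fY; rewrite /eint.
under eq_integral do rewrite -sumEFin.
rewrite ge0_integral_sum//=; last 2 first.
- by move=> i; exact: mfe_EFin.
- by move=> i w _; rewrite lee_fin.
by rewrite -sumEFin; apply: lee_sum => i _; exact: fY.
Qed.

(* The real and imaginary parts of a frequency piece in terms of the eight operators [TT]. *)
Definition comp1 (D : bool -> bool -> bool -> R) := D true false true - D false false false + D true true false + D false true true.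
Definition comp2 (D : bool -> bool -> bool -> R) := D true false false - D true true true + D false false true + D false true false.

Lemma comp_le (D : bool -> bool -> bool -> R) :
  `|comp1 D| + `|comp2 D| <= \sum_(j : bool * (bool * bool)) `|D j.1 j.2.1 j.2.2|.
Proof.
rewrite -(pair_bigA _ (fun p hw => `|D p hw.1 hw.2|)) /= big_bool/=.
rewrite -!(pair_bigA _ (fun h w => `|D _ h w|)) /= !big_bool/=.
have h (a b c e : R) : `|a - b + c + e| <= `|a| + `|b| + `|c| + `|e|.
  by apply: le_trans (ler_normD _ _) _; rewrite lerD2r; apply: le_trans (ler_normD _ _) _; rewrite lerD2r ler_normB.
apply: le_trans (lerD (h _ _ _ _) (h _ _ _ _)) _; rewrite le_eqVlt; apply/orP; left; apply/eqP; ring.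
Qed.

Lemma sum_comp1 K (D X : nat -> bool -> bool -> bool -> R) :
  \sum_(k < K) comp1 (D k) - \sum_(k < K) comp1 (X k) = \sum_(k < K) comp1 (fun p h w => D k p h w - X k p h w).
Proof. by rewrite -sumrB; apply: eq_bigr => k _; rewrite /comp1; ring. Qed.

Lemma sum_comp2 K (D X : nat -> bool -> bool -> bool -> R) :
  \sum_(k < K) comp2 (D k) - \sum_(k < K) comp2 (X k) = \sum_(k < K) comp2 (fun p h w => D k p h w - X k p h w).
Proof. by rewrite -sumrB; apply: eq_bigr => k _; rewrite /comp2; ring. Qed.

(** The subtracted complex constant is assembled from constants [X] of the real operators, so that
    each operator is compared with its own constant. *)
Lemma cabs_pieces K (D X : nat -> bool -> bool -> bool -> R) (z : R[i]) (e : R) :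
  `|complex.Re z - \sum_(k < K) comp1 (D k)| <= e -> `|complex.Im z - \sum_(k < K) comp2 (D k)| <= e ->
  cabs (z - Complex (\sum_(k < K) comp1 (X k)) (\sum_(k < K) comp2 (X k))) <=
  2 * e + \sum_(i : 'I_K * (bool * (bool * bool))) `|D i.1 i.2.1 i.2.2.1 i.2.2.2 - X i.1 i.2.1 i.2.2.1 i.2.2.2|.
Proof.
move=> re im; apply: le_trans (cabs_le _) _; rewrite !Re_add !Im_add Re_opp Im_opp /=.
rewrite -(pair_bigA _ (fun (k : 'I_K) (j : bool * (bool * bool)) => `|D k j.1 j.2.1 j.2.2 - X k j.1 j.2.1 j.2.2|)) /=.
apply: (@le_trans _ _ (2 * e + \sum_(k < K) (`|comp1 (fun p h w => D k p h w - X k p h w)| + `|comp2 (fun p h w => D k p h w - X k p h w)|))); last first.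
  by rewrite lerD2l; apply: ler_sum => k _; exact: comp_le.
rewrite [X in _ <= _ + X]big_split /=.
have r1 := ler_norm_sum (index_enum 'I_K) (fun k : 'I_K => comp1 (fun p h w => D k p h w - X k p h w)) xpredT.
have r2 := ler_norm_sum (index_enum 'I_K) (fun k : 'I_K => comp2 (fun p h w => D k p h w - X k p h w)) xpredT.
rewrite -sum_comp1 in r1; rewrite -sum_comp2 in r2.
have h1 := ler_distD (\sum_(k < K) comp1 (D k)) (complex.Re z) (\sum_(k < K) comp1 (X k)).
have h2 := ler_distD (\sum_(k < K) comp2 (D k)) (complex.Im z) (\sum_(k < K) comp2 (X k)).
rewrite mulr_natl mulr2n [leRHS]addrACA; apply: lerD; first exact: le_trans h1 (lerD re r1).
exact: le_trans h2 (lerD im r2).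
Qed.

Lemma symbol_bounded n' l' (m rho : R) (sigma : 'rV[R]_n'.+1 -> ('I_l'.+1 -> 'rV[R]_n'.+1) -> R[i]) : m <= 0 ->
  in_MlS m rho sigma -> exists Ks, forall M, cabs (pack sigma M) <= Ks.
Proof.
move=> m0 [_ H].
pose t : 'I_l'.+1 * 'I_n'.+1 := (ord0, ord0).
have [K HK] := H (fun a : 'I_n'.+1 => nat_of_bool (None == Some a)) (fun j b => if (j, b) == t then 0%N else 0%N).
exists `|K| => N; have := HK N; rewrite /mderC !mder_join /= => h.
apply: (@le_trans _ _ (cabs (Complex (complex.Re (pack sigma N)) (complex.Im (pack sigma N))))); first by case: (pack _ _).
have z1 : (\sum_(i < n'.+1) (None == Some i) = 0)%N by rewrite big1.
have z2 : (\sum_(j < l'.+1) \sum_(i < n'.+1) (if (j, i) == t then 0 else 0) = 0)%N.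
  by rewrite big1// => j _; rewrite big1// => i _; case: ifP.
apply: (le_trans h); rewrite z1 z2 mulr0 addr0 subr0.
apply: (@le_trans _ _ (`|K| * (1 + \sum_j eucl (row (lift ord0 j) N)) `^ m)); first by rewrite ler_wpM2r ?powR_ge0// ler_norm.
have S1 : 1 <= 1 + \sum_j eucl (row (lift ord0 j) N) by rewrite lerDl sumr_ge0// => j _; exact: sqrtr_ge0.
rewrite ler_piMr// -[m]opprK powRN invf_le1 ?powR_gt0 ?(lt_le_trans ltr01 S1)//.
by apply: powR_ge1 S1 _; rewrite oppr_ge0.
Qed.

(** Subadditivity of the q-th power bounds the average by a truncation error plus the averages of
    all real pieces, whose bounds form three geometric sums in k. The final constant is independent
    of the number of pieces. *)
Lemma cube_estimate n' l' (m rho r q : R) (sigma : 'rV[R]_n'.+1 -> ('I_l'.+1 -> 'rV[R]_n'.+1) -> R[i]) :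
  0 < rho < 1 -> 1 < r <= 2 -> 0 < q <= 1 -> q * l'.+1%:R = r -> m * r = - ((l'.+1 * n'.+1)%:R * (1 - rho)) ->
  in_MlS m rho sigma ->
  exists Cf : R, 0 < Cf /\ forall f, (forall j, schwartz (f j)) -> forall x xc a s Lam, x = rv n'.+1 xc ->
    0 < s -> cube a s x -> 0 < Lam -> (multi_max (fun j y => (powR (cabs (f j y)) r)%:C%C) x <= Lam%:E)%E ->
    exists c, (1 <= s -> c = 0) /\
      (cube_avg a s q (Tsigma sigma f) c <= (Cf * (2 ^+ (l'.+1 * n'.+1) * Lam) `^ (l'.+1%:R)^-1)%:E)%E.
Proof.
move=> rho01 r12 q01 ql mr sM.
have /andP[r1 r2] := r12; have /andP[q0 q1] := q01; have /andP[rh0 rh1] := rho01.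
have r0 : 0 < r by exact: lt_trans ltr01 r1.
set n := n'.+1 in sigma mr sM *; set l := l'.+1 in ql mr *; set d := (l * n)%N in mr *.
have m0 : m <= 0.
  rewrite -(pmulr_lle0 _ r0) mr oppr_le0 mulr_ge0// subr_ge0; exact: ltW.
have [Ks HKs] := symbol_bounded m0 sM.
have [sm bd] := sM.
pose M := (2 * d.+1 * l)%N.
have [b [B [B0 cut]]] := cutoff_exists R M.
have smp p : smoothR (part sigma p) by case: sm => s1 s2; case: p.
have bdp p (alpha : 'I_n -> nat) (beta : 'I_l -> 'I_n -> nat) : exists K : R, forall M : 'M[R]_(l.+1, n),
    `|mder (joinidx alpha beta) (part sigma p) M| <= K * powR (1 + \sum_j eucl (row (lift ord0 j) M))
      (m + rho * (\sum_i alpha i)%:R - rho * (\sum_j \sum_i beta j i)%:R).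
  have [K HK] := bd alpha beta; exists K => N; apply: le_trans (HK N).
  by case: p; [exact: (normr_Re (mderC _ _ N))|exact: (normr_Im (mderC _ _ N))].
have [Cp HCp] := choice (fun p => piece_estimates rho01 r12 q01 ql mr (smp p) (bdp p) cut (ltW B0)).
pose C := Cp true + Cp false.
have C0 : 0 < C by exact: addr_gt0 (HCp true).1 (HCp false).1.
have CC p : Cp p <= C.
  by have h1 := ltW (HCp true).1; have h2 := ltW (HCp false).1; rewrite /C; case: p; rewrite ?lerDl ?lerDr.
(* [eta] is the smallest of the three rates: q for the oscillation of low pieces, [ep] up to the
   critical scale, (1 - rho) [ep] beyond it. One ratio [th] then serves all sums. *)
pose ep := (r - 1) / 8 * q; pose eta := (1 - rho) * ep.
have ep0 : 0 < ep by rewrite mulr_gt0// divr_gt0// subr_gt0.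
have eta0 : 0 < eta by rewrite mulr_gt0// subr_gt0.
have epq : ep <= q by rewrite ler_piMl ?(ltW q0)// ler_pdivrMr//; lra.
have etaep : eta <= ep by rewrite ler_piMl ?(ltW ep0)// gerBl ltW.
have /andP[_ th1] := th_lt1 eta0; set th := 2 `^ (- eta) in th1.
have th10 : 0 < 1 - th by rewrite subr_gt0.
pose Z0 := C `^ q + C; have Z00 : 0 < Z0 by rewrite addr_gt0// powR_gt0.
(* The 1 absorbs the truncation error, 8 counts the real operators of a piece, and 3 the geometric
   sums, each at most 1 / (1 - th). *)
exists (1 + 8 * Z0 * 3 / (1 - th)); split; first by rewrite addr_gt0// divr_gt0// mulr_gt0// mulr_gt0.
move=> f sf x xc a s Lam xE s0 ax Lam0 mL.
set L := 2 ^+ d * Lam; have L0 : 0 < L by rewrite mulr_gt0// exprn_gt0.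
pose L' := L `^ l%:R^-1; have L'0 : 0 < L' by exact: powR_gt0.
(* The error allowed in cutting off high frequencies is tuned so that (2 e)^q is exactly [L'], the
   size of the main bound. *)
pose e := L' `^ q^-1 / 2; have e0 : 0 < e by rewrite divr_gt0// powR_gt0.
have e20 : 0 <= 2 * e by apply: mulr_ge0 => //; exact: ltW.
have e2 : (2 * e) `^ q = L'.
  by rewrite /e mulrC divfK// -powRrM mulVf ?gt_eqF// powRr1// ltW.
have [K [_ HK]] := Tsigma_pieces sf sm HKs 0%N cut (ltW B0) e0.
pose D k p h w y := TT sigma f b p h w k y.
pose low k := 2 ^+ k * s < 1.
(* Only pieces with 2^k s < 1 are centred, at their value at x. When s >= 1 there is none, so the
   constant is 0 as the first supremum of the sharp function demands. *)
pose X k p h w := if low k then D k p h w xc else 0.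
pose ac i := if insub i is Some j then a 0 j else 0.
have aE : a = rv n ac by apply/rowP => i; rewrite mxE /ac valK.
have acx i : (i < n)%N -> ac i <= xc i <= ac i + s.
  by move=> ni; have := ax (Ordinal ni); rewrite xE aE !mxE.
exists (Complex (\sum_(k < K.+1) comp1 (X k)) (\sum_(k < K.+1) comp2 (X k))); split.
  move=> s1; have X0 k p h w : X k p h w = 0.
    by rewrite /X /low ltNge (le_trans s1)// ler_peMl ?(ltW s0)// exprn_ege1// ler1n.
  by rewrite /comp1 /comp2; congr (Complex _ _); rewrite big1// => k _; rewrite !X0; ring.
pose J := ('I_K.+1 * (bool * (bool * bool)))%type.
pose V (i : J) y := D i.1 i.2.1 i.2.2.1 i.2.2.2 y - X i.1 i.2.1 i.2.2.1 i.2.2.2.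
pose beta k := (if 2 ^+ k * s < 1 then (2 ^+ k * s) `^ eta else 0) +
  (if 2 ^+ k * s < 1 then 0 else (2 ^+ k * s) `^ (- eta)) + (2 ^+ k) `^ (- eta).
have [lg dg g0 Fg] := gblk_facts sf (ltW r1).
have HL := maximal_bound sf (ltW r1) xE mL.
have est (i : J) : mfr n (V i) /\ (eint n (fun y => (cubei n ac s y * `|V i y| `^ q)%:E) <= (s ^+ n * Z0 * L' * beta i.1)%:E)%E.
  have [_ /(_ i.1 (Fpart f i.2.2.2) (gblk f r) xc L (if i.2.2.1 then pi / 2 else 0)
    (Fpart_dom sf _) lg dg g0 (Fg _) L0 HL)] := HCp i.2.1.
  move=> [mT lowT highT].
  have mV : mfr n (V i) by apply: measurable_funB => //; exact: measurable_cst.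
  split=> //.
  have t2s : 0 < 2 ^+ i.1 * s by rewrite mulr_gt0// exprn_gt0.
  have sn0 : 0 < s ^+ n by exact: exprn_gt0.
  have Cs0 : 0 <= C * (2 ^+ i.1 * s) by exact: mulr_ge0 (ltW C0) (ltW t2s).
  have [kt|kt] := boolP (low i.1).
    pose Y := (C * (2 ^+ i.1 * s) * L `^ r^-1) `^ q; have Y0 : 0 <= Y by exact: powR_ge0.
    have VY y : (forall j, (j < n)%N -> ac j <= y j <= ac j + s) -> `|V i y| `^ q <= Y.
      move=> ay; apply: ge0_ler_powR; [exact: ltW|by rewrite nnegrE|rewrite nnegrE; exact: mulr_ge0 Cs0 (powR_ge0 _ _)|].
      rewrite /V /X kt; apply: le_trans (lowT s y s0 kt _) _.
        by move=> j jn; have := ay j jn; have := acx j jn; rewrite ler_norml; lra.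
      by rewrite ler_wpM2r ?powR_ge0// ler_wpM2r ?CC// ltW.
    apply: (@le_trans _ _ (eint n (fun y => (Y * cubei n ac s y)%:E))).
      apply: eint_le => y; rewrite mulr_ge0 ?cubei_ge0 ?powR_ge0//=.
      by have [->|[-> ay]] := cubeiP n ac s y; rewrite ?mul0r ?mulr0// mul1r mulr1 VY.
    rewrite (eintZ Y0 (mfr_cubei ac s))//; last by move=> c; exact: cubei_ge0.
    rewrite [X in (_ * X)%E](eint_cubei n _ (ltW s0)) -EFinM lee_fin mulrC -!mulrA; apply: ler_wpM2l; first exact: ltW.
    have -> : Y = C `^ q * ((2 ^+ i.1 * s) `^ q * L').
      rewrite /Y (powRM _ Cs0 (powR_ge0 _ _)) (powRM _ (ltW C0) (ltW t2s)) -mulrA.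
      by rewrite -powRrM -ql invfM mulrAC mulVf ?gt_eqF// mul1r.
    apply: ler_pM; rewrite ?mulr_ge0 ?powR_ge0// ?lerDl ?(ltW C0)// mulrC ler_wpM2l ?powR_ge0//.
    rewrite /beta ifT// ifT// addr0; apply: (@le_trans _ _ ((2 ^+ i.1 * s) `^ eta)); last by rewrite lerDl powR_ge0.
    by apply: ger_powR; [rewrite t2s ltW|exact: le_trans etaep epq].
  have VD y : V i y = Top n d (piece (part sigma i.2.1) b i.1) (if i.2.2.1 then pi / 2 else 0) (Fpart f i.2.2.2) y.
    by rewrite /V /X (negbTE kt) subr0.
  have kt1 : 1 <= 2 ^+ i.1 * s by rewrite leNgt.
  under [X in eint n X]eq_fun do rewrite VD.
  apply: le_trans (highT ac s s0 kt1 acx) _; rewrite lee_fin -/ep -/eta -/L'.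
  rewrite -/n (_ : s ^+ n * Z0 * L' * beta i.1 = Z0 * s ^+ n * beta i.1 * L'); last first.
    by move: (s ^+ n) (beta i.1) => u v; ring.
  apply: ler_wpM2r; first exact: ltW.
  rewrite -mulrA -[leRHS]mulrA; apply: ler_pM; rewrite ?mulr_ge0 ?addr_ge0 ?powR_ge0 ?exprn_ge0 ?(ltW s0) ?(ltW (HCp _).1)//.
    by rewrite (le_trans (CC _))// lerDr powR_ge0.
  have ktF : (2 ^+ i.1 * s < 1) = false by exact: negbTE.
  apply: ler_wpM2l; first exact: ltW.
  rewrite /beta ktF add0r lerD2r.
  by apply: ler_powR kt1 _ _ _; rewrite lerN2.
have avg : (eint n (fun y => (cubei n ac s y * (L' + \sum_i `|V i y| `^ q))%:E) <=
    (s ^+ n * (L' + 8 * Z0 * L' * \sum_(k < K.+1) beta k))%:E)%E.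
  have EE y : (cubei n ac s y * (L' + \sum_i `|V i y| `^ q))%:E =
      ((L' * cubei n ac s y)%:E + (\sum_i cubei n ac s y * `|V i y| `^ q)%:E)%E.
    by rewrite -EFinD mulrDr mulr_sumr mulrC.
  have mW i : mfr n (fun y => cubei n ac s y * `|V i y| `^ q).
    apply: measurable_funM; first exact: mfr_cubei.
    by apply: (measurableT_comp (measurable_powR q)); apply: measurableT_comp => //; exact: (est i).1.
  have W0 i y : 0 <= cubei n ac s y * `|V i y| `^ q by rewrite mulr_ge0 ?cubei_ge0 ?powR_ge0.
  rewrite /eint; under eq_integral do rewrite EE.
  rewrite ge0_integralD//; last 4 first.
  - by move=> w _; rewrite lee_fin mulr_ge0 ?cubei_ge0// ltW.
  - apply: (@mfe_EFin R n (fun y => L' * cubei n ac s y)).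
    by apply: measurable_funM => //; exact: mfr_cubei.
  - by move=> w _; rewrite lee_fin sumr_ge0.
  - apply: (@mfe_EFin R n (fun y => \sum_i cubei n ac s y * `|V i y| `^ q)).
    by apply: measurable_sum => i; exact: mW.
  rewrite mulrDr EFinD; apply: leeD.
    rewrite [leLHS](eintZ (ltW L'0) (mfr_cubei ac s)); last by move=> c; exact: cubei_ge0.
    by rewrite [X in (_ * X)%E](eint_cubei n _ (ltW s0)) -EFinM mulrC.
  apply: le_trans (eint_sum_le _ mW W0 (fun i => (est i).2)) _.
  rewrite lee_fin -(pair_bigA _ (fun (k : 'I_K.+1) (j : bool * (bool * bool)) => s ^+ n * Z0 * L' * beta k)) /=.
  under eq_bigr do rewrite sumr_const !card_prod card_bool -mulr_natl.
  by rewrite -!mulr_sumr le_eqVlt; apply/orP; left; apply/eqP; ring.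
have sb : (1 - th) * \sum_(k < K.+1) beta k <= 3.
  rewrite !big_split /= !mulrDr.
  have h1 := sum_low eta0 s0 K.+1; have h2 := sum_high eta0 s0 K.+1; have h3 := sum_powers eta0 K.+1.
  have h4 : Num.min 1 ((2 ^+ K.+1 * s / 2) `^ eta) <= 1 by rewrite ge_min lexx.
  have h5 : 0 <= Num.min 1 ((2 ^+ K.+1 * s) `^ (- eta)) by rewrite le_min ler01 powR_ge0.
  have h6 := le_trans h1 h4.
  have h7 : 1 - Num.min 1 ((2 ^+ K.+1 * s) `^ (- eta)) <= 1 by rewrite gerBl.
  have h8 := le_trans h2 h7.
  have -> : 3 = 1 + 1 + 1 :> R by ring.
  by apply: lerD h3; exact: lerD.
have sn0 : 0 < s ^+ n by exact: exprn_gt0.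
pose G y := cubei n ac s y * (L' + \sum_i `|V i y| `^ q).
have S0 y : 0 <= L' + \sum_i `|V i y| `^ q by rewrite addr_ge0 ?(ltW L'0)// sumr_ge0// => i _; exact: powR_ge0.
have mG : mfr n G.
  apply: measurable_funM; first exact: mfr_cubei.
  apply: measurable_funD => //; apply: measurable_sum => i.
  by apply: (measurableT_comp (measurable_powR q)); apply: measurableT_comp => //; exact: (est i).1.
rewrite /cube_avg; apply: (@le_trans _ _ (((s ^+ n)^-1)%:E * eint n (fun y => (G y)%:E))%E).
  apply: lee_wpmul2l; first by rewrite lee_fin invr_ge0 ltW.
  apply: Eintn_le => //.
  - by move=> y; rewrite mulr_ge0 ?powR_ge0// indicE.
  - by move=> y; rewrite mulr_ge0 ?cubei_ge0.
  move=> y; rewrite (indic_cube s y aE); apply: ler_wpM2l; first exact: cubei_ge0.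
  have [h1 h2] := HK y.
  have V0 : 0 <= \sum_i `|V i y| by exact: sumr_ge0.
  apply: (@le_trans _ _ ((2 * e + \sum_i `|V i y|) `^ q)).
    apply: ge0_ler_powR; [exact: ltW|rewrite nnegrE; exact: cabs_ge0|rewrite nnegrE; exact: addr_ge0 e20 V0|].
    exact: (@cabs_pieces K.+1 (fun k p h w => D k p h w y) X).
  apply: le_trans (powRD_le q01 e20 V0) _.
  by rewrite e2 lerD2l; apply: powR_sum_le.
apply: le_trans (lee_wpmul2l _ avg) _; first by rewrite lee_fin invr_ge0 ltW.
rewrite -EFinM lee_fin mulrA mulVf ?gt_eqF// mul1r -/L -/L' [leRHS]mulrDl mul1r lerD2l.
rewrite [8 * Z0 * L']mulrAC [leRHS](_ : _ = 8 * L' * Z0 * (3 / (1 - th))); last by ring.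
by rewrite ler_wpM2l ?mulr_ge0 ?(ltW L'0) ?(ltW Z00)// ler_pdivlMr// mulrC.
Qed.

End Final.

Lemma Eintn_ge0 (R : realType) n (h : 'rV[R]_n -> \bar R) : (forall x, 0 <= h x)%E -> (0 <= Eintn h)%E.
Proof. by elim: n h => [|n IH] h h0 /=; [exact: h0|apply: integral_ge0 => t _; exact: IH]. Qed.

Lemma cube_avg_ge0 (R : realType) n (a : 'rV[R]_n) s t F c : 0 < s -> (0 <= cube_avg a s t F c)%E.
Proof.
move=> s0; apply: mule_ge0; first by rewrite lee_fin invr_ge0 exprn_ge0// ltW.
by apply: Eintn_ge0 => y; rewrite lee_fin mulr_ge0 ?powR_ge0// indicE.
Qed.

Lemma sharp_max_le (R : realType) n (t : R) (F : 'rV[R]_n -> R[i]) x (B : \bar R) :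
  (forall a s, 0 < s -> cube a s x -> exists c, (1 <= s -> c = 0) /\ (poweR (cube_avg a s t F c) t^-1 <= B)%E) ->
  (sharp_max t F x <= B + B)%E.
Proof.
move=> H; apply: leeD; apply: ge_ereal_sup => v.
  by move=> [a [s [s1 [ax ->]]]]; have [c [/(_ s1) -> h]] := H a s (lt_le_trans ltr01 s1) ax.
move=> [a [s [s0 [_ [ax ->]]]]]; have [c [_ h]] := H a s s0 ax.
by apply: le_trans h; apply: ereal_inf_lbound; exists c.
Qed.

Theorem theorem1p6 (R : realType) (n l : nat) (rho r : R) :
  (1 <= n)%N -> (2 <= l)%N -> 0 < rho < 1 -> 1 < r <= 2 ->
  forall sigma : 'rV[R]_n -> ('I_l -> 'rV[R]_n) -> R[i],
  in_MlS (- ((n * l)%:R / r) * (1 - rho)) rho sigma ->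
  exists K : R, 0 < K /\
    forall f : 'I_l -> 'rV[R]_n -> R[i],
    (forall j, schwartz (f j)) ->
    forall x : 'rV[R]_n,
      (sharp_max (r / l%:R) (Tsigma sigma f) x <= K%:E * multi_max_r r f x)%E.
Proof.
case: n => // n _; case: l => // l l2 rho01 r12 sigma sM.
have /andP[r1 r2] := r12; have r0 : 0 < r by exact: lt_trans ltr01 r1.
pose q := r / l.+1%:R.
have q0 : 0 < q by rewrite divr_gt0.
have q01 : 0 < q <= 1.
  by rewrite q0 ler_pdivrMr// mul1r (le_trans r2)// ler_nat.
have ql : q * l.+1%:R = r by rewrite divfK// pnatr_eq0.
have mr : (- ((n.+1 * l.+1)%:R / r) * (1 - rho)) * r = - ((l.+1 * n.+1)%:R * (1 - rho)).
  by rewrite mulrAC mulNr divfK ?gt_eqF// mulNr mulnC.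
have [Cf [Cf0 H]] := cube_estimate rho01 r12 q01 ql mr sM.
set d := (l.+1 * n.+1)%N in H.
(* Raising the average to the power 1/q turns the exponent 1/l into 1 / (l q) = 1 / r; [K] is twice
   [K1] because the sharp function is a sum of two suprema. *)
pose K1 := Cf `^ q^-1 * (2 ^+ d) `^ r^-1.
have K10 : 0 < K1 by rewrite mulr_gt0// powR_gt0// exprn_gt0.
pose K := K1 + K1; have K0 : 0 < K by rewrite addr_gt0.
exists K; split=> // f sf x; rewrite /multi_max_r.
have main Lam : 0 < Lam -> (multi_max (fun j y => (powR (cabs (f j y)) r)%:C%C) x <= Lam%:E)%E ->
    (sharp_max q (Tsigma sigma f) x <= (K * Lam `^ r^-1)%:E)%E.
  move=> L0 mL; rewrite mulrDl EFinD; apply: sharp_max_le => a s s0 ax.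
  pose xc i := x 0 (inord i : 'I_n.+1).
  have xE : x = rv n.+1 xc by apply/rowP => i; rewrite mxE /xc inord_val.
  have [c [c0 h]] := H f sf x xc a s Lam xE s0 ax L0 mL.
  exists c; split=> //; have d0 : 0 < (2 : R) ^+ d by exact: exprn_gt0.
  have P0 : 0 <= (2 ^+ d * Lam) `^ l.+1%:R^-1 by exact: powR_ge0.
  have -> : K1 * Lam `^ r^-1 = (Cf * (2 ^+ d * Lam) `^ l.+1%:R^-1) `^ q^-1.
    rewrite (powRM _ (ltW Cf0) P0) -powRrM -invfM [l.+1%:R * q]mulrC ql.
    by rewrite (powRM _ (ltW d0) (ltW L0)) mulrA.
  rewrite -poweR_EFin; apply: gt0_ler_poweR => //.
  - by rewrite invr_ge0 ltW.
  - by rewrite in_itv /= cube_avg_ge0// leey.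
  - by rewrite in_itv /= lee_fin mulr_ge0 ?leey// ltW.
have S0 := maximal_ge0 sf (ltW r1) x.
case: (multi_max _ x) main S0 => [v||] main S0 //; last first.
  by rewrite poweRyr ?invr_eq0 ?gt_eqF// gt0_muley ?lte_fin// leey.
(* [main] asks for a positive bound. When the maximal function vanishes it is applied with (e / K)^r
   for arbitrary e > 0, which bounds the left side by e. *)
rewrite poweR_EFin -EFinM; rewrite lee_fin le_eqVlt in S0; case/orP: S0 => [/eqP v0|v0]; last exact: main.
rewrite -v0 powR0 ?invr_eq0 ?gt_eqF// mulr0; apply/lee_addgt0Pr => e e0; rewrite add0e.
have eK : 0 < e / K by rewrite divr_gt0.
have := main ((e / K) `^ r); rewrite -v0 lee_fin powR_ge0 powR_gt0// -powRrM divff ?gt_eqF// powRr1 ?(ltW eK)//.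
by rewrite mulrC divfK ?gt_eqF//; apply.
Qed.
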